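(* Let $w\in W$ and $J\subseteq\mathcal{I}_w$. If $X_{wB}$ is a spherical $L_J$-variety, then the stabilizer in $L_J$ of a point in general position of $X_{wB}$ is a strongly solvable spherical subgroup of $L_J$.
   Context: $G$ is a connected semisimple algebraic group over an algebraically closed field $k$ of arbitrary characteristic, $B\subset G$ a Borel subgroup, $T\subset B$ a maximal torus, $W$ the Weyl group of $(G,T)$, $\mathcal{S}$ the set of simple roots determined by $(G,B,T)$. For $w\in W$ let $\dot w\in N_G(T)$ be a representative and $X_{wB}:=\overline{B\dot wB/B}\subseteq G/B$. Put $\mathcal{I}_w:=\{\alpha\in\mathcal{S}\mid w^{-1}(\alpha)<0\}$. For $J\subseteq\mathcal{S}$, $P_J$ is the standard parabolic subgroup generated by $B$ and the root subgroups $U_{-\alpha}$, $\alpha\in J$, and $L_J$ is its Levi subgroup containing $T$. The stabilizer of $X_{wB}$ in $G$ is $P_{\mathcal{I}_w}$, so $L_J$ acts on $X_{wB}$ for every $J\subseteq\mathcal{I}_w$. For a connected reductive group $K$: a spherical $K$-variety is a normal irreducible $K$-variety on which a Borel subgroup of $K$ has an open orbit; a closed subgroup $H\subseteq K$ is spherical if $K/H$ is a spherical $K$-variety; a subgroup of $K$ is strongly solvable if it is contained in a Borel subgroup of $K$; a point of an irreducible $K$-variety is in general position if its $K$-orbit has maximal dimension. *)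

(* Defs.v *)
From mathcomp Require Import all_boot all_order all_algebra.
From mathcomp Require Import boolp classical_sets.
(* Not imported: its notations clash with those of classical_sets. *)
From mathcomp Require mpoly.

Set Implicit Arguments.
Unset Strict Implicit.
Unset Printing Implicit Defensive.

Import GRing.Theory.
Local Open Scope classical_set_scope.
Local Open Scope ring_scope.

(** * Spaces with functions and varieties

  Varieties are treated classically, as topological spaces of closed points
  with a sheaf of [k]-valued functions. *)

(* The space is the set [carrier], so that subsets and coset spaces need no
   subtype. [kclosed] lists the closed subsets of [carrier]. [regular U f] says
   that the restriction of [f] to the open set [U] is a section of the
   structure sheaf; the values of [f] outside [U] are irrelevant. The axioms are
   in [space_with_functions] below. *)
Record kspace (k : fieldType) := KSpace {
  point : Type;
  carrier : set point;
  kclosed : set (set point);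
  regular : set point -> set (point -> k) }.

Arguments carrier {k} X : rename.

Definition kopen (k : fieldType) (X : kspace k) (U : set (point X)) : Prop :=
  U `<=` carrier X /\ kclosed (carrier X `\` U).

Definition kclosure (k : fieldType) (X : kspace k) (A : set (point X)) :
    set (point X) :=
  [set x | carrier X x /\ forall C, kclosed C -> A `<=` C -> C x].

Definition irreducible_set (k : fieldType) (X : kspace k)
    (A : set (point X)) : Prop :=
  A !=set0 /\
  forall C D : set (point X), kclosed C -> kclosed D ->
    A `<=` C `|` D -> A `<=` C \/ A `<=` D.

Definition irreducible_space (k : fieldType) (X : kspace k) : Prop :=
  irreducible_set (carrier X).

Definition connected_space (k : fieldType) (X : kspace k) : Prop :=
  carrier X !=set0 /\
  forall C D : set (point X), kclosed C -> kclosed D ->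
    C `|` D = carrier X -> C `&` D = set0 -> C = set0 \/ D = set0.

(* The Krull dimension of [X] is at least [d]. *)
Definition dim_ge (k : fieldType) (X : kspace k) (d : nat) : Prop :=
  exists Z : nat -> set (point X),
    (forall i, (i <= d)%N -> kclosed (Z i) /\ irreducible_set (Z i)) /\
    (forall i, (i < d)%N -> Z i `<` Z i.+1).

Definition dim_le (k : fieldType) (X Y : kspace k) : Prop :=
  forall d, dim_ge X d -> dim_ge Y d.

Definition space_with_functions (k : fieldType) (X : kspace k) : Prop :=
  [/\ (forall C : set (point X), kclosed C -> C `<=` carrier X),
      kclosed (@set0 (point X)) /\ kclosed (carrier X),
      (forall C D : set (point X), kclosed C -> kclosed D -> kclosed (C `|` D)) &
      (forall F : set (set (point X)), F !=set0 -> F `<=` @kclosed k X ->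
         kclosed [set x | forall C, F C -> C x])] /\
  [/\ (forall (U : set (point X)) (c : k), kopen U -> regular U (fun=> c)),
      (forall (U : set (point X)) f g, kopen U -> regular U f -> regular U g ->
         regular U (fun x => f x + g x) /\ regular U (fun x => f x * g x)),
      (forall (U V : set (point X)) f g, kopen U -> kopen V -> V `<=` U ->
         regular U f -> (forall x, V x -> g x = f x) -> regular V g) &
      (forall (U : set (point X)) f, kopen U ->
         (forall x, U x ->
            exists V, [/\ kopen V, V x, V `<=` U & regular V f]) ->
         regular U f)].

Definition subspace (k : fieldType) (X : kspace k) (Y : set (point X)) :
    kspace k :=
  {| point := point X;
     carrier := Y;
     kclosed := [set C | exists2 D, kclosed D & C = Y `&` D];
     regular := fun U => [set f | forall x, U x ->
       exists V g, [/\ kopen V, V x, regular V g &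
                       forall y, U y -> V y -> f y = g y]] |}.

Definition kmorphism (k : fieldType) (X Y : kspace k)
    (phi : point X -> point Y) : Prop :=
  [/\ (forall x, carrier X x -> carrier Y (phi x)),
      (forall C, kclosed C -> kclosed (carrier X `&` phi @^-1` C)) &
      (forall V f, kopen V -> regular V f ->
         regular (carrier X `&` phi @^-1` V) (f \o phi))].

Definition isomorphic (k : fieldType) (X Y : kspace k) : Prop :=
  exists (phi : point X -> point Y) (psi : point Y -> point X),
    [/\ kmorphism phi, kmorphism psi,
        (forall x, carrier X x -> psi (phi x) = x) &
        (forall y, carrier Y y -> phi (psi y) = y)].

(* [O(U) (x) O(V)] as functions on [U * V]. *)
Definition tensor_fun (k : fieldType) (X Y : kspace k)
    (U : set (point X)) (V : set (point Y)) (F : point X * point Y -> k) :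
    Prop :=
  exists (r : nat) (f : 'I_r -> point X -> k) (g : 'I_r -> point Y -> k),
    [/\ (forall i, regular U (f i)), (forall i, regular V (g i)) &
        forall z, F z = \sum_(i < r) f i z.1 * g i z.2].

Definition product_open (k : fieldType) (X Y : kspace k)
    (W : set (point X * point Y)) : Prop :=
  forall z, W z -> exists U V F,
    [/\ kopen U /\ kopen V, U z.1 /\ V z.2, tensor_fun U V F, F z != 0 &
        forall z', U z'.1 -> V z'.2 -> F z' != 0 -> W z'].

(* The product in the category of varieties: the non-vanishing loci of the
   elements of [O(U) (x) O(V)] form a basis of its topology, and its regular
   functions are locally fractions of such elements. *)
Definition product_space (k : fieldType) (X Y : kspace k) : kspace k :=
  {| point := (point X * point Y)%type;
     carrier := carrier X `*` carrier Y;
     kclosed := [set C | C `<=` carrier X `*` carrier Y /\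
                        product_open ((carrier X `*` carrier Y) `\` C)];
     regular := fun W => [set h | forall z, W z -> exists U V A D,
       [/\ kopen U /\ kopen V, U z.1 /\ V z.2,
           tensor_fun U V A /\ tensor_fun U V D, D z != 0 &
           forall z', U z'.1 -> V z'.2 -> D z' != 0 ->
             W z' /\ h z' = A z' / D z']] |}.

Definition separated (k : fieldType) (X : kspace k) : Prop :=
  @kclosed k (product_space X X) [set z | carrier X z.1 /\ z.1 = z.2].

(** ** Zariski topology and regular functions on sets of matrices *)

Definition mxeval (k : fieldType) (m n : nat) (p : mpoly.mpoly (m * n) k)
    (A : 'M[k]_(m, n)) : k :=
  mpoly.meval (fun i => mxvec A ord0 i) p.

Definition zero_locus (k : fieldType) (m n : nat)
    (S : set (mpoly.mpoly (m * n) k)) : set 'M[k]_(m, n) :=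
  [set A | forall p, S p -> mxeval p A = 0].

Definition matrix_closed (k : fieldType) (m n : nat) (A : set 'M[k]_(m, n)) :
    set (set 'M[k]_(m, n)) :=
  [set C | exists S, C = A `&` zero_locus S].

Definition matrix_space (k : fieldType) (m n : nat) (A : set 'M[k]_(m, n)) :
    kspace k :=
  {| point := 'M[k]_(m, n);
     carrier := A;
     kclosed := matrix_closed A;
     regular := fun U => [set f | forall x, U x ->
       exists V p q, [/\ matrix_closed A (A `\` V), V `<=` U, V x &
         forall y, V y -> mxeval q y != 0 /\ f y = mxeval p y / mxeval q y]] |}.

Definition affine_space (k : fieldType) (X : kspace k) : Prop :=
  exists (m : nat) (S : set (mpoly.mpoly (1 * m) k)),
    isomorphic X (matrix_space (zero_locus S : set 'rV[k]_m)).

Definition variety (k : fieldType) (X : kspace k) : Prop :=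
  [/\ space_with_functions X,
      (exists (r : nat) (U : 'I_r -> set (point X)),
         (forall i, kopen (U i) /\ affine_space (subspace (U i))) /\
         (forall x, carrier X x -> exists i, U i x)) &
      separated X].

(* For irreducible [X]: every rational function (a regular function on some
   nonempty open [U]) that is integral over the local ring at a point [x]
   belongs to that local ring. *)
Definition normal_space (k : fieldType) (X : kspace k) : Prop :=
  forall x, carrier X x ->
  forall (U : set (point X)) (f : point X -> k),
    kopen U -> U !=set0 -> regular U f ->
  forall (V : set (point X)) (m : nat) (a : 'I_m -> point X -> k),
    kopen V -> V x -> (forall i, regular V (a i)) ->
    (forall y, U y -> V y -> f y ^+ m + \sum_(i < m) a i y * f y ^+ i = 0) ->
  exists V' g, [/\ kopen V', V' x, regular V' g &
                   forall y, U y -> V' y -> g y = f y].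

(** * Linear algebraic groups, as Zariski closed subgroups of [GL_n(k)] *)

Definition gl (k : fieldType) (n : nat) : set 'M[k]_n :=
  [set A | A \in unitmx].

Definition subgroup (k : fieldType) (n : nat) (H : set 'M[k]_n) : Prop :=
  [/\ H `<=` @gl k n, H 1%:M, (forall x y, H x -> H y -> H (x *m y)) &
      (forall x, H x -> H (invmx x))].

Definition closed_subgroup (k : fieldType) (n : nat) (K H : set 'M[k]_n) :
    Prop :=
  [/\ subgroup H, H `<=` K & @kclosed k (matrix_space K) H].

Definition algebraic_group (k : fieldType) (n : nat) (G : set 'M[k]_n) : Prop :=
  closed_subgroup (@gl k n) G.

Definition connected_subgroup (k : fieldType) (n : nat) (K H : set 'M[k]_n) :
    Prop :=
  closed_subgroup K H /\ connected_space (matrix_space H).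

Definition mxconj (k : fieldType) (n : nat) (g x : 'M[k]_n) : 'M[k]_n :=
  g *m x *m invmx g.

Definition normalizes (k : fieldType) (n : nat) (K H : set 'M[k]_n) : Prop :=
  forall g x, K g -> H x -> H (mxconj g x).

Definition generated (k : fieldType) (n : nat) (S : set 'M[k]_n) :
    set 'M[k]_n :=
  [set g | forall H, subgroup H -> S `<=` H -> H g].

Definition derived (k : fieldType) (n : nat) (H : set 'M[k]_n) : set 'M[k]_n :=
  generated [set z | exists x y,
    [/\ H x, H y & z = x *m y *m invmx x *m invmx y]].

Definition solvable_group (k : fieldType) (n : nat) (H : set 'M[k]_n) : Prop :=
  exists d : nat, iter d (@derived k n) H = [set 1%:M].

Definition unipotent_group (k : fieldType) (n : nat) (H : set 'M[k]_n) : Prop :=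
  forall g, H g -> exists m : nat, (g - 1%:M) ^+ m = 0.

Definition connected_semisimple (k : fieldType) (n : nat) (G : set 'M[k]_n) :
    Prop :=
  [/\ algebraic_group G, connected_space (matrix_space G) &
      forall N, connected_subgroup G N -> normalizes G N -> solvable_group N ->
        N = [set 1%:M]].

Definition borel_subgroup (k : fieldType) (n : nat) (K B : set 'M[k]_n) :
    Prop :=
  [/\ connected_subgroup K B, solvable_group B &
      forall B', connected_subgroup K B' -> solvable_group B' ->
        B `<=` B' -> B' = B].

Definition diagonalizable_group (k : fieldType) (n : nat) (T : set 'M[k]_n) :
    Prop :=
  exists2 P : 'M[k]_n, P \in unitmx &
    forall t, T t -> is_diag_mx (mxconj P t).

Definition torus_in (k : fieldType) (n : nat) (G T : set 'M[k]_n) : Prop :=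
  connected_subgroup G T /\ diagonalizable_group T.

Definition maximal_torus (k : fieldType) (n : nat) (G T : set 'M[k]_n) : Prop :=
  torus_in G T /\ forall T', torus_in G T' -> T `<=` T' -> T' = T.

Definition unipotent_radical (k : fieldType) (n : nat) (P U : set 'M[k]_n) :
    Prop :=
  [/\ connected_subgroup P U, normalizes P U, unipotent_group U &
      forall U', connected_subgroup P U' -> normalizes P U' ->
        unipotent_group U' -> U' `<=` U].

Definition levi_subgroup (k : fieldType) (n : nat) (P L : set 'M[k]_n) : Prop :=
  closed_subgroup P L /\
  exists U, [/\ unipotent_radical P U, L `&` U = [set 1%:M] &
                forall p, P p -> exists l u, [/\ L l, U u & p = l *m u]].

(** ** Lie algebra, roots and root subgroups *)

(* The Zariski tangent space of [G] at the identity matrix. *)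
Definition lie (k : fieldType) (n : nat) (G : set 'M[k]_n) : set 'M[k]_n :=
  [set X | forall p : mpoly.mpoly (n * n) k,
    (forall g, G g -> mxeval p g = 0) ->
    \sum_i mxeval (mpoly.mderiv i p) 1%:M * mxvec X ord0 i = 0].

(* A morphism of algebraic groups from [T] to the multiplicative group,
   extended by 0 outside [T] so that equality of characters is Leibniz equality.
   The group of characters is written multiplicatively. *)
Definition torus_character (k : fieldType) (n : nat) (T : set 'M[k]_n)
    (chi : 'M[k]_n -> k) : Prop :=
  [/\ @regular k (matrix_space T) T chi,
      (forall t, T t -> chi t != 0),
      (forall s t, T s -> T t -> chi (s *m t) = chi s * chi t) &
      (forall t, ~ T t -> chi t = 0)].

Definition weight_space (k : fieldType) (n : nat) (G T : set 'M[k]_n)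
    (chi : 'M[k]_n -> k) : set 'M[k]_n :=
  [set X | lie G X /\ forall t, T t -> mxconj t X = chi t *: X].

Definition roots (k : fieldType) (n : nat) (G T : set 'M[k]_n) :
    set ('M[k]_n -> k) :=
  [set a | [/\ torus_character T a, (exists2 t, T t & a t != 1) &
               exists2 X, weight_space G T a X & X != 0]].

Definition opp_char (k : fieldType) (n : nat) (a : 'M[k]_n -> k) :
    'M[k]_n -> k :=
  fun t => (a t)^-1.

(* The roots of [(B, T)] are the positive roots of [(G, T)]. *)
Definition positive_root (k : fieldType) (n : nat) (B T : set 'M[k]_n) :
    set ('M[k]_n -> k) :=
  roots B T.

Definition negative_root (k : fieldType) (n : nat) (B T : set 'M[k]_n) :
    set ('M[k]_n -> k) :=
  [set a | positive_root B T (opp_char a)].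

Definition simple_root (k : fieldType) (n : nat) (B T : set 'M[k]_n) :
    set ('M[k]_n -> k) :=
  [set a | positive_root B T a /\
    forall b c, positive_root B T b -> positive_root B T c ->
      a <> (fun t => b t * c t)].

(* The unique connected closed subgroup of [G] that is normalized by [T] and
   whose Lie algebra is the root space of [a]. *)
Definition root_subgroup (k : fieldType) (n : nat) (G T : set 'M[k]_n)
    (a : 'M[k]_n -> k) : set 'M[k]_n :=
  xget set0 [set U | [/\ connected_subgroup G U, normalizes T U &
                         lie U = weight_space G T a]].

Definition standard_parabolic (k : fieldType) (n : nat) (G B T : set 'M[k]_n)
    (J : set ('M[k]_n -> k)) : set 'M[k]_n :=
  generated (B `|` \bigcup_(a in J) root_subgroup G T (opp_char a)).

(** ** Coset spaces and the Weyl group *)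

Definition translate (k : fieldType) (n : nat) (g : 'M[k]_n)
    (c : set 'M[k]_n) : set 'M[k]_n :=
  [set g *m x | x in c].

Definition cosets (k : fieldType) (n : nat) (K H : set 'M[k]_n) :
    set (set 'M[k]_n) :=
  [set translate g H | g in K].

Definition quotient_preimage (k : fieldType) (n : nat) (K H : set 'M[k]_n)
    (C : set (set 'M[k]_n)) : set 'M[k]_n :=
  [set g | K g /\ C (translate g H)].

(* The variety [K/H]: quotient topology, and regular functions are the functions
   whose pullback to [K] is regular. *)
Definition quotient_space (k : fieldType) (n : nat) (K H : set 'M[k]_n) :
    kspace k :=
  {| point := set 'M[k]_n;
     carrier := cosets K H;
     kclosed := [set C | C `<=` cosets K H /\
                        @kclosed k (matrix_space K) (quotient_preimage K H C)];
     regular := fun U => [set f |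
       @regular k (matrix_space K) (quotient_preimage K H U)
         (fun g => f (translate g H))] |}.

Definition torus_normalizer (k : fieldType) (n : nat) (G T : set 'M[k]_n) :
    set 'M[k]_n :=
  [set g | G g /\ [set mxconj g t | t in T] = T].

Definition torus_centralizer (k : fieldType) (n : nat) (G T : set 'M[k]_n) :
    set 'M[k]_n :=
  [set g | G g /\ forall t, T t -> mxconj g t = t].

Definition weyl_group (k : fieldType) (n : nat) (G T : set 'M[k]_n) :
    set (set 'M[k]_n) :=
  cosets (torus_normalizer G T) (torus_centralizer G T).

(* The action on characters of the Weyl group element represented by [wd]. *)
Definition weyl_act (k : fieldType) (n : nat) (wd : 'M[k]_n)
    (a : 'M[k]_n -> k) : 'M[k]_n -> k :=
  fun t => a (mxconj (invmx wd) t).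

(* The set I_w, for [w] represented by [wd]. *)
Definition left_descents (k : fieldType) (n : nat) (B T : set 'M[k]_n)
    (wd : 'M[k]_n) : set ('M[k]_n -> k) :=
  [set a | simple_root B T a /\ negative_root B T (weyl_act (invmx wd) a)].

Definition schubert_variety (k : fieldType) (n : nat) (G B : set 'M[k]_n)
    (wd : 'M[k]_n) : kspace k :=
  @subspace k (quotient_space G B)
    (@kclosure k (quotient_space G B) [set translate (b *m wd) B | b in B]).

(** * Actions and spherical varieties *)

Definition act_orbit (k : fieldType) (n : nat) (K : set 'M[k]_n) (P : Type)
    (act : 'M[k]_n -> P -> P) (x : P) : set P :=
  [set act g x | g in K].

Definition stabilizer (k : fieldType) (n : nat) (K : set 'M[k]_n) (P : Type)
    (act : 'M[k]_n -> P -> P) (x : P) : set 'M[k]_n :=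
  [set g | K g /\ act g x = x].

Definition algebraic_action (k : fieldType) (n : nat) (K : set 'M[k]_n)
    (X : kspace k) (act : 'M[k]_n -> point X -> point X) : Prop :=
  [/\ (forall x, carrier X x -> act 1%:M x = x),
      (forall g h x, K g -> K h -> carrier X x ->
         act (g *m h) x = act g (act h x)) &
      @kmorphism k (product_space (matrix_space K) X) X
        (fun z => act z.1 z.2)].

Definition spherical_variety (k : fieldType) (n : nat) (K : set 'M[k]_n)
    (X : kspace k) (act : 'M[k]_n -> point X -> point X) : Prop :=
  [/\ variety X, algebraic_action K act, irreducible_space X, normal_space X &
      exists2 BK, borel_subgroup K BK &
        exists2 x, carrier X x & kopen (act_orbit BK act x)].

Definition general_position (k : fieldType) (n : nat) (K : set 'M[k]_n)
    (X : kspace k) (act : 'M[k]_n -> point X -> point X) (x : point X) : Prop :=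
  carrier X x /\
  forall y, carrier X y ->
    dim_le (subspace (act_orbit K act y)) (subspace (act_orbit K act x)).

Definition spherical_subgroup (k : fieldType) (n : nat) (K H : set 'M[k]_n) :
    Prop :=
  closed_subgroup K H /\
  @spherical_variety k n K (quotient_space K H) (@translate k n).

Definition strongly_solvable (k : fieldType) (n : nat) (K H : set 'M[k]_n) :
    Prop :=
  subgroup H /\ exists2 BK, borel_subgroup K BK & H `<=` BK.

(* Main.v *)
(* The open orbit of a Borel subgroup of [L] makes [x] lie in the open [L]-orbit, which meets [BwB/B]; so
 [x = luwB] with [l] in [L] and [u] in the unipotent radical [U] of [P]. As [P] and [wBw^-1] share [T], the
 solvable group they intersect in is connected, so its image in [P/U = L] lies in a Borel subgroup, and a
 conjugate of that contains [H = Stab x]. Finally [L/H -> Lx] is bijective and purely inseparable onto an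
 open subset of the normal variety [X]; together with homogeneity this makes [L/H] normal. *)
Require Import Defs.
From mathcomp Require Import all_boot all_order all_algebra all_field.
From mathcomp Require Import boolp classical_sets.
From mathcomp Require Import ring zify.
From mathcomp Require mpoly filter.
From Stdlib Require List.

Set Implicit Arguments.
Unset Strict Implicit.
Unset Printing Implicit Defensive.

Import GRing.Theory.
Import (canonicals) mpoly.
Local Open Scope classical_set_scope.
Local Open Scope ring_scope.

(** * Noetherian rings *)

(** The connectedness of the intersection [N] of [P] and [C = wBw^-1] comes from tori. Conjugacy of
    maximal tori in the identity component of [N] reduces an element of [N] to one normalizing [T],
    and in a connected solvable group such an element centralizes [T]. Two facts remain: the
    centralizer of [T] in [C] is connected, and the identity component of the centralizer of [T] in
    [G] lies in every Borel subgroup containing [T], hence in [P]. Both are proved with matrices;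
    completeness of the flag variety takes the form of places and an Iwasawa decomposition, and
    Chevalley's theorem that of quantifier elimination. The stabilizer [H] is a reduced group, so in
    positive characteristic [L/H] need not be isomorphic to the orbit and normality cannot simply be
    transported: only a power [phi^q] of a regular function descends to the orbit, and the [q]-th
    root is extracted on [L], where translations are available. Dimensions are compared through
    lengths of chains, and chains that grow forever are refuted by counting monomials. *)

Definition is_ideal (R : comNzRingType) (I : set R) :=
 [/\ I 0, forall x y, I x -> I y -> I (x + y) & forall c x, I x -> I (c * x)].

Definition igen (R : comNzRingType) (s : seq R) x :=
 forall J : set R, is_ideal J -> (forall y, y \in s -> J y) -> J x.

Definition noeth (R : comNzRingType) := forall I : set R, is_ideal I ->
 exists2 s : seq R, forall x, x \in s -> I x & forall x, I x -> igen s x.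

Lemma igen_sum (R : comNzRingType) (s : seq R) x : igen s x ->
 exists c : nat -> R, x = \sum_(i < size s) c i * s`_i.
move=> h; apply: (h [set x | exists c : nat -> R, x = \sum_(i < size s) c i * s`_i]) => [|y ys]; first split.
- by exists (fun=> 0); rewrite big1 // => i _; rewrite mul0r.
- move=> _ _ [c ->] [d ->]; exists (fun i => c i + d i).
 by rewrite -big_split; apply: eq_bigr => i _; rewrite mulrDl.
- by move=> a _ [c ->]; exists (fun i => a * c i); rewrite mulr_sumr; apply: eq_bigr => i _; rewrite mulrA.
exists (fun i => (i == index y s)%:R); rewrite -index_mem in ys.
rewrite (bigD1 (Ordinal ys)) //= eqxx mul1r nth_index -?index_mem // big1 ?addr0 // => i.
by rewrite -val_eqE /= => /negbTE ->; rewrite mul0r.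
Qed.

Lemma noeth_field (F : fieldType) : noeth F.
move=> I [I0 ID IM]; have [[x Ix x0]|nI] := pselect (exists2 x, I x & x != 0).
 exists [:: x] => [y|y _ J [_ _ JM] h]; first by rewrite inE => /eqP->.
 by rewrite -(divfK x0 y); apply: JM; apply: h; exact: mem_head.
exists [::] => // x Ix J [J0 _ _] _; have [-> //|x0] := eqVneq x 0; by case: nI; exists x.
Qed.

Lemma mkseq_mem (T : eqType) (f : nat -> T) n y : y \in mkseq f n <-> exists2 i, (i < n)%N & y = f i.
by split=> [/mapP[i]|[i i_n ->]]; [rewrite mem_iota; exists i|apply: map_f; rewrite mem_iota]. Qed.

(** The ascending chain condition in the form Hilbert's argument consumes: the ideal generated by
    all the [f m] has finitely many generators, each of which already lies in the ideal of a finite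
    initial stretch. *)
Lemma noeth_seq (R : comNzRingType) (f : nat -> R) : noeth R -> exists n, igen (mkseq f n) (f n).
move=> nR; have [|s sI sP] := nR [set x | exists m, igen (mkseq f m) x].
 split=> [|x y [m hm] [m' hm']|c x [m hm]].
 - by exists 0%N => J [].
 - exists (maxn m m') => J iJ h; have [_ JD _] := iJ; apply: JD; [apply: hm|apply: hm'] => // _ /mkseq_mem[i im ->].
   by apply/h/mkseq_mem; exists i => //; rewrite leq_max im.
  by apply/h/mkseq_mem; exists i => //; rewrite leq_max im orbT.
 - by exists m => J iJ h; have [_ _ JM] := iJ; apply: JM; exact: hm.
have /choice[m hm] : forall y, exists m, y \in s -> igen (mkseq f m) y.
 by move=> y; have [/sI[m hm]|_] := boolP (y \in s); [exists m|exists 0%N].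
exists (\max_(y <- s) m y) => J iJ h; set M := \max_(y <- s) _ in h *.
apply: (sP (f M)) => // [|y ys]; first by exists M.+1 => ? _; apply; apply/mkseq_mem; exists M.
apply: (hm y ys) => // _ /mkseq_mem[i im ->]; apply/h/mkseq_mem; exists i => //.
by apply: leq_trans im _; exact: (@leq_bigmax_seq _ s xpredT m).
Qed.

(* Hilbert's argument: if [I] is not finitely generated, pick [g n] of least degree in [I] outside the ideal
  generated by the previous ones; a relation between the leading coefficients produces a smaller choice. *)
Lemma noeth_poly (R : comNzRingType) : noeth R -> noeth {poly R}.
move=> nR I iI; have [I0 ID IM] := iI; apply: contrapT => nI.
(* The choice is made for every list, so the assumption that the list lies in [I] moves into the
   conclusion and [F] becomes a total function. *)
have /choice[F hF] : forall s : seq {poly R}, exists x, (forall y, y \in s -> I y) ->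
  [/\ I x, ~ igen s x & forall y, I y -> ~ igen s y -> (size x <= size y)%N].
 move=> s; have [sI|nsI] := pselect (forall y, y \in s -> I y); last by exists 0 => /nsI.
 pose P m := `[< exists x, [/\ I x, ~ igen s x & size x = m] >].
 have exP : exists m, P m.
  apply: contrapT => nP; apply: nI; exists s => // x Ix; apply: contrapT => nx.
  by apply: nP; exists (size x); apply/asboolP; exists x.
 have [m /asboolP[x [Ix nx <-]] mm] := ex_minnP exP; exists x => _; split=> // y Iy ny.
 by apply: mm; apply/asboolP; exists y.
pose L := fix L n := if n is m.+1 then rcons (L m) (F (L m)) else [::]; pose g n := F (L n).
have eL n : L n = mkseq g n by elim: n => // n IH; rewrite mkseqS -IH.
have [IL hg] : (forall n y, y \in L n -> I y) /\ forall n, [/\ I (g n), ~ igen (L n) (g n) &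
  forall y, I y -> ~ igen (L n) y -> (size (g n) <= size y)%N].
 suff h n : forall y, y \in L n -> I y by split=> // n; exact: hF (h n).
 by elim: n => // n IH y; rewrite mem_rcons inE => /orP[/eqP->|/IH//]; have [] := hF _ IH.
have [n hn] := noeth_seq (fun n => lead_coef (g n)) nR; have [Ig ng mg] := hg n.
(* [J] is the ideal of coefficients in the degree of [g n] of elements of at most that degree in the
   ideal of [L n]. Earlier leading coefficients enter it after multiplication by a power of [X],
   since [g i] is no larger than [g n]. *)
pose J := [set a | exists h, [/\ igen (L n) h, (size h <= size (g n))%N & h`_(size (g n)).-1 = a]].
have [h [hL sh eh]] : J (lead_coef (g n)).
 apply: hn => [|_ /mkseq_mem[i i_n ->]]; first split.
 + by exists 0; rewrite size_poly0 coef0; split=> // K [].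
 + move=> _ _ [h [hL sh <-]] [h' [hL' sh' <-]]; exists (h + h'); rewrite coefD; split=> //.
   by move=> K iK hK; have [_ KD _] := iK; apply: KD; [exact: hL|exact: hL'].
  by apply: leq_trans (size_polyD _ _) _; rewrite geq_max sh.
 + move=> c _ [h [hL sh <-]]; exists (c%:P * h); rewrite coefCM mul_polyC; split=> //.
   by move=> K iK hK; have [_ _ KM] := iK; rewrite -mul_polyC; apply: KM; exact: hL.
  exact: leq_trans (size_scale_leq _ _) _.
 have [_ ni mi] := hg i; have gL : igen (L n) (g i) by move=> K _; apply; rewrite eL; apply/mkseq_mem; exists i.
 have si : (size (g i) <= size (g n))%N.
  apply: mi => // gi; apply: ng => K iK hK; apply: gi => // y; rewrite eL => /mkseq_mem[j ji ->].
  by apply: hK; rewrite eL; apply/mkseq_mem; exists j => //; exact: ltn_trans ji i_n.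
 have i0 : (0 < size (g i))%N by rewrite lt0n size_poly_eq0; apply: contra_notN ni => /eqP-> K [].
 exists ('X^(size (g n) - size (g i)) * g i); split.
 + by move=> K iK hK; have [_ _ KM] := iK; apply: KM; exact: gL.
 + by apply: leq_trans (size_polyMleq _ _) _; rewrite size_polyXn addSn /= subnK.
 + by rewrite coefXnM ltnNge (_ : _ <= _)%N /lead_coef; [congr (_`_ _); lia|lia].
have Ih : I h by apply: hL => //; exact: IL.
suff : (size (g n) <= size (g n - h)%R)%N.
 have g0 : (0 < size (g n))%N by rewrite lt0n size_poly_eq0; apply: contra_notN ng => /eqP-> K [].
 rewrite leqNgt => /negP; apply; rewrite -(ltn_predK g0) ltnS; apply/leq_sizeP => j.
 rewrite leq_eqVlt coefB => /orP[/eqP<-|lj]; first by rewrite eh subrr.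
 rewrite -(ltn_predK g0) in sh; by rewrite !nth_default ?subr0 //; [exact: leq_trans sh lj|move: lj; rewrite (ltn_predK g0)].
apply: mg => [|nh]; first by rewrite -mulN1r; apply: ID => //; exact: IM.
by apply: ng => K iK hK; have [_ KD _] := iK; rewrite -(subrK h (g n)); apply: KD; [exact: nh|exact: hL].
Qed.

(** A tower of univariate rings, so that [noeth_poly] iterates and the degree bounds further on go
    by structural induction on [m]. *)
Fixpoint ipoly (R : comNzRingType) m : comNzRingType :=
 if m is m'.+1 then {poly (ipoly R m')} else R.

Lemma noeth_ipoly (F : fieldType) m : noeth (ipoly F m).
by elim: m => [|m IH]; [apply: noeth_field|apply: noeth_poly]. Qed.

Fixpoint ipeval (R : comNzRingType) (g : nat -> R) m :
  {rmorphism ipoly R m -> R} :=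
 match m return {rmorphism ipoly R m -> R} with
 | 0 => idfun
 | m'.+1 => horner_eval (g m') \o map_poly (ipeval g m')
 end.

Lemma ip_const (R : comNzRingType) m (c : R) :
 exists P : ipoly R m, forall g, ipeval g m P = c.
elim: m => [|m [P IH]]; first by exists c.
by exists P%:P => g; rewrite /= map_polyC /horner_eval hornerC; apply: IH.
Qed.

Lemma ip_var (R : comNzRingType) m i : (i < m)%N ->
 exists P : ipoly R m, forall g, ipeval g m P = g i.
elim: m => // m IH; rewrite ltnS leq_eqVlt => /orP[/eqP->|/IH[P HP]].
 by exists 'X => g; rewrite /= map_polyX /horner_eval hornerX.
by exists P%:P => g; rewrite /= map_polyC /horner_eval hornerC; apply: HP.
Qed.

(** * Polynomial functions *)

(* [enc] identifies [V] with an affine space over [k]; [crdx] lists further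
  functions that count as polynomial, such as the inverse of the determinant. *)
Class crd (k : fieldType) (V : Type) := Crd {
 edim : nat;
 enc : V -> seq k;
 dec : seq k -> V;
 size_enc : forall v, size (enc v) = edim;
 encK : forall v, dec (enc v) = v;
 decK : forall s, size s = edim -> enc (dec s) = s;
 crdx : seq (V -> k);
 crdxT : forall i, exists t : GRing.term k,
  forall v, nth (fun=> 0) crdx i v = GRing.eval (enc v) t }.

Arguments edim {k} V {_}.
Arguments crdx {k} V {_}.

Section Pol.
Context {k : fieldType}.

Inductive pol {V : Type} {cV : crd k V} : (V -> k) -> Prop :=
| polC c : pol (fun=> c)
| polE i : pol (fun v => (enc v)`_i)
| polX i : pol (fun v => nth (fun=> 0) (crdx V) i v)
| polD f g : pol f -> pol g -> pol (fun v => f v + g v)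
| polM f g : pol f -> pol g -> pol (fun v => f v * g v).

Section One.
Context {V : Type} {cV : crd k V}.
Implicit Types (f g : V -> k) (Z Y S : set V).

Lemma set_ext_fun (I : set (V -> k)) f g : (forall v, f v = g v) -> I f -> I g.
by move=> /funext->. Qed.

Lemma pol_ext f g : (forall v, f v = g v) -> pol f -> pol g.
by move=> /funext->. Qed.

Lemma polN f : pol f -> pol (fun v => - f v).
move=> pf; apply: (@pol_ext (fun v => -1 * f v)); first by move=> v; rewrite mulN1r.
by apply: polM => //; apply: polC.
Qed.

Lemma polB f g : pol f -> pol g -> pol (fun v => f v - g v).
by move=> pf pg; apply: polD => //; apply: polN. Qed.

Lemma pol_sum (I : Type) (r : seq I) (P : pred I) (F : I -> V -> k) :
 (forall i, pol (F i)) -> pol (fun v => \sum_(i <- r | P i) F i v).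
move=> pF; elim: r => [|i r IH].
 by apply: pol_ext (polC 0) => v; rewrite big_nil.
apply: (@pol_ext (fun v => (if P i then F i v else 0) + \sum_(i <- r | P i) F i v)).
 by move=> v; rewrite big_cons; case: (P i); rewrite ?add0r.
by apply: polD; case: (P i) => //; apply: polC.
Qed.

Lemma pol_prod (I : Type) (r : seq I) (P : pred I) (F : I -> V -> k) :
 (forall i, pol (F i)) -> pol (fun v => \prod_(i <- r | P i) F i v).
move=> pF; elim: r => [|i r IH].
 by apply: pol_ext (polC 1) => v; rewrite big_nil.
apply: (@pol_ext (fun v => (if P i then F i v else 1) * \prod_(i <- r | P i) F i v)).
 by move=> v; rewrite big_cons; case: (P i); rewrite ?mul1r.
by apply: polM; case: (P i) => //; apply: polC.
Qed.

Lemma pol_exp f n : pol f -> pol (fun v => f v ^+ n).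
move=> pf; elim: n => [|n IH]; first exact: pol_ext (polC 1) => v.
by apply: (@pol_ext (fun v => f v * f v ^+ n)) => [v|]; [rewrite exprS|apply: polM].
Qed.

Definition polmx m n (A : V -> 'M[k]_(m, n)) := forall i j, pol (fun v => A v i j).

Lemma polmxC m n (A : 'M[k]_(m, n)) : polmx (fun=> A).
by move=> i j; apply: polC. Qed.

Lemma polmxM m n p (A : V -> 'M[k]_(m, n)) (B : V -> 'M[k]_(n, p)) :
 polmx A -> polmx B -> polmx (fun v => A v *m B v).
move=> pA pB i j.
apply: (@pol_ext (fun v => \sum_l A v i l * B v l j)); first by move=> v; rewrite mxE.
by apply: pol_sum => l; apply: polM.
Qed.

Lemma polmxD m n (A B : V -> 'M[k]_(m, n)) :
 polmx A -> polmx B -> polmx (fun v => A v + B v).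
move=> pA pB i j; apply: (@pol_ext (fun v => A v i j + B v i j)); last exact: polD.
by move=> v; rewrite mxE.
Qed.

Lemma polmxN m n (A : V -> 'M[k]_(m, n)) : polmx A -> polmx (fun v => - A v).
move=> pA i j; apply: (@pol_ext (fun v => - A v i j)); last exact: polN.
by move=> v; rewrite mxE.
Qed.

Lemma polmxB m n (A B : V -> 'M[k]_(m, n)) :
 polmx A -> polmx B -> polmx (fun v => A v - B v).
by move=> pA pB; apply: polmxD => //; apply: polmxN. Qed.

Lemma polmxZ m n f (B : V -> 'M[k]_(m, n)) :
 pol f -> polmx B -> polmx (fun v => f v *: B v).
move=> pA pB i j; apply: (@pol_ext (fun v => f v * B v i j)); last exact: polM.
by move=> v; rewrite mxE.
Qed.

Lemma pol_det n (A : V -> 'M[k]_n) : polmx A -> pol (fun v => \det (A v)).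
move=> pA; apply: pol_sum => s; apply: polM; first exact: polC.
exact: pol_prod => i.
Qed.

Lemma polmx_adj n (A : V -> 'M[k]_n) : polmx A -> polmx (fun v => \adj (A v)).
move=> pA i j; apply: (@pol_ext (fun v => cofactor (A v) j i)).
 by move=> v; rewrite mxE.
apply: polM; first exact: polC.
apply: pol_det => a b.
by apply: (@pol_ext (fun v => A v (lift j a) (lift i b))) => // v; rewrite !mxE.
Qed.

Definition cl Z : set V :=
 [set v | forall f, pol f -> (forall z, Z z -> f z = 0) -> f v = 0].
Definition zclosed Z := cl Z `<=` Z.
Definition irr Z := Z !=set0 /\ forall f g, pol f -> pol g ->
 (forall z, Z z -> f z * g z = 0) ->
 (forall z, Z z -> f z = 0) \/ (forall z, Z z -> g z = 0).

Lemma sub_cl Z : Z `<=` cl Z.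
by move=> z Zz f _; apply. Qed.

Lemma cl_mono Z Y : Z `<=` Y -> cl Z `<=` cl Y.
by move=> ZY v cv f pf fY; apply: cv => // z /ZY; apply: fY. Qed.

Lemma cl_closed Z : zclosed (cl Z).
by move=> v cv f pf fZ; apply: cv => // z cz; apply: cz. Qed.

Lemma cl_sub Z Y : zclosed Y -> Z `<=` Y -> cl Z `<=` Y.
by move=> cY ZY; apply: subset_trans cY; apply: cl_mono. Qed.

Lemma closed_sep Z v : zclosed Z -> ~ Z v ->
 exists f, [/\ pol f, forall z, Z z -> f z = 0 & f v != 0].
move=> cZ nZ; apply: contrapT => nf; apply: nZ; apply: cZ => f pf fZ.
by have [//|f0] := eqVneq (f v) 0; case: nf; exists f.
Qed.

Lemma closed_zero f : pol f -> zclosed [set v | f v = 0].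
by move=> pf v; apply. Qed.

Lemma closedT : zclosed [set: V].
by []. Qed.

Lemma closed0 : zclosed (@set0 V).
by move=> v /(_ _ (polC 1)) h; have /eqP := h (fun z => False_ind _); rewrite oner_eq0. Qed.

Lemma closed_cap (I : Type) (F : I -> set V) :
 (forall i, zclosed (F i)) -> zclosed [set v | forall i, F i v].
by move=> cF v cv i; apply: cF => f pf fF; apply: cv => // z; move/(_ i)/fF. Qed.

Lemma closedI Z Y : zclosed Z -> zclosed Y -> zclosed (Z `&` Y).
by move=> cZ cY v cv; split; [apply: cZ|apply: cY] => f pf h;
 apply: cv => // z [Zz Yz]; apply: h.
Qed.

Lemma closedU Z Y : zclosed Z -> zclosed Y -> zclosed (Z `|` Y).
move=> cZ cY v cv; have [Zv|nZ] := pselect (Z v); first by left.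
have [Yv|nY] := pselect (Y v); first by right.
have [f [pf fZ fv]] := closed_sep cZ nZ; have [g [pg gY gv]] := closed_sep cY nY.
have /eqP : f v * g v = 0.
 by apply: (cv _ (polM pf pg)) => z [/fZ->|/gY->]; rewrite ?mul0r ?mulr0.
by rewrite mulf_eq0 (negbTE fv) (negbTE gv).
Qed.

Lemma irr_cl Z : irr Z -> irr (cl Z).
move=> [[z Zz] iZ]; split=> [|f g pf pg fg]; first by exists z; apply: sub_cl.
have [h|h] := iZ f g pf pg (fun z Zz => fg z (sub_cl Zz)).
 by left=> y cy; apply: cy.
by right=> y cy; apply: cy.
Qed.

Lemma irr_dense Z Y : irr Z -> Y `<=` Z -> Z `<=` cl Y -> irr Y.
move=> [[z0 Z0] iZ] YZ Zc; split.
 apply: contrapT => nY; have /eqP : 1 = 0 :> k.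
  by apply: (Zc z0 Z0 _ (polC 1)) => y Yy; case: nY; exists y.
 by rewrite oner_eq0.
move=> f g pf pg fg; have [z Zz|h|h] := iZ f g pf pg.
- by apply: (Zc z Zz (fun v => f v * g v)); first exact: polM.
- by left=> y /YZ/h.
- by right=> y /YZ/h.
Qed.

Lemma irr_sub_closedU Z Y1 Y2 : irr Z -> zclosed Y1 -> zclosed Y2 ->
 Z `<=` Y1 `|` Y2 -> Z `<=` Y1 \/ Z `<=` Y2.
move=> [_ iZ] c1 c2 h; apply: contrapT => /not_orP[n1 n2].
have [z1 [Z1 nz1]] : exists z, Z z /\ ~ Y1 z.
 by apply: contrapT => nz; apply: n1 => z Zz; apply: contrapT => nY; apply: nz; exists z.
have [z2 [Z2 nz2]] : exists z, Z z /\ ~ Y2 z.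
 by apply: contrapT => nz; apply: n2 => z Zz; apply: contrapT => nY; apply: nz; exists z.
have [f [pf fZ /eqP fv]] := closed_sep c1 nz1; have [g [pg gY /eqP gv]] := closed_sep c2 nz2.
case: (iZ f g pf pg) => [z /h[/fZ->|/gY->]|/(_ _ Z1)//|/(_ _ Z2)//]; first by rewrite mul0r.
by rewrite mulr0.
Qed.

Lemma closed_cond (P : Prop) Z : zclosed Z -> zclosed [set z | P /\ Z z].
move=> cZ; have [p|np] := pselect P; last first.
 by apply: subset_trans; [apply: cl_mono => ? []|move=> v /closed0].
by rewrite (_ : [set z | _] = Z) //; apply/seteqP; split=> z //= [].
Qed.

Lemma closed_bigU (I : Type) (s : seq I) (F : I -> set V) :
 (forall i, zclosed (F i)) -> zclosed [set z | exists i, List.In i s /\ F i z].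
move=> cF; elim: s => [|j r IHr].
 by apply: subset_trans; [apply: cl_mono => ? [? []]|move=> v /closed0].
apply: (@subset_trans _ (cl (F j `|` [set z | exists j, List.In j r /\ F j z]))).
 by apply: cl_mono => z [l [/= [<-|lr] Fz]]; [left|right; exists l].
move=> v /(closedU (cF j) IHr)[Fv|[l [lr Fl]]]; first by exists j; split=> //; left.
by exists l; split=> //; right.
Qed.

Lemma irr_sub_bigU (I : Type) (s : seq I) (F : I -> set V) Z : irr Z ->
 (forall i, zclosed (F i)) -> (forall z, Z z -> exists i, List.In i s /\ F i z) ->
 exists i, List.In i s /\ Z `<=` F i.
move=> iZ cF; elim: s => [|i s IH] h.
 by case: iZ => -[z /h[? []]].
have [z /h[j [/= [<-|js] Fz]]|hi|hr] := irr_sub_closedU iZ (cF i) (closed_bigU (s := s) cF).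
- by left.
- by right; exists j.
- by exists i; split=> //; left.
by have [j [js Zj]] := IH hr; exists j; split=> //; right.
Qed.

Lemma irr_prod_neq0 (I : Type) (s : seq I) (F : I -> V -> k) Z : irr Z ->
 (forall i, pol (F i)) ->
 (forall i, List.In i s -> exists2 z, Z z & F i z != 0) ->
 exists2 z, Z z & forall i, List.In i s -> F i z != 0.
move=> iZ pF h; apply: contrapT => nz.
have hz z : Z z -> exists i, List.In i s /\ [set z | F i z = 0] z.
 move=> Zz; apply: contrapT => nF; apply: nz; exists z => // i si; apply/eqP => Fz.
 by apply: nF; exists i.
have [i [/h[z Zz Fz] /(_ z Zz) /eqP]] := irr_sub_bigU iZ (fun i => closed_zero (pF i)) hz.
by rewrite (negbTE Fz).
Qed.

Lemma irr_directed (D : set (set V)) : D !=set0 -> (forall Z, D Z -> irr Z) ->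
 (forall Y Z, D Y -> D Z -> exists2 W, D W & Y `<=` W /\ Z `<=` W) ->
 irr [set v | exists2 Z, D Z & Z v].
move=> [Z0 DZ0] iD dD; split.
 by have [[z Zz] _] := iD Z0 DZ0; exists z; exists Z0.
move=> f g pf pg fg; apply: contrapT => /not_orP[nf ng].
have [z1 [[Z1 D1 Z1z] fz]] : exists z, (exists2 Z, D Z & Z z) /\ f z <> 0.
 by apply: contrapT => h; apply: nf => z Zz; apply: contrapT => ?; apply: h; exists z.
have [z2 [[Z2 D2 Z2z] gz]] : exists z, (exists2 Z, D Z & Z z) /\ g z <> 0.
 by apply: contrapT => h; apply: ng => z Zz; apply: contrapT => ?; apply: h; exists z.
have [W DW [W1 W2]] := dD _ _ D1 D2; have [_ iW] := iD W DW.
by have [z Wz|/(_ _ (W1 _ Z1z))|/(_ _ (W2 _ Z2z))] := iW f g pf pg; [apply: fg; exists W| |].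
Qed.

Lemma pol_ipoly f : pol f ->
 exists P : ipoly k (edim V + size (crdx V)), forall v,
  f v = ipeval (fun i => if (i < edim V)%N then (enc v)`_i
              else nth (fun=> 0) (crdx V) (i - edim V) v) _ P.
elim=> [c|i|i|{}f g _ [P HP] _ [Q HQ]|{}f g _ [P HP] _ [Q HQ]].
- by have [P HP] := ip_const (edim V + size (crdx V)) c; exists P => v.
- have [iE|iE] := ltnP i (edim V).
  have [P HP] := ip_var k (ltn_addr (size (crdx V)) iE).
  by exists P => v; rewrite HP iE.
 have [P HP] := ip_const (edim V + size (crdx V)) (0 : k).
 by exists P => v; rewrite nth_default ?size_enc.
- have [iE|iE] := ltnP i (size (crdx V)).
  have /(ip_var k)[P HP] : (edim V + i < edim V + size (crdx V))%N by rewrite ltn_add2l.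
  by exists P => v; rewrite HP ltnNge leq_addr addKn.
 have [P HP] := ip_const (edim V + size (crdx V)) (0 : k).
 by exists P => v; rewrite nth_default.
- by exists (P + Q) => v; rewrite rmorphD HP HQ.
- by exists (P * Q) => v; rewrite rmorphM HP HQ.
Qed.

Lemma ipoly_pol m (c : V -> nat -> k) (P : ipoly k m) :
 (forall i, pol (c ^~ i)) -> pol (fun v => ipeval (c v) m P).
move=> pc; elim: m P => [|m IH] P /=; first exact: polC.
apply: (@pol_ext (fun v => \sum_(i < size P) ipeval (c v) m P`_i * c v m ^+ i)).
 move=> v; rewrite /horner_eval (@horner_coef_wide _ (size P)) ?size_poly //.
 by apply: eq_bigr => i _; rewrite coef_map.
by apply: pol_sum => i; apply: polM; [apply: IH|apply: pol_exp].
Qed.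

(** Hilbert's basis theorem carried to polynomial functions: by [pol_ipoly] these are the values of
    a tower [ipoly], with the functions of [crdx] substituted for extra variables. The generators
    are indexed by [nat], padded with zero. *)
Lemma pol_ideal_fg (I : set (V -> k)) :
 I (fun=> 0) -> (forall f g, I f -> I g -> I (fun v => f v + g v)) ->
 (forall f g, pol f -> I g -> I (fun v => f v * g v)) -> (forall f, I f -> pol f) ->
 exists (N : nat) (s : nat -> V -> k), (forall i, I (s i)) /\
  forall f, I f -> exists c : nat -> V -> k, (forall i, pol (c i)) /\
   forall v, f v = \sum_(i < N) c i v * s i v.
move=> I0 ID IM Ip; pose N := (@edim k V cV + size (@crdx k V cV)).
pose ev v : {rmorphism ipoly k N -> k} :=
 ipeval (fun i => if (i < @edim k V cV)%N then (@enc k V cV v)`_i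
  else nth (fun=> 0) (@crdx k V cV) (i - @edim k V cV) v) N.
have pev P : pol (fun v => ev v P).
 apply: (@ipoly_pol N (fun v i => _)) => i; case: (_ < _)%N; [exact: polE|exact: polX].
have [|s sI sP] := @noeth_ipoly k N [set P | I (fun v => ev v P)].
 split=> /=.
 - by apply: set_ext_fun I0 => v; rewrite rmorph0.
 - by move=> P Q IP IQ; apply: set_ext_fun (ID _ _ IP IQ) => v; rewrite rmorphD.
 - by move=> P Q IQ; apply: set_ext_fun (IM _ _ (pev P) IQ) => v; rewrite rmorphM.
exists (size s), (fun i v => ev v s`_i); split=> [i|f If].
 have [is_|is_] := ltnP i (size s); first by apply: sI; apply: mem_nth.
 by rewrite nth_default //; apply: set_ext_fun I0 => v; rewrite rmorph0.
have [P HP] := pol_ipoly (Ip f If).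
have /sP/igen_sum[c Pc] : I (fun v => ev v P) by apply: set_ext_fun If => v.
exists (fun i v => ev v (c i)); split=> // v.
by rewrite HP Pc rmorph_sum; apply: eq_bigr => i _; rewrite rmorphM.
Qed.

(** The Noetherian property as a minimum principle. Along a strictly decreasing sequence the
    functions vanishing on some member form a finitely generated ideal; its generators all vanish on
    one member [n], hence so does every function vanishing on the next member. *)
Lemma closed_min (F : set (set V)) : F !=set0 -> (forall Z, F Z -> zclosed Z) ->
 exists2 Z, F Z & forall Y, F Y -> Y `<=` Z -> Z `<=` Y.
move=> [Z0 FZ0] cF; apply: contrapT => nmin.
have nx (Z : {Z | F Z}) : exists Y : {Y | F Y}, sval Y `<=` sval Z /\ ~ sval Z `<=` sval Y.
 case: Z => Z FZ; apply: contrapT => nY; apply: nmin; exists Z => // Y FY YZ.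
 by apply: contrapT => h; apply: nY; exists (exist _ Y FY).
have [nxt nxtP] := choice nx.
pose Zs i := iter i nxt (exist _ Z0 FZ0).
have Zmono i j : (i <= j)%N -> sval (Zs j) `<=` sval (Zs i).
 move=> /subnK <-; elim: (j - i)%N => // m IH; apply: subset_trans IH.
 by rewrite addSn; apply: (nxtP _).1.
pose I := [set f : V -> k | pol (cV:=cV) f /\ exists i, forall z, sval (Zs i) z -> f z = 0].
have [| | | |N [s [sI sP]]] := @pol_ideal_fg I.
- by split; [exact: polC|exists 0].
- move=> f g [pf [i fi]] [pg [j gj]]; split; first exact: polD.
 exists (maxn i j) => z Zz; rewrite fi ?gj ?addr0 //; apply: Zmono Zz;
 by rewrite ?leq_maxl ?leq_maxr.
- move=> f g pf [pg [j gj]]; split; first exact: polM.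
 by exists j => z /gj->; rewrite mulr0.
- by move=> f [].
have [n nP] : exists n, forall i, (i < N)%N -> forall z, sval (Zs n) z -> s i z = 0.
 elim: N {sP} => [|N [n IH]]; first by exists 0.
 have [_ [j sj]] := sI N; exists (maxn n j) => i; rewrite ltnS leq_eqVlt => /orP[/eqP->|iN] z Zz.
  by apply: sj; apply: Zmono Zz; exact: leq_maxr.
 by apply: IH => //; apply: Zmono Zz; exact: leq_maxl.
apply: ((nxtP (Zs n)).2) => z Zz; apply: (cF _ (svalP (nxt (Zs n)))) => f pf fY.
have [|c [pc fc]] := sP f; first by split=> //; exists n.+1.
by rewrite fc big1 // => i _; rewrite (nP _ (ltn_ord i) z Zz) mulr0.
Qed.

(** Noetherian induction on a minimal closed set without such a decomposition: if [f * g] vanishes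
    on it, it is the union of its zero sets of [f] and of [g]. *)
Lemma irr_decomp Z : zclosed Z -> exists s : seq (set V),
 (forall Y, List.In Y s -> [/\ irr Y, zclosed Y & Y `<=` Z]) /\
 forall z, Z z -> exists Y, List.In Y s /\ Y z.
move=> cZ; apply: contrapT => nZ.
pose bad Y := zclosed Y /\ ~ exists s : seq (set V),
 (forall X, List.In X s -> [/\ irr X, zclosed X & X `<=` Y]) /\
 forall z, Y z -> exists X, List.In X s /\ X z.
have [|Y [] //|{cZ nZ}Y [cY nY] mY] := @closed_min bad; first by exists Z.
have good X : zclosed X -> X `<=` Y -> ~ Y `<=` X -> exists s : seq (set V),
  (forall X', List.In X' s -> [/\ irr X', zclosed X' & X' `<=` X]) /\
  forall z, X z -> exists X', List.In X' s /\ X' z.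
 by move=> cX XY nYX; apply: contrapT => nX; apply: nYX; apply: mY.
have [[y0 Yy0]|Y0] := pselect (Y !=set0); last first.
 by apply: nY; exists [::]; split=> // z Yz; case: Y0; exists z.
have [iY|niY] := pselect (irr Y).
 apply: nY; exists [:: Y]; split=> [X [<-|[]]|z Yz]; first by split.
 by exists Y; split=> //; left.
apply: niY; split=> [|f g pf pg fg]; first by exists y0.
apply: contrapT => /not_orP[nf ng].
have [||| s1 [s1a s1b]] := good (Y `&` [set v | f v = 0]).
- by apply: closedI => //; apply: closed_zero.
- by [].
- by move=> h; apply: nf => z /h[].
have [||| s2 [s2a s2b]] := good (Y `&` [set v | g v = 0]).
- by apply: closedI => //; apply: closed_zero.
- by [].
- by move=> h; apply: ng => z /h[].
apply: nY; exists (s1 ++ s2); split.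
 move=> X /List.in_app_iff[/s1a[? ? h]|/s2a[? ? h]]; by split=> // x /h[].
move=> z Yz; have /eqP := fg z Yz; rewrite mulf_eq0 => /orP[/eqP fz|/eqP gz].
 by have [|X [Xs Xz]] := s1b z; [split|exists X; split=> //; apply/List.in_app_iff; left].
by have [|X [Xs Xz]] := s2b z; [split|exists X; split=> //; apply/List.in_app_iff; right].
Qed.

End One.
End Pol.

(** * Constructible sets and morphisms *)

Lemma mem_In (T : eqType) (s : seq T) x : x \in s <-> List.In x s.
elim: s => //= y s IH; rewrite inE; split=> [/orP[/eqP->|/IH]|[->|/IH->]]; rewrite ?eqxx ?orbT //.
- by left.
- by right.
Qed.

Section Cst.
Context {k : fieldType}.

Inductive cst {V : Type} {cV : crd k V} : set V -> Prop :=
| cst_zero f : pol f -> cst [set v | f v = 0]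
| cstI S T : cst S -> cst T -> cst (S `&` T)
| cstC S : cst S -> cst [set v | ~ S v].

Definition pon {V : Type} {cV : crd k V} (D : set V) (f : V -> k) :=
 exists2 g, pol g & forall v, D v -> f v = g v.

(** The domain [D] is arbitrary because maps such as [invmx] are given by polynomial functions only
    on the invertible matrices. *)
Definition mor {V W : Type} {cV : crd k V} {cW : crd k W} (D : set V) (F : V -> W) :=
 forall f, pol f -> pon D (f \o F).

Section One.
Context {V : Type} {cV : crd k V}.
Implicit Types (S T D Z : set V) (f : V -> k).

Lemma cst_ext S T : (forall v, S v <-> T v) -> cst S -> cst T.
by move=> h; rewrite (_ : T = S) //; apply/funext => v; apply/propext; split=> /h. Qed.

Lemma cstU S T : cst S -> cst T -> cst (S `|` T).
move=> cS cT; apply: cst_ext (cstC (cstI (cstC cS) (cstC cT))) => v; split=> /=.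
 by move=> h; apply: contrapT => /not_orP[nS nT]; apply: h.
by move=> [Sv|Tv] [nS nT].
Qed.

Lemma cstT : cst [set: V].
exact: cst_ext (cst_zero (polC 0)). Qed.

Lemma cst0 : cst (@set0 V).
by apply: cst_ext (cstC cstT) => v; split=> // /(_ I). Qed.

Lemma cst_nz f : pol f -> cst [set v | f v != 0].
by move=> pf; apply: cst_ext (cstC (cst_zero pf)) => v; split=> /eqP. Qed.

Lemma cst_forall (I : Type) (s : seq I) (F : I -> set V) :
 (forall i, cst (F i)) -> cst [set v | forall i, List.In i s -> F i v].
move=> cF; elim: s => [|i s IH]; first by apply: cst_ext cstT => v; split=> // _ i [].
apply: cst_ext (cstI (cF i) IH) => v; split=> /=.
 by move=> [Fi Fs] j [<-|/Fs].
by move=> h; split=> [|j js]; apply: h; [left|right].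
Qed.

Lemma cst_closed Z : zclosed Z -> cst Z.
move=> cZ; pose I := [set f : V -> k | pol (cV:=cV) f /\ forall z, Z z -> f z = 0].
have [| | | |N [s [sI sP]]] := @pol_ideal_fg _ _ _ I.
- by split=> //; apply: polC.
- by move=> f g [pf f0] [pg g0]; split=> [|z Zz]; [exact: polD|rewrite f0 ?g0 ?addr0].
- by move=> f g pf [pg g0]; split=> [|z Zz]; [exact: polM|rewrite g0 ?mulr0].
- by move=> f [].
apply: cst_ext (@cst_forall nat (iota 0 N) (fun i => [set v | s i v = 0]) _).
 move=> v; split=> [h|Zv i _]; last exact: (sI i).2.
 apply: cZ => f pf f0; have [//|c [_ ->]] := sP f.
 by rewrite big1 // => i _; rewrite h ?mulr0 //; apply/mem_In; rewrite mem_iota /=.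
by move=> i; apply: cst_zero; case: (sI i).
Qed.

(** On an irreducible set, the sets that contain or miss a nonempty basic open set form a Boolean
    algebra, as two such open sets meet. *)
Lemma chevalley_dichotomy S Z : cst S -> irr Z -> exists h, [/\ pol h,
 exists2 z, Z z & h z != 0 &
 (forall z, Z z -> h z != 0 -> S z) \/ (forall z, Z z -> h z != 0 -> ~ S z)].
move=> cS iZ; elim: cS => [f pf|S1 T _ [h1 [p1 [z1 Z1 hz1] d1]] _ [h2 [p2 [z2 Z2 hz2] d2]]|].
- have [f0|nf] := pselect (forall z, Z z -> f z = 0).
  exists (fun=> 1); split; [exact: polC| |by left=> z Zz _; apply: f0].
  by case: iZ => -[z Zz] _; exists z => //; rewrite oner_eq0.
 exists f; split=> //; last by right=> z _ /eqP.
 by apply: contrapT => h; apply: nf => z Zz; apply: contrapT => /eqP fz; apply: h; exists z.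
- exists (fun v => h1 v * h2 v); split; first exact: polM.
  apply: contrapT => nz; have [z Zz|h|h] := iZ.2 h1 h2 p1 p2.
  - by apply: contrapT => /eqP n; apply: nz; exists z.
  - by rewrite h ?eqxx in hz1.
  - by rewrite h ?eqxx in hz2.
 case: d1 => d1; last by right=> z Zz; rewrite mulf_eq0 => /norP[/(d1 z Zz) nS _] [].
 case: d2 => d2; last by right=> z Zz; rewrite mulf_eq0 => /norP[_ /(d2 z Zz) nS] [].
 by left=> z Zz; rewrite mulf_eq0 => /norP[/(d1 z Zz) ? /(d2 z Zz) ?].
- move=> T _ [h [ph hz [d|d]]]; exists h; split=> //; [right|left] => z Zz hz'.
  by move/(_ (d z Zz hz')).
 exact: d.
Qed.

Lemma cst_dense S Z : cst S -> irr Z -> Z `<=` cl (Z `&` S) ->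
 exists h, [/\ pol h, exists2 z, Z z & h z != 0 & forall z, Z z -> h z != 0 -> S z].
move=> cS iZ dS; have [h [ph [z0 Z0 h0] [d|d]]] := chevalley_dichotomy cS iZ.
 by exists h; split=> //; exists z0.
have /eqP : h z0 = 0; last by rewrite (negbTE h0).
by apply: (dS z0 Z0 h ph) => z [Zz Sz]; have [//|/(d z Zz)] := eqVneq (h z) 0.
Qed.

Lemma pon_pol D f : pol f -> pon D f.
by exists f. Qed.

Lemma pon_sub D D' f : D' `<=` D -> pon D f -> pon D' f.
by move=> s [g pg e]; exists g => // v /s/e. Qed.

Lemma ponmx_ex D m n (A : V -> 'M[k]_(m, n)) :
 (forall i j, pon D (fun v => A v i j)) ->
 exists2 A', polmx A' & forall v, D v -> A v = A' v.
move=> h; have /choice[B BP] : forall ij : 'I_m * 'I_n,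
  exists g, pol g /\ forall v, D v -> A v ij.1 ij.2 = g v.
 by move=> [i j]; have [g pg e] := h i j; exists g.
exists (fun v => \matrix_(i, j) B (i, j) v) => [i j|v Dv].
 by apply: pol_ext (BP (i, j)).1 => v; rewrite mxE.
by apply/matrixP => i j; rewrite mxE; apply: (BP (i, j)).2.
Qed.

Lemma morI D : mor D (fun v : V => v).
by move=> f pf; exists f. Qed.

End One.

Lemma mor_sub {V W} {cV : crd k V} {cW : crd k W} (D D' : set V) (F : V -> W) :
 D' `<=` D -> mor D F -> mor D' F.
by move=> s mF f pf; apply: pon_sub s (mF f pf). Qed.

Lemma mor_comp {V W X} {cV : crd k V} {cW : crd k W} {cX : crd k X}
  (D : set V) (D' : set W) (F : V -> W) (G : W -> X) :
 mor D F -> mor D' G -> (forall v, D v -> D' (F v)) -> mor D (G \o F).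
move=> mF mG DD f pf; have [g pg e] := mG f pf; have [h ph e'] := mF g pg.
by exists h => // v Dv; rewrite -e' //=; apply: e; apply: DD.
Qed.

Lemma mor_gen {V W} {cV : crd k V} {cW : crd k W} (D : set V) (F : V -> W) :
 (forall i, pon D (fun v => (enc (F v))`_i)) ->
 (forall i, pon D (fun v => nth (fun=> 0) (crdx W) i (F v))) -> mor D F.
move=> hE hX f; elim=> [c|i|i|{}f g _ [f' pf' ef] _ [g' pg' eg]|{}f g _ [f' pf' ef] _ [g' pg' eg]].
- by exists (fun=> c) => //; apply: polC.
- exact: hE.
- exact: hX.
- by exists (fun v => f' v + g' v); [exact: polD|move=> v Dv; rewrite -ef // -eg].
- by exists (fun v => f' v * g' v); [exact: polM|move=> v Dv; rewrite -ef // -eg].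
Qed.

Section Two.
Context {V W : Type} {cV : crd k V} {cW : crd k W}.
Implicit Types (D : set V) (F : V -> W).

Lemma cst_pre (F : V -> W) (S : set W) : mor setT F -> cst S -> cst [set v | S (F v)].
move=> mF; elim=> [f pf|S1 T _ h1 _ h2|T _ h].
- have [g pg e] := mF f pf; apply: cst_ext (cst_zero pg) => v /=.
 by rewrite -e.
- exact: cst_ext (cstI h1 h2).
- exact: cst_ext (cstC h).
Qed.

Lemma irr_image D F : irr D -> mor D F -> irr (F @` D).
move=> [[d Dd] iD] mF; split; first by exists (F d).
move=> f g pf pg fg; have [f' pf' ef] := mF f pf; have [g' pg' eg] := mF g pg.
have [z Dz|h|h] := iD f' g' pf' pg'.
- by rewrite -ef -?eg //; apply: fg.
- by left=> _ [z Dz <-]; rewrite -[f _]/((f \o F) z) ef ?h.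
- by right=> _ [z Dz <-]; rewrite -[g _]/((g \o F) z) eg ?h.
Qed.

Lemma mor_cl D D' F (Y : set W) : mor D F -> zclosed Y -> D' `<=` D ->
 (forall v, D' v -> Y (F v)) -> forall v, D v -> cl D' v -> Y (F v).
move=> mF cY DD' h v Dv cv; apply: cY => f pf fY; have [g pg e] := mF f pf.
have -> : f (F v) = g v by rewrite -e.
by apply: cv => // z D'z; rewrite -e; [apply: fY; apply: h|apply: DD'].
Qed.

Lemma closed_pre D F (Y : set W) : zclosed D -> mor D F -> zclosed Y ->
 zclosed (D `&` [set v | Y (F v)]).
move=> cD mF cY v cv; have Dv : D v by apply: (cl_sub cD) cv => z [].
split=> //; apply: (mor_cl mF cY _ _ Dv cv); first by move=> z [].
by move=> z [].
Qed.

Lemma closed_preT F (Y : set W) : mor setT F -> zclosed Y -> zclosed [set v | Y (F v)].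
by move=> mF cY; have := closed_pre closedT mF cY; rewrite setTI.
Qed.

End Two.

Fixpoint tmap (f : nat -> GRing.term k) t :=
 match t with
 | GRing.Var i => f i
 | GRing.Const c => GRing.Const c
 | GRing.NatConst n => GRing.NatConst _ n
 | GRing.Add a b => GRing.Add (tmap f a) (tmap f b)
 | GRing.Opp a => GRing.Opp (tmap f a)
 | GRing.NatMul a n => GRing.NatMul (tmap f a) n
 | GRing.Mul a b => GRing.Mul (tmap f a) (tmap f b)
 | GRing.Inv a => GRing.Inv (tmap f a)
 | GRing.Exp a n => GRing.Exp (tmap f a) n
 end.

Lemma eval_tmap f (s r : seq k) t : (forall i, GRing.eval r (f i) = s`_i) -> GRing.eval r (tmap f t) = GRing.eval s t.
by move=> h; elim: t => //= [a -> b ->|a ->|a ->|a -> b ->|a ->|a ->]. Qed.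

Lemma prod_crdxT V W {cV : crd k V} {cW : crd k W} i : exists t : GRing.term k,
 forall v : V * W, nth (fun=> 0) ([seq (fun vw => f vw.1) | f <- crdx V] ++
  [seq (fun vw => f vw.2) | f <- crdx W]) i v = GRing.eval (enc v.1 ++ enc v.2) t.
have [iV|iV] := ltnP i (size (crdx V)).
 (* A variable of index at least [edim V] reads the default 0 in [enc v], but would read a
    coordinate of [w] in the concatenation; hence the constant 0. *)
 have [t tP] := crdxT (V := V) i; exists (tmap (fun i => if (i < edim V)%N then GRing.Var _ i else GRing.Const 0) t) => -[v w].
 rewrite nth_cat size_map iV (nth_map (fun=> 0)) //= tP; apply/esym/eval_tmap => j.
 by case: ltnP => h /=; [rewrite nth_cat size_enc h|rewrite nth_default ?size_enc].
have [iW|iW] := ltnP (i - size (crdx V)) (size (crdx W)).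
 have [t tP] := crdxT (i - size (crdx V)); exists (tmap (fun i => GRing.Var _ (edim V + i)) t) => -[v w].
 rewrite nth_cat size_map ltnNge iV /= (nth_map (fun=> 0)) //= tP.
 by apply/esym/eval_tmap => j /=; rewrite -(size_enc v) nth_cat ltnNge leq_addr addKn.
exists (GRing.Const 0) => vw.
by rewrite nth_cat size_map ltnNge iV /= nth_default // size_map.
Qed.

Lemma prod_encK V W {cV : crd k V} {cW : crd k W} (vw : V * W) :
 (dec (take (edim V) (enc vw.1 ++ enc vw.2)),
  dec (drop (edim V) (enc vw.1 ++ enc vw.2))) = vw.
by case: vw => v w; rewrite take_size_cat ?drop_size_cat ?size_enc // !encK.
Qed.

Lemma prod_decK V W {cV : crd k V} {cW : crd k W} (s : seq k) :
 size s = (edim V + edim W)%N ->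
 enc (dec (take (edim V) s) : V) ++ enc (dec (drop (edim V) s) : W) = s.
move=> ss; rewrite !decK ?cat_take_drop ?size_drop ?ss ?addKn //.
by rewrite size_takel // ss leq_addr.
Qed.

Lemma prod_size_enc V W {cV : crd k V} {cW : crd k W} (vw : V * W) :
 size (enc vw.1 ++ enc vw.2) = (edim V + edim W)%N.
by rewrite size_cat !size_enc. Qed.

Definition prod_crd V W (cV : crd k V) (cW : crd k W) : crd k (V * W) :=
 @Crd k (V * W) (edim V + edim W) (fun vw => enc vw.1 ++ enc vw.2)
  (fun s => (dec (take (edim V) s), dec (drop (edim V) s)))
  (@prod_size_enc V W cV cW) (@prod_encK V W cV cW) (@prod_decK V W cV cW)
  _ (@prod_crdxT V W cV cW).
#[local] Existing Instance prod_crd.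

Lemma mor_fst V W {cV : crd k V} {cW : crd k W} (D : set (V * W)) : mor D (fun vw : V * W => vw.1).
apply: mor_sub (subsetT D) _; apply: mor_gen => i.
 have [iV|iV] := ltnP i (edim V).
  exists (fun vw => (enc vw)`_i); first exact: polE.
  by move=> [v w] _; rewrite nth_cat size_enc iV.
 by exists (fun=> 0); [exact: polC|move=> v _; rewrite nth_default ?size_enc].
have [iV|iV] := ltnP i (size (crdx V)); last first.
 by exists (fun=> 0); [exact: polC|move=> v _; rewrite nth_default].
exists (fun vw => nth (fun=> 0) (crdx (V * W)) i vw); first exact: polX.
by move=> [v w] _; rewrite nth_cat size_map iV (nth_map (fun=> 0)).
Qed.

Lemma mor_snd V W {cV : crd k V} {cW : crd k W} (D : set (V * W)) : mor D (fun vw : V * W => vw.2).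
apply: mor_sub (subsetT D) _; apply: mor_gen => i.
 exists (fun vw => (enc vw)`_(edim V + i)); first exact: polE.
 by move=> [v w] _; rewrite nth_cat size_enc ltnNge leq_addr addKn.
have [iW|iW] := ltnP i (size (crdx W)); last first.
 by exists (fun=> 0); [exact: polC|move=> v _; rewrite nth_default].
exists (fun vw => nth (fun=> 0) (crdx (V * W)) (size (crdx V) + i) vw); first exact: polX.
by move=> [v w] _; rewrite nth_cat size_map ltnNge leq_addr /= addKn (nth_map (fun=> 0)).
Qed.

Lemma mor_pair X V W {cX : crd k X} {cV : crd k V} {cW : crd k W} (D : set X)
  (F : X -> V) (G : X -> W) : mor D F -> mor D G -> mor D (fun x => (F x, G x)).
move=> mF mG; apply: mor_gen => i.
 have [iV|iV] := ltnP i (edim V).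
  have [g pg e] := mF _ (polE i); exists g => // x Dx.
  by rewrite -e //= nth_cat size_enc iV.
 have [g pg e] := mG _ (polE (i - edim V)); exists g => // x Dx.
 by rewrite -e //= nth_cat size_enc ltnNge iV.
have [iV|iV] := ltnP i (size (crdx V)).
 have [g pg e] := mF _ (polX i); exists g => // x Dx.
 by rewrite -e //= nth_cat size_map iV (nth_map (fun=> 0)).
have [iW|iW] := ltnP (i - size (crdx V)) (size (crdx W)).
 have [g pg e] := mG _ (polX (i - size (crdx V))); exists g => // x Dx.
 by rewrite -e //= nth_cat size_map ltnNge iV /= (nth_map (fun=> 0)).
exists (fun=> 0); first exact: polC.
by move=> x _; rewrite nth_cat size_map ltnNge iV /= nth_default // size_map.
Qed.

End Cst.
#[export] Existing Instance prod_crd.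

Section FinCrd.
Context {k : fieldType} {V : Type} {I : finType}.
Variables (get : V -> I -> k) (mk : (I -> k) -> V).
Hypothesis (mkK : forall v, mk (get v) = v) (getK : forall f i, get (mk f) i = f i).

Let fenc v := [seq get v i | i <- enum I].
Let fdec (s : seq k) := mk (fun i => s`_(enum_rank i)).

Lemma fin_size_enc v : size (fenc v) = #|I|.
by rewrite size_map -cardE. Qed.

Lemma nth_fenc v i : (fenc v)`_(enum_rank i) = get v i.
by rewrite (nth_map i) -?cardE // nth_enum_rank. Qed.

Lemma fin_encK v : fdec (fenc v) = v.
by rewrite -[RHS]mkK; congr mk; apply/funext => i; rewrite nth_fenc. Qed.

Lemma fin_decK s : size s = #|I| -> fenc (fdec s) = s.
move=> ss; apply: (@eq_from_nth _ 0); rewrite fin_size_enc // => i iI.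
by rewrite -[i]/(nat_of_ord (Ordinal iI)) -{1}[Ordinal iI]enum_valK nth_fenc getK enum_valK.
Qed.

Definition fin_crd x xT : crd k V := @Crd k V #|I| fenc fdec fin_size_enc fin_encK fin_decK x xT.

Lemma pol_get x xT i : @pol k V (@fin_crd x xT) (fun v => get v i).
apply: (@pol_ext k V (@fin_crd x xT) (fun v => (fenc v)`_(enum_rank i))).
 by move=> v; rewrite nth_fenc.
exact: (@polE k V (@fin_crd x xT)).
Qed.

Lemma mor_fin {X} {cX : crd k X} (D : set X) (F : X -> V) x xT :
 (forall i, pon D (fun v => get (F v) i)) ->
 (forall i, pon D (fun v => nth (fun=> 0) x i (F v))) ->
 @mor k X V cX (@fin_crd x xT) D F.
move=> hE hX; apply: mor_gen => // i; have [iI|iI] := ltnP i #|I|; last first.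
 by exists (fun=> 0); [exact: polC|move=> v _; rewrite nth_default // fin_size_enc].
have [g pg e] := hE (enum_val (Ordinal iI)); exists g => // v Dv.
by rewrite -e // -[i]/(nat_of_ord (Ordinal iI)) -{1}[Ordinal iI]enum_valK nth_fenc.
Qed.
End FinCrd.

Lemma nil_crdxT (k : fieldType) (V : Type) (e : V -> seq k) i :
 exists t : GRing.term k, forall v, nth (fun=> 0) [::] i v = GRing.eval (e v) t.
by exists (GRing.Const 0) => v; rewrite nth_nil. Qed.

Lemma pol_term (k : fieldType) (V : Type) {cV : crd k V} f : pol f ->
 exists t : GRing.term k, forall v, f v = GRing.eval (enc v) t.
elim=> [c|i|i|{}f g _ [t ht] _ [u hu]|{}f g _ [t ht] _ [u hu]].
- by exists (GRing.Const c).
- by exists (GRing.Var _ i).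
- exact: crdxT.
- by exists (GRing.Add t u) => v; rewrite ht hu.
- by exists (GRing.Mul t u) => v; rewrite ht hu.
Qed.

Lemma unit_mkK (k : fieldType) (v : k) : (fun f : unit -> k => f tt) (fun=> v) = v.
by []. Qed.
Lemma unit_getK (k : fieldType) (f : unit -> k) i : (fun=> f tt) i = f i.
by case: i. Qed.
Definition k_crd (k : fieldType) : crd k k :=
 @fin_crd k k unit (fun v _ => v) (fun f => f tt) (@unit_mkK k) (@unit_getK k) [::]
  (@nil_crdxT k k _).
#[export] Existing Instance k_crd.

Lemma row_mkK (k : fieldType) N (v : 'rV[k]_N) : \row_i (fun j => v 0 j) i = v.
by apply/rowP => i; rewrite mxE. Qed.
Lemma row_getK (k : fieldType) N (f : 'I_N -> k) i : (\row_i f i) 0 i = f i.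
by rewrite mxE. Qed.
Definition row_crd (k : fieldType) N : crd k 'rV[k]_N :=
 @fin_crd k 'rV[k]_N 'I_N (fun v j => v 0 j) (fun f => \row_i f i) (@row_mkK k N)
  (@row_getK k N) [::] (@nil_crdxT k _ _).
#[export] Existing Instance row_crd.

Lemma mx_mkK (k : fieldType) n (v : 'M[k]_n) :
 \matrix_(i, j) (fun ij : 'I_n * 'I_n => v ij.1 ij.2) (i, j) = v.
by apply/matrixP => i j; rewrite mxE. Qed.
Lemma mx_getK (k : fieldType) n (f : 'I_n * 'I_n -> k) ij :
 (\matrix_(i, j) f (i, j)) ij.1 ij.2 = f ij.
by rewrite mxE; case: ij. Qed.
Lemma mx_crdxT (k : fieldType) n i : exists t : GRing.term k, forall v : 'M[k]_n,
 nth (fun=> 0) [:: fun v : 'M[k]_n => (\det v)^-1] i v =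
 GRing.eval [seq v ij.1 ij.2 | ij <- enum {: 'I_n * 'I_n}] t.
pose c := @fin_crd k 'M[k]_n ('I_n * 'I_n)%type (fun v ij => v ij.1 ij.2)
 (fun f => \matrix_(i, j) f (i, j)) (@mx_mkK k n) (@mx_getK k n) [::] (@nil_crdxT k _ _).
case: i => [|i]; last by exists (GRing.Const 0) => v; rewrite /= nth_nil.
have [|t ht] := @pol_term k 'M_n c (fun v => \det v).
 by apply: (@pol_det k _ c) => i j; apply: (@pol_get k _ _ _ _ _ _ _ _ (i, j)).
by exists (GRing.Inv t) => v /=; rewrite ht.
Qed.
Definition mx_crd (k : fieldType) n : crd k 'M[k]_n :=
 @fin_crd k 'M[k]_n ('I_n * 'I_n)%type (fun v ij => v ij.1 ij.2)
  (fun f => \matrix_(i, j) f (i, j)) (@mx_mkK k n) (@mx_getK k n) _ (@mx_crdxT k n).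
#[export] Existing Instance mx_crd.

Section Basic.
Context {k : fieldType}.

Lemma pol_id : pol (fun x : k => x).
exact: (@pol_get k k unit _ _ _ _ _ _ tt). Qed.

Lemma pol_row N j : pol (fun v : 'rV[k]_N => v 0 j).
exact: (@pol_get k _ 'I_N _ _ _ _ _ _ j). Qed.

Lemma polmx_id n : polmx (fun v : 'M[k]_n => v).
by move=> i j; apply: (@pol_get k _ _ _ _ _ _ _ _ (i, j)). Qed.

Lemma pol_detV n : pol (fun v : 'M[k]_n => (\det v)^-1).
exact: (@polX k 'M_n _ 0). Qed.

Lemma mor_k X {cX : crd k X} (D : set X) f : pon D f -> mor D f.
move=> pf; apply: mor_fin => [//|i].
by exists (fun=> 0); [exact: polC|move=> v _; rewrite nth_nil].
Qed.

Lemma mor_row N X {cX : crd k X} (D : set X) (F : X -> 'rV[k]_N) :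
 (forall j, pon D (fun v => F v 0 j)) -> mor D F.
move=> pf; apply: mor_fin => [//|i].
by exists (fun=> 0); [exact: polC|move=> v _; rewrite nth_nil].
Qed.

Lemma mor_mx n X {cX : crd k X} (D : set X) (F : X -> 'M[k]_n) :
 (forall i j, pon D (fun v => F v i j)) -> pon D (fun v => (\det (F v))^-1) -> mor D F.
move=> pf pd; apply: mor_fin => [[i j]|[|i]] //=.
by exists (fun=> 0); [exact: polC|move=> v _; rewrite nth_nil].
Qed.

Lemma pol_comp V W {cV : crd k V} {cW : crd k W} (F : V -> W) f :
 mor setT F -> pol f -> pol (fun v => f (F v)).
by move=> mF /mF[g pg e]; apply: pol_ext pg => v; rewrite -e. Qed.

Lemma pol_fst V W {cV : crd k V} {cW : crd k W} (f : V -> k) :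
 pol f -> pol (fun vw : V * W => f vw.1).
exact: pol_comp (@mor_fst _ _ _ _ _ _). Qed.

Lemma pol_snd V W {cV : crd k V} {cW : crd k W} (f : W -> k) :
 pol f -> pol (fun vw : V * W => f vw.2).
exact: pol_comp (@mor_snd _ _ _ _ _ _). Qed.

Lemma mor_const V W {cV : crd k V} {cW : crd k W} (D : set V) (w : W) : mor D (fun=> w).
by move=> f pf; exists (fun=> f w) => //; apply: polC. Qed.

Lemma pol_pairl V W {cV : crd k V} {cW : crd k W} (f : V * W -> k) w :
 pol f -> pol (fun v => f (v, w)).
by apply: (@pol_comp _ _ _ _ (fun v => (v, w))); apply: mor_pair; [exact: morI|exact: mor_const].
Qed.

Lemma pol_pairr V W {cV : crd k V} {cW : crd k W} (f : V * W -> k) v :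
 pol f -> pol (fun w => f (v, w)).
by apply: (@pol_comp _ _ _ _ (fun w => (v, w))); apply: mor_pair; [exact: mor_const|exact: morI].
Qed.

Lemma irr_prod V W {cV : crd k V} {cW : crd k W} (Y : set V) (Z : set W) :
 irr Y -> irr Z -> irr (Y `*` Z).
move=> [[y0 Y0] iY] [[z0 Z0] iZ]; split; first by exists (y0, z0).
move=> f g pf pg fg; apply: contrapT => /not_orP[nf ng].
have [[y1 z1] [[/= Y1 Z1] f1]] : exists yz, (Y `*` Z) yz /\ f yz != 0.
 apply: contrapT => h; apply: nf => yz Pyz; apply: contrapT => /eqP n.
 by apply: h; exists yz.
have [[y2 z2] [[/= Y2 Z2] g2]] : exists yz, (Y `*` Z) yz /\ g yz != 0.
 apply: contrapT => h; apply: ng => yz Pyz; apply: contrapT => /eqP n.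
 by apply: h; exists yz.
have [y Yy|h|h] := iY _ _ (pol_pairl z1 pf) (pol_pairl z2 pg); last first.
- by rewrite h ?eqxx in g2.
- by rewrite h ?eqxx in f1.
have [z Zz|h|h] := iZ _ _ (pol_pairr y pf) (pol_pairr y pg).
- exact: fg.
- by rewrite h ?mul0r.
- by rewrite h ?mulr0.
Qed.

Lemma pon_comp V W {cV : crd k V} {cW : crd k W} (D : set V) (F : V -> W) (f : W -> k) :
 mor D F -> pol f -> pon D (fun v => f (F v)).
by move=> mF /mF. Qed.

End Basic.

(** * Chevalley's theorem *)

Section Chevalley.
Context {k : closedFieldType}.

Lemma rterm_pol V {cV : crd k V} (t : GRing.term k) : GRing.rterm t ->
 pol (fun v => GRing.eval (enc v) t).
elim: t => //=.
- by move=> i _; apply: polE.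
- by move=> c _; apply: polC.
- by move=> n _; apply: polC.
- by move=> a IHa b IHb /andP[/IHa ? /IHb ?]; apply: polD.
- by move=> a IHa /IHa ?; apply: polN.
- move=> a IHa n /IHa pa; apply: (@pol_ext _ _ _ (fun v => GRing.eval (enc v) a * n%:R)).
  by move=> v; rewrite mulr_natr.
 by apply: polM => //; apply: polC.
- by move=> a IHa b IHb /andP[/IHa ? /IHb ?]; apply: polM.
- by move=> a IHa n /IHa ?; apply: pol_exp.
Qed.

Lemma qf_cst V {cV : crd k V} (phi : GRing.formula k) :
 GRing.qf_form phi && GRing.rformula phi -> cst [set v | GRing.holds (enc v) phi].
elim: phi => //=.
- by case=> _; [apply: cst_ext cstT|apply: cst_ext cst0].
- move=> t u /andP[rt ru]; apply: cst_ext (cst_zero (polB (rterm_pol rt) (rterm_pol ru))) => v /=.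
 by split=> [/eqP|->]; rewrite ?subr_eq0 ?subrr // => /eqP.
- by move=> f1 I1 f2 I2 /andP[/andP[q1 q2] /andP[r1 r2]];
  apply: cstI; [apply: I1|apply: I2]; apply/andP.
- by move=> f1 I1 f2 I2 /andP[/andP[q1 q2] /andP[r1 r2]];
  apply: cstU; [apply: I1|apply: I2]; apply/andP.
- move=> f1 I1 f2 I2 /andP[/andP[q1 q2] /andP[r1 r2]].
 have c1 : cst [set v | GRing.holds (enc v) f1] by apply: I1; apply/andP.
 have c2 : cst [set v | GRing.holds (enc v) f2] by apply: I2; apply/andP.
 apply: cst_ext (cstU (cstC c1) c2) => v.
 split=> [[n1 /n1|h _] //|h].
 by have [/h|] := pselect (GRing.holds (enc v) f1); [right|left].
- by move=> f1 I1 qr; apply: cstC; apply: I1.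
Qed.

Lemma cst_formula V {cV : crd k V} (S : set V) : cst S ->
 exists phi : GRing.formula k, forall v, S v <-> GRing.holds (enc v) phi.
elim=> [f /pol_term[t ht]|A B _ [p hp] _ [q hq]|A _ [p hp]].
- by exists (GRing.Equal t (GRing.Const 0)) => v /=; rewrite ht.
- exists (GRing.And p q) => v; split; first by move=> [/hp ? /hq ?].
 by move=> [/hp ? /hq ?].
- by exists (GRing.Not p) => v; split=> h /hp.
Qed.

Lemma cst_proj V W {cV : crd k V} {cW : crd k W} (S : set (V * W)) :
 cst S -> cst [set v | exists w, S (v, w)].
move=> /cst_formula[phi hphi].
pose psi := foldr GRing.Exists phi (iota (@edim k V cV) (@edim k W cW)).
have psiP v : GRing.holds (enc v) psi <-> exists w, S (v, w).
 split=> [/GRing.foldExistsP[e' he hol]|[w /hphi Sw]].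
  exists (dec [seq e'`_i | i <- iota (edim V) (edim W)]); apply/hphi.
  apply: GRing.eq_holds hol => i /=; rewrite decK ?size_map ?size_iota // nth_cat size_enc.
  have [iV|iV] := ltnP i (edim V).
   by rewrite (he i) // inE mem_iota; rewrite leqNgt iV.
  have [iW|iW] := ltnP (i - edim V) (edim W).
   by rewrite (nth_map 0%N) ?size_iota // nth_iota // subnKC.
  rewrite [RHS]nth_default ?size_map ?size_iota // -(he i).
   by rewrite nth_default // size_enc.
  by rewrite inE mem_iota; apply/negP => /andP[_]; rewrite -ltn_subLR // ltnNge iW.
 apply/GRing.foldExistsP; exists (enc v ++ enc w) => // i.
 rewrite inE mem_iota negb_and -ltnNge => /orP[iV|iW].
  by rewrite /GRing.same_env nth_cat size_enc iV.
 rewrite -leqNgt in iW; rewrite !nth_default ?size_cat ?size_enc //.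
 exact: leq_trans (leq_addr _ _) iW.
have axk := @solve_monicpoly k.
have rpsi : GRing.rformula (GRing.to_rform psi) by apply: GRing.to_rform_rformula.
have qw := GRing.quantifier_elim_wf (@ClosedFieldQE.wf_ex_elim k) rpsi.
apply: cst_ext (qf_cst qw) => v; apply: iff_trans (psiP v).
have [qq _] := andP qw.
have qeP := GRing.quantifier_elim_rformP (@ClosedFieldQE.wf_ex_elim k)
 (@ClosedFieldQE.holds_ex_elim k axk) (enc v) rpsi.
split=> [/(GRing.qf_evalP _ qq)/qeP/GRing.to_rformP//|/GRing.to_rformP/qeP].
by move/(GRing.qf_evalP _ qq).
Qed.

Lemma cst_graph V W {cV : crd k V} {cW : crd k W} (S : set V) (F : V -> W) :
 cst S -> mor S F -> cst [set wv : W * V | S wv.2 /\ wv.1 = F wv.2].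
move=> cS mF.
have /choice[g hg] : forall i, exists g, pol g /\ forall v, S v -> (enc (F v))`_i = g v.
 by move=> i; have [g pg e] := mF _ (polE i); exists g.
have c1 : cst [set wv : W * V | S wv.2] by apply: cst_pre cS; apply: mor_snd.
apply: cst_ext (cstI c1 (@cst_forall _ _ _ nat (iota 0 (edim W))
 (fun i => [set wv : W * V | (enc wv.1)`_i - g i wv.2 = 0]) _)).
 move=> [w v] /=; split=> -[Sv h]; split=> //.
  rewrite -(encK w) -(encK (F v)); congr dec; apply: (@eq_from_nth _ 0); rewrite ?size_enc //.
  move=> i iW; rewrite (hg i).2 //; apply/eqP; rewrite -subr_eq0; apply/eqP; apply: h.
  by apply/mem_In; rewrite mem_iota.
 by move=> i _; rewrite h (hg i).2 // subrr.
by move=> i; apply: cst_zero; apply: polB; [exact: pol_fst (polE i)|exact: pol_snd (hg i).1].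
Qed.

Lemma cst_image V W {cV : crd k V} {cW : crd k W} (S : set V) (F : V -> W) :
 cst S -> mor S F -> cst (F @` S).
move=> cS mF; apply: cst_ext (cst_proj (cst_graph cS mF)) => w; split=> /=.
 by move=> [v [Sv ->]]; exists v.
by move=> [v Sv <-]; exists v.
Qed.

Lemma cst_prod V W {cV : crd k V} {cW : crd k W} (S : set V) (T : set W) :
 cst S -> cst T -> cst (S `*` T).
move=> cS cT; apply: cst_ext (cstI (cst_pre (@mor_fst _ _ _ _ _ _) cS)
 (cst_pre (@mor_snd _ _ _ _ _ _) cT)) => -[v w]; by split.
Qed.

End Chevalley.

(** * Dimension *)

Section Dim.
Context {k : closedFieldType}.

Lemma poly_all0 (p : {poly k}) : (forall t, p.[t] = 0) -> p = 0.
move=> h; apply/eqP; apply: contraT => p0.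
have [sp|sp] := leqP (size p) 1.
 by move: (h 0) p0; rewrite [p in p.[_]](size1_polyC sp) hornerC {2}(size1_polyC sp) => ->; rewrite eqxx.
(* A nonconstant [p] is refuted at a root of [p + 1], which has the same degree: there [p] takes the
   value -1. *)
have sp1 : size (p + 1) = size p by rewrite size_polyDl // size_poly1.
have /closed_rootP[t] : size (p + 1) != 1 by rewrite sp1 neq_ltn sp orbT.
by rewrite /root hornerD h hornerC add0r oner_eq0.
Qed.

Lemma pol_k (f : k -> k) : pol f -> exists p : {poly k}, forall t, f t = p.[t].
elim=> [c|i|i|{}f g _ [p hp] _ [q hq]|{}f g _ [p hp] _ [q hq]].
- by exists c%:P => t; rewrite hornerC.
- have [i1|i1] := ltnP i (edim k).
  exists 'X => t; rewrite hornerX; move: i1; rewrite /= card_unit ltnS leqn0 => /eqP->.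
  by rewrite nth_map // -cardE card_unit.
 by exists 0 => t; rewrite horner0 nth_default // size_enc.
- by exists 0 => t; rewrite horner0 nth_nil.
- by exists (p + q) => t; rewrite hornerD hp hq.
- by exists (p * q) => t; rewrite hornerM hp hq.
Qed.

Lemma irr_k : irr [set: k].
split=> [|f g /pol_k[p hp] /pol_k[q hq] fg]; first by exists 0.
have /eqP : p * q = 0 by apply: poly_all0 => t; rewrite hornerM -hp -hq fg.
by rewrite mulf_eq0 => /orP[/eqP p0|/eqP q0]; [left|right] => t _;
 rewrite ?hp ?hq ?p0 ?q0 horner0.
Qed.

Lemma unit_crd_size (v : unit) : size (@nil k) = 0%N. by []. Qed.
Lemma unit_crd_encK (v : unit) : tt = v. by case: v. Qed.
Lemma unit_crd_decK (s : seq k) : size s = 0%N -> [::] = s. by case: s. Qed.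
Definition unit_crd : crd k unit :=
 @Crd k unit 0 (fun=> [::]) (fun=> tt) unit_crd_size unit_crd_encK unit_crd_decK [::]
  (@nil_crdxT k unit _).

Fixpoint pw (e : nat) : Type := if e is e'.+1 then (pw e' * k)%type else unit.
Fixpoint pw_crd e : crd k (pw e) :=
 if e is e'.+1 return crd k (pw e) then prod_crd (pw_crd e') (k_crd k) else unit_crd.
#[local] Existing Instance pw_crd.

Lemma pw0 e : exists x : pw e, True.
by elim: e => [|e [x _]]; [exists tt|exists (x, 0)]. Qed.

Lemma irr_pw e : irr [set: pw e].
elim: e => [|e IH].
 split=> [|f g _ _ fg]; first by exists tt.
 by have /eqP := fg tt I; rewrite mulf_eq0 => /orP[/eqP h|/eqP h]; [left|right] => -[].
by have := irr_prod IH irr_k; rewrite setXTT.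
Qed.

(** A dominant map to affine [e]-space: the functions on [Z] have transcendence degree at least [e].
    All estimates are such lower bounds, confronted with the single upper bound [td_bound]. *)
Definition td_ge {V} {cV : crd k V} (Z : set V) e :=
 exists2 F : V -> pw e, mor setT F &
  forall f, pol f -> (forall z, Z z -> f (F z) = 0) -> forall x, f x = 0.

(** The degree bound uniform in [v] is what keeps an evaluation [(p v).[h v]] a polynomial
    function. *)
Lemma pol_last V {cV : crd k V} (f : V * k -> k) : pol f ->
 exists p : V -> {poly k}, [/\ forall i, pol (fun v => (p v)`_i),
  exists d, forall v, (size (p v) <= d)%N & forall v t, f (v, t) = (p v).[t]].
elim=> [c|i|i|{}f g _ [p [pp [d sp] hp]] _ [q [pq [e sq] hq]]|
       {}f g _ [p [pp [d sp] hp]] _ [q [pq [e sq] hq]]].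
- exists (fun=> c%:P); split=> [i||v t]; last by rewrite hornerC.
  exact: polC.
 by exists 1 => v; rewrite size_polyC leq_b1.
- have [iV|iV] := ltnP i (edim V).
  exists (fun v => ((enc v)`_i)%:P); split=> [j||v t].
  - apply: (@pol_ext _ _ _ (fun v => if j == 0 then (enc v)`_i else 0)).
    by move=> v; rewrite coefC.
   by case: eqP => _; [exact: polE|exact: polC].
  - by exists 1 => v; rewrite size_polyC leq_b1.
  - by rewrite hornerC nth_cat size_enc iV.
 have /pol_k[p hp] : pol (fun t : k => (enc t)`_(i - edim V)) by apply: polE.
 exists (fun=> p); split=> [j||v t]; first exact: polC.
  by exists (size p).
 by rewrite -hp nth_cat size_enc ltnNge iV.
- exists (fun v => (nth (fun=> 0) (crdx V) i v)%:P); split=> [j||v t].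
 - apply: (@pol_ext _ _ _ (fun v => if j == 0 then nth (fun=> 0) (crdx V) i v else 0)).
   by move=> v; rewrite coefC.
  by case: eqP => _; [exact: polX|exact: polC].
 - by exists 1 => v; rewrite size_polyC leq_b1.
 - rewrite hornerC /= cats0; have [iV|iV] := ltnP i (size (crdx V)).
   by rewrite (nth_map (fun=> 0)).
  by rewrite !nth_default // size_map.
- exists (fun v => p v + q v); split=> [i||v t].
 - apply: (@pol_ext _ _ _ (fun v => (p v)`_i + (q v)`_i)); last exact: polD.
  by move=> v; rewrite coefD.
 - exists (maxn d e) => v; apply: leq_trans (size_polyD _ _) _.
  by rewrite geq_max !leq_max sp sq orbT.
 - by rewrite hornerD hp hq.
- exists (fun v => p v * q v); split=> [i||v t].
 - apply: (@pol_ext _ _ _ (fun v => \sum_(j < i.+1) (p v)`_j * (q v)`_(i - j))).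
   by move=> v; rewrite coefM.
  by apply: pol_sum => j; apply: polM.
 - exists (d + e) => v; apply: leq_trans (size_polyMleq _ _) _.
  by apply: leq_trans (leq_pred _) _; apply: leq_add.
 - by rewrite hornerM hp hq.
Qed.

Section V.
Context {V : Type} {cV : crd k V}.
Implicit Types (Y Z S : set V).

Lemma td_ge0 Z : Z !=set0 -> td_ge Z 0.
move=> [z Zz]; exists (fun=> tt); first exact: mor_const.
by move=> f _ /(_ z Zz) h [].
Qed.

Lemma td_ge_sub Y Z e : Y `<=` Z -> td_ge Y e -> td_ge Z e.
by move=> YZ [F mF h]; exists F => // f pf f0; apply: h => // z /YZ; apply: f0. Qed.

Lemma td_ge_cl Z e : td_ge (cl Z) e -> td_ge Z e.
move=> [F mF h]; exists F => // f pf f0; apply: h => // z cz.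
by apply: (cz (fun v => f (F v))) => //; apply: pol_comp.
Qed.

(** Adjoin a function [h] vanishing on [Y] but not on [Z]. In a relation between [F] and [h] the
    lowest coefficient survives division by a power of [h], and restriction to [Y] makes it a
    relation between the components of [F] there. *)
Lemma td_gtP Y Z e : irr Z -> Y `<=` Z -> ~ Z `<=` cl Y -> td_ge Y e -> td_ge Z e.+1.
move=> iZ YZ nZY [F mF hF].
have [z0 [Z0 nz0]] : exists z, Z z /\ ~ cl Y z.
 by apply: contrapT => n; apply: nZY => z Zz; apply: contrapT => nz; apply: n; exists z.
have [h [ph h0 hz0]] := closed_sep (@cl_closed _ _ _ Y) nz0.
exists (fun z => (F z, h z)).
 by apply: mor_pair => //; apply: mor_k; apply: pon_pol.
move=> f /pol_last[p [pp [dp sdp] hp]] f0.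
suff pj j x : (p x)`_j = 0.
 by move=> [x t]; rewrite hp (_ : p x = 0) ?horner0 //; apply/polyP => j; rewrite coef0.
elim/ltn_ind: j x => j IH; apply: (hF _ (pp j)) => y Yy.
have drop x : p x = drop_poly j (p x) * 'X^j.
 rewrite -{1}(poly_take_drop j (p x)) (_ : take_poly j _ = 0) ?add0r //.
 by apply/polyP => i; rewrite coef_take_poly coef0; case: ifP => // /IH->.
have pg : pol (fun z => (drop_poly j (p (F z))).[h z]).
 have [q [pq [d sq] hq]] : exists q : pw e -> {poly k}, [/\ forall i, pol (fun v => (q v)`_i),
   exists d, forall v, (size (q v) <= d)%N & q = fun x => drop_poly j (p x)].
  exists (fun x => drop_poly j (p x)); split=> // [i|].
   by apply: pol_ext (pp (i + j)) => v; rewrite coef_drop_poly.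
  by exists dp => v; rewrite size_drop_poly (leq_trans (leq_subr _ _)).
 apply: (@pol_ext _ _ _ (fun z => \sum_(i < d) (q (F z))`_i * h z ^+ i)).
  by move=> z; rewrite -[drop_poly _ _]/((fun x => drop_poly j (p x)) (F z)) -hq
   (@horner_coef_wide _ d).
 by apply: pol_sum => i; apply: polM; [apply: pol_comp (pq i)|exact: pol_exp].
have [z Zz|g0|hj0] := iZ.2 _ _ pg (pol_exp j ph).
- by rewrite -hornerXn -hornerM -drop -hp; apply: f0.
- by have := g0 y (YZ _ Yy); rewrite h0 ?horner_coef0 ?coef_drop_poly //; apply: sub_cl.
- by have /eqP := hj0 z0 Z0; rewrite expf_eq0 (negbTE hz0) andbF.
Qed.

Lemma td_geS Z e : td_ge Z e.+1 -> td_ge Z e.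
move=> [F mF h]; exists (fun z => (F z).1).
 exact: (mor_comp mF (@mor_fst k (pw e) k _ _ setT)).
move=> f pf f0 x; have [t _] : exists t : k, True by exists 0.
exact: (h (fun xt => f xt.1) (pol_fst pf) f0 (x, t)).
Qed.

Lemma td_ge_le Z e d : (d <= e)%N -> td_ge Z e -> td_ge Z d.
by move=> /subnK <-; elim: (e - d)%N => // m IH; rewrite addSn => /td_geS/IH.
Qed.

Lemma cl1 (v : V) : cl [set v] `<=` [set v].
move=> w cw; rewrite -(encK w) -(encK v); congr dec.
apply: eq_from_nth; rewrite ?size_enc // => i _.
apply/eqP; rewrite -subr_eq0; apply/eqP.
apply: (cw (fun w => (enc w)`_i - (enc v)`_i)); first by apply: polB; [exact: polE|exact: polC].
by move=> _ ->; rewrite subrr.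
Qed.

Lemma irr1 (v : V) : irr [set v].
split=> [|f g _ _ /(_ v erefl) /eqP]; first by exists v.
by rewrite mulf_eq0 => /orP[/eqP h|/eqP h]; [left|right] => _ ->.
Qed.

(* A dominant map to affine space lets one cut down by a hyperplane of the
  target; by Chevalley's theorem a general one leaves the next map dominant. *)
Lemma td_ge_chain S e : cst S -> irr S -> td_ge S e -> exists C : nat -> set V,
 (forall i, (i <= e)%N ->
   [/\ zclosed (C i), irr (C i), C i `<=` cl (C i `&` S) & C i `<=` cl S]) /\
 forall i, (i < e)%N -> C i `<=` C i.+1 /\ ~ C i.+1 `<=` C i.
elim: e S => [|e IH] S cS iS.
 move=> _; have [[s Ss] _] := iS; exists (fun=> [set s]); split=> // i _.
 split; [exact: cl1|exact: irr1| |].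
  by move=> _ ->; apply: sub_cl.
 by move=> _ ->; apply: sub_cl.
move=> [F mF hF].
pose G z := (F z).1; pose f z := (F z).2.
have mG : mor setT G by apply: (mor_comp mF (@mor_fst k (pw e) k _ _ setT)).
have pf : pol f by apply: pol_comp (@pol_snd k (pw e) k _ _ _ pol_id).
have cF : cst (F @` S) by apply: cst_image => //; apply: mor_sub mF.
have [|h [ph [[x0 a] _ h0] hS]] := cst_dense cF (irr_pw e.+1).
 by move=> x _ g pg g0; apply: hF => // z Sz; apply: g0.
pose S' := S `&` [set z | f z - a = 0].
have cS' : cst S' by apply: cstI => //; apply: cst_zero; apply: polB => //; apply: polC.
(* [dn Y]: the first [e] components are still dominant on the part inside [Y] of the hyperplane
   section [S']. The section may be reducible; cutting it with a minimal such [Y] makes it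
   irreducible. *)
pose dn Y := forall p, pol (cV := pw_crd e) p ->
  (forall z, (S' `&` Y) z -> p (G z) = 0) -> forall x, p x = 0.
have pha : pol (fun x => h (x, a)) by apply: pol_pairl.
have dnT : dn setT.
 move=> p pp p0; have [x _|h'|h'] := (irr_pw e).2 _ _ pp pha.
 - have [->|hx] := eqVneq (h (x, a)) 0; first by rewrite mulr0.
  have [z Sz Fz] := hS (x, a) I hx; rewrite -[x]/((x, a).1) -Fz p0 ?mul0r //.
  by split=> //; split=> //=; rewrite /f Fz subrr.
 - by move=> x; apply: h'.
 - by rewrite h' ?eqxx in h0.
have [|Y []//|Y [cY dY] mY] := @closed_min _ _ _ [set Y | zclosed Y /\ dn Y].
 by exists setT.
pose S'' := S' `&` Y.
have cS'' : cst S'' by apply: cstI => //; apply: cst_closed.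
have iS'' : irr S''.
 split.
  apply: contrapT => n; have [x _] := pw0 e; have /eqP : 1 = 0 :> k.
   by apply: (dY _ (polC 1) _ x) => z Sz; case: n; exists z.
  by rewrite oner_eq0.
 move=> g1 g2 pg1 pg2 g12.
 have sub g : pol g -> dn (Y `&` [set z | g z = 0]) -> forall z, S'' z -> g z = 0.
  move=> pg dg z [_ Yz].
  have [] // : (Y `&` [set z | g z = 0]) z.
  apply: mY Yz; last by move=> ? [].
  by split=> //; apply: closedI => //; apply: closed_zero.
 have [d1|n1] := pselect (dn (Y `&` [set z | g1 z = 0])); first by left; apply: sub.
 have [d2|n2] := pselect (dn (Y `&` [set z | g2 z = 0])); first by right; apply: sub.
 have nd (g : V -> k) : ~ dn (Y `&` [set z | g z = 0]) -> exists p, [/\ pol p,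
   forall z, S'' z -> g z = 0 -> p (G z) = 0 & exists x, p x != 0].
  move=> n; apply: contrapT => n'; apply: n => p pp p0 x; apply: contrapT => /eqP px.
  apply: n'; exists p; split=> //; last by exists x.
  by move=> z [S'z Yz] gz; apply: p0.
 have [p1 [pp1 p10 [x1 px1]]] := nd _ n1; have [p2 [pp2 p20 [x2 px2]]] := nd _ n2.
 have [x _|h'|h'] := (irr_pw e).2 _ _ pp1 pp2; last first.
 - by rewrite h' ?eqxx in px2.
 - by rewrite h' ?eqxx in px1.
 apply: (dY (fun x => p1 x * p2 x)); first exact: polM.
 move=> z Sz; have /eqP := g12 z Sz; rewrite mulf_eq0 => /orP[/eqP gz|/eqP gz].
  by rewrite p10 ?mul0r.
 by rewrite p20 ?mulr0.
have [|C [C1 C2]] := IH S'' cS'' iS''; first by exists G.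
(* [C e] lies in the closure of the section, where [f = a]; if it contained [cl S], then [f] would
   be constant on [S], against dominance. *)
have top : C e `<=` cl S /\ ~ cl S `<=` C e.
 have [_ _ _ d2] := C1 e (leqnn e); split.
  by apply: subset_trans d2 _; apply: cl_mono => z [[]].
 move=> n; have fa z : S z -> f z - a = 0.
  move=> /(@sub_cl _ _ _ S)/n/d2 h'; apply: (h' (fun z => f z - a)); first by apply: polB => //; apply: polC.
  by move=> y [[]].
 have /eqP := hF (fun xt => xt.2 - a) (polB (@pol_snd k (pw e) k _ _ _ pol_id) (polC a)) fa (x0, a + 1).
 by rewrite addrC addKr oner_eq0.
exists (fun i => if (i <= e)%N then C i else cl S); split=> i.
 case: ifP => [ie _|_ _]; last first.
  split=> //; [exact: cl_closed|exact: irr_cl|].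
  by apply: cl_mono => z Sz; split=> //; apply: sub_cl.
 have [? ? d1 d2] := C1 i ie; split=> //.
  by apply: subset_trans d1 _; apply: cl_mono => z [Cz [[Sz _] _]].
 by apply: subset_trans d2 _; apply: cl_mono => z [[]].
move=> ie'; have := ie'; rewrite ltnS {1}leq_eqVlt => /orP[/eqP->|ie].
 rewrite leqnn ltnn; exact: top.
by rewrite ie (ltnW ie : (i <= e)%N); apply: C2.
Qed.

End V.
End Dim.
#[export] Existing Instance pw_crd.

(** * Counting monomials: an upper bound for dimension *)

Section Count.
Context {k : closedFieldType}.

Lemma sum_divmod (f : nat -> k) m D :
 \sum_(j < m * D) f j = \sum_(q < m) \sum_(r < D) f (q * D + r)%N.
elim: m f => [|m IH] f; first by rewrite !big_ord0.
rewrite big_split_ord big_ord_recl /=; congr (_ + _).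
under eq_bigr do rewrite -/(_ _).
rewrite (IH (fun j => f (D + j)%N)); apply: eq_bigr => q _; apply: eq_bigr => r _.
by rewrite addnA.
Qed.

(** The exponents are the digits of [j] in base [D], so the [j < D ^ e] run over the monomials of
    degree less than [D] in each variable. *)
Fixpoint mono D e (j : nat) : @pw k e -> k :=
 match e with
 | 0 => fun=> 1
 | e'.+1 => fun xt => @mono D e' (j %/ D)%N xt.1 * xt.2 ^+ (j %% D)
 end.

Lemma pol_mono D e j : pol (@mono D e j).
elim: e j => [|e IH] j; first exact: polC.
by apply: polM; [exact: pol_fst|exact: pol_exp (pol_snd pol_id)].
Qed.

Lemma mono_indep D e (l : nat -> k) :
 (forall x, \sum_(j < D ^ e) l j * @mono D e j x = 0) ->
 forall j, (j < D ^ e)%N -> l j = 0.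
elim: e l => [|e IH] l h j.
 rewrite ltnS leqn0 => /eqP->; have := h tt.
 by rewrite big_ord1 mulr1.
rewrite expnSr => jD; have D0 : (0 < D)%N by case: (D) jD => //; rewrite muln0.
rewrite (divn_eq j D); have := ltn_pmod j D0; move: (j %% D)%N => r rD.
apply: (IH (fun q => l (q * D + r))); last by rewrite ltn_divLR.
move=> x; pose p := \poly_(r < D) \sum_(q < D ^ e) l (q * D + r)%N * @mono D e q x.
have -> : \sum_(q < D ^ e) l (q * D + r)%N * @mono D e q x = p`_r by rewrite coef_poly rD.
rewrite (_ : p = 0) ?coef0 //; apply: poly_all0 => t; rewrite horner_poly -[RHS](h (x, t)).
rewrite expnSr (sum_divmod (fun j => l j * @mono D e.+1 j (x, t))) exchange_big /=.
apply: eq_bigr => s _; rewrite mulr_suml; apply: eq_bigr => q _.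
by rewrite divnMDl // modnMDl divn_small // modn_small // addn0 mulrA.
Qed.

Fixpoint ipC N : {rmorphism k -> ipoly k N} :=
 match N return {rmorphism k -> ipoly k N} with
 | 0 => idfun
 | N'.+1 => polyC \o ipC N'
 end.

Lemma ipevalC g N a : ipeval g N (ipC N a) = a.
by elim: N => //= N IH; rewrite map_polyC /horner_eval hornerC. Qed.

Fixpoint bd d N : ipoly k N -> Prop :=
 match N with
 | 0 => fun=> True
 | N'.+1 => fun P : {poly ipoly k N'} => (size P <= d.+1)%N /\ forall i, @bd d N' P`_i
 end.

Lemma bd0 d N : @bd d N 0.
by elim: N => //= N IH; split=> [|i]; rewrite ?size_poly0 ?coef0. Qed.

Lemma bdD d N P Q : @bd d N P -> @bd d N Q -> @bd d N (P + Q).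
elim: N P Q => //= N IH P Q [sP bP] [sQ bQ]; split=> [|i].
 by apply: leq_trans (size_polyD _ _) _; rewrite geq_max sP.
by rewrite coefD; apply: IH.
Qed.

Lemma bd_sum d N I (r : seq I) (F : I -> ipoly k N) :
 (forall i, @bd d N (F i)) -> @bd d N (\sum_(i <- r) F i).
by move=> h; elim: r => [|i r IH]; rewrite ?big_nil ?big_cons; [exact: bd0|exact: bdD].
Qed.

Lemma bd_le d e N P : (d <= e)%N -> @bd d N P -> @bd e N P.
move=> de; elim: N P => //= N IH P [sP bP]; split=> [|i]; last exact: IH.
exact: leq_trans sP _.
Qed.

Lemma bdM d e N P Q : @bd d N P -> @bd e N Q -> @bd (d + e) N (P * Q).
elim: N P Q => //= N IH P Q [sP bP] [sQ bQ]; split=> [|i].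
 apply: leq_trans (size_polyMleq _ _) _; rewrite -subn1 leq_subLR add1n.
 by apply: leq_trans (leq_add sP sQ) _; rewrite addnS.
by rewrite coefM; apply: bd_sum => j; apply: IH.
Qed.

Lemma bdC N a : @bd 0 N (ipC N a).
elim: N => //= N IH; split=> [|i]; first by rewrite size_polyC leq_b1.
by rewrite coefC; case: ifP => // _; apply: bd0.
Qed.

Lemma bdX d N P n : @bd d N P -> @bd (d * n) N (P ^+ n).
move=> bP; elim: n => [|n IH]; first by rewrite muln0 expr0 -(rmorph1 (ipC N)); apply: bdC.
by rewrite exprS mulnS; apply: bdM.
Qed.

Lemma bd_ex N P : exists d, @bd d N P.
elim: N P => [|N IH] P; first by exists 0.
have [d hd] : exists d, forall i, (i < size P)%N -> @bd d N P`_i.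
 elim: size => [|m [d hd]]; first by exists 0.
 have [e he] := IH P`_m; exists (maxn d e) => i; rewrite ltnS leq_eqVlt => /orP[/eqP->|im].
  by apply: bd_le he; apply: leq_maxr.
 by apply: bd_le (hd _ im); apply: leq_maxl.
exists (maxn d (size P)); split=> [|i]; first by rewrite leqW // leq_maxr.
have [iP|iP] := ltnP i (size P); first by apply: bd_le (hd _ iP); apply: leq_maxl.
by rewrite nth_default //; apply: bd0.
Qed.

Fixpoint cof d N (j : nat) : ipoly k N -> k :=
 match N with
 | 0 => fun a => a
 | N'.+1 => fun P : {poly ipoly k N'} => @cof d N' (j %/ d)%N P`_(j %% d)
 end.

Lemma cof_sum d N j m (l : nat -> k) (F : nat -> ipoly k N) :
 @cof d N j (\sum_(i < m) ipC N (l i) * F i) = \sum_(i < m) l i * @cof d N j (F i).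
elim: N j F => //= N IH j F; rewrite coef_sum -(IH _ (fun i => (F i)`_(j %% d))).
by congr cof; apply: eq_bigr => i _; rewrite coefCM.
Qed.

Lemma cof_eq0 d N P : @bd d N P ->
 (forall j, (j < d.+1 ^ N)%N -> @cof d.+1 N j P = 0) -> P = 0.
elim: N P => [|N IH] P /=; first by move=> _ /(_ 0); apply.
move=> [sP bP] h; apply/polyP => i; rewrite coef0.
have [id|id] := ltnP i d.+1; last by rewrite nth_default // (leq_trans sP).
apply: IH => // j jd; have := h (j * d.+1 + i)%N.
rewrite divnMDl // modnMDl divn_small // modn_small // addn0; apply.
rewrite expnSr; apply: (@leq_trans (j.+1 * d.+1)); last by rewrite leq_mul2r jd orbT.
by rewrite mulSn addnC ltn_add2r.
Qed.

(** For [e = N.+1], the [D ^ e] monomials in the components of [F] are polynomials in [N] variables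
    of degree at most [c * D] in each. For large [D] they outnumber the coefficients, so they are
    linearly dependent, against dominance. The functions of [crdx] are counted as free variables,
    which only weakens the bound. *)
Lemma td_bound V {cV : crd k V} (Z : set V) e :
 td_ge Z e -> (e <= edim V + size (crdx V))%N.
set N := (edim V + _)%N; move=> tdZ; rewrite leqNgt; apply/negP => Ne.
have {tdZ Ne} := td_ge_le Ne tdZ; have [{}e eN] : {e | e = N.+1} by exists N.+1.
rewrite -eN => -[F mF hF].
pose ev v := ipeval (fun i => if (i < @edim k V cV)%N then (@enc k V cV v)`_i
  else nth (fun=> 0) (@crdx k V cV) (i - @edim k V cV) v) N.
have gen e' F' : mor setT F' -> exists c, forall D j, (0 < D)%N -> exists2 M : ipoly k N, @bd (c * D) N M &
  forall v, @mono D e' j (F' v) = ev v M.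
 elim: e' F' => [|e' IH] {mF hF}F mF.
  exists 0 => D j _; exists (ipC N 1); first by rewrite mul0n; apply: bdC.
  by move=> v; rewrite ipevalC.
 have [|c hc] := IH (fun v => (F v).1).
  exact: (mor_comp mF (@mor_fst k (pw e') k _ _ setT)).
 have /pol_ipoly[P hP] : pol (fun v => (F v).2).
  exact: pol_comp (@pol_snd k (pw e') k _ _ _ pol_id).
 have [d bP] := @bd_ex N P.
 exists (c + d) => D j D0; have [M bM hM] := hc D (j %/ D)%N D0.
 exists (M * P ^+ (j %% D)).
  rewrite mulnDl; apply: bdM => //; apply: bd_le (bdX (j %% D) bP).
  by rewrite leq_mul2l ltnW ?orbT // ltn_mod.
 by move=> v; rewrite rmorphM rmorphXn -/ev -hM /= hP.
have [c hc] := gen e F mF.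
(* This [D] gives [(c * D + 1) ^ N <= c.+1 ^ N * D ^ N < D ^ N.+1]. *)
pose D := (c.+1 ^ N).+1; pose d := (c * D).
have /choice[M MP] : forall j, exists M : ipoly k N, @bd d N M /\
  forall v, @mono D e j (F v) = ev v M.
 by move=> j; have [M] := hc D j isT; exists M.
pose A := \matrix_(i < D ^ e, j < d.+1 ^ N) @cof d.+1 N j (M i).
have lt : (d.+1 ^ N < D ^ e)%N.
 apply: (@leq_ltn_trans ((c.+1 * D) ^ N)).
  have [->|N0] := posnP N; first by [].
  by rewrite leq_exp2r // -/d {1}/D ltnS leq_addl.
 by rewrite expnMn eN expnS ltn_mul2r expn_gt0 leqnn.
have /rowV0Pn[l /sub_kermxP lA l0] : kermx A != 0.
 rewrite kermx_eq0; apply/negP => /eqP rA.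
 by have := rank_leq_col A; rewrite rA leqNgt lt.
pose lf i := if insub i is Some i' then l 0 i' else 0 : k.
have lfE (i : 'I_(D ^ e)) : lf i = l 0 i by rewrite /lf valK.
have sum0 : \sum_(i < D ^ e) ipC N (lf i) * M i = 0.
 apply: (@cof_eq0 d); first by apply: bd_sum => i; rewrite -[d]add0n;
  apply: bdM (MP i).1; apply: bdC.
 move=> j jd; rewrite cof_sum; have /rowP/(_ (Ordinal jd)) := lA; rewrite !mxE => h.
 by rewrite -[RHS]h; apply: eq_bigr => i _; rewrite lfE mxE.
move/eqP: l0; apply; apply/rowP => j; rewrite mxE -lfE.
apply: mono_indep => // x.
apply: (hF (fun x => \sum_(j < D ^ e) lf j * @mono D e j x)).
 by apply: pol_sum => i; apply: polM; [exact: polC|exact: pol_mono].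
move=> v _; transitivity (ev v 0); last by rewrite rmorph0.
rewrite -sum0 rmorph_sum; apply: eq_bigr => i _.
by rewrite rmorphM ipevalC -/ev -(MP i).2.
Qed.

(** Ascending chains of irreducible closed sets stop, since by [td_gtP] each strict step raises
    [td_ge] towards the bound. *)
Lemma irr_acc V {cV : crd k V} (P : set (set V)) : P !=set0 ->
 (forall Z, P Z -> irr Z /\ zclosed Z) ->
 exists2 Z, P Z & forall Y, P Y -> Z `<=` Y -> Y `<=` Z.
move=> [Z0 PZ0] hP; apply: contrapT => nmax.
have h e : exists2 Z, P Z & td_ge Z e.
 elim: e => [|e [Z PZ tZ]]; first by exists Z0 => //; apply: td_ge0; case: (hP _ PZ0) => -[].
 apply: contrapT => nY; apply: nmax; exists Z => // Y PY ZY; apply: contrapT => nYZ.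
 apply: nY; exists Y => //; apply: td_gtP ZY _ tZ; first by case: (hP _ PY).
 by move=> h; apply: nYZ; apply: subset_trans h _; apply: (hP _ PZ).2.
by have [Z _ /td_bound] := h (edim V + size (crdx V)).+1; rewrite ltnn.
Qed.

End Count.

(** * Algebraic groups *)

Section Grp.
Context {k : closedFieldType} {n : nat}.
Local Notation M := 'M[k]_n.
Local Notation GL := (@gl k n).
Implicit Types (H K D E Z Y S : set M) (x y z g h : M).

Lemma mor_mul2 X {cX : crd k X} (A : set X) (F G : X -> M) :
 mor A F -> mor A G -> mor A (fun v => F v *m G v).
move=> mF mG; apply: mor_mx => [i j|].
 have [F' pF eF] : exists2 F', polmx F' & forall v, A v -> F v = F' v.
  by apply: ponmx_ex => a b; have := mF _ (polmx_id a b).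
 have [G' pG eG] : exists2 G', polmx G' & forall v, A v -> G v = G' v.
  by apply: ponmx_ex => a b; have := mG _ (polmx_id a b).
 by exists (fun v => (F' v *m G' v) i j); [exact: polmxM|move=> v Av; rewrite eF // eG].
have [f pf ef] := mF _ (pol_detV n); have [g pg eg] := mG _ (pol_detV n).
exists (fun v => f v * g v); first exact: polM.
by move=> v Av; rewrite det_mulmx invfM -ef // -eg.
Qed.

Lemma mor_mull X {cX : crd k X} (A : set X) g (F : X -> M) :
 mor A F -> mor A (fun v => g *m F v).
by apply: mor_mul2; apply: mor_const. Qed.

Lemma mor_mulr X {cX : crd k X} (A : set X) g (F : X -> M) :
 mor A F -> mor A (fun v => F v *m g).
by move=> mF; apply: mor_mul2 => //; apply: mor_const. Qed.

Lemma mor_inv X {cX : crd k X} (A : set X) (F : X -> M) :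
 mor A F -> (forall v, A v -> GL (F v)) -> mor A (fun v => invmx (F v)).
move=> mF gF.
have [F' pF eF] : exists2 F', polmx F' & forall v, A v -> F v = F' v.
 by apply: ponmx_ex => a b; have := mF _ (polmx_id a b).
have [f pf ef] := mF _ (pol_detV n).
apply: mor_mx => [i j|].
 exists (fun v => (f v *: \adj (F' v)) i j); first by apply: polmxZ => //; apply: polmx_adj.
 by move=> v Av; rewrite -ef //= /invmx gF // -eF.
exists (fun v => \det (F' v)); first exact: pol_det.
by move=> v Av; rewrite det_inv invrK eF.
Qed.

Lemma mor_fst_mul (A : set (M * M)) : mor A (fun xy : M * M => xy.1 *m xy.2).
by apply: mor_mul2; [exact: mor_fst|exact: mor_snd]. Qed.

(** The inverse determinant counts as a polynomial function, with value 0 at singular matrices, so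
    [det x * (det x)^-1 = 1] is a closed condition. Closed subgroups of [GL] are thus closed sets of
    matrices. *)
Lemma closed_gl : zclosed GL.
have pd : pol (fun x => \det x * (\det x)^-1 - 1).
 apply: polB; last exact: polC.
 by apply: polM; [apply: pol_det; exact: polmx_id|exact: pol_detV].
apply: (@subset_trans _ (cl [set v : M | \det v * (\det v)^-1 - 1 = 0])).
 by apply: cl_mono => x; rewrite /gl /= unitmxE unitfE => d0; rewrite divff // subrr.
move=> x /(closed_zero pd) h; rewrite /gl /= unitmxE unitfE; apply: contra_eq_neq h => ->.
by rewrite mul0r sub0r oppr_eq0 oner_eq0.
Qed.

Lemma sg1 H : subgroup H -> H 1%:M. by case. Qed.
Lemma sgM H x y : subgroup H -> H x -> H y -> H (x *m y). by case=> _ _ h _; apply: h. Qed.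
Lemma sgV H x : subgroup H -> H x -> H (invmx x). by case=> _ _ _; apply. Qed.
Lemma sg_gl H x : subgroup H -> H x -> x \in unitmx. by case=> h _ _ _; apply: h. Qed.

Lemma sg_mull H g x : subgroup H -> H g -> (H (g *m x) <-> H x).
move=> sH Hg; split=> [h|]; last exact: sgM.
by rewrite -(mulKmx (sg_gl sH Hg) x); apply: sgM => //; apply: sgV.
Qed.

Lemma sg_mulr H g x : subgroup H -> H g -> (H (x *m g) <-> H x).
move=> sH Hg; split=> [h|Hx]; last exact: sgM.
by rewrite -(mulmxK (sg_gl sH Hg) x); apply: sgM => //; apply: sgV.
Qed.

Lemma invmxM x y : x \in unitmx -> y \in unitmx -> invmx (x *m y) = invmx y *m invmx x.
move=> ux uy; have uxy : x *m y \in unitmx by rewrite unitmx_mul ux.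
apply: (can_inj (mulKmx uxy)); rewrite mulmxV // mulmxA -(mulmxA x) mulmxV // mulmx1 mulmxV //.
Qed.

Definition cgrp H := subgroup H /\ zclosed H.

Lemma sgI H K : subgroup H -> subgroup K -> subgroup (H `&` K).
move=> sH sK; split; first by move=> x [/(sg_gl sH)].
- by split; apply: sg1.
- by move=> x y [? ?] [? ?]; split; apply: sgM.
- by move=> x [? ?]; split; apply: sgV.
Qed.

Lemma cgrpI H K : cgrp H -> cgrp K -> cgrp (H `&` K).
by move=> [sH cH] [sK cK]; split; [exact: sgI|exact: closedI]. Qed.

Lemma sg_GL : subgroup GL.
split=> //; rewrite /gl /= ?unitmx1 //.
 by move=> x y ux uy; rewrite unitmx_mul ux.
by move=> x ux; rewrite unitmx_inv.
Qed.

Lemma cl_sg H : subgroup H -> subgroup (cl H).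
move=> sH; have clg : cl H `<=` GL by apply: (cl_sub closed_gl) => x /(sg_gl sH).
have h1 x y : H x -> cl H y -> cl H (x *m y).
 move=> Hx; apply: (mor_cl (mor_mull x (morI setT)) (@cl_closed _ _ _ H)) => // v Hv.
 by apply: sub_cl; apply: sgM.
split=> //; first by apply: sub_cl; apply: sg1.
- move=> x y cx cy; apply: (mor_cl (mor_mulr y (morI setT)) (@cl_closed _ _ _ H) _ _ _ cx) => // v Hv.
 exact: h1.
- move=> x cx; have mi : mor GL (fun v => invmx v) by apply: mor_inv => //; apply: morI.
 apply: (mor_cl mi (@cl_closed _ _ _ H) _ _ (clg _ cx) cx); first by move=> v /(sg_gl sH).
 by move=> v Hv; apply: sub_cl; apply: sgV.
Qed.

Lemma cl_cgrp H : subgroup H -> cgrp (cl H).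
by move=> sH; split; [exact: cl_sg|exact: cl_closed]. Qed.

Lemma irr_mul Y Z : irr Y -> irr Z -> irr [set x | exists y z, [/\ Y y, Z z & x = y *m z]].
move=> iY iZ; have := irr_image (irr_prod iY iZ) (@mor_fst_mul _).
rewrite (_ : _ @` _ = [set x | exists y z, [/\ Y y, Z z & x = y *m z]]) //.
apply/seteqP; split=> x; first by move=> [[y z] [/= Yy Zz] <-]; exists y, z.
by move=> [y [z [Yy Zz ->]]]; exists (y, z).
Qed.

Lemma cst_mul Y Z : cst Y -> cst Z -> cst [set x | exists y z, [/\ Y y, Z z & x = y *m z]].
move=> iY iZ; apply: cst_ext (cst_image (cst_prod iY iZ) (@mor_fst_mul _)) => x; split.
 by move=> [[y z] [/= Yy Zz] <-]; exists y, z.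
by move=> [y [z [Yy Zz ->]]]; exists (y, z).
Qed.

Lemma irr_invm Z : irr Z -> Z `<=` GL -> irr [set invmx z | z in Z].
by move=> iZ ZG; apply: irr_image => //; apply: mor_inv => //; apply: morI. Qed.

Definition cj g H := [set mxconj g x | x in H].

Lemma mor_conj g (A : set M) : mor A (fun x => mxconj g x).
by apply: mor_mulr; apply: mor_mull; apply: morI. Qed.

Lemma mxconjM g x y : g \in unitmx -> mxconj g (x *m y) = mxconj g x *m mxconj g y.
by move=> ug; rewrite /mxconj !mulmxA mulmxKV. Qed.

Lemma mxconj1 g : g \in unitmx -> mxconj g 1%:M = 1%:M.
by move=> ug; rewrite /mxconj mulmx1 mulmxV. Qed.

Lemma mxconjV g x : g \in unitmx -> x \in unitmx -> mxconj g (invmx x) = invmx (mxconj g x).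
move=> ug ux; rewrite invmxM ?unitmx_mul ?ug ?unitmx_inv // invmxK invmxM //.
by rewrite mulmxA.
Qed.

Lemma mxconjMl g h x : g \in unitmx -> h \in unitmx -> mxconj (g *m h) x = mxconj g (mxconj h x).
by move=> ug uh; rewrite /mxconj invmxM // !mulmxA. Qed.

Lemma mxconjK g x : g \in unitmx -> mxconj (invmx g) (mxconj g x) = x.
by move=> ug; rewrite -mxconjMl ?unitmx_inv // mulVmx // /mxconj invmx1 mulmx1 mul1mx. Qed.

Lemma mxconjVK g x : g \in unitmx -> mxconj g (mxconj (invmx g) x) = x.
by move=> ug; rewrite -mxconjMl ?unitmx_inv // mulmxV // /mxconj invmx1 mulmx1 mul1mx. Qed.

Lemma mxconj_unit g x : g \in unitmx -> (mxconj g x \in unitmx) = (x \in unitmx).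
by move=> ug; rewrite !unitmx_mul unitmx_inv ug andbT. Qed.

Lemma mxconj_id g x : x \in unitmx -> (mxconj x g = g) <-> x *m g = g *m x.
move=> ux; rewrite /mxconj; split=> [h|->]; last by rewrite mulmxK.
by rewrite -{2}h mulmxKV.
Qed.

Lemma sg_conj H g x : subgroup H -> H g -> H x -> H (mxconj g x).
by move=> sH Hg Hx; apply: sgM (sgV sH Hg) => //; apply: sgM. Qed.

Lemma cjP H g x : g \in unitmx -> cj g H x <-> H (mxconj (invmx g) x).
move=> ug; split=> [[y Hy <-]|h]; first by rewrite mxconjK.
by exists (mxconj (invmx g) x) => //; rewrite mxconjVK.
Qed.

Lemma cj_sg g H : g \in unitmx -> subgroup H -> subgroup (cj g H).
move=> ug sH; split.
- by move=> _ [x Hx <-]; rewrite /gl /= mxconj_unit // (sg_gl sH Hx).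
- by exists 1%:M; [exact: sg1|exact: mxconj1].
- by move=> _ _ [x Hx <-] [y Hy <-]; exists (x *m y); [exact: sgM|exact: mxconjM].
- by move=> _ [x Hx <-]; exists (invmx x); [exact: sgV|rewrite mxconjV // (sg_gl sH Hx)].
Qed.

Lemma cj_closed g Z : g \in unitmx -> zclosed Z -> zclosed (cj g Z).
move=> ug cZ; have := closed_preT (@mor_conj (invmx g) setT) cZ.
by rewrite (_ : [set v | _] = cj g Z) //; apply/seteqP; split=> x /(cjP _ _ ug).
Qed.

Lemma cj_cgrp g H : g \in unitmx -> cgrp H -> cgrp (cj g H).
by move=> ug [sH cH]; split; [exact: cj_sg|exact: cj_closed]. Qed.

Lemma cj_irr g Z : irr Z -> irr (cj g Z).
by move=> iZ; apply: irr_image => //; apply: mor_conj. Qed.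

Definition gcomp H := [set x | exists Z, [/\ irr Z, zclosed Z, Z `<=` H, Z 1%:M & Z x]].

Lemma gcomp_sub H : gcomp H `<=` H.
by move=> x [Z [_ _ ZH _ /ZH]]. Qed.

(** A maximal irreducible closed [Z] through 1 absorbs every irreducible [Y] through 1 in [H],
    because the closure of the product [Z Y] is irreducible and contains both. This makes [Z] a
    group, the identity component. *)
Lemma gcompP H : cgrp H -> [/\ cgrp (gcomp H), irr (gcomp H) &
 forall Z, irr Z -> Z `<=` H -> Z 1%:M -> Z `<=` gcomp H].
move=> [sH cH].
have [| |Z [iZ cZ ZH Z1] mZ] := @irr_acc k M _
  [set Z | [/\ irr Z, zclosed Z, Z `<=` H & Z 1%:M]].
- exists [set 1%:M]; split=> //; [exact: irr1|exact: cl1|].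
 by move=> _ ->; apply: sg1.
- by move=> Z [].
have prod Y : irr Y -> Y `<=` H -> Y 1%:M -> forall y z, Z z -> Y y -> Z (z *m y).
 move=> iY YH Y1 y z Zz Yy; pose W := [set x | exists y z, [/\ Z y, Y z & x = y *m z]].
 apply: (mZ (cl W)).
 - split; [by apply/irr_cl/irr_mul|exact: cl_closed| |].
   apply: (cl_sub cH) => _ [a [b [Za Yb ->]]]; apply: sgM => //; [exact: ZH|exact: YH].
  by apply: sub_cl; exists 1%:M, 1%:M; rewrite mulmx1.
 - by move=> a Za; apply: sub_cl; exists a, 1%:M; rewrite mulmx1.
 - by apply: sub_cl; exists z, y.
have max Y : irr Y -> Y `<=` H -> Y 1%:M -> Y `<=` Z.
 by move=> iY YH Y1 y Yy; rewrite -[y]mul1mx; apply: (prod Y).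
have eZ : gcomp H = Z.
 apply/seteqP; split=> x; last by move=> Zx; exists Z.
 by move=> [Y [iY _ YH Y1 Yx]]; apply: (max Y).
rewrite eZ; split=> //; split=> //; split=> //.
- by move=> x /ZH/(sg_gl sH).
- by move=> x y Zx Zy; apply: (prod Z).
- move=> x Zx; apply: (max [set invmx z | z in Z]); last by exists x.
 + by apply: irr_invm => // z /ZH/(sg_gl sH).
 + by move=> _ [z Zz <-]; apply: sgV => //; apply: ZH.
 + by exists 1%:M => //; rewrite invmx1.
Qed.

Lemma gcomp_conj H g : cgrp H -> (forall x, H x -> H (mxconj g x)) -> g \in unitmx ->
 forall x, gcomp H x -> gcomp H (mxconj g x).
move=> cH nH ug x Hx; have [[sD cD] iD mD] := gcompP cH.
apply: (mD (cj g (gcomp H))); first exact: cj_irr.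
- by move=> _ [y /gcomp_sub Hy <-]; apply: nH.
- by exists 1%:M; [exact: sg1|exact: mxconj1].
- by exists x.
Qed.

Definition fin_index E D := exists s : seq M, (forall g, List.In g s -> g \in unitmx) /\
 forall x, D x -> exists g, [/\ List.In g s & E (invmx g *m x)].

Lemma closed_coset Z g : zclosed Z -> zclosed [set x | Z (g *m x)].
by apply: closed_preT; apply: mor_mull; apply: morI. Qed.

(** Finitely many closed cosets cover [D], so one of them contains it, and as it contains 1 it is
    [E] itself. *)
Lemma irr_fin_index E D : irr D -> D 1%:M -> cgrp E -> fin_index E D -> D `<=` E.
move=> iD D1 [sE cE] [s [sg hs]].
have [|x /hs[g [gs Eg]]|g [gs Dg]] := @irr_sub_bigU _ _ _ M s (fun g => [set x | E (invmx g *m x)]) D iD.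
- by move=> g; apply: closed_coset.
- by exists g.
move=> x /Dg Ex; have := Dg _ D1; rewrite /= mulmx1 => Eg.
by apply/(sg_mull _ sE Eg).
Qed.

(** Each irreducible component, translated back by one of its points, is irreducible through 1 and
    so falls into [gcomp H]. *)
Lemma gcomp_fin H : cgrp H -> fin_index (gcomp H) H.
move=> cH; have [sH czH] := cH; have [_ _ mD] := gcompP cH.
have [s [s1 s2]] := irr_decomp czH.
have [t [tH ht]] : exists t : seq M, (forall g, List.In g t -> H g) /\
  forall Y, List.In Y s -> exists2 g, List.In g t & Y g.
 elim: s s1 {s2} => [|Y s IH] s1; first by exists [::].
 have [|t [tg ht]] := IH; first by move=> Y' h; apply: s1; right.
 have [[[y Yy] _] _ YH] := s1 Y (or_introl erefl).
 exists (y :: t); split=> [g [<-|/tg//]|Y' [<-|/ht[g gt Yg]]]; first exact: YH.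
  by exists y => //; left.
 by exists g => //; right.
exists t; split=> [g /tH/(sg_gl sH)//|x Hx].
have [Y [Ys Yx]] := s2 x Hx; have [iY _ YH] := s1 Y Ys.
have [g gt Yg] := ht Y Ys; exists g; split=> //.
have ug := sg_gl sH (tH _ gt).
apply: (mD [set invmx g *m y | y in Y]); last by exists x.
- by apply: irr_image => //; apply: mor_mull; apply: morI.
- by move=> _ [y Yy <-]; apply: sgM (YH _ Yy) => //; apply: sgV => //; apply: tH.
- by exists g => //; rewrite mulVmx.
Qed.

(** [S] and its translate by [x] both contain nonempty open subsets of the irreducible group [Z],
    hence they meet. *)
Lemma dense_cst_coset Z S x : irr Z -> zclosed Z -> subgroup Z -> cst S -> S `<=` Z ->
 Z `<=` cl S -> Z x -> exists a b, [/\ S a, S b & x = a *m invmx b].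
move=> iZ cZ sZ cS SZ ZS Zx.
have [|h [ph [z0 Z0 h0] hS]] := cst_dense cS iZ.
 by rewrite (_ : Z `&` S = S) //; apply/setIidPr.
have ph' : pol (fun z => h (invmx x *m z)).
 by apply: pol_comp ph; apply: mor_mull; apply: morI.
have [z Zz hz] : exists2 z, Z z & h z * h (invmx x *m z) != 0.
 apply: contrapT => nz; have [z Zz|h'|h'] := iZ.2 _ _ ph ph'.
 - by apply: contrapT => /eqP hz; apply: nz; exists z.
 - by rewrite h' ?eqxx in h0.
 - have := h' (x *m z0) (sgM sZ Zx Z0); rewrite mulKmx ?(sg_gl sZ Zx) // => h0'.
  by rewrite h0' eqxx in h0.
move: hz; rewrite mulf_eq0 => /norP[hz hxz].
have Zxz : Z (invmx x *m z) by apply: sgM => //; apply: sgV.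
exists z, (invmx x *m z); split; [exact: hS|exact: hS|].
have ux := sg_gl sZ Zx; have uz := sg_gl sZ Zz.
by rewrite invmxM ?unitmx_inv // invmxK mulmxA mulmxV // mul1mx.
Qed.

(** Images and products of closed groups are constructible by Chevalley's theorem; this lemma is
    what makes them closed. *)
Lemma cst_sg_closed H : cst H -> subgroup H -> zclosed H.
move=> cH sH; have cK := cl_cgrp sH; have [[sD cD] iD mD] := gcompP cK.
have [s [sg hs]] := gcomp_fin cK; have DK : gcomp (cl H) `<=` cl H by apply: gcomp_sub.
move: (gcomp (cl H)) => D in sD cD iD mD hs DK *.
(* the identity component [D] of [cl H] is open in [cl H], hence meets [H] densely *)
have HD : D `<=` cl (H `&` D).
 have cF g : zclosed [set x | ~ D g /\ D (invmx g *m x)] by apply: closed_cond; apply: (closed_coset).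
 move=> x Dx; have : cl (cl (H `&` D) `|` [set x | exists g, List.In g s /\
   [set x | ~ D g /\ D (invmx g *m x)] x]) x.
  have := DK _ Dx; apply: cl_mono => y Hy.
  have [Dy|nDy] := pselect (D y); first by left; apply: sub_cl.
  have [g [gs Dg]] := hs y (sub_cl Hy); right; exists g; split=> //; split=> //.
  move=> Dg'; apply: nDy; rewrite -(mulKVmx (sg _ gs) y); exact: sgM.
 move=> /(closedU (@cl_closed _ _ _ _) (closed_bigU cF))[//|[g [/sg ug [nDg Dgx]]]].
 case: nDg; have := sgM sD Dx (sgV sD Dgx); rewrite invmxM ?unitmx_inv ?(sg_gl sD Dx) // invmxK.
 by rewrite mulmxA mulmxV ?(sg_gl sD Dx) // mul1mx.
have cHD : cst (H `&` D) by apply: cstI => //; apply: cst_closed.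
have DH : D `<=` H.
 move=> x Dx.
 have [|a [b [[Ha _] [Hb _] ->]]] := dense_cst_coset iD cD sD cHD _ HD Dx; first by [].
 by apply: sgM => //; apply: sgV.
have cF g : zclosed [set y | H g /\ D (invmx g *m y)] by apply: closed_cond; apply: (closed_coset).
move=> x cx; have [g [gs [Hg /DH Dg]]] : [set y | exists g, List.In g s /\
  [set y | H g /\ D (invmx g *m y)] y] x.
 apply: (closed_bigU cF); apply: cl_mono cx => y Hy; have [g [gs Dg]] := hs y (sub_cl Hy).
 exists g; have := sgM sH Hy (sgV sH (DH _ Dg)).
 by rewrite invmxM ?unitmx_inv ?(sg_gl sH Hy) ?sg // invmxK mulmxA mulmxV ?(sg_gl sH Hy) // mul1mx.
by rewrite -(mulKVmx (sg_gl sH Hg) x); apply: sgM.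
Qed.

End Grp.

(** * Solvable groups and the Lie-Kolchin theorem *)

Lemma prop_min (P : nat -> Prop) : (exists m, P m) ->
 exists m, P m /\ forall j, P j -> (m <= j)%N.
move=> [m Pm]; have ex : exists m, `[< P m >] by exists m; apply/asboolP.
case: (ex_minnP ex) => j /asboolP Pj mj; exists j; split=> // i Pi.
by apply: mj; apply/asboolP.
Qed.

(** Rigidity: a function on an irreducible set with finitely many possible values is constant. It
    makes weights and eigenvalues independent of the group element that moves them. *)
Lemma irr_finite_const {k : closedFieldType} V {cV : crd k V} (Z : set V) f (p : {poly k}) :
 irr Z -> pon Z f -> p != 0 -> (forall z, Z z -> p.[f z] = 0) ->
 exists a, forall z, Z z -> f z = a.
move=> iZ [g pg e] p0 h; have [r pr] := closed_field_poly_normal p.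
have [|z Zz|a [_ ha]] := @irr_sub_bigU _ _ _ k r (fun a => [set z | g z - a = 0]) Z iZ.
- by move=> a; apply: closed_zero; apply: polB => //; apply: polC.
- have : root p (f z) by apply/eqP/h.
 rewrite pr rootZ ?lead_coef_eq0 // root_prod_XsubC => fr.
 by exists (f z); split; [apply/mem_In|rewrite /= -e // subrr].
by exists a => z Zz; apply/eqP; rewrite -subr_eq0 e //; apply/eqP; apply: ha.
Qed.

Section Solv.
Context {k : closedFieldType} {n : nat}.
Local Notation M := 'M[k]_n.
Local Notation GL := (@gl k n).
Implicit Types (H K C S Z : set M) (x y z g h : M).

Lemma gen_sub S : S `<=` generated S.
by move=> x Sx H _; apply. Qed.

Lemma gen_least S H : subgroup H -> S `<=` H -> generated S `<=` H.
by move=> sH SH x; apply. Qed.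

Lemma gen_sg S : S `<=` GL -> subgroup (generated S).
move=> SG; split; first by move=> x; apply => //; apply: sg_GL.
- by move=> H sH _; apply: sg1.
- by move=> x y hx hy H sH SH; apply: sgM; [|apply: hx|apply: hy].
- by move=> x hx H sH SH; apply: sgV => //; apply: hx.
Qed.

Definition comms H := [set z | exists x y, [/\ H x, H y & z = x *m y *m invmx x *m invmx y]].

Lemma comms_sub H K : subgroup K -> H `<=` K -> comms H `<=` K.
move=> sK HK _ [x [y [/HK Hx /HK Hy ->]]].
by apply: sgM (sgV sK Hy) => //; apply: sgM (sgV sK Hx) => //; apply: sgM.
Qed.

Lemma derived_sg H : subgroup H -> subgroup (derived H).
by move=> sH; apply: gen_sg; apply: (comms_sub sg_GL) => x /(sg_gl sH). Qed.

Lemma derived_sub H : subgroup H -> derived H `<=` H.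
by move=> sH; apply: gen_least => //; apply: comms_sub. Qed.

Lemma derived_mono H K : H `<=` K -> derived H `<=` derived K.
move=> HK x hx L sL KL; apply: hx => // _ [y [z [/HK Ky /HK Kz ->]]].
by apply: KL; exists y, z.
Qed.

Lemma iter_derived_mono d H K : H `<=` K -> iter d (@derived k n) H `<=` iter d (@derived k n) K.
by move=> HK; elim: d => //= d IH; apply: derived_mono. Qed.

Lemma iter_derived_sg d H : subgroup H -> subgroup (iter d (@derived k n) H).
by move=> sH; elim: d => //= d IH; apply: derived_sg. Qed.

Lemma solvP H : subgroup H ->
 (solvable_group H <-> exists d, iter d (@derived k n) H `<=` [set 1%:M]).
move=> sH; split=> -[d hd]; exists d; first by rewrite hd.
apply/seteqP; split=> // _ ->; apply: sg1; exact: iter_derived_sg.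
Qed.

Lemma solv_sub H K : subgroup H -> H `<=` K -> solvable_group K -> solvable_group H.
by move=> sH HK [d hd]; apply/solvP => //; exists d; rewrite -hd; apply: iter_derived_mono.
Qed.

Lemma solv_derived H : subgroup H -> solvable_group (derived H) -> solvable_group H.
by move=> sH [d hd]; exists d.+1; rewrite iterSr. Qed.

Lemma derived_cj g H : g \in unitmx -> subgroup H -> derived (cj g H) `<=` cj g (derived H).
move=> ug sH; apply: gen_least; first by apply: cj_sg => //; apply: derived_sg.
move=> _ [_ [_ [[x Hx <-] [y Hy <-] ->]]]; exists (x *m y *m invmx x *m invmx y).
 by apply: gen_sub; exists x, y.
by rewrite !mxconjM // !mxconjV // (sg_gl sH).
Qed.

Lemma solv_cj g H : g \in unitmx -> subgroup H -> solvable_group H -> solvable_group (cj g H).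
move=> ug sH [d hd]; apply/solvP; first exact: cj_sg.
exists d; apply: (@subset_trans _ (cj g (iter d (@derived k n) H))).
 elim: (d) => //= m IH; apply: subset_trans (derived_mono IH) _.
 by apply: derived_cj => //; apply: iter_derived_sg.
by rewrite hd => _ [_ -> <-]; rewrite mxconj1.
Qed.

Fixpoint spow S m : set M :=
 if m is m'.+1 then [set x | exists y z, [/\ S y, spow S m' z & x = y *m z]] else [set 1%:M].

Lemma spow_sub S m H : subgroup H -> S `<=` H -> spow S m `<=` H.
move=> sH SH; elim: m => [_ ->|m IH]; first exact: sg1.
by move=> _ [y [z [/SH Hy /IH Hz ->]]]; apply: sgM.
Qed.

Lemma spowD S a b x y : spow S a x -> spow S b y -> spow S (a + b) (x *m y).
elim: a x => [_ ->|a IH x [u [v [Su hv ->]]] hy]; first by rewrite mul1mx.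
by exists u, (v *m y); split=> //; [exact: IH|rewrite mulmxA].
Qed.

Lemma gen_spow S : S `<=` GL -> (forall x, S x -> S (invmx x)) ->
 generated S = [set x | exists m, spow S m x].
move=> SG SV; apply/seteqP; split=> [x hx|x [m hm] H sH SH]; last exact: spow_sub hm.
apply: hx; last by move=> y Sy; exists 1, y, 1%:M; rewrite mulmx1.
split.
- by move=> y [m]; apply: (spow_sub sg_GL).
- by exists 0.
- by move=> y z [a ha] [b hb]; exists (a + b); apply: spowD.
- move=> y [m]; elim: m y => [_ ->|m IH _ [u [v [Su hv ->]]]]; first by exists 0; rewrite invmx1.
 have [b hb] := IH v hv; exists (b + 1); rewrite invmxM ?(SG _ Su) ?(spow_sub sg_GL SG hv) //.
 by apply: spowD => //; exists (invmx u), 1%:M; split=> //; [exact: SV|rewrite mulmx1].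
Qed.

Lemma irr_spow S m : irr S -> irr (spow S m).
by move=> iS; elim: m => [|m IH]; [exact: irr1|exact: irr_mul]. Qed.

Lemma irr_gen S : S `<=` GL -> (forall x, S x -> S (invmx x)) -> S 1%:M -> irr S ->
 irr (generated S).
move=> SG SV S1 iS; rewrite gen_spow //.
have := @irr_directed _ _ (mx_crd k n) [set Z | exists m, Z = spow S m].
rewrite (_ : [set v | _] = [set x | exists m, spow S m x]); last first.
 apply/seteqP; split=> x; first by move=> [_ [m ->]]; exists m.
 by move=> [m hm]; exists (spow S m) => //; exists m.
apply; first by exists (spow S 0); exists 0.
 by move=> _ [m ->]; apply: irr_spow.
have ones m : spow S m 1%:M by elim: m => //= m h; exists 1%:M, 1%:M; rewrite mulmx1.
move=> _ _ [a ->] [b ->]; exists (spow S (a + b)); first by exists (a + b).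
split=> x hx.
 by rewrite -[x]mulmx1; apply: spowD.
by rewrite -[x]mul1mx; apply: spowD.
Qed.

(** The commutators form the image of the irreducible set of pairs and are stable under inversion,
    so the derived group is a directed union of irreducible products. *)
Lemma irr_derived H : subgroup H -> irr H -> irr (derived H).
move=> sH iH; apply: irr_gen.
- by apply: (comms_sub sg_GL) => x /(sg_gl sH).
- move=> _ [x [y [Hx Hy ->]]].
 exists y, x.
 by rewrite !invmxM ?unitmx_mul ?unitmx_inv ?(sg_gl sH Hx) ?(sg_gl sH Hy) // !invmxK !mulmxA.
- by exists 1%:M, 1%:M; split; [exact: sg1|exact: sg1|rewrite invmx1 !mulmx1].
- have := @irr_image _ _ _ _ _ (H `*` H) (fun xy => xy.1 *m xy.2 *m invmx xy.1 *m invmx xy.2) (irr_prod iH iH).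
 rewrite (_ : _ @` _ = [set z | exists x y, [/\ H x, H y & z = x *m y *m invmx x *m invmx y]]).
  apply; apply: mor_mul2; [apply: mor_mul2; [exact: mor_fst_mul|]|].
   by apply: mor_inv => [|xy [/(sg_gl sH)]] //; apply: mor_fst.
  by apply: mor_inv => [|xy [_ /(sg_gl sH)]] //; apply: mor_snd.
 apply/seteqP; split=> z; first by move=> [[x y] [/= Hx Hy] <-]; exists x, y.
 by move=> [x [y [Hx Hy ->]]]; exists (x, y).
Qed.

(** Turns a linear condition, typically quantified over a whole group, into a row space: among the
    matrices whose row space satisfies it, one of largest rank. *)
Lemma subspace_mx (P : 'rV[k]_n -> Prop) : P 0 ->
 (forall a u v, P u -> P v -> P (a *: u + v)) ->
 exists U : M, forall v : 'rV_n, (v <= U)%MS <-> P v.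
move=> P0 PL.
have Pmul m A (w : 'rV_m) : (forall i, P (row i A)) -> P (w *m A).
 move=> PA; rewrite mulmx_sum_row; apply: big_ind => // [u v Pu Pv|i _].
  by rewrite -[u]scale1r; apply: PL.
 by rewrite -[_ *: _]addr0; apply: PL.
pose Q m := exists U : M, (forall v : 'rV_n, (v <= U)%MS -> P v) /\ (n - \rank U)%N = m.
have [|m [[U [UP rU]] mm]] := @prop_min Q.
 by exists n, 0; split=> [v|]; [rewrite submx0 => /eqP->|rewrite mxrank0 subn0].
exists U => v; split=> [/UP//|Pv]; apply: contrapT => /negP nv.
have /mm : Q (n - \rank (U + v)%MS)%N.
 exists (U + v)%MS; split=> // w /sub_addsmxP[[a b] ->].
 rewrite -[_ *m U]scale1r; apply: PL; first by apply: UP; apply: submxMl.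
 by apply: Pmul => i; rewrite ord1 (_ : row 0 v = v) //; apply/rowP => j; rewrite mxE.
have lt : (\rank U < \rank (U + v)%MS)%N.
 rewrite ltn_neqAle mxrankS ?addsmxSl // andbT; apply: contra nv => /eqP e.
 have := mxrank_leqif_sup (addsmxSl U v); rewrite e => /leqif_refl.
 by apply: submx_trans; apply: addsmxSr.
have := rank_leq_col (U + v)%MS => le.
by rewrite -rU leqNgt ltn_sub2l // (leq_trans lt).
Qed.

End Solv.

Section LK.
Context {k : closedFieldType} {n' : nat}.
Local Notation n := n'.+1.
Local Notation M := 'M[k]_n.
Implicit Types (v w : 'rV[k]_n) (W : M) (x y : M).

Lemma eigen_horner W x v a (p : {poly k}) : stablemx W x -> (v *m x - a *: v <= W)%MS ->
 (v *m horner_mx x p - p.[a] *: v <= W)%MS.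
move=> sW vx; elim/poly_ind: p => [|p c IH].
 by rewrite horner0 rmorph0 mulmx0 scale0r subr0 sub0mx.
rewrite rmorphD rmorphM /= horner_mx_X horner_mx_C hornerMXaddC mulmxDr scalerDl.
rewrite mul_mx_scalar opprD addrACA subrr addr0 mulmxA.
rewrite -(subrK (p.[a] *: v *m x) (v *m _ *m x)) -addrA; apply: addmx_sub.
 by rewrite -mulmxBl (submx_trans (submxMr _ IH)).
by rewrite -scalerA -scalemxAl -scalerBr; apply: scalemx_sub.
Qed.

Lemma eigen_root W x v a (p : {poly k}) : stablemx W x -> (v *m x - a *: v <= W)%MS ->
 ~~ (v <= W)%MS -> horner_mx x p = 0 -> p.[a] = 0.
move=> sW vx nv px; have := eigen_horner p sW vx; rewrite px mulmx0 sub0r -scaleNr.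
by apply: contraTeq => pa; rewrite eqmx_scale // oppr_eq0.
Qed.

Lemma eigen_exists W' W x v : stablemx W' x -> stablemx W x -> (v <= W)%MS -> ~~ (v <= W')%MS ->
 exists v1 a, [/\ (v1 <= W)%MS, ~~ (v1 <= W')%MS & (v1 *m x - a *: v1 <= W')%MS].
move=> sW' sW; have [r pr] := closed_field_poly_normal (char_poly x).
have : horner_mx x (\prod_(z <- r) ('X - z%:P)) = 0.
 by move: pr (Cayley_Hamilton x); rewrite (monicP (char_poly_monic x)) scale1r => <-.
rewrite rmorph_prod; move=> h0; have : (v *m \prod_(z <- r) horner_mx x ('X - z%:P) <= W')%MS.
 by rewrite h0 mulmx0 sub0mx.
elim: r v {pr h0} => [|a r IH] v; first by rewrite big_nil mulmx1 => ->.
rewrite big_cons mulmxA => h vW vW'.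
have [hv|hv] := boolP (v *m x - a *: v <= W')%MS; first by exists v, a.
have e : v *m horner_mx x ('X - a%:P) = v *m x - a *: v.
 by rewrite rmorphB /= horner_mx_X horner_mx_C mulmxBr mul_mx_scalar.
apply: (IH _ h); rewrite e //; apply: addmx_sub; last by rewrite -scaleNr scalemx_sub.
exact: submx_trans (submxMr _ vW) sW.
Qed.

(** Lie-Kolchin in the subquotient [W/W']. Induction on the derived length gives a weight [chi] of
    the derived group. Rigidity makes [chi] invariant under [C], so by minimality of [W1]
    commutators act on [W1/W'] as scalars; rigidity again makes these scalars 1, so the eigenspaces
    of elements of [C] are stable and fill [W1/W']. *)
Lemma lie_kolchin_sub d (C : set M) : subgroup C -> irr C ->
 iter d (@derived k n) C `<=` [set 1%:M] -> forall W' W : M,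
 (forall c, C c -> stablemx W' c) -> (forall c, C c -> stablemx W c) ->
 (W' <= W)%MS -> ~~ (W <= W')%MS ->
 exists v, [/\ (v <= W)%MS, ~~ (v <= W')%MS &
        forall c, C c -> exists a, (v *m c - a *: v <= W')%MS].
elim: d C => [|d IH] C sC iC hd W' W sW' sW W'W WW'.
 have [i ri] := row_subPn WW'; exists (row i W); split=> //; first exact: row_sub.
 by move=> c /hd ->; exists 1; rewrite mulmx1 scale1r subrr sub0mx.
pose Q m := exists U : M, [/\ forall c, C c -> stablemx U c, (W' <= U)%MS, (U <= W)%MS,
 ~~ (U <= W')%MS & \rank U = m].
have [|m [[{sW W'W WW'}W1 [sW1 W'W1 W1W W1W' rW1]] mm]] := @prop_min Q; first by exists (\rank W), W.
have minW (U : M) : (forall c, C c -> stablemx U c) -> (W' <= U)%MS -> (U <= W1)%MS ->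
  ~~ (U <= W')%MS -> (W1 <= U)%MS.
 move=> sU W'U UW1 UW'; have /mm : Q (\rank U) by exists U; split=> //; apply: submx_trans W1W.
 rewrite -rW1 => le; have := mxrank_leqif_sup UW1 => -[_ <-].
 by rewrite eqn_leq mxrankS.
have sC' := derived_sg sC; have C'C := derived_sub sC.
have [|||v0 [v0W v0W' v0e]] := IH (derived C) sC' (irr_derived sC iC) _ W' W1 _ _ W'W1 W1W'.
- by rewrite -iterSr.
- by move=> c /C'C/sW'.
- by move=> c /C'C/sW1.
have [j b0] : exists j, (v0 *m cokermx W') 0 j != 0.
 apply/existsP; apply: contra v0W' => /forallP h.
 by rewrite submxE; apply/eqP/rowP => j; rewrite [RHS]mxE; apply/eqP.
set b := (v0 *m _) 0 j in b0.
(* Reading [chi] off one coordinate of [v0] modulo [W'] makes it a polynomial function on all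
   matrices, to which rigidity applies. *)
pose chi x := (v0 *m x *m cokermx W') 0 j / b.
have pchi : pol (fun x => chi x).
 apply: polM; last exact: polC.
 by apply: (polmxM); [apply: polmxM; [exact: polmxC|exact: polmx_id]|exact: polmxC].
have chiP c : derived C c -> (v0 *m c - chi c *: v0 <= W')%MS.
 move=> Cc; have [a ha] := v0e c Cc; suff -> : chi c = a by [].
 move: ha; rewrite submxE mulmxBl subr_eq0 -scalemxAl => /eqP e.
 by rewrite /chi e mxE mulfK.
have conjC' c c' : C c -> derived C c' -> derived C (mxconj c c').
 move=> Cc Cc'; have Dc' := C'C _ Cc'.
 rewrite -(mulmxKV (sg_gl sC Dc') (mxconj c c')); by apply: (sgM sC' _ Cc'); apply: gen_sub; exists c, c'.
have chiJ c c' : C c -> derived C c' -> chi (mxconj c c') = chi c'.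
 move=> Cc Cc'.
 have [||y Cy|a ha] := @irr_finite_const _ _ _ C (fun c => chi (mxconj c c')) (char_poly c') iC.
 - apply: (pon_comp _ pchi).
  apply: mor_mul2; first by apply: mor_mulr; apply: morI.
  by apply: mor_inv => [|v /(sg_gl sC)] //; apply: morI.
 - exact: monic_neq0 (char_poly_monic c').
 - have uy := sg_gl sC Cy; apply: (eigen_root _ (chiP _ (conjC' y c' Cy Cc')) v0W').
   by apply: sW'; apply: C'C; apply: conjC'.
  rewrite horner_mx_uconj // Cayley_Hamilton.
  by rewrite mulmx0 mul0mx.
 rewrite ha // -(ha _ (sg1 sC)).
 by rewrite /mxconj invmx1 mulmx1 mul1mx.
have [|a u v [hu1 hu2] [hv1 hv2]|U UP] := @subspace_mx _ _ (fun v => (v <= W1)%MS /\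
  forall c, derived C c -> (v *m c - chi c *: v <= W')%MS).
- by split=> [|c _]; rewrite ?mul0mx ?scaler0 ?subr0 sub0mx.
- split=> [|c Cc]; first by apply: addmx_sub => //; apply: scalemx_sub.
 rewrite mulmxDl -scalemxAl scalerDr opprD addrACA addmx_sub ?hv2 //.
 by rewrite scalerA mulrC -scalerA -scalerBr scalemx_sub // hu2.
have W1U : (W1 <= U)%MS.
 apply: minW.
 - move=> c Cc; apply/row_subP => i; rewrite row_mul; apply/UP.
  have [h1 h2] := (UP (row i U)).1 (row_sub _ _); split.
   exact: submx_trans (submxMr _ h1) (sW1 _ Cc).
  move=> c' Cc'; have uc := sg_gl sC Cc.
  have := h2 _ (conjC' c c' Cc Cc'); rewrite chiJ // => h3.
  have -> : row i U *m c *m c' - chi c' *: (row i U *m c) =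
       (row i U *m mxconj c c' - chi c' *: row i U) *m c.
   by rewrite mulmxBl -scalemxAl !mulmxA mulmxKV.
  exact: submx_trans (submxMr _ h3) (sW' _ Cc).
 - apply/row_subP => i; apply/UP; split; first exact: submx_trans (row_sub _ _) W'W1.
  move=> c Cc; apply: addmx_sub; last by rewrite -scaleNr scalemx_sub // row_sub.
  exact: submx_trans (submxMr _ (row_sub _ _)) (sW' _ (C'C _ Cc)).
 - by apply/row_subP => i; case: ((UP (row i U)).1 (row_sub _ _)).
 - apply: contra v0W' => UW'; apply: submx_trans UW'; apply/UP; by split.
have scal v c : (v <= W1)%MS -> derived C c -> (v *m c - chi c *: v <= W')%MS.
 by move=> vW1; case: ((UP v).1 (submx_trans vW1 W1U)) => _; apply.
have chi1 : chi 1%:M = 1 by rewrite /chi mulmx1 divff.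
have comC z x : C z -> C x -> derived C (z *m x *m invmx z *m invmx x).
 by move=> Cz Cx; apply: gen_sub; exists z, x.
have comE z x v : C z -> C x ->
  v *m z *m x = v *m (z *m x *m invmx z *m invmx x) *m (x *m z).
 by move=> Cz Cx; rewrite !mulmxA mulmxKV ?(sg_gl sC Cx) // mulmxKV // (sg_gl sC Cz).
have stab v c : C c -> (v <= W')%MS -> (v *m c <= W')%MS.
 by move=> Cc vW; apply: submx_trans (submxMr _ vW) (sW' _ Cc).
(* If [v1] has eigenvalue [a] for [x] modulo [W'], then [v1 *m z] has eigenvalue [chi] of the
   commutator times [a]. As a function of [z] this is a root of the characteristic polynomial of
   [x], hence constant. *)
have key z x v1 a : C z -> C x -> (v1 <= W1)%MS -> (v1 *m x - a *: v1 <= W')%MS ->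
  (v1 *m z *m x - (chi (z *m x *m invmx z *m invmx x) * a) *: (v1 *m z) <= W')%MS.
 move=> Cz Cx v1W ha; rewrite comE //; set w := z *m x *m _ *m _.
 rewrite -(subrK (chi w *: v1 *m (x *m z)) (v1 *m w *m _)) -addrA; apply: addmx_sub.
  by rewrite -mulmxBl; apply: stab; [exact: sgM|apply: scal => //; apply: comC].
 rewrite -scalerA -!scalemxAl -scalerBr scalemx_sub // mulmxA.
 by rewrite [X in - X]scalemxAl -mulmxBl; apply: stab.
exists v0; split=> //; first exact: submx_trans W1W.
move=> x Cx; have [v1 [a [v1W v1W' ha]]] := eigen_exists (sW' x Cx) (sW1 x Cx) v0W v0W'.
have a0 : a != 0.
 apply: contraNneq v1W' => a0; move: ha; rewrite a0 scale0r subr0 => ha.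
 by rewrite -(mulmxK (sg_gl sC Cx) v1); apply: stab => //; apply: sgV.
have chiz z : C z -> chi (z *m x *m invmx z *m invmx x) = 1.
 have [||y Cy|e he Cz] := @irr_finite_const _ _ _ C
   (fun z => chi (z *m x *m invmx z *m invmx x) * a) (char_poly x) iC.
 - have mz : mor C (fun z => z *m x *m invmx z *m invmx x).
   apply: mor_mulr; apply: mor_mul2; first by apply: mor_mulr; apply: morI.
   by apply: mor_inv => [|v /(sg_gl sC)] //; apply: morI.
  have [f pf e] := mz _ pchi; exists (fun z => f z * a); first by apply: polM => //; apply: polC.
  by move=> v Cv; rewrite -e.
 - exact: monic_neq0 (char_poly_monic x).
 - apply: (eigen_root (sW' x Cx) (key y x v1 a Cy Cx v1W ha)); last exact: Cayley_Hamilton.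
  apply: contra v1W' => h; rewrite -(mulmxK (sg_gl sC Cy) v1); apply: stab => //; exact: sgV.
 have := he _ Cz; rewrite -(he _ (sg1 sC)) => /(mulIf a0) ->.
 by rewrite invmx1 mulmx1 mul1mx mulmxV // (sg_gl sC Cx).
have [|c u v [hu1 hu2] [hv1 hv2]|U2 U2P] := @subspace_mx _ _ (fun v => (v <= W1)%MS /\
  (v *m x - a *: v <= W')%MS).
- by rewrite mul0mx scaler0 subr0 !sub0mx.
- split; first by apply: addmx_sub => //; apply: scalemx_sub.
 rewrite mulmxDl -scalemxAl scalerDr opprD addrACA addmx_sub //.
 by rewrite scalerA mulrC -scalerA -scalerBr scalemx_sub.
have W1U2 : (W1 <= U2)%MS.
 apply: minW.
 - move=> c Cc; apply/row_subP => i; rewrite row_mul; apply/U2P.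
  have [h1 h2] := (U2P (row i U2)).1 (row_sub _ _); split.
   exact: submx_trans (submxMr _ h1) (sW1 _ Cc).
  by have := key c x _ a Cc Cx h1 h2; rewrite chiz // mul1r.
 - apply/row_subP => i; apply/U2P; split; first exact: submx_trans (row_sub _ _) W'W1.
  apply: addmx_sub; last by rewrite -scaleNr scalemx_sub // row_sub.
  by apply: stab => //; apply: row_sub.
 - by apply/row_subP => i; case: ((U2P (row i U2)).1 (row_sub _ _)).
 - by apply: contra v1W' => UW'; apply: submx_trans UW'; apply/U2P.
by exists a; case: ((U2P v0).1 (submx_trans v0W W1U2)).
Qed.

End LK.

(** * Places *)

Lemma mxpol_ind (k : fieldType) n (P : ('M[k]_n -> k) -> Prop) :
 (forall c, P (fun=> c)) -> (forall i j, P (fun v => v i j)) -> P (fun v => (\det v)^-1) ->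
 (forall f g, P f -> P g -> P (fun v => f v + g v)) ->
 (forall f g, P f -> P g -> P (fun v => f v * g v)) -> forall f, pol f -> P f.
move=> PC PE PD Padd Pmul f; elim=> [//|i|i|{}f g _ Pf _ Pg|{}f g _ Pf _ Pg]; last 2 first.
- exact: Padd.
- exact: Pmul.
- have [iI|iI] := ltnP i #|{: 'I_n * 'I_n}|; last first.
  apply: set_ext_fun (PC 0) => v; rewrite nth_default //.
  by rewrite (fin_size_enc (fun (v : 'M[k]_n) ij => v ij.1 ij.2)).
 apply: set_ext_fun (PE (enum_val (Ordinal iI)).1 (enum_val (Ordinal iI)).2) => v.
 rewrite -[i]/(nat_of_ord (Ordinal iI)) -{3}[Ordinal iI]enum_valK.
 by rewrite (nth_fenc (fun (v : 'M[k]_n) ij => v ij.1 ij.2)).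
- case: i => [//|i]; apply: set_ext_fun (PC 0) => v /=; by rewrite nth_nil.
Qed.

Section Ultra.
Context {k : closedFieldType} {X : Type}.
Implicit Types (U : set (set X)) (f : X -> k).

(** Modulo an ultrafilter the functions on [X] form a field, so places are available without
    building a function field. *)
Record ultra U : Prop := Ultra {
 ultraI : forall A B, U A -> U B -> U (A `&` B);
 ultraS : forall A B, A `<=` B -> U A -> U B;
 ultra0 : ~ U set0;
 ultraC : forall A, U A \/ U (~` A) }.

Lemma ultraT U : ultra U -> U setT.
by move=> uU; have [//|] := ultraC uU setT; rewrite setCT => /ultra0. Qed.

Lemma ultra_ex U A : ultra U -> U A -> exists x, A x.
move=> uU UA; apply: contrapT => nA; apply: (ultra0 uU); apply: ultraS UA => //.
by move=> x Ax; apply: nA; exists x.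
Qed.

Lemma ultra_bigU U (I : Type) (s : seq I) (F : I -> set X) : ultra U ->
 U [set x | exists i, List.In i s /\ F i x] -> exists i, List.In i s /\ U (F i).
move=> uU; elim: s => [|i s IH] h.
 by have [x [i [[]]]] := ultra_ex uU h.
have [Fi|nFi] := ultraC uU (F i); first by exists i; split=> //; left.
have [|j [js Fj]] := IH; last by exists j; split=> //; right.
apply: (ultraS uU _ (ultraI uU h nFi)) => x [[j [[<-|js] Fj]] nF] //.
by exists j.
Qed.

(** A [k]-valued place of the field of functions modulo [U]: [pl f a] means that [f] is finite with
    residue [a], and [plV] that a function which is not finite has a pole. It is a relation because
    residues exist only on the valuation ring. *)
Record place U (pl : (X -> k) -> k -> Prop) : Prop := Place {
 plC : forall c, pl (fun=> c) c;
 plD : forall f g a b, pl f a -> pl g b -> pl (fun x => f x + g x) (a + b);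
 plM : forall f g a b, pl f a -> pl g b -> pl (fun x => f x * g x) (a * b);
 plU : forall f a b, pl f a -> pl f b -> a = b;
 plX : forall f g a, U [set x | f x = g x] -> pl f a -> pl g a;
 plV : forall f, (exists a, pl f a) \/ pl (fun x => (f x)^-1) 0 }.

Definition preplace U (R : set ((X -> k) * k)) :=
 [/\ forall c, R (fun=> c, c),
   forall (f g : X -> k) a b, R (f, a) -> R (g, b) -> R (fun x => f x + g x, a + b),
   forall f g a b, R (f, a) -> R (g, b) -> R (fun x => f x * g x, a * b),
   forall f a b, R (f, a) -> R (f, b) -> a = b &
   forall f g a, U [set x | f x = g x] -> R (f, a) -> R (g, a)].

Lemma proper_ideal_root (I : set {poly k}) : (forall p q, I p -> I q -> I (p + q)) ->
 (forall r p, I p -> I (r * p)) -> ~ I 1 -> exists t, forall p, I p -> p.[t] = 0.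
move=> ID IM I1; have [[p0 [Ip0 p00]]|n0] := pselect (exists p, I p /\ p != 0); last first.
 exists 0 => p Ip; have [->|p0] := eqVneq p 0; first by rewrite horner0.
 by case: n0; exists p.
pose Q m := exists p, [/\ I p, p != 0 & size p = m].
have [|m [[p [Ip p_0 sp]] mm]] := @prop_min Q; first by exists (size p0), p0.
have dv q : I q -> p %| q.
 move=> Iq; apply: contrapT => /negP nd; have /mm : Q (size (q %% p)).
  exists (q %% p); split=> //.
  have -> : q %% p = q + (- (q %/ p)) * p by rewrite {2}(divp_eq q p) mulNr addrAC subrr add0r.
  by apply: ID => //; apply: IM.
 by rewrite -sp leqNgt ltn_modp p_0.
have /closed_rootP[t rt] : size p != 1.
 apply/negP => /size_poly1P[c c0 pc]; apply: I1.
 have -> : 1 = c^-1%:P * p by rewrite pc -polyCM mulVf.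
 exact: IM.
by exists t => q /dv /dvdpP[r ->]; rewrite hornerM (eqP rt) mulr0.
Qed.

Section Ext.
Variables (U : set (set X)) (uU : ultra U) (R : set ((X -> k) * k)) (pR : preplace U R).

Let RC c : R (fun=> c, c). by case: pR. Qed.
Let RD f g a b : R (f, a) -> R (g, b) -> R (fun x => f x + g x, a + b).
by case: pR => _ + _ _ _; apply. Qed.
Let RM f g a b : R (f, a) -> R (g, b) -> R (fun x => f x * g x, a * b).
by case: pR => _ _ + _ _; apply. Qed.
Let RU f a b : R (f, a) -> R (f, b) -> a = b.
by case: pR => _ _ _ + _; apply. Qed.
Let RX f g a : U [set x | f x = g x] -> R (f, a) -> R (g, a).
by case: pR => _ _ _ _; apply. Qed.
Let Rext f g a b : (forall x, f x = g x) -> a = b -> R (f, a) -> R (g, b).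
by move=> /funext-> ->. Qed.

Let Rsum (I : Type) (r : seq I) (F : I -> X -> k) (a : I -> k) :
 (forall i, R (F i, a i)) -> R (fun x => \sum_(i <- r) F i x, \sum_(i <- r) a i).
move=> h; elim: r => [|i r IH].
 by apply: Rext (RC 0) => [x|]; rewrite big_nil.
by apply: Rext (RD (h i) IH) => [x|]; rewrite big_cons.
Qed.

Definition Rp (g : X -> {poly k}) (p : {poly k}) :=
 (exists d, forall x, (size (g x) <= d)%N) /\ forall i, R (fun x => (g x)`_i, p`_i).

Lemma RpC f a : R (f, a) -> Rp (fun x => (f x)%:P) a%:P.
move=> Rf; split; first by exists 1 => x; rewrite size_polyC leq_b1.
move=> i; case: i => [|i]; first by apply: Rext Rf => [x|]; rewrite coefC.
by apply: Rext (RC 0) => [x|]; rewrite coefC.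
Qed.

Lemma Rpc (p : {poly k}) : Rp (fun=> p) p.
by split=> [|i]; [exists (size p)|exact: RC]. Qed.

Lemma RpD g h p q : Rp g p -> Rp h q -> Rp (fun x => g x + h x) (p + q).
move=> [[d sg] hg] [[e sh] hh]; split.
 exists (maxn d e) => x; apply: leq_trans (size_polyD _ _) _.
 by rewrite geq_max !leq_max sg sh orbT.
by move=> i; apply: Rext (RD (hg i) (hh i)) => [x|]; rewrite coefD.
Qed.

Lemma RpM g h p q : Rp g p -> Rp h q -> Rp (fun x => g x * h x) (p * q).
move=> [[d sg] hg] [[e sh] hh]; split.
 exists (d + e) => x; apply: leq_trans (size_polyMleq _ _) _.
 by apply: leq_trans (leq_pred _) _; apply: leq_add.
move=> i.
apply: Rext (Rsum (index_enum 'I_i.+1)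
 _) => [x||j]; [by rewrite coefM|by rewrite coefM|exact: RM].
Qed.

Lemma Rp_horner g p u b : Rp g p -> R (u, b) -> R (fun x => (g x).[u x], p.[b]).
move=> [[d sg] hg] Ru.
have RX_ i : R (fun x => u x ^+ i, b ^+ i).
 elim: i => [|i IH]; first exact: Rext (RC 1) => [x|].
 by apply: Rext (RM Ru IH) => [x|]; rewrite exprS.
apply: Rext (Rsum (index_enum 'I_(maxn d (size p))) (F := fun j x => (g x)`_j * u x ^+ j)
 _) => [x||j]; last exact: RM.
- by rewrite (@horner_coef_wide _ (maxn d (size p))) // leq_max sg.
- by rewrite (@horner_coef_wide _ (maxn d (size p))) // leq_maxr.
Qed.

(** The residues of polynomial relations satisfied by [f]. Any common root of them can serve as
    residue of [f], so the only obstruction to extending [R] is that 1 occurs among them. *)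
Definition Rid f := [set p | exists2 g, Rp g p & U [set x | (g x).[f x] = 0]].

Lemma place_extend f : ~ Rid f 1 -> exists2 R', preplace U R' & R `<=` R' /\ exists a, R' (f, a).
move=> nI; have [p q [g hg zg] [h hh zh]|r p [g hg zg]|t ht] := proper_ideal_root _ _ nI.
- exists (fun x => g x + h x); first exact: RpD.
 by apply: ultraS (ultraI uU zg zh) => // x [/= e1 e2]; rewrite hornerD e2 addr0.
- exists (fun x => r * g x); first by apply: RpM => //; apply: Rpc.
 by apply: ultraS zg => // x /= e; rewrite hornerM e mulr0.
pose R' : set ((X -> k) * k) := [set ub | exists g p, [/\ Rp g p,
 U [set x | ub.1 x = (g x).[f x]] & ub.2 = p.[t]]].
have RR' : R `<=` R'.
 move=> [u b] Rub; exists (fun x => (u x)%:P), b%:P; split; [exact: RpC| |by rewrite hornerC].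
 by apply: ultraS (ultraT uU) => // x /=; rewrite hornerC.
exists R'; last first.
 split=> //; exists t, (fun=> 'X), 'X; split; [exact: Rpc| |by rewrite hornerX].
 by apply: ultraS (ultraT uU) => // x /=; rewrite hornerX.
split.
- by move=> c; apply: RR'.
- move=> u v a b [g [p [hg eg /= ->]]] [h [q [hh eh /= ->]]].
 exists (fun x => g x + h x), (p + q); split; [exact: RpD| |by rewrite hornerD].
 by apply: ultraS (ultraI uU eg eh) => // x [/= -> ->]; rewrite hornerD.
- move=> u v a b [g [p [hg eg /= ->]]] [h [q [hh eh /= ->]]].
 exists (fun x => g x * h x), (p * q); split; [exact: RpM| |by rewrite hornerM].
 by apply: ultraS (ultraI uU eg eh) => // x [/= -> ->]; rewrite hornerM.
- move=> u a b [g [p [hg eg /= ->]]] [h [q [hh eh /= ->]]].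
 apply/eqP; rewrite -subr_eq0 -mulN1r -[-1](hornerC _ t) -hornerM -hornerD; apply/eqP; apply: ht.
 exists (fun x => g x + (-1)%:P * h x); first by apply: RpD => //; apply: RpM => //; apply: Rpc.
 apply: ultraS (ultraI uU eg eh) => // x [/= e1 e2].
 by rewrite hornerD hornerM hornerC -e1 -e2 mulN1r subrr.
- move=> u v a e [g [p [hg eg /= ->]]]; exists g, p; split=> //.
 by apply: ultraS (ultraI uU e eg) => // x [/= <- <-].
Qed.

Hypothesis maxR : forall R', preplace U R' -> R `<=` R' -> R' `<=` R.

Let dom f : (exists a, R (f, a)) \/ Rid f 1.
have [|nI] := pselect (Rid f 1); first by right.
left; have [R' pR' [RR' [a hf]]] := place_extend nI; exists a; exact: maxR hf.
Qed.

Let horner_rev (p : {poly k}) d (u : k) : (size p <= d.+1)%N -> u != 0 ->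
 (\poly_(i < d.+1) p`_(d - i)).[u] = u ^+ d * p.[u^-1].
move=> sp u0; rewrite horner_poly (horner_coef_wide _ sp) mulr_sumr.
rewrite (reindex_inj rev_ord_inj); apply: eq_bigr => i _.
have id : (i <= d)%N by rewrite -ltnS.
rewrite subKn // mulrCA exprVn.
have -> : u ^+ d = u ^+ (d - i) * u ^+ i by rewrite -exprD subnK.
by rewrite mulfK // expf_neq0.
Qed.

Let Runit u b : R (u, b) -> b != 0 -> R (fun x => (u x)^-1, b^-1).
move=> Ru b0; have Unz : U [set x | u x != 0].
 have [//|h] := ultraC uU [set x | u x != 0].
 have : R (u, 0) by apply: RX (RC 0); apply: ultraS h => // x /= /negP; rewrite negbK => /eqP ->.
 by move=> /(RU Ru) e; rewrite e eqxx in b0.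
have [[c Rc]|[g hg zg]] := dom (fun x => (u x)^-1).
 suff -> : b^-1 = c by [].
 have : R (fun=> 1, b * c).
  by apply: RX (RM Ru Rc); apply: ultraS Unz => // x /= ux; rewrite divff.
 by move=> /(RU (RC 1)) e; apply: (mulfI b0); rewrite divff.
have [[d sg] hgi] := hg.
(* Reversing the relation [g] for the inverse of [u] gives a relation for [u] itself with residue
   [X ^ d], which does not vanish at [b]. *)
pose g' x := \poly_(i < d.+1) (g x)`_(d - i).
have hg' : Rp g' 'X^d.
 split; first by exists d.+1 => x; apply: size_poly.
 move=> i; have [id|id] := ltnP i d.+1.
  apply: Rext (hgi (d - i)%N) => [x|]; first by rewrite coef_poly id.
  rewrite coef1 coefXn.
  by rewrite subn_eq0 eqn_leq (ltnSE id).
 apply: Rext (RC 0) => [x|]; first by rewrite coef_poly ltnNge id.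
 by rewrite coefXn gtn_eqF.
have := Rp_horner hg' Ru; rewrite hornerXn => h.
have : R (fun=> 0, b ^+ d).
 apply: RX h; apply: ultraS (ultraI uU Unz zg) => // x [/= ux e].
 by rewrite horner_rev ?e ?mulr0 // (leq_trans (sg x)).
by move=> /(RU (RC 0)) /esym/eqP; rewrite expf_eq0 (negbTE b0) andbF.
Qed.

Let Rdeg f d := exists2 g, Rp g 1 /\ (forall x, (size (g x) <= d.+1)%N) & U [set x | (g x).[f x] = 0].

Let Rdeg_ex f : Rid f 1 -> exists d, Rdeg f d.
by move=> [g hg zg]; have [[d sg] _] := hg; exists d, g => //; split=> // x; apply: leqW. Qed.

(** Suppose neither [f] nor its inverse can be given a residue, and take relations with residue 1,
    the one for [f] of least degree [d >= e]. The reversed relation of the inverse has leading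
    coefficient of residue 1, so it cancels the top term of the other. The factor used has residue
    0, so the residue stays 1 while the degree drops. *)
Let valuation_aux f d e : U [set x | f x != 0] -> Rdeg f d -> Rdeg (fun x => (f x)^-1) e ->
 (forall j, Rdeg f j -> (d <= j)%N) -> (e <= d)%N -> False.
move=> Uf [g [hg sg] zg] [h [hh sh] zh] md ed.
have [[_ hgi] [_ hhi]] := (hg, hh).
case: d => [|d] in sg md ed *.
 have h0 := hgi 0; rewrite coef1 in h0; have : R (fun=> 0, 1).
  apply: RX h0; apply: ultraS zg => // x /=.
  by rewrite {1}(size1_polyC (sg x)) hornerC.
 by move=> /(RU (RC 0)) /eqP; rewrite eq_sym oner_eq0.
have h0 := hhi 0; rewrite coef1 in h0.
have Uh0 : U [set x | (h x)`_0 != 0].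
 have [//|n0] := ultraC uU [set x | (h x)`_0 != 0].
 have : R (fun=> 0, 1).
  by apply: RX h0; apply: ultraS n0 => // x /= /negP; rewrite negbK => /eqP ->.
 by move=> /(RU (RC 0)) /eqP; rewrite eq_sym oner_eq0.
pose c x := (g x)`_d.+1 / (h x)`_0.
pose rh x := \poly_(i < e.+1) (h x)`_(e - i).
have hrh : Rp rh 'X^e.
 split; first by exists e.+1 => x; apply: size_poly.
 move=> i; have [id|id] := ltnP i e.+1.
  apply: Rext (hhi (e - i)%N) => [x|]; first by rewrite coef_poly id.
  rewrite coef1 coefXn.
  by rewrite subn_eq0 eqn_leq (ltnSE id).
 apply: Rext (RC 0) => [x|]; first by rewrite coef_poly ltnNge id.
 by rewrite coefXn gtn_eqF.
have Rc : R (c, 0).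
 have := RM (hgi d.+1) (Runit h0 (oner_neq0 _)); rewrite coef1 mul0r.
 by [].
pose g1 x := if (h x)`_0 == 0 then 0 else g x - (c x)%:P * 'X^(d.+1 - e) * rh x.
have : Rdeg f d.
 exists g1; last first.
  apply: ultraS (ultraI uU (ultraI uU zg zh) (ultraI uU Uf Uh0)) => // x [[/= gx hx] [fx hx0]].
  rewrite /g1 (negbTE hx0) hornerD hornerN !hornerM gx horner_rev ?hx //.
  by rewrite !mulr0 subrr.
 have hg1 : Rp (fun x => g x + (-1)%:P * ((c x)%:P * 'X^(d.+1 - e) * rh x)) 1.
  have -> : 1 = 1 + (-1)%:P * (0%:P * 'X^(d.+1 - e) * 'X^e) :> {poly k}.
   by rewrite !mul0r mulr0 addr0.
  apply: RpD => //; apply: RpM; first exact: Rpc.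
  by apply: RpM => //; apply: RpM; [exact: RpC|exact: Rpc].
 split; last first.
  move=> x; rewrite /g1; case: eqP => [_|/eqP hx0]; first by rewrite size_poly0.
  apply/leq_sizeP => j; rewrite leq_eqVlt => /orP[/eqP<-|dj]; rewrite coefB -mulrA coefCM coefXnM.
   rewrite ltnNge leq_subr subKn // coef_poly leqnn subnn divfK // subrr //.
  rewrite (nth_default _ (leq_trans (sg x) dj)) sub0r.
  have je : (d.+1 - e <= j)%N by rewrite (leq_trans (leq_subr _ _)) // ltnW.
  rewrite ltnNge je coef_poly ifF ?mulr0 ?oppr0 //.
  by rewrite ltnS; apply/negbTE; rewrite -ltnNge ltn_subRL subnK.
 split.
  have [[D sD] _] := hg1; exists D => x; rewrite /g1; case: eqP => _; first by rewrite size_poly0.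
  by have := sD x; rewrite -[(-1)%:P]/(polyC (-1)) polyCN mulN1r.
 move=> i; apply: RX (hg1.2 i); apply: ultraS Uh0 => // x /= hx0.
 by rewrite /g1 (negbTE hx0) polyCN mulN1r.
by move=> /md; rewrite ltnn.
Qed.

Lemma maximal_place : place U (fun f a => R (f, a)).
split=> // f; have [Uf|Uf0] := ultraC uU [set x | f x != 0]; last first.
 by left; exists 0; apply: RX (RC 0); apply: ultraS Uf0 => // x /= /negP; rewrite negbK => /eqP->.
have [h|If] := dom f; first by left.
have [[b Rb]|Ig] := dom (fun x => (f x)^-1).
 have [b0|b0] := eqVneq b 0; first by right; rewrite -b0.
 left; exists b^-1; apply: Rext (Runit Rb b0) => [x|//]; by rewrite invrK.
exfalso; have [d [Rd md]] := prop_min (Rdeg_ex If); have [e [Re me]] := prop_min (Rdeg_ex Ig).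
have [ed|de] := leqP e d; first exact: (valuation_aux Uf Rd Re).
apply: (@valuation_aux (fun x => (f x)^-1) e d) => //; last exact: ltnW.
 by apply: ultraS Uf => // x /= fx; rewrite invr_eq0.
by case: Rd => g hg zg; exists g => //; apply: ultraS zg => // x /=; rewrite invrK.
Qed.

End Ext.

(** Start from the polynomials in the inverse of [h], with their value at 0 as residue. This is well
    defined since [h], not being constant modulo [U], is transcendental over the algebraically
    closed [k]. Zorn's lemma and [maximal_place] do the rest. *)
Lemma place_exists U h : ultra U -> (forall c, ~ U [set x | h x = c]) ->
 exists2 pl, place U pl & pl (fun x => (h x)^-1) 0.
move=> uU hc.
pose R0 : set ((X -> k) * k) := [set ub | exists p : {poly k},
 U [set x | ub.1 x = p.[(h x)^-1]] /\ ub.2 = p.[0]].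
have pR0 : preplace U R0.
 split.
 - move=> c; exists c%:P; rewrite hornerC; split=> //.
  by apply: ultraS (ultraT uU) => // x /=; rewrite hornerC.
 - move=> u v a b [p [ep /= ->]] [q [eq /= ->]]; exists (p + q); rewrite hornerD; split=> //.
  by apply: ultraS (ultraI uU ep eq) => // x [/= -> ->]; rewrite hornerD.
 - move=> u v a b [p [ep /= ->]] [q [eq /= ->]]; exists (p * q); rewrite hornerM; split=> //.
  by apply: ultraS (ultraI uU ep eq) => // x [/= -> ->]; rewrite hornerM.
 - move=> u a b [p [ep /= ->]] [q [eq /= ->]]; apply/eqP; rewrite -subr_eq0.
  rewrite -hornerN -hornerD; have [->|pq0] := eqVneq (p - q) 0; first by rewrite horner0.
  have [r er] := closed_field_poly_normal (p - q).
  have [|c [_ Uc]] := @ultra_bigU U k r (fun a => [set x | (h x)^-1 = a]) uU.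
   apply: ultraS (ultraI uU ep eq) => // x [/= -> e]; exists (h x)^-1; split=> //.
   apply/mem_In; rewrite -root_prod_XsubC -(rootZ _ _ (_ : lead_coef (p - q) != 0)) ?lead_coef_eq0 //.
   by rewrite -er /root hornerD hornerN e subrr.
  by case: (hc c^-1); apply: ultraS Uc => // x <-; rewrite invrK.
 - move=> u v a e [p [ep /= ->]]; exists p; split=> //.
  by apply: ultraS (ultraI uU e ep) => // x [/= <- <-].
(* [R0] is added inside the predicate so that the empty chain has an upper bound too. *)
pose P (A : set ((X -> k) * k)) := preplace U (A `|` R0).
have [F FP tF|A [PA mA]] := @Zorn_bigcup _ P.
 have [[A0 FA0]|F0] := pselect (F !=set0); last first.
  rewrite /P (_ : \bigcup_(A in F) A = set0) ?set0U //.
  by apply/seteqP; split=> // x [A FA _]; case: F0; exists A.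
 have two u v : (\bigcup_(A in F) A `|` R0) u -> (\bigcup_(A in F) A `|` R0) v ->
   exists A, [/\ F A, (A `|` R0) u & (A `|` R0) v].
  move=> [[A FA Au]|Ru] [[B FB Bv]|Rv].
  - have [AB|BA] := tF A B FA FB.
    by exists B; split=> //; left=> //; apply: AB.
   by exists A; split=> //; left=> //; apply: BA.
  - by exists A; split=> //; [left|right].
  - by exists B; split=> //; [right|left].
  - by exists A0; split=> //; right.
 have up A : F A -> A `|` R0 `<=` \bigcup_(A in F) A `|` R0.
  by move=> FA x [Ax|]; [left; exists A|right].
 split.
 - by move=> c; right; case: pR0.
 - move=> f g a b hf hg; have [A [FA Af Ag]] := two _ _ hf hg; apply: (up A FA).
  by case: (FP A FA) => _ + _ _ _; apply.
 - move=> f g a b hf hg; have [A [FA Af Ag]] := two _ _ hf hg; apply: (up A FA).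
  by case: (FP A FA) => _ _ + _ _; apply.
 - move=> f a b hf hg; have [A [FA Af Ag]] := two _ _ hf hg.
  by case: (FP A FA) => _ _ _ + _; apply; [exact: Af|].
 - move=> f g a e hf; have [A [FA Af _]] := two _ _ hf hf; apply: (up A FA).
  by case: (FP A FA) => _ _ _ _; apply; [exact: e|].
exists (fun f a => (A `|` R0) (f, a)).
 apply: maximal_place => // R' pR' AR'; apply: contrapT => nR'.
 apply: (mA R'); last by rewrite /P (_ : R' `|` R0 = R') //; apply/setUidPl; apply: subset_trans AR'.
 rewrite properEneq; split; last exact: subset_trans AR'.
 by apply/eqP => e; apply: nR'; rewrite -e.
right; exists 'X; rewrite hornerX; split=> //.
by apply: ultraS (ultraT uU) => // x /=; rewrite hornerX.
Qed.

Lemma pl_inv U pl f a : ultra U -> place U pl -> pl f a -> a != 0 ->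
 pl (fun x => (f x)^-1) a^-1 /\ U [set x | f x != 0].
move=> uU hp pf a0; have Uf : U [set x | f x != 0].
 have [//|h] := ultraC uU [set x | f x != 0].
 have : pl f 0 by apply: (plX hp) (plC hp 0); apply: ultraS h => // x /= /negP; rewrite negbK => /eqP ->.
 by move=> /(plU hp pf) e; rewrite e eqxx in a0.
split=> //; have [[c pc]|h] := plV hp (fun x => (f x)^-1).
 have := plM hp pf pc => h; have := plX hp (_ : U [set x | f x * (f x)^-1 = 1]) h.
 move=> /(_ _)/(plU hp (plC hp 1)) e; suff -> : a^-1 = c by [].
 by apply: (mulfI a0); rewrite -e ?divff //; apply: ultraS Uf => // x /= fx; rewrite divff.
have h' : pl f 0 by apply: (plX hp) h; apply: ultraS (ultraT uU) => // x /=; rewrite invrK.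
by rewrite (plU hp pf h') eqxx in a0.
Qed.

End Ultra.

(** [U] plays the generic point of [Z]: it extends the filter of nonempty basic open subsets, which
    is proper by irreducibility. *)
Lemma ultra_irr {k : closedFieldType} {V} {cV : crd k V} (Z : set V) : irr Z ->
 exists2 U : set (set V), ultra U &
  U Z /\ forall g, pol g -> (exists2 z, Z z & g z != 0) -> U [set z | g z != 0].
move=> iZ.
pose F : set (set V) := [set A | exists g, [/\ pol (cV := cV) g, exists2 z, Z z & g z != 0 &
 forall z, Z z -> g z != 0 -> A z]].
have FT : F setT.
 by exists (fun=> 1); split=> //; [exact: polC|case: iZ => -[z Zz] _; exists z; rewrite ?oner_eq0].
have pF : filter.ProperFilter F.
 apply: filter.Build_ProperFilter_ex.
  move=> A [g [_ [z Zz gz] h]]; exists z; exact: h.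
 split=> //.
  move=> A B [f [pf [z1 Z1 f1] hf]] [g [pg [z2 Z2 g2] hg]]; exists (fun z => f z * g z).
  split; first exact: polM.
   apply: contrapT => nz; have [z Zz|h|h] := iZ.2 f g pf pg.
   - by apply: contrapT => /eqP ?; apply: nz; exists z.
   - by rewrite h ?eqxx in f1.
   - by rewrite h ?eqxx in g2.
  by move=> z Zz; rewrite mulf_eq0 => /norP[? ?]; split; [exact: hf|exact: hg].
 by move=> A B AB [g [pg nz h]]; exists g; split=> // z Zz gz; apply: AB; apply: h.
have [U [uU FU]] := filter.ultraFilterLemma pF.
exists U.
 split.
 - exact: filter.filterI.
 - by move=> A B AB UA; apply: filter.filterS UA.
 - exact: filter.filter_not_empty.
 - by move=> A; apply: filter.in_ultra_setVsetC.
split; first by apply: FU; exists (fun=> 1); split=> //;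
 [exact: polC|case: iZ => -[z Zz] _; exists z; rewrite ?oner_eq0].
by move=> g pg nz; apply: FU; exists g.
Qed.

(** * The Iwasawa decomposition and Borel's fixed point theorem *)

Notation trig := is_trig_mx.

Section Trig.
Context {k : fieldType} {n : nat}.
Implicit Types (s t : 'M[k]_n).

Lemma trigP t : reflect (forall i j : 'I_n, (i < j)%N -> t i j = 0) (trig t).
exact: is_trig_mxP. Qed.

Lemma trigM s t : trig s -> trig t -> trig (s *m t).
move=> /trigP hs /trigP ht; apply/trigP => i j ij; rewrite mxE big1 // => l _.
have [il|li] := ltnP i l; first by rewrite hs ?mul0r.
by rewrite ht ?mulr0 // (leq_ltn_trans li).
Qed.

Lemma trig1 : trig (1%:M : 'M[k]_n).
by []. Qed.

Lemma trigM_diag s t i : trig s -> trig t -> (s *m t) i i = s i i * t i i.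
move=> /trigP hs /trigP ht; rewrite mxE (bigD1 i) //= big1 ?addr0 // => l li.
have [il|il] := ltnP i l; first by rewrite hs ?mul0r.
by rewrite ht ?mulr0 // ltn_neqAle li.
Qed.

Lemma trig_unit t : trig t -> (t \in unitmx) = [forall i, t i i != 0].
move=> tt; rewrite unitmxE unitfE det_trig //; apply/prodf_neq0/forallP => [h i|h i _]; exact: h.
Qed.

Lemma trigV t : trig t -> t \in unitmx -> trig (invmx t).
move=> tt ut; have /trigP ht := tt.
suff h a (i j : 'I_n) : val i = a -> (i < j)%N -> invmx t i j = 0.
 by apply/trigP => i j; apply: h.
elim/ltn_ind: a i => a IH i ia ij.
apply: (mulfI ((forallP (etrans (esym (trig_unit tt)) ut)) i)); rewrite mulr0.
have /matrixP/(_ i j) := mulmxV ut; rewrite !mxE -val_eqE (ltn_eqF ij) => e.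
rewrite -[RHS]e [RHS](bigD1 i) //= big1 ?addr0 // => l li.
have [il|il] := ltnP i l; first by rewrite ht ?mul0r.
by rewrite (IH (val l)) ?mulr0 // -?ia; [rewrite ltn_neqAle il andbT|rewrite (leq_ltn_trans il ij)].
Qed.

End Trig.

Section Iwasawa.
Context {k : closedFieldType} {X : Type} {n : nat}.
Variables (U : set (set X)) (uU : ultra U) (pl : (X -> k) -> k -> Prop) (hp : place U pl).

Lemma pl_ext f g a b : (forall x, f x = g x) -> a = b -> pl f a -> pl g b.
by move=> /funext-> ->. Qed.

Lemma pl_sum (I : Type) (r : seq I) (F : I -> X -> k) (a : I -> k) :
 (forall i, pl (F i) (a i)) -> pl (fun x => \sum_(i <- r) F i x) (\sum_(i <- r) a i).
move=> h; elim: r => [|i r IH].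
 by apply: pl_ext (plC hp 0) => [x|]; rewrite big_nil.
by apply: pl_ext (plD hp (h i) IH) => [x|]; rewrite big_cons.
Qed.

Lemma pl_prod (I : Type) (r : seq I) (F : I -> X -> k) (a : I -> k) :
 (forall i, pl (F i) (a i)) -> pl (fun x => \prod_(i <- r) F i x) (\prod_(i <- r) a i).
move=> h; elim: r => [|i r IH].
 by apply: pl_ext (plC hp 1) => [x|]; rewrite big_nil.
by apply: pl_ext (plM hp (h i) IH) => [x|]; rewrite big_cons.
Qed.

(** An entry of least valuation, to be used as pivot. *)
Lemma pl_best (I : Type) (s : seq I) (f : I -> X -> k) i1 : U [set x | f i1 x != 0] ->
 exists i0, U [set x | f i0 x != 0] /\
  forall i, List.In i s -> exists a, pl (fun x => f i x / f i0 x) a.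
move=> h1; elim: s => [|i s [i0 [h0 hs]]]; first by exists i1.
have [d|nd] := pselect (exists a, pl (fun x => f i x / f i0 x) a).
 by exists i0; split=> // j [<-|/hs].
have [//|pv] := plV hp (fun x => f i x / f i0 x).
have Ui : U [set x | f i x != 0].
 have [//|n0] := ultraC uU [set x | f i x != 0]; case: nd; exists 0.
 apply: (plX hp) (plC hp 0); apply: ultraS n0 => // x /= /negP; rewrite negbK => /eqP->.
 by rewrite mul0r.
exists i; split=> // j [<-|/hs[a ha]].
 by exists 1; apply: (plX hp) (plC hp 1); apply: ultraS Ui => // x /= fx; rewrite divff.
exists (a * 0); apply: (plX hp) (plM hp ha pv); apply: ultraS (ultraI uU h0 Ui) => // x [/= x0 xi].
by rewrite invf_div mulrA divfK.
Qed.

Definition plmx m p (u : X -> 'M[k]_(m, p)) (a : 'M[k]_(m, p)) :=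
 forall i j, pl (fun x => u x i j) (a i j).

Lemma plmxC m p (A : 'M[k]_(m, p)) : plmx (fun=> A) A.
by move=> i j; apply: (plC hp). Qed.

Lemma plmxM m p q (u : X -> 'M[k]_(m, p)) (v : X -> 'M[k]_(p, q)) a b :
 plmx u a -> plmx v b -> plmx (fun x => u x *m v x) (a *m b).
move=> hu hv i j; apply: pl_ext (pl_sum (index_enum 'I_p)
 _) => [x||l]; [by rewrite mxE|by rewrite mxE|exact: (plM hp)].
Qed.

Lemma pl_pol (f : 'M[k]_n -> k) u a : pol f -> plmx u a -> a \in unitmx ->
 pl (fun x => f (u x)) (f a).
move=> pf hu ua; elim/mxpol_ind: f / pf => //.
- exact: (plC hp).
- apply: (pl_inv uU hp _ _).1; last by rewrite -unitfE -unitmxE.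
 apply: pl_sum => s; apply: (plM hp); first exact: (plC hp).
 exact: pl_prod => i.
- by move=> f g hf hg; apply: (plD hp).
- by move=> f g hf hg; apply: (plM hp).
Qed.

Lemma pl_closed (Y : set 'M[k]_n) u a : zclosed Y -> plmx u a -> a \in unitmx ->
 U [set x | Y (u x)] -> Y a.
move=> cY hu ua UY; apply: cY => f pf fY; apply: (plU hp (pl_pol pf hu ua)).
by apply: (plX hp) (plC hp 0); apply: ultraS UY => // x /= /fY ->.
Qed.

(** [GL_n] of the field is [GL_n] of the valuation ring times the triangular group. This is the
    valuative form of completeness of the flag variety: the family of flags given by [A] acquires a
    limit, the flag of [a]. *)
Lemma iwasawa (A : X -> 'M[k]_n) : U [set x | A x \in unitmx] ->
 exists b, [/\ forall x, trig (b x), U [set x | b x \in unitmx] &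
  exists2 a, a \in unitmx & plmx (fun x => A x *m b x) a].
move=> UA.
(* Columns are treated from the last to the first. In a finished column [j] all entries are finite,
   row [p j] carries a pivot of residue 1, and that row is zero to the left of [j]. *)
have step m : (m <= n)%N -> exists b p,
  [/\ forall x, trig (b x), U [set x | b x \in unitmx] &
   forall j : 'I_n, (n - m <= j)%N -> [/\ forall i, exists a, pl (fun x => (A x *m b x) i j) a,
    pl (fun x => (A x *m b x) (p j) j) 1 &
    forall l : 'I_n, (l < j)%N -> U [set x | (A x *m b x) (p j) l = 0]]].
 elim: m => [_|m IH mn].
  exists (fun=> 1%:M), id; split=> [x||j]; first exact: trig1.
   by apply: ultraS (ultraT uU) => // x _; rewrite unitmx1.
  by rewrite subn0 leqNgt ltn_ord.
 have [b [p [tb Ub hb]]] := IH (ltnW mn).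
 have jn : (n - m.+1 < n)%N by rewrite ltn_subrL (leq_ltn_trans _ mn).
 pose j0 := Ordinal jn; pose u x := A x *m b x.
 have Uu : U [set x | u x \in unitmx].
  by apply: ultraS (ultraI uU UA Ub) => // x [/= ? ?]; rewrite unitmx_mul; apply/andP.
 have [|i1 [_ hi1]] := @ultra_bigU X U 'I_n (enum 'I_n) (fun i => [set x | u x i j0 != 0]) uU.
  apply: ultraS Uu => // x ux; apply: contrapT => nz.
  have : invmx (u x) *m col j0 (u x) = 0.
   rewrite (_ : col j0 (u x) = 0) ?mulmx0 //; apply/colP => i; rewrite [LHS]mxE [RHS]mxE.
   by apply: contrapT => /eqP h; apply: nz; exists i; split=> //; apply/mem_In; rewrite mem_enum.
  rewrite colE mulmxA mulVmx // mul1mx => /colP/(_ j0); rewrite !mxE !eqxx => /eqP.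
  by rewrite oner_eq0.
 have [i0 [hi0 best]] := pl_best (enum 'I_n) (f := fun i x => u x i j0) hi1.
 (* [G] differs from the identity in row [j0] only: it scales column [j0] by the inverse pivot and
    clears the pivot row in the columns to its left. *)
 pose g x (l : 'I_n) := if (l < j0)%N then - u x i0 l / u x i0 j0
             else if l == j0 then (u x i0 j0)^-1 - 1 else 0.
 pose G x : 'M[k]_n := if u x i0 j0 == 0 then 1%:M else
  \matrix_(a, c) ((a == c)%:R + (a == j0)%:R * g x c).
 have uG x i l : u x i0 j0 != 0 -> (u x *m G x) i l = u x i l + u x i j0 * g x l.
  move=> nz; rewrite mxE /G (negbTE nz).
  under eq_bigr do rewrite [X in _ * X]mxE mulrDr mulrA.
  rewrite big_split -mulr_suml; congr (_ + _ * _).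
   rewrite (bigD1 l) //= eqxx mulr1 big1 ?addr0 // => a /negbTE ->; by rewrite mulr0.
  rewrite (bigD1 j0) //= eqxx mulr1 big1 ?addr0 // => a /negbTE ->; by rewrite mulr0.
 have tG x : trig (G x).
  rewrite /G; case: ifP => _; first exact: trig1.
  apply/trigP => a c ac; rewrite mxE -val_eqE (ltn_eqF ac) add0r.
  case: eqP => [aj|_]; last by rewrite mul0r.
  by rewrite /g -aj ltnNge (ltnW ac) -val_eqE gtn_eqF // mulr0.
 have UG : U [set x | G x \in unitmx].
  apply: ultraS hi0 => // x /= nz; rewrite trig_unit //; apply/forallP => a.
  rewrite /G (negbTE nz) mxE eqxx; have [->|_] := eqVneq a j0; last by rewrite mul0r addr0 oner_eq0.
  by rewrite /g ltnn eqxx mul1r addrC subrK invr_eq0.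
 exists (fun x => b x *m G x), (fun j => if j == j0 then i0 else p j); split.
 - by move=> x; apply: trigM.
 - by apply: ultraS (ultraI uU Ub UG) => // x [/= ? ?]; rewrite unitmx_mul; apply/andP.
 have eqU i l : U [set x | u x i l + u x i j0 * g x l = (A x *m (b x *m G x)) i l].
  by apply: ultraS hi0 => // x /= nz; rewrite mulmxA -uG.
 move=> j; rewrite leq_eqVlt => /orP[/eqP jj|jj].
  have -> : j = j0 by apply/val_inj.
  rewrite eqxx; split.
  - move=> i; have [a ha] := best i ((mem_In _ _).1 (mem_enum _ _)); exists a.
   apply: (plX hp) ha; apply: ultraS (ultraI uU hi0 (eqU i j0)) => // x [/= nz <-].
   by rewrite /g ltnn eqxx mulrBr mulr1 addrC subrK.
  - apply: (plX hp) (plC hp 1); apply: ultraS (ultraI uU hi0 (eqU i0 j0)) => // x [/= nz <-].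
   by rewrite /g ltnn eqxx mulrBr mulr1 addrC subrK divff.
  - move=> l lj; apply: ultraS (ultraI uU hi0 (eqU i0 l)) => // x [/= nz <-].
   by rewrite /g lj mulNr mulrN mulrC divfK // subrr.
 have jm : (n - m <= j)%N by rewrite -subnSK.
 have [h1 h2 h3] := hb j jm.
 have jj0 : (j == j0) = false by rewrite -val_eqE gtn_eqF.
 have gj x : g x j = 0 by rewrite /g jj0 ltnNge ltnW.
 have eqj i : U [set x | (A x *m b x) i j = (A x *m (b x *m G x)) i j].
  by apply: ultraS (eqU i j) => // x /= <-; rewrite gj mulr0 addr0.
 rewrite jj0; split.
 - by move=> i; have [a ha] := h1 i; exists a; apply: (plX hp) ha.
 - exact: (plX hp) h2.
 - move=> l lj; apply: ultraS (ultraI uU (eqU (p j) l) (ultraI uU (h3 l lj) (h3 j0 jj))) => // x.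
  by move=> [/= <- [/= e1 e2]]; rewrite e2 mul0r addr0.
have [b [p [tb Ub hb]]] := step n (leqnn n); exists b; split=> //.
have /choice[a ha] : forall ij : 'I_n * 'I_n, exists a, pl (fun x => (A x *m b x) ij.1 ij.2) a.
 by move=> [i j]; have [|h _ _] := hb j; [rewrite subnn|exact: h].
pose abar := \matrix_(i, j) a (i, j).
have habar : plmx (fun x => A x *m b x) abar.
 by move=> i j; apply: pl_ext (ha (i, j)) => // ; rewrite mxE.
(* The pivots make the residue matrix unitriangular up to the choice of rows [p j], so a vector in
   the kernel vanishes from its last coordinate down. *)
exists abar => //; rewrite -unitmx_tr -row_free_unit -kermx_eq0; apply: contraT => /rowV0Pn[v].
move=> /sub_kermxP v0 nv; suff vz m (j : 'I_n) : (n - m <= j)%N -> v 0 j = 0.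
 by case/negP: nv; apply/eqP/rowP => j; rewrite mxE (vz n) // subnn.
elim: m j => [|m IH] j; first by rewrite subn0 leqNgt ltn_ord.
rewrite leq_eqVlt => /orP[/eqP jj|jj]; last first.
 apply: IH; have [mn|nm] := ltnP m n; first by rewrite -subnSK.
 by rewrite (eqP (_ : n - m == 0)%N).
have [|_ h2 h3] := hb j; first by rewrite subnn.
have /rowP/(_ (p j)) := v0; rewrite !mxE (bigD1 j) //= big1 => [|l lj].
 have -> : abar^T j (p j) = 1 by rewrite mxE; apply: (plU hp (habar _ _) h2).
 by rewrite mulr1 addr0.
have [lt|le] := ltnP l j.
 rewrite mxE (_ : abar (p j) l = 0) ?mulr0 //; apply: (plU hp (habar _ _)).
 by apply: (plX hp) (plC hp 0); apply: ultraS (h3 l lt) => // x ->.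
have lt : (j < l)%N by rewrite ltn_neqAle eq_sym lj.
rewrite IH ?mul0r //; have [mn|nm] := ltnP m n; first by rewrite -(subnSK mn) jj.
by rewrite (eqP (_ : n - m == 0)%N).
Qed.

End Iwasawa.

Section FixedPoint.
Context {k : closedFieldType} {n' : nat}.
Local Notation n := n'.+1.
Local Notation M := 'M[k]_n.

(** [Y] modulo triangular matrices stands for a closed set of flags. All points of a minimal [Y0]
    are shown to define the same flag: [P i] is the space of row vectors [v] such that [v *m y] is
    supported in the first [i] coordinates for every [y] in [Y0], and [Inv] says that a single [y]
    decides membership. *)
Lemma borel_fixed_pointS (C Y : set M) : subgroup C -> irr C -> solvable_group C ->
 zclosed Y -> Y !=set0 -> Y `<=` @gl k n ->
 (forall c y, C c -> Y y -> Y (c *m y)) ->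
 (forall y t, Y y -> trig t -> t \in unitmx -> Y (y *m t)) ->
 exists2 y, Y y & forall c, C c -> trig (invmx y *m c *m y).
move=> sC iC /(solvP sC)[d hd] cY nY YG CY YT.
have [|Z []//|Y0 [cY0 [y0 Yy0] Y0Y CY0 YT0] mY] := @closed_min _ _ (mx_crd k n) [set Z |
 [/\ zclosed Z, Z !=set0, Z `<=` Y, forall c y, C c -> Z y -> Z (c *m y) &
  forall y t, Z y -> trig t -> t \in unitmx -> Z (y *m t)]]; first by exists Y; split.
have gY y : Y0 y -> y \in unitmx by move=> /Y0Y/YG.
pose P i (v : 'rV[k]_n) := forall y (l : 'I_n), Y0 y -> (i <= l)%N -> (v *m y) 0 l = 0.
have PL i : forall a u v, P i u -> P i v -> P i (a *: u + v).
 by move=> a u v hu hv y l Yy il; rewrite mulmxDl -scalemxAl mxE mxE hu // hv // mulr0 addr0.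
have PC i c v : C c -> P i v -> P i (v *m c).
 by move=> Cc hv y l Yy il; rewrite -mulmxA hv //; apply: CY0.
have /choice[A AP] : forall i, exists U : M, forall v : 'rV_n, (v <= U)%MS <-> P i v.
 by move=> i; apply: subspace_mx => [y l _ _|]; [rewrite mul0mx mxE|exact: PL].
have trigE i (il : (i < n)%N) v y t : P i.+1 v -> Y0 y -> trig t ->
  (v *m (y *m t)) 0 (Ordinal il) = (v *m y) 0 (Ordinal il) * t (Ordinal il) (Ordinal il).
 move=> Pv Yy /trigP tt; rewrite mulmxA mxE (bigD1 (Ordinal il)) //= big1 ?addr0 // => l li.
 have [lt|le] := ltnP l i; first by rewrite tt ?mulr0.
 by rewrite Pv ?mul0r // ltn_neqAle le andbT eq_sym.
suff Inv m y v : Y0 y -> (forall l : 'I_n, (n - m <= l)%N -> (v *m y) 0 l = 0) -> P (n - m)%N v.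
 exists y0; first exact: Y0Y.
 move=> c Cc; apply/trigP => i j ij.
 have Pi : P i.+1 (row i (invmx y0)).
  rewrite -(subKn (ltn_ord i)); apply: (Inv _ y0) => // l; rewrite subKn // => il.
  by rewrite -row_mul mulVmx ?gY // !mxE -val_eqE ltn_eqF.
 by have := Pi (c *m y0) j (CY0 _ _ Cc Yy0) ij; rewrite -row_mul mxE mulmxA.
elim: m y v => [|m IH] y v Yy hv.
 by move=> z l _; rewrite leqNgt ltn_ord.
have [mn|nm] := ltnP m n; last first.
 have z a (h : (n <= a)%N) : (n - a = 0)%N by apply/eqP.
 have e : (n - m.+1 = n - m)%N by rewrite (z m nm) (z m.+1 (leqW nm)).
 by rewrite e in hv *; apply: (IH y).
set i := (n - m.+1)%N; have ei : (n - m = i.+1)%N by rewrite subnSK.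
have il : (i < n)%N by rewrite ltn_subrL.
rewrite ei in IH; pose i0 := Ordinal il.
have PS v' : P i.+1 v' -> (forall y, Y0 y -> (v' *m y) 0 i0 = 0) -> P i v'.
 move=> h1 h2 z l Yz; rewrite leq_eqVlt => /orP[/eqP e|?]; last exact: h1.
 by rewrite (_ : l = i0) ?h2 //; apply/val_inj.
have [||||v1 [v1W v1W' v1e]] := lie_kolchin_sub sC iC hd (W' := A i) (W := A i.+1).
- by move=> c Cc; apply/row_subP => j; rewrite row_mul; apply/AP; apply: PC => //; apply/AP; apply: row_sub.
- by move=> c Cc; apply/row_subP => j; rewrite row_mul; apply/AP; apply: PC => //; apply/AP; apply: row_sub.
- apply/row_subP => j; apply/AP => z l Yz il'; have /AP h := row_sub j (A i).
 by apply: h => //; apply: ltnW.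
- apply/negP => AA; have : P i.+1 (row i0 (invmx y0)).
  apply: (IH y0) => // l il'; rewrite -row_mul mulVmx ?gY // !mxE -val_eqE ltn_eqF //.
 move=> /AP/submx_trans/(_ AA)/AP/(_ y0 i0 Yy0 (leqnn _)) /eqP.
 by rewrite -row_mul mulVmx ?gY // !mxE eqxx oner_eq0.
have {}v1W : P i.+1 v1 by apply/AP.
(* The zero set on [Y0] of coordinate [i0] of [u *m y] is closed and stable on both sides; being
   nonempty, it is all of [Y0] by minimality. *)
have minS u z : P i.+1 u -> Y0 z -> (u *m z) 0 i0 = 0 ->
  (forall c y, C c -> Y0 y -> (u *m y) 0 i0 = 0 -> (u *m (c *m y)) 0 i0 = 0) -> P i u.
 move=> Pu Yz uz uC; apply: PS => // y' Yy'.
 suff : [set y | Y0 y /\ (u *m y) 0 i0 = 0] y' by case.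
 apply: mY Yy' => [|? []//]; split.
 - apply: closedI => //; apply: closed_zero; apply: polmxM; [exact: polmxC|exact: polmx_id].
 - by exists z.
 - by move=> ? [/Y0Y].
 - by move=> c w Cc [Yw uw]; split; [exact: CY0|exact: uC].
 - by move=> w t [Yw uw] tt ut; split; [exact: YT0|rewrite trigE // uw mul0r].
have v1nz z : Y0 z -> (v1 *m z) 0 i0 != 0.
 move=> Yz; apply: contraNneq v1W' => vz; apply/AP; apply: (minS v1 z) => // c y' Cc Yy' vy'.
 have [a ha] := v1e c Cc; rewrite mulmxA -(subrK (a *: v1) (v1 *m c)) mulmxDl -scalemxAl mxE [X in _ + X]mxE.
 by rewrite vy' mulr0 addr0; have /AP := ha; apply.
(* A nonconstant quotient would have a pole at some place of [C]. At the limit point [a], which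
   [iwasawa] provides and closedness puts in [Y0], the denominator is nonzero by [v1nz], so the
   quotient is finite there. *)
have ratio psi z : P i.+1 psi -> Y0 z -> exists a, forall c, C c ->
  (psi *m (c *m z)) 0 i0 = a * (v1 *m (c *m z)) 0 i0.
 move=> Ppsi Yz; have [U uU [UC Upol]] := ultra_irr iC.
 have pf u : pol (fun c => (u *m (c *m z)) 0 i0).
  apply: polmxM; first exact: polmxC.
  by apply: polmxM; [exact: polmx_id|exact: polmxC].
 pose h c := (psi *m (c *m z)) 0 i0 / (v1 *m (c *m z)) 0 i0.
 have [[a ha]|nc] := pselect (exists a, U [set c | h c = a]).
  exists a => c Cc; apply/eqP; rewrite -subr_eq0; apply: contraT => nz.
  have pd : pol (fun c => (psi *m (c *m z)) 0 i0 - a * (v1 *m (c *m z)) 0 i0).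
   by apply: polB => //; apply: polM => //; apply: polC.
  have Un := Upol _ pd (ex_intro2 _ _ c Cc nz).
  have [c' [[/= e1 e2] Cc']] := ultra_ex uU (ultraI uU (ultraI uU ha Un) UC).
  by move: e2; rewrite -e1 divfK ?subrr ?eqxx //; apply: v1nz; apply: CY0.
 have [|pl hp ph] := place_exists (h := h) uU; first by move=> c Uc; apply: nc; exists c.
 have [|b [tb Ub [a ua ha]]] := iwasawa uU hp (A := fun c => c *m z).
  by apply: ultraS UC => // c Cc; apply: gY; apply: CY0.
 have Ya : Y0 a.
  apply: (pl_closed uU hp cY0 ha ua); apply: ultraS (ultraI uU UC Ub) => // c [/= Cc bc].
  by apply: YT0 => //; apply: CY0.
 have hu (u : 'rV[k]_n) := plmxM hp (plmxC hp u) ha 0 i0.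
 have [hv1 _] := pl_inv uU hp (hu v1) (v1nz _ Ya).
 have hh : pl h ((psi *m a) 0 i0 * ((v1 *m a) 0 i0)^-1).
  apply: (plX hp) (plM hp (hu psi) hv1); apply: ultraS (ultraI uU UC Ub) => // c [/= Cc bc].
  have Ycz := CY0 _ _ Cc Yz.
  rewrite (trigE _ il psi (c *m z) _ Ppsi Ycz (tb c)) (trigE _ il v1 (c *m z) _ v1W Ycz (tb c)).
  have bi : b c i0 i0 != 0 by move: bc; rewrite trig_unit // => /forallP.
  by rewrite invfM mulrACA divff // mulr1.
 have : pl (fun=> 1) 0.
  rewrite -(mulr0 ((psi *m a) 0 i0 * ((v1 *m a) 0 i0)^-1)); apply: (plX hp) (plM hp hh ph).
  have [h0|] := ultraC uU [set c | h c = 0]; first by case: nc; exists 0.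
  by apply: ultraS => // c /= /eqP hc; rewrite divff.
 by move=> /(plU hp (plC hp 1)) /eqP; rewrite oner_eq0.
have Pv : P i.+1 v by apply: (IH y) => // l lt; apply: hv; apply: ltnW.
have [a ha] := ratio v y Pv Yy.
have sE w : ((v - a *: v1) *m w) 0 i0 = (v *m w) 0 i0 - a * (v1 *m w) 0 i0.
 by rewrite mulmxBl -scalemxAl; rewrite !mxE.
have Pva : P i (v - a *: v1).
 have Pd : P i.+1 (v - a *: v1) by rewrite addrC -scaleNr; apply: PL.
 apply: (minS _ y) => //.
  by rewrite sE; have := ha _ (sg1 sC); rewrite !mul1mx => ->; rewrite subrr.
 move=> c w Cc Yw; have [b hb] := ratio v w Pv Yw; rewrite !sE hb //.
 have := hb _ (sg1 sC); rewrite !mul1mx => -> /eqP; rewrite subr_eq0 => /eqP/(mulIf (v1nz _ Yw)) ->.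
 by rewrite subrr.
have a0 : a = 0.
 have := ha _ (sg1 sC); rewrite !mul1mx hv // => /esym/eqP; rewrite mulf_eq0 (negbTE (v1nz _ Yy)) orbF.
 by move/eqP.
by rewrite a0 scale0r subr0 in Pva.
Qed.

End FixedPoint.

Lemma borel_fixed_point {k : closedFieldType} {n} (C Y : set 'M[k]_n) :
 subgroup C -> irr C -> solvable_group C ->
 zclosed Y -> Y !=set0 -> Y `<=` @gl k n ->
 (forall c y, C c -> Y y -> Y (c *m y)) ->
 (forall y t, Y y -> trig t -> t \in unitmx -> Y (y *m t)) ->
 exists2 y, Y y & forall c, C c -> trig (invmx y *m c *m y).
case: n C Y => [|n] C Y; last exact: borel_fixed_pointS.
by move=> _ _ _ _ [y Yy] _; exists y => // c _; apply/trigP => -[].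
Qed.

(** * Semisimple matrices and the Jordan decomposition *)

(** Chinese remainders: evaluated at a triangular matrix with diagonal entries [rs], such a
    polynomial gives its semisimple part. *)
Lemma crt_poly (k : fieldType) (N : nat) (rs : seq k) : uniq rs ->
 exists p : {poly k}, forall a, a \in rs -> ('X - a%:P) ^+ N %| p - a%:P.
elim: rs => [|b rs IH]; first by exists 0.
move=> /andP[nb /IH[p hp]]; pose q := \prod_(a <- rs) ('X - a%:P) ^+ N.
have cq : coprimep q (('X - b%:P) ^+ N).
 apply: coprimep_expr; rewrite coprimep_XsubC /root horner_prod; rewrite prodf_seq_neq0.
 apply/allP => a ars; rewrite !hornerE expf_eq0 negb_and subr_eq0 eq_sym.
 by apply/orP; right; apply: contraNneq nb => <-.
have [[u v] e] := Bezout_eq1_coprimepP _ _ cq.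
exists (p + u * q * (b%:P - p)) => a; rewrite inE => /orP[/eqP->|ars].
 have -> : p + u * q * (b%:P - p) - b%:P = v * ('X - b%:P) ^+ N * (p - b%:P).
  have -> : v * ('X - b%:P) ^+ N = 1 - u * q by rewrite -e addrAC subrr add0r.
  by ring.
 by rewrite mulrAC dvdp_mull.
rewrite addrAC dvdp_add ?hp //; apply: dvdp_mulr; apply: dvdp_mull.
by rewrite /q (big_rem a) //= dvdp_mulr.
Qed.

Section SstBasic.
Context {k : closedFieldType} {n : nat}.
Local Notation M := 'M[k]_n.
Implicit Types (s g : M).

Definition sst s := exists2 P, P \in unitmx & is_diag_mx (mxconj P s).

Lemma sst_conj g s : g \in unitmx -> sst s -> sst (mxconj g s).
move=> ug [P uP d]; exists (P *m invmx g); first by rewrite unitmx_mul uP unitmx_inv.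
by rewrite mxconjMl ?unitmx_inv // mxconjK.
Qed.

Lemma diagonalizableE s : sst s <-> diagonalizable s.
by split=> -[P uP h]; exists P => //; move: h; rewrite /similar_to conjumx.
Qed.

(** The family may be infinite: a finite subfamily spanning it is diagonalized, and its linear
    combinations follow. *)
Lemma sst_set (S : set M) : (forall x y, S x -> S y -> x *m y = y *m x) ->
 (forall x, S x -> sst x) -> diagonalizable_group S.
move=> com dS.
have [r [rS rmax]] : exists r : seq M, (forall x, x \in r -> S x) /\
  forall x, S x -> exists c : nat -> k, x = \sum_(i < size r) c i *: r`_i.
 suff H m : exists r : seq M, (forall x, x \in r -> S x) /\
   ((forall x, S x -> exists c : nat -> k, x = \sum_(i < size r) c i *: r`_i) \/
    exists2 U : 'A[k]_n, (forall v, (v <= U)%MS -> exists c : nat -> k,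
     vec_mx v = \sum_(i < size r) c i *: r`_i) & (m <= \rank U)%N).
  have [r [rS [h|[U _ h]]]] := H (n ^ 2).+1; first by exists r.
  by have := leq_trans h (rank_leq_col U); rewrite ltnn.
 elim: m => [|m [r [rS [h|[U hU hm]]]]].
 - exists [::]; split=> //; right; exists 0 => // v; rewrite submx0 => /eqP ->.
  by exists (fun=> 0); rewrite big_ord0 linear0.
 - by exists r; split=> //; left.
 have [h|/existsNP[x /not_implyP[Sx nx]]] :=
  pselect (forall x, S x -> exists c : nat -> k, x = \sum_(i < size r) c i *: r`_i).
  by exists r; split=> //; left.
 exists (x :: r); split=> [y|]; first by rewrite inE => /orP[/eqP->|/rS].
 right; exists (U + <<mxvec x>>)%MS => [v /sub_addsmxP[[v1 v2] ->]|].
  have [c hc] := hU (v1 *m U) (submxMl _ _).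
  have /sub_rVP[a ha] : (v2 *m <<mxvec x>>%MS <= mxvec x)%MS.
   by rewrite (submx_trans (submxMl _ _)) // genmxE.
  exists (fun i => if i is i'.+1 then c i' else a).
  by rewrite linearD /= hc ha linearZ /= mxvecK big_ord_recl addrC.
 apply: leq_ltn_trans hm _; rewrite (ltn_leqif (mxrank_leqif_sup (addsmxSl _ _))).
 rewrite addsmx_sub submx_refl genmxE; apply/negP => /hU[c]; rewrite mxvecK => e.
 by apply: nx; exists c.
have [|P uP hP] := (codiagonalizableP r).1.
 split=> [x y /rS Sx /rS Sy|x /rS/dS/diagonalizableE //]; exact: com.
exists P => // t St; have [c ->] := rmax t St.
rewrite /mxconj mulmx_sumr mulmx_suml; apply/is_diag_mxP => a b ab.
rewrite summxE big1 // => i _; rewrite -scalemxAr -scalemxAl mxE.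
have /allP/(_ _ (mem_nth 0 (ltn_ord i))) := hP.
by rewrite /similar_to /= conjumx // => /is_diag_mxP ->; rewrite ?mulr0.
Qed.

Lemma diag_group_sst (S : set M) x : diagonalizable_group S -> S x -> sst x.
by move=> [P uP h] Sx; exists P => //; apply: h. Qed.

Lemma diag_group_comm (S : set M) x y : diagonalizable_group S -> S x -> S y -> x *m y = y *m x.
move=> [P uP h] /h dx /h dy.
have /is_diag_mxP hx := dx; have /is_diag_mxP hy := dy.
apply: (can_inj (fun z => mxconjK z uP)); rewrite !mxconjM //.
apply/matrixP => a b; rewrite !mxE (bigD1 a) //= [RHS](bigD1 b) //=.
rewrite !big1 => [|l lb|l la]; last 2 first.
- by rewrite [X in _ * X]hx ?mulr0.
- by rewrite hx ?mul0r //; apply: contraNneq la => /val_inj ->.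
have [->|ab] := eqVneq a b; first by rewrite mulrC.
by rewrite hy ?mulr0 ?mul0r.
Qed.

Lemma diag_group_cj (S : set M) g : g \in unitmx -> diagonalizable_group S ->
 diagonalizable_group (cj g S).
move=> ug [P uP h]; exists (P *m invmx g); first by rewrite unitmx_mul uP unitmx_inv.
by move=> _ [t St <-]; rewrite mxconjMl ?unitmx_inv // mxconjK //; apply: h.
Qed.

Lemma closed_diag (P : M) : zclosed [set x | is_diag_mx (mxconj P x)].
have -> : [set x | is_diag_mx (mxconj P x)] = [set x | forall ab : 'I_n * 'I_n,
  ab.1 != ab.2 -> mxconj P x ab.1 ab.2 = 0].
 by apply/seteqP; split=> [x /is_diag_mxP h [a b]|x h]; [exact: h|apply/is_diag_mxP => a b; apply: (h (a, b))].
apply: (closed_cap).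
move=> [a b].
case: eqP => [e|ne]; first by move=> x _.
have : zclosed [set x | mxconj P x a b = 0].
 apply: closed_zero; apply: polmxM; last exact: polmxC.
 by apply: polmxM; [exact: polmxC|exact: polmx_id].
by move=> h x hx _; apply: h; apply: cl_mono hx => y; apply.
Qed.

End SstBasic.

(** * Semisimple parts stay in closed groups *)

Section JordanClosed.
Context {k : closedFieldType} {n : nat}.
Local Notation M := 'M[k]_n.
Variables (s u : M).
Hypotheses (ss : sst s) (su : s *m u = u *m s) (us : s \in unitmx) (uu : u \in unitmx).
Hypotheses (nu : exists m, iter m (mulmx (u - 1%:M)) 1%:M = 0) (du : \det u = 1).
Implicit Types (f h : M -> k).

Definition udiff f : M -> k := fun x => f (u *m x) - f x.

Lemma udiffD m f h : iter m udiff (fun x => f x + h x) = (fun x => iter m udiff f x + iter m udiff h x).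
by elim: m => //= m ->; apply/funext => x; rewrite /udiff; ring. Qed.

Lemma udiff0 m : iter m udiff (fun=> 0) = (fun=> 0).
by elim: m => //= m ->; rewrite /udiff subrr. Qed.

Lemma udiff_eq0 m f d : iter m udiff f = (fun=> 0) -> iter (d + m) udiff f = (fun=> 0).
by rewrite iterD => ->; apply: udiff0. Qed.

(** Twisted Leibniz rule: [udiff (f * h)] is [udiff f * h + udiff f * udiff h + f * udiff h], so
    orders of nilpotency add. *)
Lemma udiffM m a b f h : (a + b <= m)%N -> iter a udiff f = (fun=> 0) ->
 iter b udiff h = (fun=> 0) -> iter m udiff (fun x => f x * h x) = (fun=> 0).
elim: m a b f h => [|m IH] a b f h.
 by rewrite leqn0 addn_eq0 => /andP[/eqP-> _] /= -> _; apply/funext => x; rewrite mul0r.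
case: a => [_ /= -> _|a].
 have -> : (fun x => 0 * h x) = (fun=> 0) by apply/funext => x; rewrite mul0r.
 exact: (udiff0 m.+1).
case: b => [_ _ /= ->|b].
 have -> : (fun x => f x * 0) = (fun=> 0) by apply/funext => x; rewrite mulr0.
 exact: (udiff0 m.+1).
move=> abm f0 h0; rewrite iterSr.
have -> : udiff (fun x => f x * h x) =
  (fun x => udiff f x * h x + (udiff f x * udiff h x + f x * udiff h x)).
 by apply/funext => x; rewrite /udiff; ring.
rewrite !udiffD.
have f1 : iter a udiff (udiff f) = (fun=> 0) by rewrite -iterSr.
have h1 : iter b udiff (udiff h) = (fun=> 0) by rewrite -iterSr.
rewrite (IH a b.+1 _ _ _ f1 h0); last by lia.
rewrite (IH a b _ _ _ f1 h1); last by lia.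
rewrite (IH a.+1 b _ _ _ f0 h1); last by lia.
by apply/funext => x; rewrite !addr0.
Qed.

Lemma udiffZ m c f : iter m udiff (fun x => c * f x) = (fun x => c * iter m udiff f x).
by elim: m => //= m ->; apply/funext => x; rewrite mulrBr. Qed.

(** Generalized eigenfunctions of translation by [s *m u]: exact eigenfunctions for [s] on which [u]
    acts unipotently. *)
Definition jfun (ah : k * (M -> k)) :=
 (forall x, ah.2 (s *m x) = ah.1 * ah.2 x) /\ exists m, iter m udiff ah.2 = (fun=> 0).

Lemma jfun_decomp f : pol f -> exists r : seq (k * (M -> k)),
 (forall p, List.In p r -> jfun p) /\ forall x, f x = \sum_(p <- r) p.2 x.
elim/mxpol_ind => [c|i j||{}f h [r [hr er]] [r' [hr' er']]|{}f h [r [hr er]] [r' [hr' er']]].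
- exists [:: (1, fun=> c)]; split=> [p [<-|//]|x]; last by rewrite big_seq1.
 split=> [x|]; first by rewrite mul1r.
 by exists 1; rewrite /= /udiff subrr.
- have [P uP /is_diag_mxP dP] := ss.
 exists [seq (mxconj P s l l, fun x => invmx P i l * (P *m x) l j) | l <- enum 'I_n]; split.
  move=> p /List.in_map_iff[l [<- _]]; split=> [x /=|/=].
   have -> : P *m (s *m x) = mxconj P s *m (P *m x) by rewrite !mulmxA mulmxKV.
   rewrite [in LHS]mxE (bigD1 l) //= big1 ?addr0; first by rewrite mulrCA.
   by move=> a al; rewrite dP ?mul0r //; apply: contraNneq al => /val_inj ->.
  have [m hm] := nu; exists m.
  have -> : iter m udiff (fun x => invmx P i l * (P *m x) l j) =
    fun x => invmx P i l * (P *m (iter m (mulmx (u - 1%:M)) 1%:M *m x)) l j.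
   elim: m {hm} => [|m IH]; first by apply/funext => x; rewrite mul1mx.
   have cm : iter m (mulmx (u - 1%:M)) 1%:M *m u = u *m iter m (mulmx (u - 1%:M)) 1%:M.
    elim: m {IH} => [|m IH]; first by rewrite mul1mx mulmx1.
    by rewrite -mulmxA IH !mulmxA mulmxBl mulmxBr mul1mx mulmx1.
   apply/funext => x; rewrite iterS IH /udiff !mulmxA -[P *m _ *m u]mulmxA cm.
   rewrite -mulrBr !mulmxA mulmxBr mulmx1 !mulmxBl.
   by move: (_ *m x) (_ *m x) => A B; rewrite !mxE.
  by rewrite hm; apply/funext => x; rewrite mul0mx mulmx0 mxE mulr0.
 move=> x; rewrite big_map big_enum -{1}[x](mulKmx uP) mxE.
 by [].
- exists [:: ((\det s)^-1, fun x => (\det x)^-1)]; split=> [p [<-|//]|x]; last by rewrite big_seq1.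
 split=> [x /=|]; first by rewrite det_mulmx invfM.
 by exists 1; apply/funext => x; rewrite /= /udiff det_mulmx du mul1r subrr.
- exists (r ++ r'); split=> [p /List.in_app_iff[/hr|/hr']|x] //; by rewrite big_cat er er'.
exists [seq (p.1 * q.1, fun x => p.2 x * q.2 x) | p <- r, q <- r']; split.
 have hp p : List.In p r -> forall q, List.In q [seq (p.1 * q.1, fun x => p.2 x * q.2 x) | q <- r'] -> jfun q.
  move=> /hr[p1 [m1 p2]] _ /List.in_map_iff[q [<- /hr'[q1 [m2 q2]]]]; split=> [x /=|/=].
   by rewrite p1 q1 mulrACA.
  by exists (m1 + m2); apply: udiffM.
 elim: r {hr er} hp => //= p r IH hp q /List.in_app_iff[]; first by apply: hp; left.
 by apply: IH => p' hp'; apply: hp; right.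
move=> x; rewrite er er' big_allpairs_dep mulr_suml; apply: eq_bigr => p _.
by rewrite mulr_sumr.
Qed.

Definition shiftact (p : {poly k}) f : M -> k :=
 fun x => \sum_(i < size p) p`_i * f (iter i (mulmx (s *m u)) x).

Lemma shiftact_wide m (p : {poly k}) f x : (size p <= m)%N ->
 shiftact p f x = \sum_(i < m) p`_i * f (iter i (mulmx (s *m u)) x).
move=> pm; rewrite /shiftact (big_ord_widen m (fun i => p`_i * f (iter i (mulmx (s *m u)) x)) pm) big_mkcond.
by apply: eq_bigr => i _; case: ltnP => // le; rewrite nth_default ?mul0r.
Qed.

Lemma shiftactD (p q : {poly k}) f x : shiftact (p + q) f x = shiftact p f x + shiftact q f x.
rewrite !(@shiftact_wide (maxn (size p) (size q))) ?leq_maxl ?leq_maxr ?size_polyD //.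
by rewrite -big_split; apply: eq_bigr => i _; rewrite coefD mulrDl.
Qed.

Lemma shiftact_sub (p : {poly k}) a f x :
 shiftact (p * ('X - a%:P)) f x = shiftact p (fun x => f (s *m u *m x) - a * f x) x.
rewrite (@shiftact_wide (size p).+1); last first.
 by rewrite (leq_trans (size_polyMleq _ _)) // size_XsubC addnS addn1.
under eq_bigr do rewrite mulrBr coefB mulrBl coefMC coefMX.
rewrite sumrB big_ord_recl mul0r add0r [X in - X]big_ord_recr /= nth_default // mul0r mul0r addr0.
rewrite -sumrB; apply: eq_bigr => i _; rewrite mulrBr mulrA; congr _.
Qed.

Lemma shiftact_dvd (p : {poly k}) a m f x : (forall x, f (s *m x) = a * f x) ->
 iter m udiff f = (fun=> 0) -> ('X - a%:P) ^+ m %| p -> shiftact p f x = 0.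
move=> fs fm /Pdiv.Field.dvdpP[q ->].
elim: m q f fs fm => [|m IH] q f fs fm.
 rewrite /shiftact big1 // => i _.
 by rewrite [f _](_ : _ = 0) ?mulr0 //; rewrite -[f]/(iter 0 udiff f) fm.
rewrite exprSr mulrA shiftact_sub IH // => [y|].
 by rewrite [s *m u *m (s *m y)]mulmxA -[s *m u *m s]mulmxA -su -!mulmxA !fs mulrBr.
have -> : (fun x => f (s *m u *m x) - a * f x) = (fun x => a * udiff f x).
 by apply/funext => y; rewrite -mulmxA fs mulrBr.
by rewrite udiffZ -iterSr fm; rewrite mulr0.
Qed.

(** A polynomial [q] congruent to [a] modulo [(X - a) ^ m] for each occurring eigenvalue [a] turns
    translation by [s *m u] into translation by [s]. Hence [f s] is a combination of values of [f]
    at powers of [s *m u], all zero. *)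
Lemma jordan_closed (H : set M) : cgrp H -> H (s *m u) -> H s.
move=> [sH cH] Hg; apply: cH => f pf fH; have [r [hr er]] := jfun_decomp pf.
have [m hm] : exists m, forall p, List.In p r -> iter m udiff p.2 = (fun=> 0).
 elim: r {er} hr => [|p r IH] hr; first by exists 0.
 have [|m hm] := IH; first by move=> q qr; apply: hr; right.
 have [_ [m' hm']] := hr p (or_introl erefl); exists (m + m')%N => q [<-|/hm e].
  exact: udiff_eq0.
 by rewrite addnC; apply: udiff_eq0.
have [q hq] := crt_poly m (undup_uniq [seq p.1 | p <- r]).
have -> : f s = shiftact q f 1%:M.
 rewrite er; under [RHS]eq_bigr do rewrite er mulr_sumr.
 rewrite exchange_big.
 have : forall p, List.In p r -> jfun p /\ ('X - p.1%:P) ^+ m %| q - p.1%:P.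
  move=> p pr; split; first exact: hr.
  apply: hq; rewrite mem_undup; apply/mem_In; exact: List.in_map.
 elim: {er hr hq} r hm => [|p r' IH] hm hr; first by rewrite !big_nil.
 rewrite !big_cons IH => [|p' pr|p' pr]; [|by apply: hm; right|by apply: hr; right].
 congr _; have [[ps _] pq] := hr p (or_introl erefl).
 have ec : shiftact (- p.1%:P) p.2 1%:M = - (p.1 * p.2 1%:M).
  rewrite (@shiftact_wide 1) ?big_ord1 ?coefN ?coefC ?mulNr //.
  by rewrite size_polyN size_polyC leq_b1.
 move: (shiftact_dvd 1%:M ps (hm _ (or_introl erefl)) pq); rewrite shiftactD ec -ps mulmx1 => /eqP; rewrite subr_eq0 => /eqP <-.
 by [].
rewrite /shiftact big1 // => i _; rewrite fH ?mulr0 //.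
by elim: val => [|j IH]; [exact: sg1|exact: sgM].
Qed.

End JordanClosed.

Section JordanTrig.
Context {k : closedFieldType} {n' : nat}.
Local Notation n := n'.+1.
Local Notation M := 'M[k]_n.
Implicit Types (s g : M).

Lemma sstP s : sst s <-> exists2 rs, uniq rs & horner_mx s (\prod_(r <- rs) ('X - r%:P)) = 0.
rewrite diagonalizableE diagonalizableP; split=> -[rs u h]; exists rs => //.
 by apply/mxminpoly_minP.
by apply/mxminpoly_minP.
Qed.

Definition diagpoly s : {poly k} := \prod_(r <- undup [seq s i i | i <- enum 'I_n]) ('X - r%:P).

Lemma sst_diagpoly s : trig s -> sst s -> horner_mx s (diagpoly s) = 0.
move=> ts /sstP[rs u]; rewrite (bigID (mem [seq s i i | i <- enum 'I_n])) rmorphM.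
set A := \prod_(_ <- _ | _) _; set B := \prod_(_ <- _ | _) _ => AB.
have uB : horner_mx s B \in unitmx.
 rewrite rmorph_prod; elim/big_rec: _ => [|r y hr uy]; first exact: unitmx1.
 rewrite -[_ * y]/(_ *m y) unitmx_mul uy andbT rmorphB /= horner_mx_X horner_mx_C.
 rewrite trig_unit; last first.
  by apply/trigP => i j ij; rewrite !mxE (trigP _ ts) // -val_eqE (ltn_eqF ij) subr0.
 apply/forallP => i; rewrite !mxE eqxx mulr1n subr_eq0; apply: contraNneq hr => <-.
 by apply/mapP; exists i; rewrite ?mem_enum.
have A0 : horner_mx s A = 0 by rewrite -[LHS](mulmxK uB) (AB : _ *m _ = _) mul0mx.
have /Pdiv.Field.dvdpP[q ->] : A %| diagpoly s; last by rewrite rmorphM /= A0 mulr0.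
rewrite /A -big_filter; apply: uniq_roots_dvdp; last by rewrite uniq_rootsE filter_uniq.
apply/allP => r; rewrite mem_filter => /andP[hr _].
by rewrite root_prod_XsubC mem_undup.
Qed.

Lemma diagpoly_root s i : (diagpoly s).[s i i] = 0.
apply/rootP; rewrite root_prod_XsubC mem_undup; apply/mapP; exists i => //; exact: mem_enum.
Qed.

Lemma diagpoly_deriv s i : (diagpoly s)^`().[s i i] != 0.
apply: (coprimep_root); last exact/rootP/diagpoly_root.
have : separable_poly (diagpoly s) by rewrite separable_prod_XsubC undup_uniq.
by rewrite unlock.
Qed.

Lemma trig_horner g p i : trig g -> trig (horner_mx g p) /\ horner_mx g p i i = p.[g i i].
move=> tg; elim/poly_ind: p => [|p c [IH1 IH2]].
 by rewrite rmorph0 !hornerE mxE; split=> //; apply/trigP => a b _; rewrite mxE.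
rewrite rmorphD rmorphM /= horner_mx_X horner_mx_C !hornerE -IH2 -trigM_diag //; split.
 have /trigP h := trigM IH1 tg; apply/trigP => a b ab.
 by rewrite mxE [X in X + _]h // add0r mxE -val_eqE ltn_eqF.
by rewrite mxE [X in _ + X]mxE eqxx mulr1n.
Qed.

(** The semisimple part is a polynomial in [g], hence triangular with the diagonal of [g], and
    [jordan_closed] keeps it in [H]. *)
Lemma jordan_trig (H : set M) g : cgrp H -> H g -> trig g ->
 exists s, [/\ H s, sst s, trig s & forall i, s i i = g i i].
move=> cH Hg tg; have ug := sg_gl cH.1 Hg.
have [p hp] := crt_poly n (undup_uniq [seq g i i | i <- enum 'I_n]).
pose s := horner_mx g p.
have in_d i : g i i \in undup [seq g i i | i <- enum 'I_n].
 by rewrite mem_undup; apply/mapP; exists i; rewrite ?mem_enum.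
have sd i : s i i = g i i.
 rewrite (trig_horner p i tg).2; have /dvdp_trans/(_ (hp _ (in_d i))) : ('X - (g i i)%:P) %| ('X - (g i i)%:P) ^+ n.
  by rewrite exprS dvdp_mulr.
 by rewrite dvdp_XsubCl rootE !hornerE subr_eq0 => /eqP.
have ts : trig s := (trig_horner p ord0 tg).1.
have us : s \in unitmx.
 by move: ug; rewrite !trig_unit // => /forallP h; apply/forallP => i; rewrite sd.
have CH : horner_mx g (\prod_i ('X - (g i i)%:P)) = 0.
 by rewrite -char_poly_trig // Cayley_Hamilton.
have ss : sst s.
 apply/sstP; exists (undup [seq g i i | i <- enum 'I_n]); first exact: undup_uniq.
 have -> : horner_mx s (\prod_(r <- undup [seq g i i | i <- enum 'I_n]) ('X - r%:P)) =
   horner_mx g (\prod_(r <- undup [seq g i i | i <- enum 'I_n]) (p - r%:P)).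
  rewrite !rmorph_prod; apply: eq_bigr => r _; rewrite !rmorphB /=.
  by rewrite horner_mx_X !horner_mx_C.
 set P := \prod_(_ <- _) _.
 have /Pdiv.Field.dvdpP[q ->] : \prod_i ('X - (g i i)%:P) %| P.
  have : \prod_(r <- undup [seq g i i | i <- enum 'I_n]) ('X - r%:P) ^+ n %| P.
   rewrite big_seq [X in _ %| X]big_seq; elim/big_rec2: _ => // r x y hr; exact/dvdp_mul/hp.
  apply: dvdp_trans; rewrite prodrXl.
  rewrite -[X in _ %| _ ^+ X]card_ord -prodr_const; elim/big_rec2: _ => // i x y _; apply: dvdp_mul.
  by rewrite dvdp_XsubCl root_prod_XsubC.
 by rewrite rmorphM /= CH mulr0.
exists s; split=> //.
have cgs : g *m s = s *m g.
 by rewrite -[X in X *m _]horner_mx_X -[_ *m _]/(_ * _) -rmorphM mulrC rmorphM /= horner_mx_X.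
have cVs : invmx s *m g = g *m invmx s.
 by apply: (canRL (mulmxK us)); rewrite -mulmxA cgs mulmxA mulVmx // mul1mx.
apply: (@jordan_closed _ _ s (invmx s *m g)) => //; last by rewrite mulmxA mulmxV // mul1mx.
- by rewrite mulmxA mulmxV // mul1mx cVs -mulmxA mulVmx // mulmx1.
- by rewrite unitmx_mul unitmx_inv us.
- exists n; have -> : invmx s *m g - 1%:M = invmx s *m (g - s) by rewrite mulmxBr mulVmx.
 have cV2 : (g - s) *m invmx s = invmx s *m (g - s) by rewrite mulmxBl mulmxBr cVs mulmxV // mulVmx.
 have -> A m : iter m (mulmx A) 1%:M = A ^+ m by elim: m => //= m ->; rewrite exprS.
 have -> : (invmx s *m (g - s)) ^+ n = invmx s ^+ n * (g - s) ^+ n by apply: exprMn_comm.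
 suff -> : (g - s) ^+ n = 0 by rewrite mulr0.
 have -> : g - s = horner_mx g ('X - p) by rewrite rmorphB /= horner_mx_X.
 rewrite -rmorphXn; have /Pdiv.Field.dvdpP[q ->] : \prod_i ('X - (g i i)%:P) %| ('X - p) ^+ n.
  rewrite -[X in _ %| _ ^+ X]card_ord -prodr_const; elim/big_rec2: _ => // i x y _; apply: dvdp_mul.
  by rewrite dvdp_XsubCl rootE !hornerE -(trig_horner p i tg).2 -/s sd subrr.
 by rewrite rmorphM /= CH mulr0.
- rewrite det_mulmx det_inv !det_trig // (eq_bigr _ (fun i _ => sd i)) mulVf //.
 by rewrite -det_trig // -unitfE -unitmxE.
Qed.

End JordanTrig.

Section Cent.
Context {k : closedFieldType} {n : nat}.
Local Notation M := 'M[k]_n.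
Implicit Types (S H : set M).

Definition cent S : set M := [set x | x \in unitmx /\ forall t, S t -> x *m t = t *m x].

Lemma cent_cgrp S : cgrp (cent S).
split; first split=> [x [//]||x y [ux xs] [uy ys]|x [ux xs]].
- by split=> [|t _]; rewrite ?unitmx1 // mul1mx mulmx1.
- by split=> [|t St]; rewrite ?unitmx_mul ?ux // -mulmxA ys // mulmxA xs // mulmxA.
- split=> [|t St]; first by rewrite unitmx_inv.
 by rewrite -[LHS](mulmxK ux) -(mulmxA _ t) -xs // !mulmxA mulVmx // mul1mx.
apply: closedI; first exact: closed_gl.
apply: (closed_cap) => t x hx St.
apply/matrixP => a b; apply/eqP; rewrite -subr_eq0; apply/eqP.
apply: (hx (fun x => (x *m t) a b - (t *m x) a b)) => [|y /(_ St) ->]; last by rewrite subrr.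
by apply: polB; apply: polmxM; [exact: polmx_id|exact: polmxC|exact: polmxC|exact: polmx_id].
Qed.

Lemma dense_mull S (Z : set M) g : g \in unitmx -> Z `<=` cl S -> (forall z, Z z -> Z (invmx g *m z)) ->
 Z `<=` cl [set g *m x | x in S].
move=> ug ZS Zg z Zz f pf fS; rewrite -(mulKVmx ug z).
apply: (ZS _ (Zg _ Zz) (fun x => f (g *m x))) => [|x Sx]; last by apply: fS; exists x.
by apply: pol_comp pf; apply: mor_mull; apply: morI.
Qed.

Lemma dense_meet S S' (Z : set M) : cst S -> cst S' -> irr Z -> Z `<=` cl (Z `&` S) -> Z `<=` cl (Z `&` S') ->
 exists z, [/\ Z z, S z & S' z].
move=> cS cS' iZ h h'; have [f [pf [a Za fa] fS]] := cst_dense cS iZ h.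
have [g [pg [b Zb gb] gS]] := cst_dense cS' iZ h'.
apply: contrapT => no; have [|h0|h0] := iZ.2 f g pf pg.
- move=> z Zz; apply/eqP; rewrite mulf_eq0; apply: contraT; rewrite negb_or => /andP[f0 g0].
 by case: no; exists z; split=> //; [exact: fS|exact: gS].
- by rewrite h0 ?eqxx in fa.
- by rewrite h0 ?eqxx in gb.
Qed.

End Cent.

(** * Unitriangular groups and semisimple elements *)

Section Levels.
Context {k : closedFieldType} {n' : nat}.
Local Notation n := n'.+1.
Local Notation M := 'M[k]_n.
Implicit Types (A E : M) (s t x y r g : M) (i j : nat) (a b : 'I_n) (V : set M).

(** Filtration by lower diagonals: [lev 0] is triangular, [lev 1] strictly triangular, [lev n] zero.
    The groups [ut i.+1] give the matching filtration of the unitriangular group, additive on each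
    new diagonal ([utM]). *)
Definition lev i A := forall a b, (a < b + i)%N -> A a b = 0.
Definition ut i x := lev i (x - 1%:M).

Lemma lev_le i j A : (i <= j)%N -> lev j A -> lev i A.
by move=> ij h a b ab; apply: h; lia. Qed.

Lemma levD i A E : lev i A -> lev i E -> lev i (A + E).
by move=> h1 h2 a b ab; rewrite mxE h1 // h2 // addr0. Qed.

Lemma levN i A : lev i A -> lev i (- A).
by move=> h a b ab; rewrite mxE h // oppr0. Qed.

Lemma levM i j A E : lev i A -> lev j E -> lev (i + j) (A *m E).
move=> hA hE a b ab; rewrite mxE big1 // => c _.
have [ac|ca] := ltnP a (c + i); first by rewrite hA ?mul0r.
by rewrite hE ?mulr0 //; lia.
Qed.

Lemma lev_trig t : trig t <-> lev 0 t.
by split=> [/trigP h a b|h]; rewrite ?addn0; [exact: h|apply/trigP => a b ab; apply: h; rewrite addn0]. Qed.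

Lemma lev_top A : lev n A -> A = 0.
by move=> h; apply/matrixP => a b; rewrite h ?mxE //; have := ltn_ord a; lia. Qed.

Lemma levEl i s A a b : trig s -> lev i A -> (a <= b + i)%N -> (s *m A) a b = s a a * A a b.
move=> /trigP hs hA ab; rewrite mxE (bigD1 a) //= big1 ?addr0 // => c ca.
have [lt|le] := ltnP a c; first by rewrite hs ?mul0r.
by rewrite hA ?mulr0 //; move: ca; rewrite -val_eqE /=; lia.
Qed.

Lemma levEr i t A a b : trig t -> lev i A -> (a <= b + i)%N -> (A *m t) a b = A a b * t b b.
move=> /trigP ht hA ab; rewrite mxE (bigD1 b) //= big1 ?addr0 // => c cb.
have [lt|le] := ltnP c b; first by rewrite ht ?mulr0.
by rewrite hA ?mul0r //; move: cb; rewrite -val_eqE /=; lia.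
Qed.

Lemma ut_trig i x : ut i.+1 x -> trig x.
move=> h; apply/trigP => a b ab; have := h a b; rewrite !mxE -val_eqE (ltn_eqF ab) subr0.
by apply; lia.
Qed.

Lemma ut_diag i x a : ut i.+1 x -> x a a = 1.
move=> h; have : (x - 1%:M) a a = 0 by apply: h; lia.
by rewrite !mxE eqxx => /eqP; rewrite subr_eq0 => /eqP.
Qed.

Lemma ut_unit i x : ut i.+1 x -> x \in unitmx.
by move=> h; rewrite trig_unit ?(ut_trig h) //; apply/forallP => a; rewrite (ut_diag a h) oner_eq0.
Qed.

Lemma ut1P x : trig x -> (forall a, x a a = 1) -> ut 1 x.
move=> /trigP tx dx a b; rewrite addn1 ltnS leq_eqVlt => /orP[/eqP/val_inj->|ab].
 by rewrite !mxE dx eqxx subrr.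
by rewrite !mxE tx // -val_eqE (ltn_eqF ab) subrr.
Qed.

Lemma ut_le i j x : (i <= j)%N -> ut j x -> ut i x.
exact: lev_le. Qed.

Lemma utM i x y : ut i.+1 x -> ut i.+1 y -> ut i.+1 (x *m y) /\
 forall a b, (a <= b + i.+1)%N -> (x *m y - 1%:M) a b = (x - 1%:M) a b + (y - 1%:M) a b.
move=> hx hy.
have e : x *m y - 1%:M = (x - 1%:M) *m (y - 1%:M) + ((x - 1%:M) + (y - 1%:M)).
 by rewrite mulmxBl mulmxBr mulmx1 mul1mx; apply/matrixP => ? ?; rewrite !mxE; ring.
split; first by rewrite /ut e; apply: levD; [apply: lev_le (levM hx hy); lia|exact: levD].
by move=> a b ab; rewrite e mxE (levM hx hy) ?add0r ?[LHS]mxE //; lia.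
Qed.

Lemma utV i x : ut i.+1 x -> ut i.+1 (invmx x) /\
 forall a b, (a <= b + i.+1)%N -> (invmx x - 1%:M) a b = - (x - 1%:M) a b.
move=> hx; have ux := ut_unit hx; have tx := ut_trig hx; have tv := trigV tx ux.
have e : invmx x - 1%:M = - (invmx x *m (x - 1%:M)) by rewrite mulmxBr mulVmx // mulmx1 opprB.
have dv a : invmx x a a = 1.
 have := trigM_diag a tv tx; rewrite mulVmx // mxE eqxx (ut_diag a hx) mulr1.
 by [].
split; first by rewrite /ut e; apply: levN; apply: (@lev_le _ (0 + i.+1)) => //; apply: levM => //; apply/lev_trig.
by move=> a b ab; rewrite e mxE (levEl tv hx) // dv mul1r.
Qed.

Lemma utJ i s x : trig s -> s \in unitmx -> ut i.+1 x -> ut i.+1 (mxconj s x) /\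
 forall a b, (a <= b + i.+1)%N -> (mxconj s x - 1%:M) a b = s a a / s b b * (x - 1%:M) a b.
move=> ts us hx; have tv := trigV ts us.
have e : mxconj s x - 1%:M = s *m (x - 1%:M) *m invmx s.
 by rewrite mulmxBr mulmxBl mulmx1 mulmxV.
have dv a : invmx s a a = (s a a)^-1.
 have := trigM_diag a ts tv; rewrite mulmxV // mxE eqxx.
 by move=> h; apply/(mulfI (forallP (etrans (esym (trig_unit ts)) us) a)); rewrite mulfV // (forallP (etrans (esym (trig_unit ts)) us)).
have l1 : lev i.+1 (s *m (x - 1%:M)) by apply: (@levM 0) => //; apply/lev_trig.
split; first by rewrite /ut e -[i.+1]addn0; apply: levM => //; apply/lev_trig.
by move=> a b ab; rewrite e (levEr tv l1) // (levEl ts hx) // dv mulrAC.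
Qed.

Lemma closed_ut i : zclosed (@ut i).
apply: (closed_cap) => a.
apply: (closed_cap) => b.
case: ltnP => _; last by move=> x _.
have : zclosed [set x : M | (x - 1%:M) a b = 0].
 by apply: closed_zero; apply: polmxB; [exact: polmx_id|exact: polmxC].
by move=> h x hx _; apply: h; apply: cl_mono hx => y; apply.
Qed.

Lemma ut_cgrp i : cgrp (@ut i.+1).
split; last exact: closed_ut; split.
- by move=> x /ut_unit.
- by move=> a b _; rewrite subrr mxE.
- by move=> x y hx hy; have [] := utM hx hy.
- by move=> x /utV[].
Qed.

(** First order Taylor expansion: at such an entry [p t - p s] is the derivative of [p] at the
    common eigenvalue times [t - s]. For [diagpoly], which kills both matrices and has simple roots,
    the entry must vanish. *)
Lemma sst_level i s t : trig s -> trig t -> (forall a, s a a = t a a) ->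
 sst s -> sst t -> lev i.+1 (t - s) ->
 forall a b, (a <= b + i.+1)%N -> s a a = s b b -> (t - s) a b = 0.
move=> ts tt d ss st E a b ab dab.
have H p : lev i.+1 (horner_mx t p - horner_mx s p) /\
  (horner_mx t p - horner_mx s p) a b = p^`().[s a a] * (t - s) a b.
 elim/poly_ind: p => [|p c [IH1 IH2]].
  by rewrite !rmorph0 subrr deriv0 horner0 mul0r mxE; split=> // a' b' _; rewrite mxE.
 rewrite !rmorphD !rmorphM /= !horner_mx_X !horner_mx_C.
 have -> : horner_mx t p * t + c%:M - (horner_mx s p * s + c%:M) =
   (horner_mx t p - horner_mx s p) *m t + horner_mx s p *m (t - s).
  rewrite mulmxBl mulmxBr -![_ * _]/(_ *m _).
  by move: (_ *m _) (_ *m _) (_ *m _) => A B C; apply/matrixP => ? ?; rewrite !mxE; ring.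
 have [th dh] := trig_horner p a ts; split.
  apply: levD; first by rewrite -[i.+1]addn0; apply: levM => //; apply/lev_trig.
  by apply: (@levM 0) => //; apply/lev_trig.
 rewrite mxE (levEr tt IH1) // (levEl th E) // IH2 dh derivD derivM derivX derivC mulr1.
 by rewrite !hornerE -d -dab; ring.
have e : diagpoly t = diagpoly s.
 by rewrite /diagpoly (eq_map (fun a => (d a))).
have [_] := H (diagpoly s); rewrite {1}sst_diagpoly // -e sst_diagpoly // subrr mxE.
by move=> /esym/eqP; rewrite mulf_eq0 e (negbTE (diagpoly_deriv _ _)) => /eqP.
Qed.

Lemma ut_step i x : ut i.+1 x -> (forall a b, (a = b + i.+1 :> nat)%N -> (x - 1%:M) a b = 0) -> ut i.+2 x.
move=> hx h a b; rewrite addnS ltnS leq_eqVlt => /orP[/eqP|ab]; [exact: h|exact: hx].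
Qed.

Lemma ut_all x : ut 1 x -> (forall i, ut i.+1 x -> ut i.+2 x) -> x = 1%:M.
move=> h1 h; have H i : ut i.+1 x by elim: i.
by apply/eqP; rewrite -subr_eq0; apply/eqP/lev_top/H.
Qed.

Lemma sst_ut1 x : ut 1 x -> sst x -> x = 1%:M.
move=> hx sx; apply: ut_all => // i hi; apply: ut_step => // a b ab.
apply: (sst_level _ (ut_trig hi)); rewrite ?ab //.
- by move=> c; rewrite (ut_diag c hi) mxE eqxx.
- by exists 1%:M; rewrite ?unitmx1 // mxconj1 ?unitmx1.
- exact: hi.
- by rewrite !mxE !eqxx.
Qed.

Section Normalized.
Variables (s : M) (ts : trig s) (us : s \in unitmx).

Definition nrm V := forall x, V x -> V (mxconj s x).

Lemma sdn a : s a a != 0.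
by move: us; rewrite trig_unit // => /forallP. Qed.

(* The subgroups [D j] of level-[i] parts divisible by [(d - 1)^j] decrease, so they become stationary. *)
Lemma level_split i V r : cgrp V -> V `<=` @ut i.+1 -> nrm V -> V r ->
 exists2 y, V y & forall a b, (a <= b + i.+1)%N -> s a a != s b b ->
  (r - 1%:M) a b = (s a a / s b b - 1) * (y - 1%:M) a b.
move=> [sV cV] Vi nV Vr.
pose rel m x y := forall a b, (a <= b + i.+1)%N ->
 (x - 1%:M) a b = (s a a / s b b - 1) ^+ m * (y - 1%:M) a b.
pose D m : set M := [set x | V x /\ exists2 y, V y & rel m x y].
have step y : V y -> exists2 y', V y' & rel 1 y' y.
 move=> Vy; have Vys := nV _ Vy; exists (mxconj s y *m invmx y).
  by apply: sgM => //; apply: sgV.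
 move=> a b ab; have [h1 h2] := utJ ts us (Vi _ Vy); have [h3 h4] := utV (Vi _ Vy).
 by have [_ ->] := utM h1 h3; rewrite // h2 // h4 // mulrBl mul1r.
have cD m : cgrp (D m).
 have sD : subgroup (D m).
  split=> [x [/(sg_gl sV)//]||x x' [Vx [y Vy hy]] [Vx' [y' Vy' hy']]|x [Vx [y Vy hy]]].
  - split; first exact: sg1.
   by exists 1%:M; [exact: sg1|move=> a b _; rewrite subrr !mxE mulr0].
  - split; [exact: sgM|exists (y *m y'); first exact: sgM].
   move=> a b ab; have [_ ->] := utM (Vi _ Vx) (Vi _ Vx'); rewrite //.
   by have [_ ->] := utM (Vi _ Vy) (Vi _ Vy'); rewrite // hy // hy' // mulrDr.
  - split; [exact: sgV|exists (invmx y); first exact: sgV].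
   move=> a b ab; have [_ ->] := utV (Vi _ Vx); rewrite //.
   by have [_ ->] := utV (Vi _ Vy); rewrite // hy // mulrN.
 split=> //; apply: cst_sg_closed => //.
 have : cst (V `*` V `&` [set xy : M * M | forall ab : 'I_n * 'I_n, (ab.1 <= ab.2 + i.+1)%N ->
   (xy.1 - 1%:M) ab.1 ab.2 = (s ab.1 ab.1 / s ab.2 ab.2 - 1) ^+ m * (xy.2 - 1%:M) ab.1 ab.2]).
  apply: cstI; first by apply: cst_prod; apply: cst_closed.
  apply: cst_closed; apply: (closed_cap).
  move=> [a b]; case: leqP => _; last by move=> x _.
  have : zclosed [set xy : M * M |
    (xy.1 - 1%:M) a b - (s a a / s b b - 1) ^+ m * (xy.2 - 1%:M) a b = 0].
   have pm : polmx (fun x => x - 1%:M) by apply: polmxB; [exact: polmx_id|exact: polmxC].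
   apply: closed_zero; apply: polB; first exact: (pol_fst (pm a b)).
   by apply: polM; [exact: polC|exact: (pol_snd (pm a b))].
  move=> h x hx _; apply/eqP; rewrite -subr_eq0; apply/eqP; apply: h; apply: cl_mono hx => y /= hy.
  by rewrite hy // subrr.
 move=> /cst_proj; apply: cst_ext => x; split.
  by move=> [y [[/= Vx Vy] h]]; split=> //; exists y => // a b; apply: (h (a, b)).
 by move=> [Vx [y Vy h]]; exists y; split=> // -[a b]; apply: h.
have [|_ [m] -> |_ [m ->] min] := closed_min (F := [set Z | exists m, Z = D m]).
- by exists (D 0), 0.
- by case: (cD m).
have Dm : D m `<=` D m.+1.
 apply: min; first by exists m.+1.
 move=> x [Vx [y Vy hy]]; split=> //; have [y' Vy' hy'] := step _ Vy; exists y' => // a b ab.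
 by rewrite hy // hy' // exprSr mulrA.
have [x Vx hx] : exists2 x, V x & rel m x r.
 elim: (m) => [|j [x Vx hx]]; first by exists r => // a b ab; rewrite mul1r.
 have [x' Vx' hx'] := step _ Vx; exists x' => // a b ab.
 by rewrite hx' // hx // mulrA -exprS.
have [|_ [y Vy hy]] := Dm x; first by split=> //; exists r.
exists y => // a b ab ne; have := hy a b ab; rewrite hx // exprSr -mulrA; apply: mulfI.
by rewrite expf_neq0 // subr_eq0 (can2_eq (divfK (sdn b)) (mulfK (sdn b))) mul1r.
Qed.

Lemma nrmI i V : nrm V -> nrm (V `&` @ut i.+1).
by move=> nV x [Vx hx]; split; [exact: nV|have [] := utJ ts us hx]. Qed.

Lemma cgrp_uti i V : cgrp V -> cgrp (V `&` @ut i.+1).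
by move=> cV; apply: cgrpI => //; apply: ut_cgrp. Qed.

(** Successive approximation along the levels. Entries joining different eigenvalues of [s] are
    removed by conjugating with the [y] of [level_split]; those joining equal eigenvalues vanish by
    [sst_level], both elements being semisimple. *)
Lemma conj_sst V r : cgrp V -> V `<=` @ut 1 -> nrm V -> sst s -> V r -> sst (r *m s) ->
 exists2 x, V x & r *m s = mxconj x s.
move=> cV V1 nV ss Vr srs; have [sV _] := cV.
suff H i : exists x r', [/\ V x, V r', ut i.+1 r' & r *m s = mxconj x (r' *m s)].
 have [x [r' [Vx Vr' hr' e]]] := H n; exists x => //; rewrite e.
 have -> : r' = 1%:M by apply/eqP; rewrite -subr_eq0; apply/eqP/lev_top; apply: lev_le.
 by rewrite mul1mx.
elim: i => [|i [x [r' [Vx Vr' hr' e]]]].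
 by exists 1%:M, r; split=> //; [exact: sg1|exact: V1|rewrite /mxconj invmx1 mulmx1 mul1mx].
have [|y [Vy hy] hrel] := @level_split i _ r' (cgrp_uti i cV) _ (nrmI nV) (conj Vr' hr').
 by [].
have ux := sg_gl sV Vx; have uy := sg_gl sV Vy.
have [hyJ yJ] := utJ ts us hy; have [hyJV yJV] := utV hyJ.
pose r2 := y *m r' *m invmx (mxconj s y).
have Vr2 : V r2 by apply: (sgM sV); [exact: sgM|apply: sgV => //; apply: nV].
have [h1 e1] := utM hy hr'; have [h2 e2] := utM h1 hyJV.
have er2 a b : (a <= b + i.+1)%N -> (r2 - 1%:M) a b = (r' - 1%:M) a b - (s a a / s b b - 1) * (y - 1%:M) a b.
 by move=> ab; rewrite e2 // e1 // yJV // yJ //; ring.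
have r2s : r2 *m s = mxconj y (r' *m s).
 by rewrite /r2 -mxconjV // /mxconj !mulmxA mulmxKV.
exists (x *m invmx y), r2; split=> //; first by apply: sgM => //; apply: sgV.
 apply: ut_step => // a b ab; have [dab|ne] := eqVneq (s a a) (s b b); last first.
  by rewrite er2 ?ab // hrel ?ab // subrr.
 have lE : lev i.+1 (r2 *m s - s).
  rewrite (_ : _ - _ = (r2 - 1%:M) *m s); last by rewrite mulmxBl mul1mx.
  by rewrite -[i.+1]addn0; apply: levM => //; apply/lev_trig.
 have : (r2 *m s - s) a b = 0.
  apply: (sst_level ts _ _ ss _ lE); rewrite ?ab //.
  - by apply: trigM => //; apply: ut_trig h2.
  - by move=> c; rewrite trigM_diag ?(ut_trig h2) // (ut_diag c h2) mul1r.
  - rewrite r2s; apply: sst_conj => //.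
   by rewrite -[_ *m s](mxconjK _ ux) -e; apply: sst_conj; rewrite ?unitmx_inv.
 rewrite (_ : _ - _ = (r2 - 1%:M) *m s); last by rewrite mulmxBl mul1mx.
 rewrite (levEr ts h2) ?ab // => /eqP; rewrite mulf_eq0 (negbTE (sdn b)) orbF => /eqP //.
by rewrite r2s mxconjMl ?unitmx_inv // mxconjK.
Qed.

Definition sphi x := x *m s *m invmx x *m invmx s.

Lemma sphiE x : x \in unitmx -> sphi x = x *m invmx (mxconj s x).
by move=> ux; rewrite -mxconjV // !mulmxA. Qed.

Lemma sphi_in V x : cgrp V -> nrm V -> V x -> V (sphi x).
move=> [sV _] nV Vx; rewrite sphiE ?(sg_gl sV Vx) //; apply: sgM => //; apply: sgV => //; exact: nV.
Qed.

Lemma sphi_ut i x : ut i.+1 x -> ut i.+1 (sphi x) /\ forall a b, (a <= b + i.+1)%N ->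
 (sphi x - 1%:M) a b = (1 - s a a / s b b) * (x - 1%:M) a b.
move=> hx; rewrite sphiE ?(ut_unit hx) //.
have [hJ eJ] := utJ ts us hx; have [hV eV] := utV hJ; have [h e] := utM hx hV; split=> // a b ab.
by rewrite e // eV // eJ //; ring.
Qed.

Lemma sphiM x y : x \in unitmx -> y \in unitmx -> sphi (x *m y) = mxconj x (sphi y) *m sphi x.
by move=> ux uy; rewrite /sphi /mxconj invmxM // !mulmxA !mulmxKV. Qed.

(* Any lift of a fixed point modulo the next level is moved to a fixed point by [conj_sst]. *)
Lemma fixed_lift i V v : cgrp V -> V `<=` @ut 1 -> nrm V -> sst s -> V v -> ut i.+1 v ->
 (forall a b, (a = b + i.+1 :> nat)%N -> s a a != s b b -> (v - 1%:M) a b = 0) ->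
 exists c, [/\ V c, ut i.+1 c, c *m s = s *m c &
  forall a b, (a <= b + i.+1)%N -> (c - 1%:M) a b = (v - 1%:M) a b].
move=> cV V1 nV ss Vv hv fv; have [sV _] := cV; have uv := sg_gl sV Vv.
have [h e] := sphi_ut hv.
have h2 : ut i.+2 (sphi v).
 apply: ut_step => // a b ab; rewrite e ?ab //.
 have [->|ne] := eqVneq (s a a) (s b b); first by rewrite divff ?sdn // subrr mul0r.
 by rewrite fv ?mulr0.
have [|||y [Vy hy] ey] := @conj_sst (V `&` @ut i.+2) (sphi v) (cgrp_uti _ cV) _ (nrmI nV) ss.
- by move=> ? [/V1].
- by split=> //; apply: sphi_in.
- by rewrite mulmxKV //; apply: sst_conj.
have uy := sg_gl sV Vy.
move: ey.
have [hyV eyV] := utV hy; have [hc ec] := utM (ut_le (ltnW (ltnSn _)) hyV) hv.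
exists (invmx y *m v); split=> //; first by apply: sgM => //; apply: sgV.
 have := congr1 (fun z => invmx y *m z *m v) ey; rewrite !mulmxA mulVmx // mul1mx.
 by rewrite !mulmxKV // => ->.
by move=> a b ab; rewrite ec // [X in X + _]hyV ?add0r //; lia.
Qed.

(** Level by level, the part of [r] joining different eigenvalues is matched by some [sphi x], and
    the rest is lifted to a fixed element by [fixed_lift]. The induction carries [x0] along because
    [sphi] is only a crossed homomorphism ([sphiM]). *)
Lemma sphi_cover V r : cgrp V -> V `<=` @ut 1 -> nrm V -> sst s -> V r ->
 exists c x, [/\ V c, V x, c *m s = s *m c & r = c *m sphi x].
move=> cV V1 nV ss Vr; have [sV _] := cV.
suff H m i x0 : (n <= i + m)%N -> V x0 -> forall r, V r -> ut i.+1 r ->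
  exists c x, [/\ V c, V x, c *m s = s *m c & r *m sphi x0 = c *m sphi (x0 *m x)].
 have [|c [x [Vc Vx cs e]]] := H n 0 1%:M (leqnn _) (sg1 sV) r Vr; first exact: V1.
 exists c, x; move: e.
 by rewrite mul1mx {1}/sphi mul1mx invmx1 mulmx1 mulmxV // mulmx1.
elim: m i x0 => [|m IH] i x0 nim Vx0 {Vr}r Vr hr.
 exists 1%:M, 1%:M; rewrite !mul1mx !mulmx1; split=> //; try exact: sg1.
 have -> : r = 1%:M; last by rewrite mul1mx.
 by apply/eqP; rewrite -subr_eq0; apply/eqP/lev_top; apply: lev_le hr; lia.
have [|y [Vy hy] hrel] := @level_split i _ r (cgrp_uti i cV) _ (nrmI nV) (conj Vr hr).
 by [].
have [hyV eyV] := utV hy; pose x1 := invmx y.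
have Vx1 : V x1 by apply: sgV.
have [hp ep] := sphi_ut hyV; have Vp := sphi_in cV nV Vx1.
have [hpV epV] := utV hp; have [hv ev] := utM hr hpV.
have [||c [Vc hc cs ec]] := fixed_lift cV V1 nV ss _ hv.
- by apply: sgM => //; apply: sgV.
- move=> a b ab ne; rewrite ev ?ab // epV ?ab // ep ?ab // eyV ?ab // hrel ?ab //; ring.
have ux0 := sg_gl sV Vx0; have ux1 := sg_gl sV Vx1; have uc := sg_gl sV Vc.
have [hJ eJ] := utJ (ut_trig (V1 _ Vx0)) ux0 hp; have [hJV eJV] := utV hJ.
have [hcV ecV] := utV hc; have [h1 e1] := utM hcV hr; have [h2 e2] := utM h1 hJV.
pose r1 := invmx c *m r *m invmx (mxconj x0 (sphi x1)).
have Vr1 : V r1.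
 by apply: (sgM sV); [apply: sgM => //; apply: sgV|apply: sgV => //; apply: sg_conj].
have hr1 : ut i.+2 r1.
 apply: ut_step => // a b ab; rewrite e2 ?ab // e1 ?ab // ecV ?ab // ec ?ab // ev ?ab // eJV ?ab //.
 rewrite epV ?ab // eJ ?ab // !(ut_diag _ (V1 _ Vx0)); rewrite divr1 mul1r; ring.
have [||c' [x' [Vc' Vx' cs' e']]] := IH i.+1 (x0 *m x1) _ _ r1 Vr1 hr1.
- by lia.
- exact: sgM.
exists (c *m c'), (x1 *m x'); split; [exact: sgM|exact: sgM|by rewrite -mulmxA cs' mulmxA cs mulmxA|].
have uJ : mxconj x0 (sphi x1) \in unitmx by rewrite mxconj_unit (sg_gl sV).
rewrite [x0 *m (x1 *m x')]mulmxA -[c *m c' *m _]mulmxA -e' sphiM // /r1.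
move: mxconj sphi uJ => J p uJ.
by rewrite !mulmxA mulmxV // mul1mx mulmxKV.
Qed.

(** Entries of [m] joining different eigenvalues vanish because [m] commutes with [s]; for equal
    eigenvalues [sst_level] compares two conjugates of [s]. *)
Lemma sphi_uniq m x y : m \in unitmx -> ut 1 m -> ut 1 x -> ut 1 y -> sst s -> m *m s = s *m m ->
 m *m sphi x = sphi y -> m = 1%:M.
move=> um h1 hx hy ss ms e; apply: ut_all => // i hi; apply: ut_step => // a b ab.
have [dab|ne] := eqVneq (s a a) (s b b); last first.
 have e1 : (s *m (m - 1%:M)) a b = ((m - 1%:M) *m s) a b by rewrite mulmxBl mulmxBr ms mul1mx mulmx1.
 move: e1; rewrite (levEl ts hi) ?(levEr ts hi) ?ab // mulrC => /eqP; rewrite -subr_eq0 -mulrBr.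
 by rewrite mulf_eq0 subr_eq0 (negbTE ne) orbF => /eqP.
have ux := ut_unit hx; have uy := ut_unit hy.
have e2 : m *m mxconj x s = mxconj y s.
 by have := congr1 (fun z => z *m s) e; rewrite !mulmxA !mulmxKV // !mulmxA.
have dJ z : ut 1 z -> trig (mxconj z s) /\ forall a, mxconj z s a a = s a a.
 move=> hz; have [hV _] := utV hz.
 have t1 := trigM (ut_trig hz) ts; split; first exact: trigM (ut_trig hV).
 move=> c; rewrite trigM_diag ?(ut_trig hV) // trigM_diag ?(ut_trig hz) //.
 by rewrite (ut_diag c hz) (ut_diag c hV) mul1r mulr1.
have [tx dx] := dJ _ hx; have [ty dy] := dJ _ hy.
have eE : mxconj y s - mxconj x s = (m - 1%:M) *m mxconj x s by rewrite mulmxBl mul1mx e2.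
have lE : lev i.+1 (mxconj y s - mxconj x s).
 by rewrite eE -[i.+1]addn0; apply: levM => //; apply/lev_trig.
have : (mxconj y s - mxconj x s) a b = 0.
 apply: (sst_level tx ty _ _ _ lE); rewrite ?ab ?dx //; try exact: sst_conj.
 by move=> c; rewrite dy.
rewrite eE (levEr tx hi) ?ab // dx => /eqP; rewrite mulf_eq0 (negbTE (sdn b)) orbF => /eqP //.
Qed.

(** Let [K] be the fixed group. [A c] is the coset of [c] modulo the identity component of [K],
    multiplied by the commutators [sphi] of [V]. Finitely many of these sets cover [V], and they are
    translates of each other: one is dense, so all are, so any two meet, and [sphi_uniq] then
    identifies their cosets. *)
Lemma irr_fixed V : cgrp V -> V `<=` @ut 1 -> nrm V -> sst s -> irr V -> irr (V `&` cent [set s]).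
move=> cV V1 nV ss iV; set K := V `&` _; have [sV zV] := cV.
have cK : cgrp K by apply: cgrpI => //; apply: cent_cgrp.
have [sK _] := cK; have [cK0 iK0 _] := gcompP cK; have [sK0 zK0] := cK0.
have mphi : mor V sphi.
 apply: mor_mulr; apply: mor_mul2; first by apply: mor_mulr; apply: morI.
 by apply: mor_inv; [exact: morI|move=> v /(sg_gl sV)].
pose A c : set M := [set z | exists x y, [/\ [set x | K x /\ gcomp K (invmx c *m x)] x, (sphi @` V) y & z = x *m y]].
have AV c : K c -> A c `<=` V.
 by move=> [Vc _] z [x [y [[[Vx _] _] [v Vv <-] ->]]]; apply: sgM => //; apply: sphi_in.
have cA c : cst (A c).
 apply: cst_mul; first by apply: cst_closed; apply: closedI; [case: cK|exact: closed_coset].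
 by apply: cst_image => //; apply: cst_closed.
have At c d : K c -> K d -> [set d *m invmx c *m x | x in A c] `<=` A d.
 move=> Kc Kd _ [_ [x [y [/= [Kx K0x] py ->]]] <-]; have ud := sg_gl sK Kd.
 exists (d *m (invmx c *m x)), y; split=> //; last by rewrite !mulmxA.
 split; last by rewrite mulKmx.
 by apply: sgM => //; apply: sgM => //; apply: sgV.
have dA c d : K c -> K d -> V `<=` cl (A c) -> V `<=` cl (A d).
 move=> Kc Kd h; apply: subset_trans (cl_mono (At c d Kc Kd)).
 have uc := sg_gl sK Kc; have ud := sg_gl sK Kd.
 apply: dense_mull => //; first by rewrite unitmx_mul ud unitmx_inv.
 move=> v Vv; apply: sgM => //; apply: sgV => //; apply: sgM => //; first by case: Kd.
 by apply: sgV; case: Kc.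
have [sq [usq hsq]] := gcomp_fin cK.
have [||g [gs Vg]] := irr_sub_bigU (s := sq) (F := fun g => cl (A g)) iV.
- by move=> g; apply: cl_closed.
- move=> v Vv; have [c [x [Vc Vx cs ->]]] := sphi_cover cV V1 nV ss Vv.
 have Kc : K c by split=> //; split=> [|t ->]; [exact: sg_gl Vc|].
 have [g [gs K0]] := hsq c Kc; exists g; split=> //; apply: sub_cl.
 by exists c, (sphi x).
have [c Kc ec] : exists2 c, K c & A g `<=` A c.
 have [v Vv] := iV.1.
 have [e|/set0P[_ [x [_ [/= [Kx K0] _ _]]]]] := eqVneq (A g) set0.
  have : (1 : k) = 0 by apply: (Vg v Vv (fun=> 1) (polC _)); rewrite e.
  by move/eqP; rewrite oner_eq0.
 exists x => // _ [y [z [/= [Ky K0y] pz ->]]]; exists y, z.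
 have := sgM sK0 (sgV sK0 K0) K0y; have ug := usq _ gs; have ux := sg_gl sK Kx.
 by rewrite invmxM ?unitmx_inv // invmxK mulmxA mulmxK.
have {Vg} Vc : V `<=` cl (A c) by move=> v /Vg; apply: cl_mono.
suff -> : K = gcomp K by [].
apply/seteqP; split=> [d Kd|]; last exact: gcomp_sub.
have K1 := sg1 sK.
have [z [_]] : exists z, [/\ V z, A 1%:M z & A d z].
 apply: dense_meet => //.
  by move=> v /(dA _ _ Kc K1 Vc); apply: cl_mono => z Az; split=> //; apply: AV Az.
 by move=> v /(dA _ _ Kc Kd Vc); apply: cl_mono => z Az; split=> //; apply: AV Az.
move=> [x [_ [/= [Kx K0x] [v Vv <-] ->]]] [x' [_ [/= [Kx' K0x'] [v' Vv' <-] e]]].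
rewrite invmx1 mul1mx in K0x.
have ux := sg_gl sK Kx.
have ux' := sg_gl sK Kx'; have ud := sg_gl sK Kd.
have /sphi_uniq : invmx x' *m x *m sphi v = sphi v' by rewrite -mulmxA e mulKmx.
have [Vz [uz cz]] : K (invmx x' *m x) by apply: sgM => //; apply: sgV.
move=> /(_ uz (V1 _ Vz) (V1 _ Vv) (V1 _ Vv') ss (cz _ erefl)) /(congr1 (mulmx x')).
rewrite mulKVmx // mulmx1 => xx; rewrite -xx in K0x'.
have := sgM sK0 K0x (sgV sK0 K0x'); rewrite invmxM ?unitmx_inv // invmxK mulmxA mulmxV // mul1mx.
by [].
Qed.

End Normalized.
End Levels.

(** * Maximal tori of connected solvable groups *)

Section Tori.
Context {k : closedFieldType} {n : nat}.
Local Notation M := 'M[k]_n.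
Implicit Types (S T G C : set M) (x y g s t : M).

Definition torus T := [/\ cgrp T, irr T & diagonalizable_group T].
Definition maxtor G T := [/\ torus T, T `<=` G & forall S, torus S -> S `<=` G -> T `<=` S -> S `<=` T].

Lemma torus_cj g T : g \in unitmx -> torus T -> torus (cj g T).
by move=> ug [cT iT dT]; split; [exact: cj_cgrp|exact: cj_irr|exact: diag_group_cj]. Qed.

Lemma cjK g S : g \in unitmx -> cj (invmx g) (cj g S) = S.
move=> ug; apply/seteqP; split=> [_ [_ [x Sx <-] <-]|x Sx]; first by rewrite mxconjK.
by exists (mxconj g x); [exists x|rewrite mxconjK].
Qed.

Lemma cjVK g S : g \in unitmx -> cj g (cj (invmx g) S) = S.
by move=> ug; rewrite -{1}[g]invmxK cjK // unitmx_inv. Qed.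

Lemma cj_mono g S T : S `<=` T -> cj g S `<=` cj g T.
by move=> h _ [x /h Tx <-]; exists x. Qed.

Lemma cj_id G g : subgroup G -> G g -> cj g G = G.
move=> sG Gg; have ug := sg_gl sG Gg; apply/seteqP; split=> [_ [x Gx <-]|x Gx]; first exact: sg_conj.
by apply/cjP => //; apply: sg_conj => //; apply: sgV.
Qed.

Lemma maxtor_cj g G T : g \in unitmx -> maxtor G T -> maxtor (cj g G) (cj g T).
move=> ug [tT TG mT]; split; [exact: torus_cj|exact: cj_mono|].
move=> S tS SG TS; rewrite -(cjVK S ug); apply: cj_mono; apply: mT.
- by apply: torus_cj; rewrite ?unitmx_inv.
- by rewrite -(cjK G ug); apply: cj_mono.
- by rewrite -(cjK T ug); apply: cj_mono.
Qed.

Lemma maxtor_sub G C T : T `<=` C -> C `<=` G -> maxtor G T -> maxtor C T.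
by move=> TC CG [tT TG mT]; split=> // S tS /subset_trans/(_ CG); apply: mT. Qed.

(** Two diagonal entries that do not agree on all of [T] agree on a proper closed subset; [s] avoids
    these finitely many subsets of the irreducible [T]. *)
Lemma regular_element T : torus T -> exists2 s, T s &
 forall g, g *m s = s *m g -> forall t, T t -> g *m t = t *m g.
move=> [[sT cT] iT [P uP dP]].
pose F ab x := mxconj P x ab.1 ab.1 - mxconj P x ab.2 ab.2.
have pF ab : pol (F ab).
 by apply: polB; apply: polmxM; try exact: polmxC; apply: polmxM; [exact: polmxC|exact: polmx_id|exact: polmxC|exact: polmx_id].
have [s Ts hs] : exists2 s, T s & forall ab, (exists2 t, T t & F ab t != 0) -> F ab s != 0.
 have [|s Ts hs] := irr_prod_neq0
  (s := [seq ab <- enum {: 'I_n * 'I_n} | `[< exists2 t, T t & F ab t != 0 >]]) iT pF.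
  by move=> ab /mem_In; rewrite mem_filter => /andP[/asboolP].
 exists s => // ab hab; apply: hs; apply/mem_In; rewrite mem_filter mem_enum andbT.
 exact/asboolP.
exists s => // g gs t Tt; apply: (can_inj (fun z => mxconjK z uP)).
have := congr1 (mxconj P) gs; rewrite !mxconjM //.
have /is_diag_mxP ds := dP _ Ts; have /is_diag_mxP dt := dP _ Tt.
have mulE (h d : M) a b : (forall i j : 'I_n, i != j :> nat -> d i j = 0) ->
  (h *m d) a b = h a b * d b b /\ (d *m h) a b = d a a * h a b.
 move=> hd; split; rewrite mxE; [rewrite (bigD1 b)|rewrite (bigD1 a)] => //=.
  by rewrite big1 ?addr0 // => l lb; rewrite hd ?mulr0.
 by rewrite big1 ?addr0 // => l lb; rewrite hd ?mul0r //; apply: contraNneq lb => /val_inj ->.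
move=> /matrixP h; apply/matrixP => a b; have := h a b.
have [-> ->] := mulE (mxconj P g) _ a b ds; have [-> ->] := mulE (mxconj P g) _ a b dt.
rewrite mulrC => /eqP; rewrite -subr_eq0 -mulrBl mulf_eq0 => /orP[e|/eqP ->]; last by rewrite mulr0 mul0r.
rewrite mulrC; congr (_ * _); apply/eqP; rewrite -subr_eq0; apply: contraTT e => ne.
by apply: (hs (b, a)); exists t.
Qed.

Lemma torus_mul G T S : cgrp G -> T `<=` G -> S `<=` G -> torus T -> torus S ->
 (forall t s, T t -> S s -> t *m s = s *m t) ->
 exists2 T', torus T' & [/\ T' `<=` G, T `<=` T' & S `<=` T'].
move=> [sG zG] TG SG [[sT zT] iT dT] [[sS zS] iS dS] com.
pose A : set M := [set x | exists t s, [/\ T t, S s & x = t *m s]].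
have iA : irr A by apply: irr_mul.
have sA : subgroup A.
 split=> [x [t [s [/sg_gl ut /(sg_gl sS) us ->]]]||_ _ [t [s [Tt Ss ->]]] [t' [s' [Tt' Ss' ->]]]|_ [t [s [Tt Ss ->]]]].
 - by rewrite /gl /= unitmx_mul ut.
 - by exists 1%:M, 1%:M; split; [exact: sg1|exact: sg1|rewrite mul1mx].
 - exists (t *m t'), (s *m s'); split; [exact: sgM|exact: sgM|].
  by rewrite -!mulmxA; congr (_ *m _); rewrite !mulmxA (com t' s).
 - exists (invmx t), (invmx s); split; [exact: sgV|exact: sgV|].
  rewrite invmxM ?(sg_gl sT Tt) ?(sg_gl sS Ss) //.
  have := com _ _ (sgV sT Tt) (sgV sS Ss) => <- //.
have [P uP dP] : diagonalizable_group (T `|` S).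
 apply: sst_set => [x y [Tx|Sx] [Ty|Sy]|x [Tx|Sx]].
 - exact: diag_group_comm dT _ _.
 - exact: com.
 - by apply: esym; apply: com.
 - exact: diag_group_comm dS _ _.
 - exact: diag_group_sst dT _.
 - exact: diag_group_sst dS _.
have AP : A `<=` [set x | is_diag_mx (mxconj P x)].
 move=> _ [t [s [Tt Ss ->]]] /=.
 rewrite mxconjM //; have /is_diag_mxP h1 := dP t (or_introl Tt).
 have /is_diag_mxP h2 := dP s (or_intror Ss); apply/is_diag_mxP => a b ab.
 rewrite mxE big1 // => l _; have [e|ne] := eqVneq a l; last by rewrite h1 ?mul0r.
 by rewrite h2 ?mulr0 // -e.
exists (cl A); split.
- exact: cl_cgrp.
- exact: irr_cl.
- by exists P => // x /(cl_sub (@closed_diag _ _ P) AP).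
- by apply: cl_sub zG _ => _ [t [s [/TG Gt /SG Gs ->]]]; apply: sgM.
- by apply: subset_trans (@sub_cl _ _ _ A) => t Tt; exists t, 1%:M; rewrite mulmx1; split=> //; exact: sg1.
- by apply: subset_trans (@sub_cl _ _ _ A) => s Ss; exists 1%:M, s; rewrite mul1mx; split=> //; exact: sg1.
Qed.

End Tori.

(** * Connected solvable groups in triangular form *)

Section SolvTrig.
Context {k : closedFieldType} {n' : nat}.
Local Notation n := n'.+1.
Local Notation M := 'M[k]_n.
Implicit Types (S T G C D : set M) (x y g s t r c : M).

Definition dmx x : M := diag_mx (\row_i x i i).

Lemma dmxM x y : trig x -> trig y -> dmx (x *m y) = dmx x *m dmx y.
by move=> tx ty; rewrite mulmx_diag; congr diag_mx; apply/rowP => i; rewrite !mxE -trigM_diag // mxE.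
Qed.

Lemma dmx_eq x y : (dmx x = dmx y) <-> forall i, x i i = y i i.
split=> [h i|h]; last by congr diag_mx; apply/rowP => i; rewrite !mxE.
by have /matrixP/(_ i i) := h; rewrite !mxE eqxx.
Qed.

Lemma dmx_trig x : trig (dmx x).
exact: diag_mx_is_trig. Qed.

Lemma dmxE x i : dmx x i i = x i i.
by rewrite !mxE eqxx. Qed.

Lemma dmx_det x : trig x -> \det (dmx x) = \det x.
move=> tx; rewrite !det_trig ?dmx_trig //.
by apply: eq_bigr => i _; rewrite dmxE.
Qed.

Lemma dmx_unit x : trig x -> (dmx x \in unitmx) = (x \in unitmx).
by move=> tx; rewrite !unitmxE dmx_det. Qed.

Lemma dmx1 : dmx 1%:M = 1%:M.
by apply/matrixP => i j; rewrite !mxE eqxx. Qed.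

Lemma dmxV x : trig x -> x \in unitmx -> dmx (invmx x) = invmx (dmx x).
move=> tx ux; have ud : dmx x \in unitmx by rewrite dmx_unit.
by rewrite -[LHS](mulmxK ud) -dmxM ?trigV // mulVmx // dmx1 mul1mx.
Qed.

Lemma mor_dmx C : (forall c, C c -> trig c) -> mor C dmx.
move=> tC; apply: mor_mx => [i j|].
 exists (fun x => (x i i) *+ (i == j)); last by move=> x _; rewrite !mxE.
 by case: (i == j); [exact: polmx_id|exact: polC].
by exists (fun x => (\det x)^-1); [exact: pol_detV|move=> x /tC tx; rewrite dmx_det].
Qed.

Lemma dmx_cgrp C : cgrp C -> (forall c, C c -> trig c) -> cgrp (dmx @` C).
move=> [sC zC] tC.
have sD : subgroup (dmx @` C).
 split=> [_ [c Cc <-]||_ _ [c Cc <-] [d Cd <-]|_ [c Cc <-]].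
 - by rewrite /gl /= dmx_unit ?tC // (sg_gl sC).
 - by exists 1%:M; rewrite ?dmx1 //; exact: sg1.
 - by exists (c *m d); [exact: sgM|rewrite dmxM //; exact: tC].
 - by exists (invmx c); [exact: sgV|rewrite dmxV ?tC // (sg_gl sC)].
split=> //; apply: cst_sg_closed => //; apply: cst_image; first exact: cst_closed.
exact: mor_dmx.
Qed.

Lemma dmx_irr C : irr C -> (forall c, C c -> trig c) -> irr (dmx @` C).
by move=> iC tC; apply: irr_image => //; apply: mor_dmx. Qed.

(** Passing to the identity component of [K] loses no diagonal parts: they form an irreducible
    group, in which those of the component have finite index. *)
Lemma dmx_gcomp C K : irr C -> cgrp C -> (forall c, C c -> trig c) -> cgrp K -> K `<=` C ->
 (forall c, C c -> exists2 d, K d & forall i, c i i = d i i) ->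
 forall c, C c -> exists2 d, gcomp K d & forall i, c i i = d i i.
move=> iC cC tC cK KC hK; have [cK0 iK0 _] := gcompP cK.
have tK c : K c -> trig c by move=> /KC/tC.
have tK0 c : gcomp K c -> trig c by move=> /gcomp_sub/tK.
have h : dmx @` C `<=` dmx @` gcomp K.
 apply: irr_fin_index; [exact: dmx_irr| |exact: dmx_cgrp|].
  by exists 1%:M; [exact: sg1 cC.1|exact: dmx1].
 have [sq [usq hsq]] := gcomp_fin cK.
 exists [seq dmx g | g <- [seq g <- sq | `[< K g >]]]; split=> [_ /List.in_map_iff[g [<-]]|_ [c Cc <-]].
  by move=> /mem_In; rewrite mem_filter => /andP[/asboolP Kg _]; rewrite dmx_unit ?tK // (sg_gl cK.1).
 have [d Kd cd] := hK _ Cc; have [g [gs K0]] := hsq d Kd.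
 have ug := usq _ gs; have ud := sg_gl cK.1 Kd.
 have Kg : K g.
  have := sgM cK.1 Kd (sgV cK.1 (gcomp_sub K0)).
  by rewrite invmxM ?unitmx_inv // invmxK mulmxA mulmxV // mul1mx.
 exists (dmx g); split.
  apply/List.in_map_iff; exists g; split=> //; apply/mem_In; rewrite mem_filter.
  by apply/andP; split; [exact/asboolP|exact/mem_In].
 exists (invmx g *m d) => //; rewrite ((dmx_eq c d).2 cd) dmxM ?dmxV ?tK //.
 exact: sgV cK.1 _.
by move=> c Cc; have [|d K0d /dmx_eq e] := h (dmx c); [exists c|exists d].
Qed.

Local Notation rad C := (C `&` @ut k n' 1).

Section One.
Variables (C : set M).
Hypotheses (cC : cgrp C) (tC : forall c, C c -> trig c).
Let R := rad C.

Lemma crad : cgrp R.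
by apply: cgrpI => //; apply: ut_cgrp. Qed.

Lemma rad_nrm s : C s -> nrm s R.
move=> Cs x [Cx hx]; split; first exact: sg_conj cC.1 _ _.
by have [] := utJ (tC Cs) (sg_gl cC.1 Cs) hx.
Qed.

Lemma rad_div c d : C c -> C d -> (forall i, c i i = d i i) -> R (c *m invmx d).
move=> Cc Cd e; have [sC _] := cC; have ud := sg_gl sC Cd; have td := tC Cd.
split; first by apply: sgM => //; apply: sgV.
apply: ut1P; first by apply: trigM; [exact: tC|exact: trigV].
move=> i; rewrite trigM_diag ?trigV ?tC // e.
by rewrite -[X in _ * X]dmxE dmxV // -dmxE -trigM_diag ?trigV ?dmx_trig ?dmx_unit // mulmxV ?dmx_unit // mxE eqxx.
Qed.

Lemma rad_comm c s : C c -> C s -> R (mxconj c s *m invmx s).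
move=> Cc Cs; have [sC _] := cC; apply: rad_div => //; first exact: sg_conj.
move=> i; have uc := sg_gl sC Cc; have tc := tC Cc; have ts := tC Cs.
have tv := trigV tc uc; rewrite trigM_diag ?trigM // trigM_diag // mulrAC -trigM_diag //.
by rewrite mulmxV // mxE eqxx mul1r.
Qed.

(** The commutator of [c] and [s] is unipotent, so by [conj_sst] the conjugate of [s] by [c] is also
    its conjugate by some unipotent [x]; then [invmx x *m c] centralizes [s] and has the diagonal of
    [c]. *)
Lemma cent_diag s c : C s -> sst s -> C c -> exists2 d, (C `&` cent [set s]) d & forall i, c i i = d i i.
move=> Cs ss Cc; have [sC _] := cC; have us := sg_gl sC Cs; have uc := sg_gl sC Cc.
have [||x [Cx hx] e] := conj_sst (tC Cs) us crad _ (rad_nrm Cs) ss (rad_comm Cc Cs).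
- by move=> ? [].
- by rewrite mulmxKV //; apply: sst_conj.
rewrite mulmxKV // in e; have ux := sg_gl sC Cx.
exists (invmx x *m c); last first.
 by have [hV _] := utV hx => i; rewrite trigM_diag ?(ut_trig hV) ?tC // (ut_diag i hV) mul1r.
split; first by apply: sgM => //; apply: sgV.
split=> [|_ ->]; first by rewrite unitmx_mul unitmx_inv ux.
have := congr1 (fun z => invmx x *m z *m c) e.
by rewrite !mulmxA mulmxKV // mulVmx // mul1mx => ->.
Qed.

End One.

(* A minimal closed irreducible subgroup with the same diagonal parts centralizes its own semisimple elements. *)
Lemma torus_cover C T : cgrp C -> irr C -> (forall c, C c -> trig c) -> maxtor C T ->
 forall c, C c -> exists2 t, T t & forall i, c i i = t i i.
move=> cC iC tC [[cT iT dT] TC mT]; have [sT zT] := cT.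
have [|Z [[]//]|D [cD iD TD [DC hD]] minD] := closed_min (F := [set D | [/\ cgrp D, irr D, T `<=` D &
  D `<=` C /\ forall c, C c -> exists2 d, D d & forall i, c i i = d i i]]).
 by exists C; split=> //; split=> // c Cc; exists c.
have tD c : D c -> trig c by move=> /DC/tC.
have cen s : D s -> sst s -> (forall t, T t -> t *m s = s *m t) -> D `<=` cent [set s].
 move=> Ds ss sT'; pose K := D `&` cent [set s].
 have cK : cgrp K by apply: cgrpI => //; apply: cent_cgrp.
 have [cK0 iK0 mK0] := gcompP cK.
 have : D `<=` gcomp K.
  apply: minD; last by move=> x /gcomp_sub[].
  split=> //.
   apply: mK0 => //; last exact: sg1.
   by move=> t Tt; split; [exact: TD|split=> [|_ ->]; [exact: sg_gl sT Tt|exact: sT']].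
  split; first by move=> x /gcomp_sub[/DC].
  move=> c Cc; have [d Dd cd] := hD _ Cc.
  have [|d' K0d' dd'] := dmx_gcomp iD cD tD cK (fun x => @proj1 _ _) _ Dd.
   by move=> e De; apply: cent_diag.
  by exists d' => // i; rewrite cd.
 by move=> h x /h/gcomp_sub[].
have cenT t : T t -> D `<=` cent [set t].
 move=> Tt; apply: cen; [exact: TD|exact: diag_group_sst Tt|move=> t' Tt'; exact: diag_group_comm dT _ _].
have censt s : D s -> sst s -> D `<=` cent [set s].
 by move=> Ds ss; apply: cen => // t Tt; have [_ ->] := cenT _ Tt _ Ds.
(* The semisimple elements of [D] commute, so they lie in one diagonalizable closed group [S], whose
   identity component is in [T] by maximality. By the Jordan decomposition they carry all diagonal
   parts. *)
have [P uP dP] : diagonalizable_group [set s | D s /\ sst s].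
 apply: sst_set => [x y [Dx sx] [Dy sy]|x []//]; by have [_ ->] := censt _ Dy sy _ Dx.
pose S := D `&` [set x | is_diag_mx (mxconj P x)].
have Sst x : D x -> sst x -> S x by move=> Dx sx; split=> //; apply: dP.
have [sD zD] := cD.
have cS : cgrp S.
 split; last by apply: closedI => //; apply: closed_diag.
 split=> [x [/(sg_gl sD)//]||x y [Dx dx] [Dy dy]|x [Dx dx]].
 - split; first exact: sg1.
  by rewrite /= mxconj1.
 - split; first exact: sgM.
  rewrite /= mxconjM //; move: dx dy => /is_diag_mxP h1 /is_diag_mxP h2; apply/is_diag_mxP => a b ab.
  rewrite mxE big1 // => l _; have [e|ne] := eqVneq a l; last by rewrite h1 ?mul0r.
  by rewrite h2 ?mulr0 // -e.
 - split; first exact: sgV.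
  have ux := sg_gl sD Dx; rewrite /= mxconjV //.
  have /diag_mxP[d ed] := dx; have := mxconj_unit x uP; rewrite ux ed => ud.
  have dd i : d 0 i != 0 by move: ud; rewrite unitmxE det_diag unitfE => /prodf_neq0/(_ i isT).
  rewrite (_ : invmx _ = diag_mx (\row_i (d 0 i)^-1)) //.
  rewrite -[RHS](mulmxK ud) mulmx_diag (_ : diag_mx _ = 1%:M) ?mul1mx //.
  by apply/matrixP => a b; rewrite !mxE mulVf.
have [cS0 iS0 mS0] := gcompP cS.
have S0T : gcomp S `<=` T.
 apply: mT.
 - split=> //; exists P => // t /gcomp_sub[] //.
 - by move=> x /gcomp_sub[/DC].
 - by apply: mS0 => //; [move=> t Tt; apply: Sst; [exact: TD|exact: diag_group_sst Tt]|exact: sg1].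
move=> c Cc; have [d Dd cd] := hD _ Cc.
have [|d' S0d' dd'] := dmx_gcomp iD cD tD cS (fun x => @proj1 _ _) _ Dd.
 move=> e De; have [s [Ds ss ts es]] := jordan_trig cD De (tD _ De).
 by exists s; [exact: Sst|move=> i].
by exists d' => [|i]; [exact: S0T|rewrite cd].
Qed.

Lemma no_torus_ut C : cgrp C -> irr C -> (forall c, C c -> trig c) ->
 (forall S, torus S -> S `<=` C -> S `<=` [set 1%:M]) -> C `<=` @ut k n' 1.
move=> cC iC tC nt c Cc.
have [|t -> ct] := torus_cover (T := [set 1%:M]) cC iC tC _ Cc.
 have s1 : subgroup [set 1%:M : M].
  by split=> [_ ->||_ _ -> ->|_ ->]; rewrite ?mulmx1 ?invmx1 // /gl /= unitmx1.
 split; last by move=> S tS SC _; apply: nt.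
  split; [split=> //; exact: cl1|exact: irr1|exists 1%:M; rewrite ?unitmx1 // => _ ->].
  by rewrite mxconj1 ?unitmx1.
 by move=> _ ->; apply: sg1 cC.1.
by apply: ut1P; [exact: tC|move=> i; rewrite ct mxE eqxx].
Qed.

Section Two.
Variables (C T : set M).
Hypotheses (cC : cgrp C) (iC : irr C) (tC : forall c, C c -> trig c) (mT : maxtor C T).

Lemma rad_torus c : C c -> exists r t, [/\ rad C r, T t & c = r *m t].
move=> Cc; have [t Tt ct] := torus_cover cC iC tC mT Cc; have [_ TC _] := mT.
have Ct := TC _ Tt; exists (c *m invmx t), t; split=> //; first exact: rad_div.
by rewrite mulmxKV // (sg_gl cC.1).
Qed.

(** The identity component of the radical times [T] is closed of finite index in [C], hence all of
    [C]; a unipotent element then has trivial factor in [T]. *)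
Lemma rad_irr : irr (rad C).
have cR := crad cC; have [cR0 iR0 _] := gcompP cR; have [[[sT zT] iT dT] TC _] := mT.
have [sC zC] := cC; have [sR _] := cR; have [sR0 _] := cR0.
have nR0 t x : T t -> gcomp (rad C) x -> gcomp (rad C) (mxconj t x).
 move=> Tt; apply: gcomp_conj => //; last exact: sg_gl sT Tt.
 by apply: rad_nrm => //; apply: TC.
pose A : set M := [set x | exists r t, [/\ gcomp (rad C) r, T t & x = r *m t]].
have sA : subgroup A.
 split=> [_ [r [t [/sg_gl ur /(sg_gl sT) ut ->]]]||_ _ [r [t [Rr Tt ->]]] [r' [t' [Rr' Tt' ->]]]|_ [r [t [Rr Tt ->]]]].
 - by rewrite /gl /= unitmx_mul ur.
 - by exists 1%:M, 1%:M; rewrite mul1mx; split=> //; exact: sg1.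
 - exists (r *m mxconj t r'), (t *m t'); split; [by apply: sgM => //; apply: nR0|exact: sgM|].
  by rewrite !mulmxA mulmxKV // (sg_gl sT).
 - have ut := sg_gl sT Tt; have ur := sg_gl sR0 Rr.
  exists (mxconj (invmx t) (invmx r)), (invmx t); split; [|exact: sgV|].
   by apply: nR0; exact: sgV.
  by rewrite /mxconj invmxK mulmxK // invmxM.
have cA : cgrp A.
 by split=> //; apply: cst_sg_closed => //; apply: cst_mul; apply: cst_closed; case: cR0.
have CA : C `<=` A.
 apply: irr_fin_index => //; first exact: sg1.
 have [sq [usq hsq]] := gcomp_fin cR; exists sq; split=> // c Cc.
 have [r [t [Rr Tt ->]]] := rad_torus Cc; have [g [gs K0]] := hsq _ Rr; exists g; split=> //.
 by exists (invmx g *m r), t; rewrite mulmxA.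
suff -> : rad C = gcomp (rad C) by [].
apply/seteqP; split=> [x Rx|]; last exact: gcomp_sub.
have [r [t [R0r Tt e]]] := CA _ Rx.1; rewrite e.
suff -> : t = 1%:M by rewrite mulmx1.
have [_ ht] : rad C t.
 by rewrite -[t](mulKmx (sg_gl sR0 R0r)) -e; apply: sgM => //; apply: sgV => //; apply: gcomp_sub.
by apply: sst_ut1 => //; apply: diag_group_sst Tt.
Qed.

(** Centralizing [T] amounts to centralizing one regular [s], so the group is the product of [T]
    with the fixed group of [s] in the radical, connected by [irr_fixed]. *)
Lemma irr_cent_trig : irr (C `&` cent T).
have [tT TC _] := mT; have [[sT zT] iT dT] := tT; have [sC _] := cC.
have [s Ts hs] := regular_element tT; have ss := diag_group_sst dT Ts; have Cs := TC _ Ts.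
have us := sg_gl sT Ts.
have iRs : irr (rad C `&` cent [set s]).
 apply: irr_fixed => //; [exact: tC|exact: crad|exact: rad_nrm|exact: rad_irr].
have := irr_mul iRs iT; congr irr; apply/seteqP; split=> [_ [r [t [[[Cr _] [ur rs]] Tt ->]]]|c [Cc [uc cT]]].
 have Ct := TC _ Tt; split; first exact: sgM.
 split=> [|t' Tt']; first by rewrite unitmx_mul ur (sg_gl sT).
 rewrite -mulmxA (diag_group_comm dT Tt Tt') !mulmxA; congr (_ *m _).
 by apply: hs => //; apply: rs.
have [r [t [Rr Tt e]]] := rad_torus Cc; have ut := sg_gl sT Tt.
exists r, t; split=> //; split=> //; have ur := sg_gl (crad cC).1 Rr; split=> // _ ->.
have er : r = c *m invmx t by rewrite e mulmxK.
by rewrite er -mulmxA (diag_group_comm dT (sgV sT Tt) Ts) !mulmxA cT.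
Qed.

(** A regular [s] of [S] is [r *m t], and [conj_sst] conjugates [t] to [s]. The conjugate of [T]
    then commutes with [s], hence with [S]; the two tori generate a torus, and both are maximal in
    [G]. *)
Lemma tori_conj_trig G S : cgrp G -> C `<=` G -> maxtor G T -> maxtor G S -> S `<=` C ->
 exists2 x, C x & cj x T = S.
move=> cG CG mGT mGS SC; have [tT TC _] := mT; have [tS _ maxS] := mGS.
have [[sT zT] iT dT] := tT; have [[sS zS] iS dS] := tS; have [sC _] := cC.
have [s Ss hs] := regular_element tS; have ss := diag_group_sst dS Ss; have Cs := SC _ Ss.
have [r [t [Rr Tt e]]] := rad_torus Cs; have Ct := TC _ Tt; have ut := sg_gl sT Tt.
have [||x [Cx hx] ex] := conj_sst (tC Ct) ut (crad cC) _ (rad_nrm cC tC Ct) (diag_group_sst dT Tt) Rr.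
- by [].
- by rewrite -e.
have ux := sg_gl sC Cx; exists x => //.
have [||t' _ St' [z Tz <-]|T' tT' [T'G ST' xT']] := torus_mul cG _ _ tS (torus_cj ux tT).
- by move=> y /SC/CG.
- by move=> _ [y Ty <-]; apply: CG; apply: sg_conj => //; apply: TC.
- move: (St'); have : mxconj x z *m s = s *m mxconj x z.
  by rewrite e ex -!mxconjM // (diag_group_comm dT Tz).
 by move=> /hs h /h.
apply/seteqP; split; first by apply: subset_trans xT' _; apply: maxS.
have [_ _ maxT] := maxtor_cj ux mGT; rewrite (cj_id cG.1 (CG _ Cx)) in maxT.
apply: subset_trans ST' _; exact: maxT.
Qed.

End Two.
End SolvTrig.

Section SolvGroup.
Context {k : closedFieldType} {n : nat}.
Local Notation M := 'M[k]_n.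
Implicit Types (S T G C : set M).

Lemma trigonalize C : subgroup C -> irr C -> solvable_group C ->
 exists2 y, y \in unitmx & forall c, cj y C c -> trig c.
move=> sC iC solC.
have [||y c Cc uy|y t uy ut|y uy h] := borel_fixed_point sC iC solC closed_gl.
- by exists 1%:M; rewrite /gl /= unitmx1.
- by [].
- by rewrite /gl /= unitmx_mul (sg_gl sC Cc).
- by rewrite /gl /= unitmx_mul uy.
exists (invmx y); first by rewrite unitmx_inv.
by move=> _ [c Cc <-]; rewrite /mxconj invmxK; apply: h.
Qed.

Lemma cj_cent g S : g \in unitmx -> cj g (cent S) = cent (cj g S).
move=> ug; apply/seteqP; split=> [_ [x [ux xS] <-]|x [ux xS]].
 split=> [|_ [t St <-]]; first by rewrite mxconj_unit.
 by rewrite -!mxconjM // xS.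
apply/cjP => //; split=> [|t St]; first by rewrite mxconj_unit ?unitmx_inv.
rewrite -{1 2}[t](mxconjK _ ug) -!mxconjM ?unitmx_inv //.
by rewrite xS //; exists t.
Qed.

Lemma cjI g S T : g \in unitmx -> cj g (S `&` T) = cj g S `&` cj g T.
by move=> ug; apply/seteqP; split=> x; [move=> /cjP[]// ? ?; split; apply/cjP|move=> [/cjP ? /cjP ?]; apply/cjP => //; split; auto].
Qed.

End SolvGroup.

Lemma irr_cent {k : closedFieldType} {n} (C T : set 'M[k]_n) : cgrp C -> irr C -> solvable_group C -> maxtor C T -> irr (C `&` cent T).
case: n C T => [|n'] C T cC iC solC mT.
 rewrite (_ : C `&` _ = C) //; apply/seteqP; split=> [x []//|x Cx]; split=> //.
 by split=> [|t _]; [exact: sg_gl cC.1 Cx|apply/matrixP => -[]].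
have [y uy tr] := trigonalize cC.1 iC solC.
rewrite -(cjK (C `&` _) uy); apply: cj_irr; rewrite cjI // cj_cent //.
apply: irr_cent_trig => //; [exact: cj_cgrp|exact: cj_irr|exact: maxtor_cj].
Qed.

Lemma tori_conj {k : closedFieldType} {n} (G C T S : set 'M[k]_n) : cgrp G -> C `<=` G -> cgrp C -> irr C -> solvable_group C ->
 maxtor G T -> maxtor G S -> T `<=` C -> S `<=` C -> exists2 x, C x & cj x T = S.
case: n G C T S => [|n'] G C T S cG CG cC iC solC mT mS TC SC.
 exists 1%:M; first exact: sg1 cC.1.
 have [[[sT _] _ _] _ _] := mT; have [[[sS _] _ _] _ _] := mS.
 apply/seteqP; split=> [x _|x _]; first by rewrite (_ : x = 1%:M); [exact: sg1|apply/matrixP => -[]].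
 by exists 1%:M; [exact: sg1|apply/matrixP => -[]].
have [y uy tr] := trigonalize cC.1 iC solC.
have [||||||||_ [c Cc <-] e] := @tori_conj_trig _ _ (cj y C) (cj y T) _ _ tr _ (cj y G) (cj y S).
- exact: cj_cgrp.
- exact: cj_irr.
- by apply: maxtor_cj => //; apply: maxtor_sub mT.
- exact: cj_cgrp.
- exact: cj_mono.
- exact: maxtor_cj.
- exact: maxtor_cj.
- exact: cj_mono.
exists c => //; rewrite -(cjK S uy) -e; have uc := sg_gl cC.1 Cc.
apply/seteqP; split=> [_ [t Tt <-]|_ [_ [_ [t Tt <-] <-] <-]].
 exists (mxconj (mxconj y c) (mxconj y t)); first by exists (mxconj y t) => //; exists t.
 by rewrite {2}/mxconj -mxconjV // -!mxconjM // mxconjK.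
by exists t => //; rewrite [mxconj (mxconj y c) _]/mxconj -mxconjV // -!mxconjM // mxconjK.
Qed.

(** * Centralizers of maximal tori *)

Lemma irr_row (k : closedFieldType) N : irr [set: 'rV[k]_N].
have ee e : @edim k (pw e) (pw_crd e) = e.
 elim: e => // e IH; rewrite -[LHS]/(@edim k (pw e) (pw_crd e) + @edim k k (k_crd k))%N IH.
 by rewrite -[X in (_ + X)%N]/#|{: unit}| card_unit addn1.
have eN : @edim k 'rV[k]_N (row_crd k N) = N by rewrite /= card_ord.
rewrite (_ : setT = (fun x : pw N => dec (enc x) : 'rV[k]_N) @` setT).
 apply: irr_image; first exact: irr_pw.
 apply: mor_gen => i; last by exists (fun=> 0); [exact: polC|move=> v _; rewrite nth_nil].
 exists (fun x => (enc x)`_i); first exact: polE.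
 by move=> x _; rewrite decK // size_enc eN.
apply/seteqP; split=> // v _; exists (dec (enc v)) => //.
by rewrite decK ?encK // size_enc eN.
Qed.

(** A principal open subset of an affine space parametrizes these matrices. Functions involving the
    inverse determinant pull back to polynomials after multiplication by a power of the determinant,
    as [cl_f] records. *)
Lemma irr_trig (k : closedFieldType) n : irr [set t : 'M[k]_n | trig t /\ t \in unitmx].
set Z := [set t | _].
pose L v : 'M[k]_n := \matrix_(i, j) (if (i < j)%N then 0 else vec_mx v i j).
have pL : polmx L.
 move=> i j; apply: (pol_ext).
  by move=> v; rewrite [RHS]mxE; rewrite mxE.
 by case: (i < j)%N; [exact: polC|exact: pol_row].
have LK t : trig t -> L (mxvec t) = t.
 move=> /trigP tt; apply/matrixP => i j; rewrite mxE mxvecK; case: ltnP => // ij; exact/esym/tt.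
have tL v : trig (L v) by apply/trigP => i j ij; rewrite mxE ij.
pose h v := \det (L v); have ph : pol h by apply: pol_det.
have cl_f f : pol f -> exists N f', pol f' /\
  forall v, h v != 0 -> f (L v) * h v ^+ N = f' v.
 elim/mxpol_ind => [c|i j||{}f g [N [f' [pf ef]]] [N' [g' [pg eg]]]|{}f g [N [f' [pf ef]]] [N' [g' [pg eg]]]].
 - by exists 0, (fun=> c); split; [exact: polC|move=> v _; rewrite mulr1].
 - by exists 0, (fun v => L v i j); split=> // v _; rewrite mulr1.
 - by exists 1, (fun=> 1); split; [exact: polC|move=> v hv; rewrite mulVf].
 - exists (N + N'), (fun v => f' v * h v ^+ N' + g' v * h v ^+ N); split.
   by apply: polD; apply: polM => //; apply: pol_exp.
  by move=> v hv; rewrite -ef // -eg // exprD; ring.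
 - exists (N + N'), (fun v => f' v * g' v); split; first exact: polM.
  by move=> v hv; rewrite -ef // -eg // exprD; ring.
split; first by exists 1%:M; split; [exact: trig1|exact: unitmx1].
move=> f g pf pg fg.
have [N [f' [pf' ef]]] := cl_f f pf; have [N' [g' [pg' eg]]] := cl_f g pg.
have h1 : h (mxvec 1%:M) != 0 by rewrite /h LK // det1 oner_eq0.
have ZL v : h v != 0 -> Z (L v) by move=> hv; split=> //; rewrite unitmxE unitfE.
have LZ t : Z t -> h (mxvec t) != 0.
 by move=> [tt ut]; rewrite /h LK // -unitfE -unitmxE.
have [_ irrR] := irr_row k (n * n).
have conc f0 f0' N0 : (forall v, h v != 0 -> f0 (L v) * h v ^+ N0 = f0' v) ->
  (forall v, f0' v = 0) -> forall z, Z z -> f0 z = 0.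
 move=> e0 z0 z Zz; have hz := LZ z Zz; have := e0 _ hz; rewrite z0 LK; last by case: Zz.
 by move/eqP; rewrite mulf_eq0 (negbTE (expf_neq0 _ hz)) orbF => /eqP.
have : forall v, f' v * g' v * h v = 0.
 move=> v; have [->|hv] := eqVneq (h v) 0; first by rewrite mulr0.
 by rewrite -ef // -eg // mulrACA fg ?mul0r //; apply: ZL.
move=> fgh; have [|//||fg0|h0] := irrR (fun v => f' v * g' v) h.
- exact: polM.
- by [].
- have [f0|g0] := irrR f' g' pf' pg' (fun v _ => fg0 v I).
  by left; apply: conc ef (fun v => f0 v I).
 by right; apply: conc eg (fun v => g0 v I).
- by rewrite h0 ?eqxx in h1.
Qed.

Section Orbit.
Context {k : closedFieldType} {n : nat}.
Local Notation M := 'M[k]_n.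
Implicit Types (H Y Z : set M).
Local Notation tr := [set t : M | trig t /\ t \in unitmx].

Lemma closed_trig : zclosed [set t : M | trig t].
move=> t ht; apply/trigP => i j ij; apply: (ht (fun t => t i j)); first exact: polmx_id.
by move=> z /trigP; apply.
Qed.

Lemma tr_cgrp : cgrp tr.
split; last exact: closedI closed_trig closed_gl.
split=> [t []//||s t [ts us] [tt ut]|t [tt ut]].
- by split; [exact: trig1|exact: unitmx1].
- by split; [exact: trigM|rewrite unitmx_mul us].
- by split; [exact: trigV|rewrite unitmx_inv].
Qed.

Definition orb H y := [set z | exists h x, [/\ H h, [set y *m t | t in tr] x & z = h *m x]].

(** In a minimal closed stable set every orbit of [H] times the triangular group is dense and
    constructible, and two such orbits meet. In the flag variety this is a closed orbit of [H]. *)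
Lemma minimal_orbit H : cgrp H -> irr H -> exists Y : set M, [/\ zclosed Y, Y !=set0, Y `<=` @gl k n, irr Y &
 (forall h y, H h -> Y y -> Y (h *m y)) /\ (forall y t, Y y -> trig t -> t \in unitmx -> Y (y *m t)) /\
 forall y z, Y y -> Y z -> exists h t, [/\ H h, trig t, t \in unitmx & z = h *m y *m t]].
move=> [sH zH] iH.
have [||Y [cY [y0 Yy0] YG HY YT] mY] := closed_min (F := [set Z | [/\ zclosed (cV := mx_crd k n) Z, Z !=set0, Z `<=` @gl k n,
  forall h y, H h -> Z y -> Z (h *m y) & forall y t, Z y -> trig t -> t \in unitmx -> Z (y *m t)]]).
- exists (@gl k n); split; [exact: closed_gl|by exists 1%:M; rewrite /gl /= unitmx1|by []| |].
  by move=> h y /sg_gl uh uy; rewrite /gl /= unitmx_mul uh.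
 by move=> y t uy _ ut; rewrite /gl /= unitmx_mul uy.
- by move=> Z [].
have iT := irr_trig k n; have [sT zT] := tr_cgrp.
have mT y : mor tr (fun t => y *m t) by apply: mor_mull; apply: morI.
have iO y : irr (orb H y) by apply: irr_mul => //; apply: irr_image.
have cO y : cst (orb H y).
 by apply: cst_mul; [exact: cst_closed|apply: cst_image => //; apply: cst_closed].
have OY y : Y y -> orb H y `<=` Y.
 by move=> Yy _ [h [_ [Hh [t [tt ut] <-] ->]]]; apply: HY => //; apply: YT.
have dO y : Y y -> Y `<=` cl (orb H y).
 move=> Yy; apply: mY; last exact: cl_sub (OY _ Yy).
 split; first exact: cl_closed.
 - exists y; apply: sub_cl; exists 1%:M, y; split; [exact: sg1| |by rewrite mul1mx].
  by exists 1%:M; [exact: sg1|rewrite mulmx1].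
 - by move=> z /(cl_sub cY (OY _ Yy))/YG.
 - move=> h z Hh; apply: (mor_cl (D := setT)) => //.
  + by apply: mor_mull; apply: morI.
  + exact: cl_closed.
  + move=> _ [h' [x [Hh' tx ->]]]; apply: sub_cl; exists (h *m h'), x.
   by rewrite mulmxA; split=> //; apply: sgM.
 - move=> z t clz tt ut; apply: (mor_cl (D := setT) (D' := orb H y) (F := fun z => z *m t) _ _ _ _ I clz) => //.
  + by apply: mor_mulr; apply: morI.
  + exact: cl_closed.
  + move=> _ [h' [_ [Hh' [t' Tt' <-] ->]]]; apply: sub_cl; exists h', (y *m t' *m t).
   by rewrite !mulmxA; split=> //; exists (t' *m t); [apply: sgM|rewrite mulmxA].
have iY : irr Y.
 have -> : Y = cl (orb H y0) by apply/seteqP; split; [exact: dO|exact: cl_sub (OY _ Yy0)].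
 exact: irr_cl.
exists Y; split=> //; first by exists y0.
split=> //; split=> // y z Yy Yz.
have [||x [_ [h1 [_ [Hh1 [t1 Tt1 <-] ->]]] [h2 [_ [Hh2 [t2 Tt2 <-] e]]]]] := dense_meet (cO y) (cO z) iY.
- by move=> x /(dO _ Yy); apply: cl_mono => w Ow; split=> //; apply: OY Ow.
- by move=> x /(dO _ Yz); apply: cl_mono => w Ow; split=> //; apply: OY Ow.
have [tt ut] := sgM sT Tt1 (sgV sT Tt2).
exists (invmx h2 *m h1), (t1 *m invmx t2); split=> //; first by apply: sgM => //; apply: sgV.
have u2 := sg_gl sH Hh2; have ut2 := sg_gl sT Tt2.
by rewrite !mulmxA -[invmx h2 *m h1 *m y *m t1]mulmxA -[invmx h2 *m h1 *m _]mulmxA e !mulmxA mulVmx // mul1mx mulmxK.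
Qed.

End Orbit.

(** First commutators are unitriangular, and each further commutator goes at least one level
    deeper. *)
Lemma trig_solvable (k : closedFieldType) n (H : set 'M[k]_n) : subgroup H ->
 (forall h, H h -> trig h) -> solvable_group H.
case: n H => [|n'] H sH tH; apply/solvP => //.
 by exists 0 => x _; apply/matrixP => -[].
have comm i x y : trig x -> trig y -> x \in unitmx -> y \in unitmx ->
  lev i.+1 (x *m y - y *m x) -> ut i.+1 (x *m y *m invmx x *m invmx y).
 move=> tx ty ux uy hl.
 have u2 : y *m x \in unitmx by rewrite unitmx_mul uy.
 rewrite /ut -mulmxA -invmxM // (_ : _ - _ = (x *m y - y *m x) *m invmx (y *m x)).
  by rewrite -[i.+1]addn0; apply: levM => //; apply/lev_trig; apply: trigV => //; apply: trigM.
 by rewrite mulmxBl mulmxV.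
have d1 : derived H `<=` @ut k n' 1.
 apply: gen_least; first by have [] := @ut_cgrp k n' 0.
 move=> _ [x [y [Hx Hy ->]]]; apply: comm; try exact: tH; try exact: sg_gl sH _.
 move=> a b; rewrite addn1 ltnS leq_eqVlt => /orP[/eqP/val_inj->|ab].
  by rewrite mxE [X in _ + X]mxE !trigM_diag ?tH // mulrC subrr.
 by rewrite mxE [X in _ + X]mxE !(trigP _ (trigM _ _)) ?tH // subrr.
exists n'.+1; rewrite iterSr => x Hx.
have step j : iter j (@derived k n'.+1) (derived H) `<=` @ut k n' j.+1.
 elim: j => [|j IH] //=; apply: subset_trans (derived_mono IH) _.
 apply: gen_least; first by have [] := @ut_cgrp k n' j.+1.
 move=> _ [y [z [hy hz ->]]]; apply: comm; try exact: ut_trig hy; try exact: ut_trig hz; try exact: ut_unit hy; try exact: ut_unit hz.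
 have -> : y *m z - z *m y = (y - 1%:M) *m (z - 1%:M) - (z - 1%:M) *m (y - 1%:M).
  rewrite !mulmxBl !mulmxBr !mul1mx !mulmx1.
  by move: (y *m z) (z *m y) => e1 e2; apply/matrixP => a b; rewrite !mxE; ring.
 by apply: levD; [|apply: levN]; [apply: lev_le (levM hy hz)|apply: lev_le (levM hz hy)]; lia.
by apply/eqP; rewrite -subr_eq0; apply/eqP/lev_top; apply: step.
Qed.

(** Valuation rings are integrally closed; a leading coefficient with nonzero residue is as good as
    1. *)
Lemma pl_integral {k : closedFieldType} {X : Type} (U : set (set X)) (pl : (X -> k) -> k -> Prop)
  (a : nat -> X -> k) (abar : nat -> k) m (f : X -> k) : ultra U -> place U pl ->
 (forall j, pl (a j) (abar j)) -> abar m != 0 ->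
 U [set x | \sum_(j < m.+1) a j x * f x ^+ j = 0] -> exists b, pl f b.
move=> uU hp ha am U0; have [//|pv] := plV hp f.
have [f0|fn] := ultraC uU [set x | f x = 0].
 by exists 0; apply: (plX hp) (plC hp 0); apply: ultraS f0 => // x ->.
have hX j : pl (fun x => (f x)^-1 ^+ j) (0 ^+ j).
 elim: j => [|j IH]; first exact: pl_ext (plC hp 1) => // x.
 by apply: pl_ext (plM hp pv IH) => [x|]; rewrite exprS.
have hs : pl (fun x => \sum_(j < m.+1) a j x * (f x)^-1 ^+ (m - j)) (\sum_(j < m.+1) abar j * 0 ^+ (m - j)).
 by apply: (pl_sum hp) => j; apply: (plM hp).
have : pl (fun x => \sum_(j < m.+1) a j x * (f x)^-1 ^+ (m - j)) 0.
 apply: (plX hp) (plC hp 0); apply: ultraS (ultraI uU U0 fn) => // x [/= e /eqP nz].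
 have -> : \sum_(j < m.+1) a j x * (f x)^-1 ^+ (m - j) = (f x)^-1 ^+ m * \sum_(j < m.+1) a j x * f x ^+ j.
  rewrite mulr_sumr; apply: eq_bigr => j _; rewrite mulrCA.
  have jm : (j <= m)%N by rewrite -ltnS.
  have -> : (f x)^-1 ^+ m = (f x)^-1 ^+ (m - j) * (f x)^-1 ^+ j by rewrite -exprD subnK.
  by rewrite -mulrA -exprMn mulVf // expr1n mulr1.
 by rewrite e mulr0.
move=> /(plU hp hs) /eqP; rewrite big_ord_recr /= subnn expr0 mulr1 big1 ?add0r ?(negbTE am) // => j _.
by rewrite expr0n subn_eq0 leqNgt ltn_ord mulr0.
Qed.

Section NoTorus.
Context {k : closedFieldType} {n' : nat}.
Local Notation n := n'.+1.
Local Notation M := 'M[k]_n.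

(* For a closed orbit [Y = Q y Trig], the functions [q |-> phi (col i (q y))] satisfy polynomial equations over [Y],
  so they have no pole at any place of [Q] and are constant. *)
Lemma no_torus_trig (Q : set M) : cgrp Q -> irr Q ->
 (forall S, torus S -> S `<=` Q -> S `<=` [set 1%:M]) ->
 exists2 y, y \in unitmx & forall q, Q q -> trig (invmx y *m q *m y).
move=> cQ iQ nt; have [sQ zQ] := cQ.
have [Y [cY [y Yy] YG iY [QY [YT oY]]]] := minimal_orbit cQ iQ.
have uy := YG _ Yy; exists y => //.
have [sT zT] := @tr_cgrp k n.
pose E := Q `&` cj y [set t : M | trig t /\ t \in unitmx].
have cE : cgrp E by apply: cgrpI => //; apply: cj_cgrp.
have [cE0 iE0 _] := gcompP cE.
have tE e : E e -> trig (mxconj (invmx y) e).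
 by move=> [_ [t [tt ut] <-]]; rewrite mxconjK.
(* [E] fixes the flag of [y]. Its identity component contains no nontrivial torus, so it is
   unipotent, and on [E] itself each diagonal entry takes finitely many values ([thf]). *)
have th0 e i : gcomp E e -> mxconj (invmx y) e i i = 1.
 move=> E0e; have : cj (invmx y) (gcomp E) `<=` @ut k n' 1.
  have uV : invmx y \in unitmx by rewrite unitmx_inv.
  apply: no_torus_ut; [exact: cj_cgrp|exact: cj_irr|by move=> _ [x /gcomp_sub/tE ? <-]|].
  move=> S tS SE x Sx; have : mxconj y x = 1%:M.
   apply: (nt _ (torus_cj uy tS)); last by exists x.
   by move=> _ [x' /SE[w /gcomp_sub[Qw _] <-] <-]; rewrite mxconjVK.
  by move/(congr1 (mxconj (invmx y))); rewrite mxconjK // mxconj1.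
 by move=> /(_ (mxconj (invmx y) e)) h; apply: ut_diag; apply: h; exists e.
have [sq [usq hsq]] := gcomp_fin cE.
have thf e i : E e -> exists g, List.In g sq /\ mxconj (invmx y) e i i = mxconj (invmx y) g i i.
 move=> Ee; have [g [gs E0]] := hsq e Ee; exists g; have ug := usq _ gs.
 have ue := sg_gl cE.1 Ee.
 have Eg : E g.
  have := sgM cE.1 Ee (sgV cE.1 (gcomp_sub E0)).
  by rewrite invmxM ?unitmx_inv // invmxK mulmxA mulmxV // mul1mx.
 rewrite -{1}(mulKVmx ug e) mxconjM ?unitmx_inv // trigM_diag; [|exact: tE|apply: tE; exact: gcomp_sub].
 by rewrite (th0 _ i E0) mulr1.
pose P i (v : 'rV[k]_n) := forall y (l : 'I_n), Y y -> (i <= l)%N -> (v *m y) 0 l = 0.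
have PL i : forall a u v, P i u -> P i v -> P i (a *: u + v).
 by move=> a u v hu hv z l Yz il; rewrite mulmxDl -scalemxAl mxE mxE hu // hv // mulr0 addr0.
have PC i c v : Q c -> P i v -> P i (v *m c).
 by move=> Cc hv z l Yz il; rewrite -mulmxA hv //; apply: QY.
have trigE i (il : (i < n)%N) v z t : P i.+1 v -> Y z -> trig t ->
  (v *m (z *m t)) 0 (Ordinal il) = (v *m z) 0 (Ordinal il) * t (Ordinal il) (Ordinal il).
 move=> Pv Yz /trigP tt; rewrite mulmxA mxE (bigD1 (Ordinal il)) //= big1 ?addr0 // => l li.
 have [lt|le] := ltnP l i; first by rewrite tt ?mulr0.
 by rewrite Pv ?mul0r // ltn_neqAle le andbT eq_sym.
have pf (u : 'rV[k]_n) i0 : pol (fun q => (u *m (q *m y)) 0 i0).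
 apply: polmxM; first exact: polmxC.
 by apply: polmxM; [exact: polmx_id|exact: polmxC].
(* The equation satisfied by the coordinate of [v *m (q *m y)] over the point [q *m y *m t] of [Y].
   If the map [F] were dominant, a general fibre would be infinite; but over a fixed point of [Y]
   the values differ only by factors that are diagonal entries of [E]. *)
have rel i (il : (i < n)%N) v : P i.+1 v -> exists (p : M -> {poly k}) m,
  [/\ forall j, pol (fun z => (p z)`_j), forall z, Y z -> (size (p z) <= m.+1)%N,
    exists2 z, Y z & (p z)`_m != 0 &
    forall q t, Q q -> trig t -> t \in unitmx ->
     (p (q *m y *m t)).[(v *m (q *m y)) 0 (Ordinal il)] = 0].
 move=> Pv; set i0 := Ordinal il.
 pose D : set (M * M) := Q `*` [set t : M | trig t /\ t \in unitmx].
 pose F qt : M * k := (qt.1 *m y *m qt.2, (v *m (qt.1 *m y)) 0 i0).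
 have mF : mor D F.
  apply: mor_pair; first by apply: mor_mul2; [apply: mor_mulr; apply: mor_fst|apply: mor_snd].
  apply: mor_k; apply: pon_pol; exact: (pol_fst (pf v i0)).
 have cF : cst (F @` D) by apply: cst_image => //; apply: cst_prod; apply: cst_closed.
 have iYk : irr (Y `*` [set: k]) by apply: irr_prod => //; apply: irr_k.
 have [dn|/existsNP[[z0 c0] /not_implyP[[/= Yz0 _]]]] :=
  pselect (Y `*` [set: k] `<=` cl (F @` D)); last first.
  move=> /existsNP[f /not_implyP[pf' /not_implyP[fF f0]]].
  have [p [pp [d pd] fp]] := pol_last pf'.
  have p0 : p z0 != 0.
   by apply: contra_notN f0 => /eqP p0; rewrite fp p0 horner0.
  have [|m [hm mm]] := @prop_min (fun m => forall z, Y z -> (size (p z) <= m)%N).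
   by exists d => z _.
  case: m hm mm => [|m] hm mm.
   by have := hm _ Yz0; rewrite leqn0 size_poly_eq0 (negbTE p0).
  exists p, m; split=> //.
   apply: contrapT => no; suff : (m.+1 <= m)%N by rewrite ltnn.
   apply: mm => z Yz; apply/leq_sizeP => j; rewrite leq_eqVlt => /orP[/eqP<-|mj].
    by apply: contrapT => /eqP h; apply: no; exists z.
   exact: (leq_sizeP _ _ (hm z Yz)).
  move=> q t Qq tt ut; rewrite -fp; apply: fF; exists (q, t) => //.
 have [|h [ph [[z c] [/= Yz _] h0] hF]] := cst_dense cF iYk.
  by apply: subset_trans dn _; apply: cl_mono => _ [[q t] [/= Qq [tt ut]] <-]; split; [split=> //=; apply: YT => //; apply: QY|exists (q, t)].
 have [p [_ _ hp]] := pol_last ph.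
 have p0 : p z != 0 by apply: contraNneq h0 => e; rewrite hp e horner0.
 have [q0 [t0 [Qq0 tt0 ut0 ez]]] := oY _ _ Yy Yz.
 have uq0 := sg_gl sQ Qq0.
 pose r := \prod_(g <- sq) ('X - ((v *m (q0 *m y)) 0 i0 * mxconj (invmx y) g i0 i0)%:P).
 have : p z * r = 0.
  apply: poly_all0 => c'; rewrite hornerM; apply/eqP; rewrite mulf_eq0 -implyNb -hp; apply/implyP => hz.
  have [[q t] [/= Qq [tt ut]] [e <-]] := hF (z, c') (conj Yz I) hz.
  have Ee : E (invmx q0 *m q).
   split; first by apply: sgM => //; apply: sgV.
   exists (t0 *m invmx t); first by apply: sgM => //; apply: sgV.
   by rewrite /mxconj; apply: (canRL (mulKmx uq0)); rewrite !mulmxA -ez -e mulmxK // mulmxK.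
  have [g [gs eg]] := thf _ i0 Ee; rewrite horner_prod prodf_seq_eq0; apply/hasP; exists g; first exact/mem_In.
  have -> : q *m y = q0 *m y *m mxconj (invmx y) (invmx q0 *m q).
   by rewrite /mxconj invmxK !mulmxA mulmxK // mulmxV // mul1mx.
  by rewrite (trigE _ il v (q0 *m y) _ Pv (QY _ _ Qq0 Yy) (tE _ Ee)) eg !hornerE subrr eqxx.
 by move=> /eqP; rewrite mulf_eq0 (negbTE p0) prodf_seq_eq0 => /hasP[g _]; rewrite polyXsubC_eq0.
have const i (il : (i < n)%N) v : P i.+1 v -> forall q, Q q ->
  (v *m (q *m y)) 0 (Ordinal il) = (v *m y) 0 (Ordinal il).
 move=> Pv; set i0 := Ordinal il; pose h q := (v *m (q *m y)) 0 i0.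
 have [U uU [UQ Upol]] := ultra_irr iQ.
 have [[a ha]|nc] := pselect (exists a, U [set q | h q = a]).
  have hc q : Q q -> h q = a.
   move=> Qq; apply/eqP; rewrite -subr_eq0; apply: contraT => nz.
   have pd : pol (fun q => h q - a) by apply: polB; [exact: pf|exact: polC].
   have Un := Upol _ pd (ex_intro2 _ _ q Qq nz).
   have [q' [/= e1]] := ultra_ex uU (ultraI uU ha Un).
   by rewrite e1 subrr eqxx.
  by move=> q Qq; rewrite -/(h q) hc // -(hc _ (sg1 sQ)) /h mul1mx.
 have [|pl hp ph] := place_exists (h := h) uU; first by move=> c Uc; apply: nc; exists c.
 have [|b [tb Ub [a ua ha]]] := iwasawa uU hp (A := fun q => q *m y).
  by apply: ultraS UQ => // q Qq; apply: YG; apply: QY.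
 have Ya : Y a.
  apply: (pl_closed uU hp cY ha ua); apply: ultraS (ultraI uU UQ Ub) => // q [/= Qq bq].
  by apply: YT => //; apply: QY.
 have [A AP] : exists A : M, forall v : 'rV_n, (v <= A)%MS <-> P i.+1 v.
  by apply: subspace_mx => [z l _ _|]; [rewrite mul0mx mxE|exact: PL].
 have /choice[p /choice[m rj]] : forall j : 'I_n, exists (p : M -> {poly k}) m,
  [/\ forall l, pol (fun z => (p z)`_l), forall z, Y z -> (size (p z) <= m.+1)%N,
    exists2 z, Y z & (p z)`_m != 0 &
    forall q t, Q q -> trig t -> t \in unitmx ->
     (p (q *m y *m t)).[(row j A *m (q *m y)) 0 i0] = 0].
  by move=> j; apply: rel; apply/AP; apply: row_sub.
 (* Leading coefficients must have nonzero residue. They are all nonzero at some [z1], which need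
    not be the limit point [a]; as [Y] is one orbit, [z1] is the translate of [a] by [q0] and [t0],
    and the equations are used after this translation. *)
 have [|j _|z1 Yz1 hz1] := irr_prod_neq0 (s := enum 'I_n) (F := fun j z => (p j z)`_(m j)) iY.
 - by move=> j; have [] := rj j.
 - by have [] := rj j.
 have [q0 [t0 [Qq0 tt0 ut0 ez]]] := oY _ _ Ya Yz1; have uq0 := sg_gl sQ Qq0.
 have /choice[c hc] : forall j, exists c, pl (fun q => (row j A *m (q0 *m q *m y)) 0 i0) c.
  move=> j; have [pj szj _ relj] := rj j.
  apply: (@pl_integral _ _ _ _ (fun l q => (p j (q0 *m (q *m y *m b q) *m t0))`_l)
   (fun l => (p j (q0 *m a *m t0))`_l) (m j) _ uU hp).
  - move=> l; apply: (pl_pol uU hp (f := fun x => (p j (q0 *m x *m t0))`_l) _ ha ua).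
   apply: (pol_comp _ (pj l)).
   by apply: mor_mulr; apply: mor_mull; apply: morI.
  - by rewrite -ez; apply: hz1; apply/mem_In; rewrite mem_enum.
  - apply: ultraS (ultraI uU UQ Ub) => // q [/= Qq bq].
   have Qqq := sgM sQ Qq0 Qq; have [tbt ubt] := sgM sT (conj (tb q) bq) (conj tt0 ut0).
   have sz := szj _ (YT _ _ (QY _ _ Qqq Yy) tbt ubt).
   have := relj _ _ Qqq tbt ubt; rewrite (horner_coef_wide _ sz) => e.
   by have -> : q0 *m (q *m y *m b q) *m t0 = q0 *m q *m y *m (b q *m t0) by rewrite !mulmxA.
 have Pw : P i.+1 (v *m invmx q0) by apply: PC => //; apply: sgV.
 have /AP/submxP[w ew] := Pw.
 have hv : pl h (\sum_j w 0 j * c j).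
  apply: pl_ext (pl_sum hp (index_enum 'I_n) (F := fun j q => w 0 j * (row j A *m (q0 *m q *m y)) 0 i0)
   _) => // [q|j]; last by apply: (plM hp) (hc j); apply: (plC hp).
  have -> : h q = (w *m (A *m (q0 *m q *m y))) 0 i0 by rewrite /h !mulmxA -ew mulmxKV // !mulmxA.
  by rewrite [RHS]mxE; apply: eq_bigr => j _; rewrite -row_mul [X in _ * X]mxE.
 have : pl (fun=> 1) 0.
  rewrite -(mulr0 (\sum_j w 0 j * c j)); apply: (plX hp) (plM hp hv ph).
  have [h0|] := ultraC uU [set q | h q = 0]; first by case: nc; exists 0.
  by apply: ultraS => // q /= /eqP hq; rewrite divff.
 by move=> /(plU hp (plC hp 1)) /eqP; rewrite oner_eq0.
suff Inv m v : (forall l : 'I_n, (n - m <= l)%N -> (v *m y) 0 l = 0) -> P (n - m)%N v.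
 move=> c Cc; apply/trigP => i j ij.
 have Pi : P i.+1 (row i (invmx y)).
  rewrite -(subKn (ltn_ord i)); apply: Inv => l; rewrite subKn // => il.
  by rewrite -row_mul mulVmx // !mxE -val_eqE ltn_eqF.
 by have := Pi (c *m y) j (QY _ _ Cc Yy) ij; rewrite -row_mul mxE mulmxA.
elim: m v => [|m IH] v hv; first by move=> z l _; rewrite leqNgt ltn_ord.
have [mn|nm] := ltnP m n; last first.
 have z a (h : (n <= a)%N) : (n - a = 0)%N by apply/eqP.
 have e : (n - m.+1 = n - m)%N by rewrite (z m nm) (z m.+1 (leqW nm)).
 by rewrite e in hv *; apply: IH.
set i := (n - m.+1)%N; have ei : (n - m = i.+1)%N by rewrite subnSK.
have il : (i < n)%N by rewrite ltn_subrL.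
have Pv : P i.+1 v by rewrite -ei; apply: IH => l; rewrite ei => lt; apply: hv; apply: ltnW.
move=> z l Yz; rewrite leq_eqVlt => /orP[/eqP el|lt]; last exact: Pv.
have -> : l = Ordinal il by apply/val_inj.
have [q [t [Qq tt ut ->]]] := oY _ _ Yy Yz.
rewrite trigE //; last exact: QY.
by rewrite const // hv ?mul0r.
Qed.

End NoTorus.

(** A torus in the closure of the derived group commutes with [T], so it lies in [T] and is scalar
    on each weight space of [T]. Block determinants are trivial on commutators, so the scalar is a
    root of unity of fixed order, hence 1 by rigidity. With no torus left, [no_torus_trig]
    applies. *)
Lemma cent_torus_solvable {k : closedFieldType} {n} (G T : set 'M[k]_n) : cgrp G -> maxtor G T ->
 solvable_group (gcomp (G `&` cent T)).
case: n G T => [|n'] G T cG mT.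
 by exists 0; have [[sK _] _ _] := gcompP (cgrpI cG (cent_cgrp T)); apply/seteqP; split=> [x _|_ ->];
  [apply/matrixP => -[]|exact: sg1].
set K := gcomp _; have cGT : cgrp (G `&` cent T) := cgrpI cG (cent_cgrp T).
have [cK iK _] := gcompP cGT; have [sK zK] := cK.
have KT x : K x -> cent T x by move=> /gcomp_sub[].
have KG x : K x -> G x by move=> /gcomp_sub[].
have sD := derived_sg sK.
have cQ : cgrp (cl (derived K)) by apply: cl_cgrp.
have iQ : irr (cl (derived K)) by apply: irr_cl; apply: irr_derived.
have QK : cl (derived K) `<=` K := cl_sub zK (derived_sub sK).
have [tT TG mxT] := mT; have [[sT zT] iT [P uP dP]] := tT.
pose w j l := `[< forall t, T t -> mxconj P t j j = mxconj P t l l >].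
have ww i j l : w j l -> w i j = w i l.
 by move=> /asboolP h; apply/asboolP/asboolP => h' t Tt; rewrite h' // h.
have wxx j : w j j by apply/asboolP.
have cx x : cent T x -> forall j l, ~~ w j l -> mxconj P x j l = 0.
 move=> [ux xT] j l; apply: contraNeq => nz; apply/asboolP => t Tt.
 have := congr1 (mxconj P) (xT _ Tt); rewrite !mxconjM //; have /is_diag_mxP := dP _ Tt.
 move: mxconj mxconj nz => X D nz dt /matrixP/(_ j l).
 rewrite mxE (bigD1 l) //= big1 => [|a al]; last first.
  by rewrite dt ?mulr0.
 rewrite mxE (bigD1 j) //= big1 ?addr0 => [|a aj]; last first.
  by rewrite dt ?mul0r //; apply: contraNneq aj => /val_inj ->.
 by rewrite [RHS]mulrC => /mulfI ->.
pose E i : 'M[k]_n'.+1 := diag_mx (\row_j (w i j)%:R).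
have EE i : E i *m E i = E i.
 by rewrite mulmx_diag; congr diag_mx; apply/rowP => j; rewrite !mxE; case: (w i j); rewrite ?mulr1 ?mulr0.
have Ex i x : cent T x -> E i *m mxconj P x = mxconj P x *m E i.
 move=> /cx {}cx; move: mxconj (fun j l => cx j l) => {cx}X cx.
 apply/matrixP => j l; rewrite mul_diag_mx mul_mx_diag !mxE mulrC.
 by have [wjl|nw] := boolP (w j l); [rewrite (ww i j l)|rewrite cx // !mul0r].
(* The determinant on the weight space of [T] through the basis vector [i]: the block of [x] there,
   completed by the identity elsewhere. *)
pose Dt i x := \det (E i *m mxconj P x + (1%:M - E i)).
have DtM i x y : cent T x -> cent T y -> Dt i (x *m y) = Dt i x * Dt i y.
 move=> xT yT; rewrite /Dt -det_mulmx mxconjM //.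
 have EF : E i *m (1%:M - E i) = 0 by rewrite mulmxBr mulmx1 EE subrr.
 have FE : (1%:M - E i) *m E i = 0 by rewrite mulmxBl mul1mx EE subrr.
 have FF : (1%:M - E i) *m (1%:M - E i) = 1%:M - E i by rewrite mulmxBl EF subr0 mul1mx.
 move: (1%:M - E i) EF FE FF => F EF FE FF.
 rewrite mulmxDl !mulmxDr FF [F *m (_ *m _)]mulmxA FE mul0mx add0r.
 rewrite {2}Ex // -[mxconj P x *m E i *m _]mulmxA EF mulmx0 addr0.
 move: (mxconj P x) (mxconj P y) (Ex i x xT) => X Z cX.
 by rewrite !mulmxA -[_ *m X *m E i]mulmxA -cX mulmxA EE.
have Dt1 i : Dt i 1%:M = 1 by rewrite /Dt mxconj1 // mulmx1 addrC subrK det1.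
have [sc zc] := cent_cgrp T.
have DQ i x : cl (derived K) x -> Dt i x = 1.
 move=> Qx; apply/eqP; rewrite -subr_eq0; apply/eqP.
 apply: (Qx (fun x => Dt i x - 1)) => [|z Dz].
  apply: polB; last exact: polC.
  apply: pol_det; apply: polmxD; last exact: polmxC.
  apply: polmxM; first exact: polmxC.
  by apply: polmxM; [apply: polmxM; [exact: polmxC|exact: polmx_id]|exact: polmxC].
 suff [_ ->] : [set x | cent T x /\ Dt i x = 1] z by rewrite subrr.
 apply: gen_least Dz; first split=> [y [/(sg_gl sc)//]||y y' [h1 e1] [h2 e2]|y [h1 e1]].
 - by split=> //; apply: sg1.
 - by split; [exact: sgM|rewrite DtM // e2 mulr1].
 - split; first exact: sgV.
  have := DtM i _ _ h1 (sgV sc h1); rewrite mulmxV ?(sg_gl sc h1) // Dt1 e1 mul1r.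
  by [].
 move=> _ [a [b [/KT ha /KT hb ->]]].
 have hVa := sgV sc ha; have hVb := sgV sc hb; have hab := sgM sc ha hb; have h3 := sgM sc hab hVa.
 split; first exact: sgM.
 have e1 := DtM i _ _ ha hVa; have e2 := DtM i _ _ hb hVb.
 rewrite mulmxV ?(sg_gl sc ha) in e1; rewrite mulmxV ?(sg_gl sc hb) // Dt1 in e2.
 rewrite !DtM // (_ : _ * _ = Dt i a * Dt i (invmx a) * (Dt i b * Dt i (invmx b))); last by ring.
 by rewrite -e1 -e2 mulr1.
have nt S : torus S -> S `<=` cl (derived K) -> S `<=` [set 1%:M].
 move=> tS SQ; have [[sS zS] iS dS] := tS.
 have ST : S `<=` T.
  have [||T' tT' [T'G TT' ST']] := torus_mul cG TG _ tT tS.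
  - by move=> x /SQ/QK/KG.
  - by move=> t s Tt /SQ/QK/KT[_ ->].
  by move=> x /ST'; apply: mxT.
 have h1 i t : S t -> mxconj P t i i = 1.
  pose m := #|[pred j | w i j]|.
  have rt s : S s -> ('X^m - 1 : {poly k}).[mxconj P s i i] = 0.
   move=> Ss; have hw j : w i j -> mxconj P s i i = mxconj P s j j.
    by move/asboolP; apply; apply: ST.
   have /is_diag_mxP := dP _ (ST _ Ss); have := DQ i _ (SQ _ Ss); rewrite /Dt.
   move: mxconj hw => X hw e ds; move: e; rewrite det_trig => [e|]; last first.
    apply/trigP => a b ab; rewrite mul_diag_mx !mxE -val_eqE (ltn_eqF ab).
    by rewrite ds ?ltn_eqF // mulr0 subrr addr0.
   rewrite !hornerE; apply/eqP; rewrite subr_eq0 -[X in _ == X]e -prodr_const.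
   rewrite big_mkcond; apply/eqP; apply: eq_bigr => j _.
   rewrite inE mul_diag_mx !mxE eqxx.
   case wij : w; rewrite ?mul0r ?mul1r ?subr0 ?add0r ?subrr ?addr0 //.
   exact: hw.
  have [||a ha] := irr_finite_const iS _ _ rt.
  - apply: pon_pol; apply: polmxM; last exact: polmxC.
   by apply: polmxM; [exact: polmxC|exact: polmx_id].
  - apply/negP => /eqP/(congr1 (fun p => p.[0])); rewrite !hornerE expr0n.
   have -> : (m == 0) = false by apply/negbTE; rewrite -lt0n; apply/card_gt0P; exists i; exact: wxx.
   by rewrite sub0r => /eqP; rewrite oppr_eq0 oner_eq0.
  by move=> St; rewrite ha // -(ha _ (sg1 sS)) mxconj1 // mxE eqxx.
 move=> t St /=; rewrite -[t](mxconjK _ uP) -[RHS](mxconjK _ uP) mxconj1 //; congr mxconj.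
 have /is_diag_mxP dt := dP _ (ST _ St); apply/matrixP => a b; rewrite [RHS]mxE.
 by have [->|ab] := eqVneq a b; [rewrite h1|rewrite dt].
have [y uy hy] := no_torus_trig cQ iQ nt.
apply: solv_derived => //; apply: (solv_sub sD (@sub_cl _ _ _ _)).
rewrite -(cjVK (cl (derived K)) uy); apply: solv_cj => //.
 by apply: cj_sg; rewrite ?unitmx_inv; case: cQ.
apply: trig_solvable; first by apply: cj_sg; rewrite ?unitmx_inv; case: cQ.
by move=> _ [q Qq <-]; rewrite /mxconj invmxK; apply: hy.
Qed.

(** * Borel subgroups and centralizers of tori *)

Section BorelSub.
Context {k : closedFieldType} {n : nat}.
Local Notation M := 'M[k]_n.
Implicit Types (G B T : set M).

Definition borel G B := [/\ cgrp B, irr B, B `<=` G, solvable_group B &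
 forall B', cgrp B' -> irr B' -> B' `<=` G -> solvable_group B' -> B `<=` B' -> B' `<=` B].

(** [B] and the solvable group [K] fix flags in one closed orbit of [G], so a conjugate of [K] by
    some [g] fixes the flag of [B], whose connected stabilizer is solvable and thus equal to [B].
    Conjugacy of tori in [B] corrects [g] to an [h] that normalizes [T], and with it [K]. *)
Lemma cent_in_borel G B T : cgrp G -> irr G -> borel G B -> maxtor G T -> T `<=` B ->
 gcomp (G `&` cent T) `<=` B.
move=> cG iG [cB iB BG solB mB] mT TB; have [sG zG] := cG; have [sB zB] := cB.
have [tT TG mxT] := mT; have [[sT zT] iT dT] := tT.
set K := gcomp _; have cGT : cgrp (G `&` cent T) := cgrpI cG (cent_cgrp T).
have [cK iK mK] := gcompP cGT; have solK : solvable_group K := cent_torus_solvable cG mT.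
have TK : T `<=` K.
 apply: mK => //; last exact: sg1.
 move=> t Tt; split; first exact: TG.
 by split=> [|t' Tt']; [exact: sg_gl sT Tt|exact: diag_group_comm dT _ _].
have KG x : K x -> G x by move=> /gcomp_sub[].
have [Y [cY nY YG iY [GY [YT oY]]]] := minimal_orbit cG iG.
have [|y Yy hy] := borel_fixed_point cK.1 iK solK cY nY YG _ YT.
 by move=> c z Kc; apply: GY; apply: KG.
have [|z Yz hz] := borel_fixed_point cB.1 iB solB cY nY YG _ YT.
 by move=> c u Bc; apply: GY; apply: BG.
have [g [t [Gg tt ut ez]]] := oY _ _ Yy Yz; have ug := sg_gl sG Gg.
have uz := YG _ Yz; have uy := YG _ Yy.
have [str ztr] := @tr_cgrp k n.
have St u : u \in unitmx -> cgrp (G `&` cj u [set t : M | trig t /\ t \in unitmx]).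
 by move=> uu; apply: cgrpI => //; apply: cj_cgrp.
have Btr : B `<=` gcomp (G `&` cj z [set t : M | trig t /\ t \in unitmx]).
 have [_ _ h] := gcompP (St z uz); apply: h => //; last exact: sg1.
 move=> b Bb; split; first exact: BG.
 apply/cjP => //; split; first by rewrite /mxconj invmxK; apply: hz.
 by rewrite mxconj_unit ?unitmx_inv // (sg_gl sB).
have trB : gcomp (G `&` cj z [set t : M | trig t /\ t \in unitmx]) `<=` B.
 have [c1 i1 _] := gcompP (St z uz); apply: mB => //; first by move=> x /gcomp_sub[].
 have c2 := cj_sg _ c1.1.
 rewrite -(cjVK (gcomp _) uz); apply: solv_cj => //; first by apply: c2; rewrite unitmx_inv.
 apply: trig_solvable; first by apply: c2; rewrite unitmx_inv.
 by move=> _ [x /gcomp_sub[_ [u [tu _] <-]] <-]; rewrite mxconjK.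
have gKB : cj g K `<=` B.
 apply: subset_trans trB; have [_ _ h] := gcompP (St z uz); apply: h.
 - exact: cj_irr.
 - move=> _ [x Kx <-]; split; first by apply: sg_conj => //; apply: KG.
  have ux := sg_gl cK.1 Kx; apply/cjP => //.
  have -> : mxconj (invmx z) (mxconj g x) = mxconj (invmx t) (mxconj (invmx y) x).
   rewrite -[mxconj (invmx t) _]mxconjMl ?unitmx_inv // -mxconjMl ?unitmx_inv // ez !invmxM ?unitmx_mul ?ug //.
   by rewrite -mulmxA mulmxKV.
  apply: sg_conj => //; first exact: sgV.
  by split; [rewrite /mxconj invmxK; apply: hy|rewrite mxconj_unit ?unitmx_inv].
 - by exists 1%:M; [exact: sg1 cK.1|rewrite mxconj1].
have mgT : maxtor G (cj g T) by rewrite -(cj_id sG Gg); apply: maxtor_cj.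
have [|b Bb e] := tori_conj cG BG cB iB solB mgT mT _ TB.
 by apply: subset_trans gKB; apply: cj_mono.
have ub := sg_gl sB Bb; have Gb := BG _ Bb.
pose h := b *m g; have uh : h \in unitmx by rewrite unitmx_mul ub.
have hT : cj h T = T.
 rewrite -[RHS]e; apply/seteqP; split=> [_ [s Ts <-]|_ [_ [s Ts <-] <-]].
  by exists (mxconj g s); [exists s|rewrite -mxconjMl].
 by exists s => //; rewrite mxconjMl.
have hK : cj h (G `&` cent T) = G `&` cent T.
 by rewrite cjI // cj_cent // hT cj_id //; apply: sgM.
have hKB : cj h K `<=` B.
 move=> _ [x Kx <-]; rewrite mxconjMl //; apply: sg_conj => //; apply: gKB; exists x => //.
apply: subset_trans hKB => x Kx; apply/cjP => //.
have uVh : invmx h \in unitmx by rewrite unitmx_inv.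
apply: gcomp_conj => // z' hz'; rewrite -hK in hz'; by have /cjP := hz'; apply.
Qed.

End BorelSub.

(** * Stabilizers in Levi subgroups *)

Section Levi.
Context {k : closedFieldType} {n : nat}.
Local Notation M := 'M[k]_n.
Implicit Types (G B T P L U A N C : set M) (x y g : M).

(** Among closures of irreducible constructible subsets of [P] through 1, a maximal one absorbs
    products and inverses. The dense constructible [A] inside it gives [cl A = A A^-1], so the
    closure does not leave [P]. *)
Lemma generated_irr_closed (F : set (set M)) : (forall A, F A -> cgrp A /\ irr A) -> F !=set0 ->
 let P := generated (\bigcup_(A in F) A) in cgrp P /\ irr P.
move=> hF [A0 FA0] P.
have FG : \bigcup_(A in F) A `<=` @gl k n by move=> x [A /hF[[sA _] _]]; apply: sg_gl.
have sP : subgroup P by apply: gen_sg.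
have FP A : F A -> A `<=` P by move=> FA x Ax; apply: gen_sub; exists A.
pose good A := [/\ irr (cV := mx_crd k n) A, cst (cV := mx_crd k n) A, A `<=` P & A 1%:M].
have goodM A C : good A -> good C -> good [set x | exists y z, [/\ A y, C z & x = y *m z]].
 move=> [iA cA AP A1] [iC cC CP C1]; split; [exact: irr_mul|exact: cst_mul| |].
  by move=> _ [y [z [/AP Py /CP Pz ->]]]; apply: (sgM sP).
 by exists 1%:M, 1%:M; rewrite mul1mx.
have goodF A : F A -> good A.
 move=> FA; have [[sA zA] iA] := hF _ FA; split=> //; [exact: cst_closed|exact: FP|exact: sg1].
have goodV A : good A -> good [set invmx z | z in A].
 move=> [iA cA AP A1]; have AG : A `<=` @gl k n by move=> a /AP; apply: sg_gl.
 split.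
 - exact: irr_invm.
 - apply: cst_image => //; apply: mor_inv => //; exact: morI.
 - by move=> _ [z /AP Pz <-]; apply: (sgV sP).
 - by exists 1%:M => //; rewrite invmx1.
have [|_ [A [[iA _ _ _] ->]]|_ [A [gA ->]] mA] := irr_acc (P := [set Z | exists A, good A /\ Z = cl A]).
- by exists (cl A0), A0; split=> //; apply: goodF.
- by split; [exact: irr_cl|exact: cl_closed].
have [iA cA AP A1] := gA.
have mul C : good C -> forall x y, cl A x -> C y -> cl A (x *m y).
 move=> gC x y Ax Cy; have gAC := goodM _ _ gA gC; have [_ _ _ C1] := gC.
 have : cl A `<=` cl [set x | exists y z, [/\ A y, C z & x = y *m z]].
  by apply: cl_mono => a Aa; exists a, 1%:M; rewrite mulmx1.
 move=> /(mA _ (ex_intro _ _ (conj gAC erefl))); apply.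
 apply: (mor_cl (D := setT) (D' := A) (F := fun z => z *m y) _ _ _ _ I Ax) => //.
 - by apply: mor_mulr; apply: morI.
 - exact: cl_closed.
 - by move=> a Aa; apply: sub_cl; exists a, y.
have c1 : cl A 1%:M by apply: sub_cl.
have in_cl C : good C -> C `<=` cl A by move=> gC y Cy; rewrite -[y]mul1mx; apply: (mul C).
have clP x : cl A x -> x \in unitmx.
 by apply: (cl_sub closed_gl) => a /AP; apply: sg_gl.
have sZ : subgroup (cl A).
 split=> // [x y Ax Ay|x Ax].
  apply: (mor_cl (D := setT) (D' := A) _ _ _ _ I Ay) => //.
  - by apply: mor_mull; apply: morI.
  - exact: cl_closed.
  - by move=> a Aa; apply: (mul A).
 have /(_ x) : forall v, gl v -> cl A v -> cl A (invmx v).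
  move=> v gv cv; apply: (mor_cl (D' := A) _ _ _ _ gv cv).
  - by apply: mor_inv => //; apply: morI.
  - exact: cl_closed.
  - by move=> a /AP; apply: sg_gl.
  - by move=> a Aa; apply: in_cl (goodV _ gA) _ _; exists a.
 by apply=> //; apply: clP.
have -> : P = cl A.
 apply/seteqP; split.
  by apply: gen_least => // x [C FC Cx]; apply: in_cl (goodF _ FC) _ Cx.
 move=> x Ax; have [||a [b [Aa Ab ->]]] := dense_cst_coset (irr_cl iA) (cl_closed (Z := A)) sZ cA _ _ Ax.
 - exact: sub_cl.
 - by [].
 by apply: (sgM sP); [exact: AP|apply: (sgV sP); apply: AP].
by split; [split=> //; exact: cl_closed|exact: irr_cl].
Qed.

Lemma sg_mul_normal A U : subgroup A -> subgroup U -> (forall a u, A a -> U u -> U (mxconj a u)) ->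
 subgroup [set x | exists a u, [/\ A a, U u & x = a *m u]].
move=> sA sU nU.
split=> [_ [m [u [/sg_gl um /(sg_gl sU) uu ->]]]||_ _ [m [u [Mm Uu ->]]] [m' [u' [Mm' Uu' ->]]]|_ [m [u [Mm Uu ->]]]].
- by rewrite /gl /= unitmx_mul um.
- by exists 1%:M, 1%:M; rewrite mul1mx; split=> //; exact: sg1.
- have um' := sg_gl sA Mm'.
 exists (m *m m'), (mxconj (invmx m') u *m u'); split; [exact: sgM| |].
  by apply: sgM => //; apply: nU => //; apply: sgV.
 by rewrite /mxconj invmxK !mulmxA mulmxK.
- have um := sg_gl sA Mm; have uu := sg_gl sU Uu.
 exists (invmx m), (mxconj m (invmx u)); split; [exact: sgV| |].
  by apply: nU; [|exact: sgV].
 by rewrite invmxM // !mulmxA mulVmx // mul1mx.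
Qed.

(** The identity component of the intersection, times [U], is closed of finite index in [A], hence
    equal to [A]; since [L] meets [U] trivially, the component exhausts the intersection. *)
Lemma irr_levi A L U : cgrp A -> irr A -> cgrp L -> cgrp U -> U `<=` A ->
 (forall a u, A a -> U u -> U (mxconj a u)) -> L `&` U `<=` [set 1%:M] ->
 (forall a, A a -> exists l u, [/\ L l, U u & a = l *m u]) -> irr (A `&` L).
move=> [sA zA] iA [sL zL] [sU zU] UA nU LU dec.
have cM : cgrp (A `&` L) by apply: cgrpI.
have [cM0 iM0 _] := gcompP cM; have [sM0 zM0] := cM0.
pose D : set M := [set x | exists m u, [/\ gcomp (A `&` L) m, U u & x = m *m u]].
have M0A m : gcomp (A `&` L) m -> A m by move=> /gcomp_sub[].
have sD : subgroup D by apply: sg_mul_normal => // a u /M0A; apply: nU.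
have cD : cgrp D.
 by split=> //; apply: cst_sg_closed => //; apply: cst_mul; apply: cst_closed.
have AD : A `<=` D.
 apply: irr_fin_index => //; first exact: sg1.
 have [sq [usq hsq]] := gcomp_fin cM; exists sq; split=> // a Aa.
 have [l [u [Ll Uu e]]] := dec _ Aa.
 have Ml : (A `&` L) l by split=> //; rewrite -[l](mulmxK (sg_gl sU Uu)) -e; apply: sgM => //; apply: sgV => //; apply: UA.
 have [g [gs M0]] := hsq _ Ml; exists g; split=> //; exists (invmx g *m l), u.
 by rewrite e mulmxA.
suff -> : A `&` L = gcomp (A `&` L) by [].
apply/seteqP; split=> [x [Ax Lx]|]; last exact: gcomp_sub.
have [m [u [Mm Uu e]]] := AD _ Ax; rewrite e.
suff -> : u = 1%:M by rewrite mulmx1.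
apply: LU; split=> //; rewrite -[u](mulKmx (sg_gl sM0 Mm)) -e; apply: sgM => //; apply: sgV => //.
by have [] := gcomp_sub Mm.
Qed.

(** Derived groups modulo the normal subgroup [U]. It transports the solvability of [N] to its image
    in [P/U], realized inside [L]. *)
Lemma derived_mod P U A N : subgroup P -> subgroup U -> U `<=` P -> (forall p u, P p -> U u -> U (mxconj p u)) ->
 subgroup A -> A `<=` P -> subgroup N -> N `<=` P -> (forall a, A a -> exists2 x, N x & U (invmx x *m a)) ->
 forall a, derived A a -> exists2 x, derived N x & U (invmx x *m a).
move=> sP sU UP nU sA AP sN NP h a da.
have sdN := derived_sg sN; have dNP x : derived N x -> P x by move=> /(derived_sub sN)/NP.
have modM a1 a2 x1 x2 : P a1 -> P a2 -> P x1 -> P x2 -> U (invmx x1 *m a1) -> U (invmx x2 *m a2) ->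
  U (invmx (x1 *m x2) *m (a1 *m a2)).
 move=> p1 p2 q1 q2 h1 h2; have u1 := sg_gl sP q1; have u2 := sg_gl sP q2.
 have -> : invmx (x1 *m x2) *m (a1 *m a2) = mxconj (invmx x2) (invmx x1 *m a1) *m (invmx x2 *m a2).
  by rewrite invmxM // /mxconj invmxK !mulmxA mulmxK.
 by apply: sgM => //; apply: nU => //; apply: sgV.
have modV a1 x1 : P a1 -> P x1 -> U (invmx x1 *m a1) -> U (invmx (invmx x1) *m invmx a1).
 move=> p1 q1 h1; have u1 := sg_gl sP q1; have v1 := sg_gl sP p1.
 have -> : invmx (invmx x1) *m invmx a1 = mxconj x1 (invmx (invmx x1 *m a1)).
  by rewrite invmxM ?unitmx_inv // /mxconj !invmxK mulmxA mulmxK.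
 by apply: nU => //; apply: sgV.
suff [] : [set a | P a /\ exists2 x, derived N x & U (invmx x *m a)] a by [].
apply: gen_least da; first split=> [x [/(sg_gl sP)//]||x y [Px [x' dx hx]] [Py [y' dy hy]]|x [Px [x' dx hx]]].
- split; first exact: sg1.
 by exists 1%:M; [exact: sg1|rewrite invmx1 mulmx1; exact: sg1].
- by split; [exact: sgM|exists (x' *m y'); [exact: sgM sdN dx dy|apply: modM => //; exact: dNP]].
- by split; [exact: sgV|exists (invmx x'); [exact: sgV sdN dx|apply: modV => //; exact: dNP]].
move=> _ [x [y [Ax Ay ->]]]; have Px := AP _ Ax; have Py := AP _ Ay.
have [x' Nx hx] := h _ Ax; have [y' Ny hy] := h _ Ay; have Qx := NP _ Nx; have Qy := NP _ Ny.
have sgVP := sgV sP; split; first by apply: sgM (sgVP _ Py) => //; apply: sgM (sgVP _ Px) => //; apply: sgM.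
exists (x' *m y' *m invmx x' *m invmx y'); first by apply: gen_sub; exists x', y'.
apply: (modM _ _ _ _ _ _ _ _ _ (modV _ _ _ _ hy)) => //; try exact: sgVP.
- by apply: sgM (sgVP _ Px) => //; apply: sgM.
- by apply: sgM (sgVP _ Qx) => //; apply: sgM.
by apply: (modM _ _ _ _ _ _ _ _ _ (modV _ _ _ _ hx)) => //; [exact: sgM|exact: sgVP|exact: sgM|exact: sgVP|exact: modM].
Qed.

Lemma borel_exists L A : cgrp A -> irr A -> A `<=` L -> solvable_group A -> exists2 B, borel L B & A `<=` B.
move=> cA iA AL solA.
have [|Z [[[_ ?] ? _] _]//|B [[cB iB BL] [solB AB]] mB] := irr_acc (P := [set Z | [/\ cgrp Z, irr Z & Z `<=` L] /\ solvable_group Z /\ A `<=` Z]).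
- by exists A; split; split.
exists B => //; split=> // B' cB' iB' B'L solB' BB'; apply: mB => //; split=> //; split=> //.
exact: subset_trans BB'.
Qed.

Lemma borel_cj L B g : subgroup L -> L g -> borel L B -> borel L (cj g B).
move=> sL Lg [cB iB BL solB mB]; have ug := sg_gl sL Lg; have uV : invmx g \in unitmx by rewrite unitmx_inv.
split; [exact: cj_cgrp|exact: cj_irr|by rewrite -(cj_id sL Lg); apply: cj_mono|by apply: solv_cj; case: cB|].
move=> B' cB' iB' B'L solB' BB'; rewrite -(cjVK B' ug); apply: cj_mono; apply: mB.
- exact: cj_cgrp.
- exact: cj_irr.
- by rewrite -(cj_id sL (sgV sL Lg)); apply: cj_mono.
- by apply: solv_cj; case: cB'.
- by rewrite -(cjK B ug); apply: cj_mono.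
Qed.

Lemma iter_derived_sub d A : subgroup A -> iter d (@derived k n) A `<=` A.
move=> sA; elim: d => //= d IH; apply: subset_trans IH; apply: derived_sub; exact: iter_derived_sg.
Qed.

End Levi.

(** The commutator of [x] and [t] lies in [T], so it is semisimple, and in triangular form it is
    unipotent; hence it is 1. *)
Lemma normalizer_torus {k : closedFieldType} {n} (C T : set 'M[k]_n) x : cgrp C -> irr C ->
 solvable_group C -> subgroup T -> T `<=` C -> diagonalizable_group T ->
 C x -> cj x T `<=` T -> cent T x.
case: n C T x => [|n'] C T x cC iC solC sT TC dT Cx nx.
 by split=> [|t _]; [exact: sg_gl cC.1 Cx|apply/matrixP => -[]].
have [sC _] := cC; have ux := sg_gl sC Cx; split=> // t Tt; have ut := sg_gl sT Tt.
have [y uy tr] := trigonalize sC iC solC.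
have e : mxconj (mxconj y x) (mxconj y t) = mxconj y (mxconj x t).
 by rewrite {1}/mxconj -mxconjV // -!mxconjM.
have [_ h1] := rad_comm (cj_cgrp uy cC) tr
 (ex_intro2 _ _ x Cx erefl) (ex_intro2 _ _ t (TC _ Tt) erefl).
have e2 : mxconj x t *m invmx t = 1%:M.
 apply: (can_inj (fun z => mxconjK z uy)); rewrite [RHS]mxconj1 // mxconjM // mxconjV // -e.
 apply: sst_ut1 => //; rewrite e -mxconjV // -mxconjM //; apply: sst_conj => //.
 apply: (diag_group_sst dT); apply: sgM => //; last exact: sgV.
 by apply: nx; exists t.
have : mxconj x t = t by rewrite -[LHS](mulmxKV ut) e2 mul1mx.
by rewrite mxconj_id.
Qed.

(** * Stabilizers are strongly solvable *)

Section Stab.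
Context {k : closedFieldType} {n : nat}.
Local Notation M := 'M[k]_n.
Implicit Types (G B T P L U : set M) (x y g : M).

(** The image of [N] in [P/U] is realized as the intersection of [A = N U] with [L]. If [l] fixes
    the point, its conjugate by [l1^-1] is conjugated by [u^-1] into [N]; conjugation by [u] changes
    an element of [P] only by a factor in [U], so the conjugate of [l] lies in that image. *)
Lemma stab_in_borel G B T P L U wd l1 u : cgrp G -> irr G -> borel G B -> maxtor G T -> T `<=` B ->
 G wd -> cj wd T = T -> cgrp P -> irr P -> B `<=` P -> P `<=` G -> cgrp L -> L `<=` P ->
 cgrp U -> irr U -> U `<=` P -> (forall p u, P p -> U u -> U (mxconj p u)) -> L `&` U `<=` [set 1%:M] ->
 (forall p, P p -> exists l u, [/\ L l, U u & p = l *m u]) -> L l1 -> U u ->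
 exists2 BK, borel L BK & forall l, L l -> (exists2 b, B b & l *m (l1 *m u *m wd) = l1 *m u *m wd *m b) -> BK l.
move=> cG iG bB mT TB Gwd wT cP iP BP PG cL LP cU iU UP nU LU dec Ll1 Uu.
have [cB iB BG solB _] := bB; have [sG zG] := cG; have [sP zP] := cP; have [sL zL] := cL; have [sU zU] := cU.
have [tT TG mxT] := mT; have [[sT zT] iT dT] := tT; have uw := sg_gl sG Gwd.
pose C := cj wd B; have cC : cgrp C by apply: cj_cgrp.
have iC : irr C by apply: cj_irr.
have solC : solvable_group C by apply: solv_cj; case: cB.
have TC : T `<=` C by rewrite -wT; apply: cj_mono.
have CG : C `<=` G by rewrite -(cj_id sG Gwd); apply: cj_mono.
have cenB := cent_in_borel cG iG bB mT TB.
have iCT : irr (C `&` cent T) by apply: irr_cent => //; apply: maxtor_sub mT.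
have [cGT0 iGT0 mGT] := gcompP (cgrpI cG (cent_cgrp T)).
(* The centralizer of [T] in [C] is connected, so it lies in the identity component of the
   centralizer in [G], hence in [B] and in [P]. *)
have CTB : C `&` cent T `<=` B.
 apply: subset_trans cenB; apply: mGT => //; first by move=> x [/CG Gx ?].
 by split; [exact: sg1 cC.1|exact: sg1 (cent_cgrp T).1].
pose N := P `&` C; have cN : cgrp N by apply: cgrpI.
have [cN0 iN0 mN0] := gcompP cN; have [sN zN] := cN.
have CTN : C `&` cent T `<=` gcomp N.
 apply: mN0 => //; last by split; [exact: sg1 cC.1|exact: sg1 (cent_cgrp T).1].
 by move=> x hx; split; [apply: BP; exact: CTB|case: hx].
have iN : irr N.
 suff -> : N = gcomp N by [].
 apply/seteqP; split=> [x Nx|]; last exact: gcomp_sub.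
 have ux := sg_gl sN Nx; have [Px Cx] := Nx; have Gx := PG _ Px.
 have TN : T `<=` N by move=> t Tt; split; [apply: BP; exact: TB|exact: TC].
 have TN0 : T `<=` gcomp N by apply: mN0 => //; exact: sg1.
 have xTN0 : cj x T `<=` gcomp N.
  apply: mN0; [exact: cj_irr| |by exists 1%:M; [exact: sg1|rewrite mxconj1]].
  by move=> _ [t Tt <-]; apply: sg_conj => //; apply: TN.
 have mxT' : maxtor G (cj x T) by rewrite -(cj_id sG Gx); apply: maxtor_cj.
 have [||y N0y e] := tori_conj cG _ cN0 iN0 _ mT mxT' TN0 xTN0.
 - by move=> z /gcomp_sub[/PG].
 - by apply: solv_sub solC; [case: cN0|move=> z /gcomp_sub[]].
 have Ny := gcomp_sub N0y; have uy := sg_gl sN Ny.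
 suff : gcomp N (invmx y *m x) by move=> /(sgM cN0.1 N0y); rewrite mulKVmx.
 apply: CTN; have Cyx : C (invmx y *m x) by apply: sgM (sgV cC.1 _) _ => //; [exact: cC.1|case: Ny].
 split=> //; apply: (normalizer_torus cC) => // _ [t Tt <-].
 rewrite mxconjMl ?unitmx_inv //; have : cj y T (mxconj x t) by rewrite e; exists t.
 by move=> [t' Tt' <-]; rewrite mxconjK.
have solN : solvable_group N by apply: solv_sub solC => // x [].
pose A : set M := [set x | exists m v, [/\ N m, U v & x = m *m v]].
have NP m : N m -> P m by case.
have sA : subgroup A by apply: sg_mul_normal => // a v /NP; apply: nU.
have cA : cgrp A by split=> //; apply: cst_sg_closed => //; apply: cst_mul; apply: cst_closed.
have iA : irr A by apply: irr_mul.
have AP : A `<=` P by move=> _ [m [v [/NP Pm /UP Pv ->]]]; apply: sgM.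
have UA : U `<=` A by move=> v Uv; exists 1%:M, v; rewrite mul1mx; split=> //; apply: sg1.
have cM : cgrp (A `&` L) by apply: cgrpI.
have iM : irr (A `&` L).
 apply: (irr_levi (U := U)) => //; first by move=> a v /AP Pa; apply: nU.
 by move=> a /AP /dec.
have solM : solvable_group (A `&` L).
 apply/solvP; first by case: cM.
 have [d hd] := (solvP sN).1 solN; exists d => x Dx.
 have [y /hd -> hy] : exists2 y, iter d (@derived k n) N y & U (invmx y *m x).
  elim: d x Dx {hd} => [|d IH] x.
   by move=> [[m [v [Nm Uv ->]]] _]; exists m => //; rewrite mulKmx // (sg_gl sN).
  apply: (derived_mod sP sU UP nU) => //.
  - exact: iter_derived_sg cM.1.
  - by move=> z /(iter_derived_sub cM.1)[/AP].
  - exact: iter_derived_sg.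
  - by move=> z /(iter_derived_sub sN)/NP.
 apply: LU; split; first by have [] := iter_derived_sub cM.1 Dx.
 by move: hy; rewrite invmx1 mul1mx.
have [BK bBK MBK] := borel_exists cM iM (fun x => @proj2 _ _) solM.
have ul1 := sg_gl sL Ll1; have uu := sg_gl sU Uu.
exists (cj l1 BK); first exact: borel_cj.
move=> l Ll [b Bb e]; apply/cjP => //; apply: MBK.
have Ll' : L (mxconj (invmx l1) l) by apply: sg_conj => //; apply: sgV.
split=> //; set l' := mxconj _ l in Ll' *; pose m := mxconj (invmx u) l'.
have Pm : P m by apply: sg_conj => //; [apply: sgV => //; apply: UP|apply: LP].
have Nm : N m.
 split=> //; exists b => //; rewrite /m /l' -mxconjMl ?unitmx_inv // -invmxM //.
 have := congr1 (fun z => invmx (l1 *m u) *m z *m invmx wd) e.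
 rewrite /mxconj invmxK !mulmxA mulmxK // => ->.
 by rewrite -[invmx _ *m l1 *m u]mulmxA mulVmx ?unitmx_mul ?ul1 // mul1mx.
exists m, (mxconj (invmx m) u *m invmx u); split=> //.
 by apply: sgM => //; [apply: nU => //; apply: sgV|apply: sgV].
rewrite /mxconj invmxK !mulmxA mulmxV ?(sg_gl sP Pm) // mul1mx.
by rewrite /l' mulmxV // mul1mx [invmx (invmx u)]invmxK mulmxK.
Qed.

End Stab.

(** * Translation-stable families of functions *)

Section Fam.
Context {k : closedFieldType} {n : nat}.
Local Notation M := 'M[k]_n.

(** A finite-dimensional space of functions stable under left translation, with its representation
    [R]. The [E i] only span it, so that sums and products of families are again families. *)
Definition ffam (I : finType) (E : M -> I -> k) (R : M -> I -> I -> k) :=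
 [/\ forall i, pol (E ^~ i), forall i j, pol (fun x => R x i j),
  forall g x i, g \in unitmx -> E (g *m x) i = \sum_j R g i j * E x j,
  forall g h i j, g \in unitmx -> h \in unitmx -> R (g *m h) i j = \sum_l R g i l * R h l j &
  forall i j, R 1%:M i j = (i == j)%:R].

Lemma ffam_sum I1 E1 R1 I2 E2 R2 : @ffam I1 E1 R1 -> @ffam I2 E2 R2 ->
 @ffam (I1 + I2)%type (fun x i => match i with inl i => E1 x i | inr i => E2 x i end)
  (fun x i j => match i, j with inl i, inl j => R1 x i j | inr i, inr j => R2 x i j | _, _ => 0 end).
move=> [pE1 pR1 eE1 eR1 e11] [pE2 pR2 eE2 eR2 e12].
split=> [[]//|[i|i] [j|j]|g x [i|i] ug|g h [i|i] [j|j] ug uh|[i|i] [j|j]] //; try exact: polC.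
- by rewrite eE1 // big_sumType /= [X in _ + X]big1 ?addr0 // => j _; rewrite mul0r.
- by rewrite eE2 // big_sumType /= [X in X + _]big1 ?add0r // => j _; rewrite mul0r.
- by rewrite eR1 // big_sumType /= [X in _ + X]big1 ?addr0 // => l _; rewrite mul0r.
- by rewrite big_sumType /= !big1 ?addr0 // => l _; rewrite ?mul0r ?mulr0.
- by rewrite big_sumType /= !big1 ?addr0 // => l _; rewrite ?mul0r ?mulr0.
- by rewrite eR2 // big_sumType /= [X in X + _]big1 ?add0r // => l _; rewrite mul0r.
Qed.

Lemma ffam_prod I1 E1 R1 I2 E2 R2 : @ffam I1 E1 R1 -> @ffam I2 E2 R2 ->
 @ffam (I1 * I2)%type (fun x i => E1 x i.1 * E2 x i.2) (fun x i j => R1 x i.1 j.1 * R2 x i.2 j.2).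
move=> [pE1 pR1 eE1 eR1 e11] [pE2 pR2 eE2 eR2 e12].
split=> [i|i j|g x [i1 i2] ug|g h [i1 i2] [j1 j2] ug uh|[i1 i2] [j1 j2]]; try exact: polM.
- rewrite eE1 // eE2 // mulr_suml.
 under [LHS]eq_bigr do rewrite mulr_sumr; rewrite pair_bigA.
 by apply: eq_bigr => j _; rewrite mulrACA.
- rewrite eR1 // eR2 // mulr_suml.
 under [LHS]eq_bigr do rewrite mulr_sumr; rewrite pair_bigA.
 by apply: eq_bigr => j _; rewrite mulrACA.
- by rewrite e11 e12 -natrM mulnb.
Qed.

Lemma ffam_pol f : pol f -> exists (I : finType) E R, @ffam I E R /\
 exists l : I -> k, forall x, f x = \sum_i l i * E x i.
elim/mxpol_ind => [c|i j||{}f g [I1 [E1 [R1 [F1 [l1 h1]]]]] [I2 [E2 [R2 [F2 [l2 h2]]]]]|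
  {}f g [I1 [E1 [R1 [F1 [l1 h1]]]]] [I2 [E2 [R2 [F2 [l2 h2]]]]]].
- exists unit, (fun _ _ => 1), (fun _ _ _ => 1); split.
  by split=> [i|i j|*|*|[] []]; rewrite ?big_const ?card_unit /= ?addr0 ?mulr1 //; exact: polC.
 by exists (fun=> c) => x; rewrite big_const card_unit /= addr0 mulr1.
- exists 'I_n, (fun x i => x i j), (fun x i j => x i j); split.
  split=> [i'|i' j'|g x i' _|g h i' j' _ _|i' j']; rewrite ?mxE //; exact: polmx_id.
 exists (fun l => (l == i)%:R) => x; rewrite (bigD1 i) //= eqxx mul1r big1 ?addr0 // => l.
 by move=> /negbTE ->; rewrite mul0r.
- exists unit, (fun x _ => (\det x)^-1), (fun x _ _ => (\det x)^-1); split.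
  split=> [i|i j|g x i _|g h i j _ _|[] []]; rewrite ?big_const ?card_unit /= ?addr0 ?det_mulmx ?invfM ?det1 ?invr1 //;
   exact: pol_detV.
 by exists (fun=> 1) => x; rewrite big_const card_unit /= addr0 mul1r.
- exists (I1 + I2)%type; do 2 eexists; split; first exact: ffam_sum F1 F2.
 by exists (fun i => match i with inl i => l1 i | inr i => l2 i end) => x; rewrite big_sumType h1 h2.
- exists (I1 * I2)%type; do 2 eexists; split; first exact: ffam_prod F1 F2.
 exists (fun i => l1 i.1 * l2 i.2) => x; rewrite h1 h2 mulr_suml.
 under [LHS]eq_bigr do rewrite mulr_sumr; rewrite pair_bigA.
 by apply: eq_bigr => j _; rewrite mulrACA.
Qed.

Definition fam N (E : M -> 'cV[k]_N) (R : M -> 'M[k]_N) :=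
 [/\ polmx E, polmx R, forall g x, g \in unitmx -> E (g *m x) = R g *m E x,
  forall g h, g \in unitmx -> h \in unitmx -> R (g *m h) = R g *m R h & R 1%:M = 1%:M].

Lemma fam_pols (fs : seq (M -> k)) : (forall f, List.In f fs -> pol f) ->
 exists N E R, @fam N E R /\ forall f, List.In f fs -> exists l : 'rV_N, forall x, f x = (l *m E x) 0 0.
move=> pfs.
have [I [E [R [[pE pR eE eR e1] hl]]]] : exists I E R, @ffam I E R /\
  forall f, List.In f fs -> exists l : I -> k, forall x, f x = \sum_i l i * E x i.
 elim: fs pfs => [|f fs IH] pfs.
  by have [I [E [R [F _]]]] := ffam_pol (polC 0); exists I, E, R.
 have [|I1 [E1 [R1 [F1 h1]]]] := IH; first by move=> g gs; apply: pfs; right.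
 have [I2 [E2 [R2 [F2 [l2 h2]]]]] := ffam_pol (pfs f (or_introl erefl)).
 exists (I1 + I2)%type; do 2 eexists; split; first exact: ffam_sum F1 F2.
 move=> g [<-|/h1[l1 hl]].
  exists (fun i => match i with inl i => 0 | inr i => l2 i end) => x.
  by rewrite big_sumType /= [X in X + _]big1 ?add0r // => j _; rewrite mul0r.
 exists (fun i => match i with inl i => l1 i | inr i => 0 end) => x.
 by rewrite big_sumType /= [X in _ + X]big1 ?addr0 // => j _; rewrite mul0r.
have sE (F : I -> k) : \sum_i F i = \sum_(j < #|I|) F (enum_val j).
 by rewrite (reindex (@enum_val I I)) //; apply: onW_bij; apply: enum_val_bij.
exists #|I|, (fun x => \col_i E x (enum_val i)), (fun x => \matrix_(i, j) R x (enum_val i) (enum_val j)).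
split; first split=> [i j|i j|g x ug|g h ug uh|].
- by apply: (pol_ext (f := E ^~ (enum_val i))) => // x; rewrite mxE.
- by apply: (pol_ext (f := fun x => R x (enum_val i) (enum_val j))) => // x; rewrite mxE.
- by apply/colP => i; rewrite !mxE eE // sE; apply: eq_bigr => j _; rewrite !mxE.
- by apply/matrixP => i j; rewrite !mxE eR // sE; apply: eq_bigr => l _; rewrite !mxE.
- by apply/matrixP => i j; rewrite !mxE e1 (inj_eq enum_val_inj).
move=> f /hl[l h]; exists (\row_i l (enum_val i)) => x; rewrite h sE mxE.
by apply: eq_bigr => j _; rewrite !mxE.
Qed.

Lemma fam_unit N E R g : @fam N E R -> g \in unitmx -> R g *m R (invmx g) = 1%:M /\ R (invmx g) *m R g = 1%:M.
by move=> [_ _ _ eR e1] ug; rewrite -!eR ?unitmx_inv // mulmxV // mulVmx.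
Qed.

End Fam.

(** The conditions imposed by finite sets of points cut out closed sets of row vectors; a minimal
    one already satisfies all conditions. *)
Lemma fin_points {k : closedFieldType} (T : Type) (Z : set T) N (e : T -> 'cV[k]_N) :
 exists zs : seq T, (forall z, List.In z zs -> Z z) /\
  forall l : 'rV_N, (forall z, List.In z zs -> l *m e z = 0) -> forall z, Z z -> l *m e z = 0.
pose A zs : set 'rV[k]_N := [set l | forall z, List.In z zs -> l *m e z = 0].
have cA zs : zclosed (A zs).
 move=> l hl z zzs; apply/matrixP => i j; rewrite !ord1 [RHS]mxE.
 apply: (hl (fun l => (l *m e z) 0 0)) => [|l' /(_ z zzs) ->]; last by rewrite mxE.
 apply: polmxM; last exact: polmxC.
 by move=> a b; rewrite ord1; apply: pol_row.
have [|_ [zs [_ ->]]|_ [zs [hzs ->]] mA] := closed_min (F := [set Y | exists zs, (forall z, List.In z zs -> Z z) /\ Y = A zs]).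
- by exists (A [::]), [::].
- exact: cA.
exists zs; split=> // l hl z Zz.
have : A (z :: zs) l; last by apply; left.
apply: mA hl => [|l' h' z' z's]; last by apply: h'; right.
by exists (z :: zs); split=> // z' [<-|/hzs].
Qed.

Lemma In_nth (T : Type) (s : seq T) x x0 : List.In x s -> exists2 i, (i < size s)%N & nth x0 s i = x.
by elim: s => //= y s IH [->|/IH[i il <-]]; [exists 0|exists i.+1]. Qed.

Lemma nth_In (T : Type) (s : seq T) x0 i : (i < size s)%N -> List.In (nth x0 s i) s.
by elim: s i => //= y s IH [_|i /IH]; [left|right]. Qed.

Lemma fin_span {k : closedFieldType} (T : Type) (Z : set T) N (e : T -> 'rV[k]_N) :
 exists zs : seq T, (forall z, List.In z zs -> Z z) /\
  forall z, Z z -> exists c : nat -> k, forall z0, e z = \sum_(i < size zs) c i *: e (nth z0 zs i).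
have [zs [hzs h]] := fin_points Z (fun z => (e z)^T); exists zs; split=> // z Zz.
pose A := \matrix_(i < size zs) e (nth z zs i).
have /submxP[c ec] : (e z <= A)%MS.
 rewrite submxE; apply/eqP; set X := cokermx A.
 have AX : A *m X = 0 by rewrite mulmx_coker.
 suff : X^T *m (e z)^T = 0 by move/(congr1 trmx); rewrite trmx_mul !trmxK trmx0.
 apply/row_matrixP => i; rewrite row_mul row0; apply: h Zz => z' /(In_nth z)[j jl <-].
 have /(congr1 (row (Ordinal jl))) := AX; rewrite row_mul row0 rowK => ej.
 have := congr1 trmx ej; rewrite trmx_mul trmx0 => /(congr1 (row i)); rewrite row_mul => ->; exact: row0.
exists (fun i => if insub i is Some j then c 0 j else 0) => z0.
rewrite ec mulmx_sum_row; apply: eq_bigr => i _; rewrite valK rowK.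
by rewrite (set_nth_default z).
Qed.

Section ConstRank.
Context {k : closedFieldType} {V : Type} {cV : crd k V}.

(** [det (D v)] is a generalized minor of size the rank at [v0]. Where it is nonzero and the rank
    does not exceed that at [v0], the rank is constant, and [Pk v] and [Pr v] are polynomial
    projections up to this minor. *)
Lemma const_rank a b (Y : V -> 'M[k]_(a, b)) v0 : polmx Y -> exists (B : V -> k) (Pk : V -> 'M[k]_a) (Pr : V -> 'M[k]_b),
 [/\ pol B, polmx Pk, polmx Pr, B v0 != 0 & forall v, (\rank (Y v) <= \rank (Y v0))%N -> B v != 0 ->
  (forall w : 'rV_a, w *m Y v = 0 <-> (w <= Pk v)%MS) /\
  (forall l : 'rV_b, (l <= Y v)%MS <-> l *m Pr v = 0)].
move=> pY; set r := \rank (Y v0).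
pose P1 := pinvmx (col_base (Y v0)); pose P2 := pinvmx (row_base (Y v0)).
pose D v := P1 *m Y v *m P2.
have D0 : D v0 = 1%:M.
 have e : P1 *m Y v0 = row_base (Y v0).
  rewrite -[X in _ *m X]mulmx_base mulmxA mulVpmx ?col_base_full //; exact: mul1mx.
 by rewrite /D e mulmxVp // row_base_free.
clearbody P1 P2.
have pD : polmx D by apply: polmxM; [apply: polmxM => //|]; exact: polmxC.
have pA := polmx_adj pD; have pB := pol_det pD.
exists (fun v => \det (D v)), (fun v => (\det (D v))%:M - Y v *m P2 *m \adj (D v) *m P1),
 (fun v => (\det (D v))%:M - P2 *m \adj (D v) *m P1 *m Y v); split=> //.
- apply: polmxB; last by apply: polmxM; [apply: polmxM => //; apply: polmxM => //|]; exact: polmxC.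
 by move=> i j; apply: (pol_ext (f := fun v => \det (D v) *+ (i == j))) => [v|]; [rewrite mxE|case: (i == j); [exact: pB|exact: polC]].
- apply: polmxB; last by apply: polmxM => //; apply: polmxM; [apply: polmxM => //|]; exact: polmxC.
 by move=> i j; apply: (pol_ext (f := fun v => \det (D v) *+ (i == j))) => [v|]; [rewrite mxE|case: (i == j); [exact: pB|exact: polC]].
- by rewrite D0 det1 oner_eq0.
move=> v rv Bv; have uD : D v \in unitmx by rewrite unitmxE unitfE.
have rP : \rank (P1 *m Y v) = r.
 apply/eqP; rewrite eqn_leq rank_leq_row; have := mxrankM_maxl (P1 *m Y v) P2.
 by rewrite -/D mxrank_unit.
have /submxP[Z eZ] : (Y v <= P1 *m Y v)%MS.
 by rewrite -(geq_leqif (mxrank_leqif_sup (submxMl _ _))) rP.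
have eY : Y v *m P2 *m \adj (D v) *m P1 *m Y v = \det (D v) *: Y v.
 have -> : Y v *m P2 = Z *m D v by rewrite {1}eZ !mulmxA.
 by rewrite -(mulmxA Z) mul_mx_adj mul_mx_scalar -!scalemxAl -mulmxA -eZ.
split=> [w|l]; split.
- move=> w0; apply/submxP; exists ((\det (D v))^-1 *: w).
 by rewrite mulmxBr mul_mx_scalar -!scalemxAl !mulmxA w0 !mul0mx scaler0 subr0 scalerA mulfV // scale1r.
- by move=> /submxP[z ->]; rewrite -(mulmxA z) mulmxBl eY mul_scalar_mx subrr mulmx0.
- by move=> /submxP[z ->]; rewrite -mulmxA mulmxBr mul_mx_scalar !mulmxA eY subrr mulmx0.
- rewrite mulmxBr mul_mx_scalar => /eqP; rewrite subr_eq0 => /eqP e.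
 by rewrite -(eqmx_scale _ Bv) e !mulmxA submxMl.
Qed.

End ConstRank.

(** * Coset spaces *)

(** Locally a fraction on [K]. The clause [W y] makes [W] open in [K] at the same time. *)
Definition lreg {k : fieldType} {V : Type} {cV : crd k V} (K W : set V) (phi : V -> k) := forall x, W x -> exists p q,
 [/\ pol p, pol q, q x != 0 & forall y, K y -> q y != 0 -> W y /\ phi y = p y / q y].

Section Nf.
Context {k : closedFieldType} {n : nat}.
Local Notation M := 'M[k]_n.
Variables (K H : set M).
Hypotheses (cK : cgrp K) (cH : cgrp H) (HK : H `<=` K).
Implicit Types (x y g h : M) (W : set M).

Definition hinv W (phi : M -> k) :=
 W `<=` K /\ forall x h, W x -> H h -> W (x *m h) /\ phi (x *m h) = phi x.

(** The equations of the coset [x H] among linear combinations of the family [E]. *)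
Definition inI N (E : M -> 'cV[k]_N) x (l : 'rV_N) := forall h, H h -> l *m E (x *m h) = 0.

(** A chart of a Grassmannian: the left kernel of [nf x] is the space of equations of [x H], and
    [nf_proj] normalizes the matrix, so that it depends on the coset only ([nf_H]). *)
Record isnf N (E : M -> 'cV[k]_N) a (P0 : 'M[k]_(a, N)) (delta : M -> k) (nf : M -> 'M[k]_(N, a)) : Prop := IsNf {
 nf_pol : pol delta;
 nf_rat : exists2 nu, polmx nu & forall x, delta x != 0 -> nf x = (delta x)^-1 *: nu x;
 nf_stab : forall x h, K x -> H h -> delta x != 0 -> delta (x *m h) != 0;
 nf_proj : forall x, delta x != 0 -> P0 *m nf x = 1%:M;
 nf_ker : forall x, K x -> delta x != 0 -> forall l, l *m nf x = 0 <-> inI E x l }.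

Let uK x : K x -> x \in unitmx := sg_gl cK.1.
Let uH x : H x -> x \in unitmx := sg_gl cH.1.

Section Family.
Variables (N : nat) (E : M -> 'cV[k]_N) (R : M -> 'M[k]_N).
Hypothesis (F : fam E R).

Lemma inI_mul g x l : g \in unitmx -> inI E (g *m x) l <-> inI E x (l *m R g).
case: F => _ _ eE _ _ ug; have e h : l *m E (g *m x *m h) = l *m R g *m E (x *m h).
 by rewrite -mulmxA eE // mulmxA.
by split=> hl h /hl; rewrite e.
Qed.

Lemma inI_H h x l : H h -> inI E (x *m h) l <-> inI E x l.
move=> Hh; split=> hl h' Hh'.
 by have := hl _ (sgM cH.1 (sgV cH.1 Hh) Hh'); rewrite mulmxA mulmxK // uH.
by rewrite -mulmxA; apply: hl; apply: sgM cH.1 _ _.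
Qed.

(** The equations of [x H] are the [l] with [l *m R x *m C = 0], where [C] has the equations of [H]
    as left kernel; dividing by the square block [den x], invertible near [x0], normalizes. *)
Lemma nf_ex x0 : K x0 -> exists a P0 delta nf, @isnf N E a P0 delta nf /\ delta x0 != 0.
move=> Kx0; case: (F) => pE pR eE eR e1.
have [U hU] : exists U : 'M[k]_N, forall v : 'rV_N, (v <= U)%MS <-> inI E 1%:M v.
 apply: subspace_mx => [h _|c u v hu hv h Hh]; first by rewrite mul0mx.
 by rewrite mulmxDl -scalemxAl hu // hv // scaler0 addr0.
have [r [C [P [PC hC]]]] : exists r C (P : 'M_(r, N)), P *m C = 1%:M /\
  forall l, l *m C = 0 <-> inI E 1%:M l.
 exists _, (col_base (cokermx U)), (pinvmx (col_base (cokermx U))).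
 split=> [|l]; first by rewrite mulVpmx ?col_base_full.
 pose C := col_base (cokermx U); have -> : (l *m C = 0) <-> l *m (C *m row_base (cokermx U)) = 0.
  rewrite (mulmxA l C); split=> [->|e]; first by rewrite mul0mx.
  by apply: (row_free_inj (row_base_free (cokermx U))); rewrite mul0mx.
 by rewrite -hU submxE mulmx_base; split=> [->|/eqP].
have RC h : H h -> R h *m C = C *m (P *m R h *m C).
 move=> Hh; apply/eqP; rewrite -subr_eq0 !mulmxA -mulmxBl -{1}(mul1mx (R h)) -mulmxBl; apply/eqP/row_matrixP => i.
 rewrite row0 2!row_mul; apply/hC/inI_mul; first exact: uH.
 rewrite mulmx1 -[h]mul1mx; apply/inI_H => //; apply/hC.
 by rewrite -row_mul mulmxBl mul1mx -mulmxA PC mulmx1 subrr row0.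
have uG h : H h -> P *m R h *m C \in unitmx.
 move=> Hh; have [/mulmx1_unit[]//] : P *m R h *m C *m (P *m R (invmx h) *m C) = 1%:M.
 rewrite -mulmxA -RC; last exact: sgV cH.1 _.
 by rewrite -mulmxA (mulmxA (R h)) (fam_unit F (uH Hh)).1 mul1mx.
pose P0 := P *m R (invmx x0); pose den x := P0 *m R x *m C.
have d0 : den x0 = 1%:M by rewrite /den -(mulmxA P) (fam_unit F (uK Kx0)).2 mulmx1.
clearbody P0.
have pRC : polmx (fun x => R x *m C) by apply: polmxM => //; exact: polmxC.
have pden : polmx den.
 have : polmx (fun x => P0 *m (R x *m C)) by apply: polmxM => //; exact: polmxC.
 by move=> h i j; apply: pol_ext (h i j) => v; rewrite mulmxA.
exists _, P0, (fun x => \det (den x)), (fun x => R x *m C *m invmx (den x)); split; first split.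
- exact: pol_det.
- exists (fun x => R x *m C *m \adj (den x)); first by apply: polmxM => //; apply: polmx_adj.
 by move=> x dx; rewrite /invmx unitmxE unitfE dx scalemxAr.
- move=> x h Kx Hh dx; have -> : den (x *m h) = den x *m (P *m R h *m C).
  by rewrite /den (eR _ _ (uK Kx) (uH Hh)) mulmxA -mulmxA RC // !mulmxA.
 by rewrite det_mulmx mulf_neq0 // -unitfE -unitmxE uG.
- by move=> x dx; rewrite !mulmxA mulmxV // unitmxE unitfE.
- move=> x Kx dx l; have ud : den x \in unitmx by rewrite unitmxE unitfE.
 have -> : inI E x l <-> l *m R x *m C = 0 by rewrite hC -inI_mul ?mulmx1 //; exact: uK.
 rewrite !mulmxA; split=> [e|->]; last by rewrite mul0mx.
 by rewrite -[LHS](mulmxKV ud) e mul0mx.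
by rewrite d0 det1 oner_eq0.
Qed.

Section Isnf.
Variables (a : nat) (P0 : 'M[k]_(a, N)) (delta : M -> k) (nf : M -> 'M[k]_(N, a)).
Hypothesis (hn : isnf E P0 delta nf).

Lemma nf_row x i : K x -> delta x != 0 -> inI E x (row i (1%:M - nf x *m P0)).
move=> Kx dx; apply/(nf_ker hn) => //.
by rewrite -row_mul mulmxBl mul1mx -mulmxA (nf_proj hn) // mulmx1 subrr row0.
Qed.

Lemma nf_span x l : K x -> delta x != 0 -> inI E x l -> l = l *m (1%:M - nf x *m P0).
by move=> Kx dx /(nf_ker hn Kx dx) e; rewrite mulmxBr mulmx1 mulmxA e mul0mx subr0. Qed.

Lemma nf_fact x b (X : 'M_(N, b)) : K x -> delta x != 0 -> (forall l, inI E x l -> l *m X = 0) ->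
 X = nf x *m (P0 *m X).
move=> Kx dx h; apply/eqP; rewrite -subr_eq0 mulmxA -{1}(mul1mx X) -mulmxBl; apply/eqP/row_matrixP => i.
by rewrite row_mul row0 h //; exact: nf_row.
Qed.

Lemma nf_H x h : K x -> H h -> delta x != 0 -> nf (x *m h) = nf x.
move=> Kx Hh dx; have dh := nf_stab hn Kx Hh dx.
rewrite [LHS](@nf_fact x) ?(nf_proj hn) ?mulmx1 // => l hl.
by apply/(nf_ker hn _ dh); [exact: sgM cK.1 Kx (HK Hh)|apply/inI_H].
Qed.

End Isnf.
End Family.

(** Multiplying numerator and denominator by [q] makes [p = phi * q] hold along the whole coset:
    where [q] vanishes it reads [0 = 0]. *)
Lemma lreg_num W phi y0 : hinv W phi -> lreg K W phi -> W y0 -> exists p q, [/\ pol p, pol q, q y0 != 0,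
 forall y h, K y -> H h -> q (y *m h) != 0 -> W y &
 forall y h, W y -> H h -> p (y *m h) = phi y * q (y *m h)].
move=> [WK ih] lr W0; have [p [q [pp pq q0 h]]] := lr _ W0.
exists (fun x => p x * q x), (fun x => q x * q x); split; try exact: polM.
- by rewrite mulf_neq0.
- move=> y a Ky Ha; rewrite mulf_eq0 orbb => qa.
 have [Wa _] := h _ (sgM cK.1 Ky (HK Ha)) qa.
 by have [] := ih _ _ Wa (sgV cH.1 Ha); rewrite mulmxK // uH.
- move=> y a Wy Ha; have [q0a|q0a] := eqVneq (q (y *m a)) 0; first by rewrite q0a !mulr0.
 have [Wa <-] := ih _ _ Wy Ha; have [_ ->] := h _ (WK _ Wa) q0a.
 by rewrite mulrA divfK.
Qed.

(* Near [y0] both [p] and [q] lie in the span of a family, and comparing normal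
  forms of the two coefficient vectors recovers [phi]. *)
Lemma lreg_nf W phi y0 : hinv W phi -> lreg K W phi -> W y0 -> exists N E R (l m : 'rV[k]_N), [/\ @fam k n N E R,
 ~ inI E y0 m, forall y, K y -> ~ inI E y m -> W y & forall y, W y -> inI E y (l - phi y *: m)].
move=> hi lr W0; have [p [q [pp pq q0 h1 h2]]] := lreg_num hi lr W0.
have [|N [E [R [F hE]]]] := @fam_pols k n [:: p; q]; first by move=> f [<-|[<-|[]]].
have [l el] := hE p (or_introl erefl); have [m em] := hE q (or_intror (or_introl erefl)).
have z (w : 'rV_N) x : (w *m E x = 0) <-> (w *m E x) 0 0 = 0.
 by split=> [->|e]; [rewrite mxE|apply/matrixP => i j; rewrite !ord1 e mxE].
exists N, E, R, l, m; split=> //.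
- by move/(_ _ (sg1 cH.1)); rewrite mulmx1 => /z /eqP; rewrite -em; apply/negP.
- move=> y Ky; apply: contra_notP => nW h Hh; apply/z; rewrite -em; apply/eqP/negPn/negP => qh.
 exact: nW (h1 _ _ Ky Hh qh).
- move=> y Wy h Hh; apply/z; rewrite mulmxBl -scalemxAl.
 have := h2 _ _ Wy Hh; rewrite el em; move: (l *m _) (m *m _) => A A' e.
 by rewrite !mxE e subrr.
Qed.

End Nf.

(** * One family determines the equations in all others *)

Section Key.
Context {k : closedFieldType} {n : nat}.
Local Notation M := 'M[k]_n.
Variables (K H : set M).
Hypotheses (cK : cgrp K) (cH : cgrp H) (HK : H `<=` K).
Let uK x : K x -> x \in unitmx := sg_gl cK.1.
Let uH x : H x -> x \in unitmx := sg_gl cH.1.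

(** Linear combinations of [E0] generate the full ideal of functions vanishing on [H]. Using the
    ideal and not only the zero set is what lets the resulting chart see all regular functions, in
    any characteristic. *)
Definition genfam N0 (E0 : M -> 'cV[k]_N0) := exists (m : nat) (s : nat -> 'rV[k]_N0), (forall i, inI H E0 1%:M (s i)) /\
 forall f, pol f -> (forall h, H h -> f h = 0) ->
  exists c : nat -> M -> k, (forall i, pol (c i)) /\ forall x, f x = \sum_(i < m) c i x * (s i *m E0 x) 0 0.

Lemma genfam_ex : exists N0 E0 R0, @fam k n N0 E0 R0 /\ genfam E0.
have [||||m [s [hs gs]]] := pol_ideal_fg (I := [set f : M -> k | pol f /\ forall h, H h -> f h = 0]).
- by split=> //; exact: polC.
- by move=> f g [pf zf] [pg zg]; split=> [|h Hh]; [exact: polD|rewrite zf ?zg ?addr0].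
- by move=> f g pf [pg zg]; split=> [|h Hh]; [exact: polM|rewrite zg ?mulr0].
- by move=> f [].
have [|N [E [R [F h]]]] := @fam_pols k n [seq s i | i <- iota 0 m].
 by move=> f /List.in_map_iff[i [<- _]]; case: (hs i).
have /choice[l el] i : exists l : 'rV_N, (i < m)%N -> forall x, s i x = (l *m E x) 0 0.
 have [im|] := boolP (i < m)%N; last by exists 0.
 have [|l el] := h (s i); last by exists l.
 by apply: List.in_map; apply/mem_In; rewrite mem_iota.
exists N, E, R; split=> //; exists m, (fun i => if (i < m)%N then l i else 0); split=> [i h' Hh|f pf zf].
 case: ifP => im; last by rewrite mul0mx.
 by apply/matrixP => a b; rewrite !ord1 mul1mx -el // (hs i).2 // mxE.
have [|c [pc ec]] := gs f; first by [].
by exists c; split=> // x; rewrite ec; apply: eq_bigr => i _; rewrite ltn_ord el.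
Qed.

Variables (N0 : nat) (E0 : M -> 'cV[k]_N0) (R0 : M -> 'M[k]_N0) (F0 : fam E0 R0) (G0 : genfam E0).
Variables (a0 : nat) (P0 : 'M[k]_(a0, N0)) (d0 : M -> k) (nf0 : M -> 'M[k]_(N0, a0)).
Hypothesis (hn0 : isnf K H E0 P0 d0 nf0).

Section Rel.
Variables (N : nat) (E : M -> 'cV[k]_N) (R : M -> 'M[k]_N) (F : fam E R).

Definition chv (v : 'rV[k]_(N0 * a0)) : 'M[k]_N0 := 1%:M - vec_mx v *m P0.

Lemma chv_nf x : chv (mxvec (nf0 x)) = 1%:M - nf0 x *m P0.
by rewrite /chv mxvecK. Qed.

(* Coefficients expressing the equations of [xH] in [E] through the generators
  in [E0] can be taken in one finite-dimensional space for all [x]. *)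
Lemma rel_ex : exists N1 E1 R1, @fam k n N1 E1 R1 /\ forall x l, K x -> d0 x != 0 -> inI H E x l ->
 exists m : 'M[k]_(N1, N0), forall z, K z ->
  l *m E z + mxvec m *m (mxvec (E1 z *m (chv (mxvec (nf0 x)) *m E0 z)^T))^T = 0.
case: G0 => m [s [hs gs]]; case: (F0) => _ _ eE0 _ _; case: (F) => pE _ eE _ _.
have [U hU] : exists U : 'M[k]_N, forall v : 'rV_N, (v <= U)%MS <-> inI H E 1%:M v.
 apply: subspace_mx => [h _|c u v hu hv h Hh]; first by rewrite mul0mx.
 by rewrite mulmxDl -scalemxAl hu // hv // scaler0 addr0.
have /choice[c hc] t : exists c : nat -> M -> k, (forall i, pol (c i)) /\
  forall x, (row t U *m E x) 0 0 = \sum_(i < m) c i x * (s i *m E0 x) 0 0.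
 apply: gs => [|h Hh]; first by apply: polmxM => //; exact: polmxC.
 by have := hU (row t U); rewrite row_sub => -[/(_ isT) /(_ h Hh)]; rewrite mul1mx => -> _; rewrite mxE.
have [|N1 [E1 [R1 [F1 h1]]]] := @fam_pols k n [seq c ti.1 ti.2 | ti : 'I_N * 'I_m <- enum {: 'I_N * 'I_m}].
 by move=> f /List.in_map_iff[ti [<- _]]; exact: (hc _).1.
have /choice[al hal] (ti : 'I_N * 'I_m) : exists al : 'rV_N1, forall x, c ti.1 ti.2 x = (al *m E1 x) 0 0.
 apply: h1; apply: (List.in_map (fun ti : 'I_N * 'I_m => c ti.1 ti.2)); apply/mem_In; exact: mem_enum.
exists N1, E1, R1; split=> // x l Kx dx hl; case: (F1) => _ _ eE1 _ _.
have ux := uK Kx; have uxV : invmx x \in unitmx by rewrite unitmx_inv.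
have /hU/submxP[w ew] : inI H E 1%:M (l *m R x) by apply/inI_mul => //; rewrite mulmx1.
pose sg i := s i *m R0 (invmx x).
have hsg i : sg i = sg i *m (1%:M - nf0 x *m P0).
 apply: (nf_span hn0) => //; apply/inI_mul => //.
 by rewrite mulVmx.
exists (- \sum_ti w 0 ti.1 *: ((al ti *m R1 (invmx x))^T *m sg ti.2)) => z Kz.
rewrite linearN mulNmx linear_sum mulmx_suml; apply/eqP; rewrite subr_eq0; apply/eqP.
have ez : z = x *m (invmx x *m z) by rewrite mulKVmx.
rewrite {1}ez eE // mulmxA ew -mulmxA; apply/matrixP => i j; rewrite !ord1 {i j} mxE [RHS]summxE.
under eq_bigr => t _.
 have -> : (U *m E (invmx x *m z)) t 0 = (row t U *m E (invmx x *m z)) 0 0 by rewrite -row_mul [RHS]mxE.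
 rewrite (hc t).2 mulr_sumr; over.
rewrite pair_bigA; apply: eq_bigr => [[t i] _]; rewrite linearZ -scalemxAl mxvec_dotmul [RHS]mxE.
congr (_ * _); rewrite hal eE1 // eE0 // !mulmxA chv_nf -/(sg i).
have {1}-> := hsg i.
rewrite -(mulmxA (sg i)); set X := _ *m E1 z.
rewrite -mulmxA -trmx_mul.
by rewrite [RHS]mxE big_ord1; congr (_ * _); rewrite [RHS]mxE.
Qed.

(** By [rel_ex] the equations of [x H] in [E] are the first components of the kernel of a matrix
    [Q], polynomial in the coordinates [nf0 x]. Translations bound its rank by that at [x1], so
    [const_rank] applies to the kernel, and once more to the projection onto first components. *)
Lemma nf_key x1 : K x1 -> d0 x1 != 0 -> exists (B : 'rV[k]_(N0 * a0) -> k) (A : 'rV[k]_(N0 * a0) -> 'M[k]_N),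
 [/\ pol B, polmx A, B (mxvec (nf0 x1)) != 0 & forall x, K x -> d0 x != 0 -> B (mxvec (nf0 x)) != 0 ->
  forall l, inI H E x l <-> l *m A (mxvec (nf0 x)) = 0].
move=> Kx1 dx1; have [N1 [E1 [R1 [F1 rel]]]] := rel_ex.
case: (F0) => _ _ eE0 _ _; case: (F) => pE _ eE eR _; case: (F1) => _ _ eE1 _ _.
pose cc x := mxvec (nf0 x).
pose TT v z := E1 z *m (chv v *m E0 z)^T.
pose qr v z : 'rV[k]_(N + N1 * N0) := row_mx (E z)^T (mxvec (TT v z)).
(* [qr v z] is [e z] times a matrix depending on [v] alone, so finitely many points [zs] chosen for
   [e] serve for every [v]. *)
pose e z : 'rV[k]_(N + N1 * N0) := row_mx (E z)^T (mxvec (E1 z *m (E0 z)^T)).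
have qrE v z : qr v z = e z *m block_mx 1%:M 0 0 (lin_mx (mulmxr (chv v)^T)).
 rewrite mul_row_block mulmx1 !mulmx0 addr0 add0r mul_vec_lin /qr /TT trmx_mul.
 by rewrite mulmxA.
have [zs [Kzs hzs]] := fin_span K e.
pose Q v := \matrix_(i < size zs) qr v (nth x1 zs i).
have hQ v z : K z -> (qr v z <= Q v)%MS.
 move=> /hzs[c ec]; rewrite qrE (ec x1) mulmx_suml; apply: summx_sub => i _.
 by rewrite -scalemxAl -qrE scalemx_sub // -(rowK (fun i : 'I_(size zs) => qr v (nth x1 zs i)) i) row_sub.
have pch : polmx chv.
 apply: polmxB; first exact: polmxC.
 apply: polmxM; last exact: polmxC.
 by move=> i j; apply: (pol_ext (f := fun v : 'rV_(N0 * a0) => v 0 (mxvec_index i j))) => [v|]; [rewrite mxE|exact: pol_row].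
have pQ : polmx (fun v => (Q v)^T).
 move=> j i; set z := nth x1 zs i; apply: (pol_ext) => [v|]; first by rewrite [RHS]mxE [RHS]mxE.
 rewrite -(splitK j); case: fintype.split => {}j.
  by apply: (pol_ext (f := fun=> E z j 0)) => [v|]; [rewrite row_mxEl mxE|exact: polC].
 case/mxvec_indexP: j => b c; apply: (pol_ext) => [v|]; first by rewrite row_mxEr mxvecE.
 apply: (polmxM (polmxC (E1 z))) => {}b {}c.
 apply: (pol_ext) => [v|]; first by rewrite [RHS]mxE.
 by apply: polmxM => //; exact: polmxC.
have tr x : K x -> d0 x != 0 -> exists2 g, K g & x = g *m x1 /\ exists Y,
  (1%:M - nf0 x *m P0) *m R0 g = Y *m (1%:M - nf0 x1 *m P0).
 move=> Kx dx; exists (x *m invmx x1); first exact: sgM cK.1 Kx (sgV cK.1 Kx1).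
 have ex : x = x *m invmx x1 *m x1 by rewrite mulmxKV // uK.
 have ug : x *m invmx x1 \in unitmx by rewrite unitmx_mul unitmx_inv !uK.
 split=> //; exists ((1%:M - nf0 x *m P0) *m R0 (x *m invmx x1)).
 apply/row_matrixP => i; rewrite [RHS]row_mul; apply: (nf_span hn0) => //.
 by rewrite row_mul; apply/inI_mul => //; rewrite -ex; exact: (nf_row hn0).
have rQ x : K x -> d0 x != 0 -> (\rank (Q (cc x))^T <= \rank (Q (cc x1))^T)%N.
 move=> Kx dx; rewrite (mxrank_tr (Q (cc x))) (mxrank_tr (Q (cc x1))); have [g Kg [ex [Y eY]]] := tr x Kx dx.
 pose Th := block_mx (R g)^T 0 0 (lin_mx (mulmxr Y^T \o mulmx (R1 g))).
 apply: leq_trans (mxrankM_maxl (Q (cc x1)) Th); apply: mxrankS; apply/row_subP => i; rewrite rowK.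
 set z := nth x1 zs i; have Kz : K z by apply: Kzs; exact: nth_In.
 have Kz' : K (invmx g *m z) by apply: (sgM cK.1) Kz; exact: sgV cK.1 Kg.
 suff -> : qr (cc x) z = qr (cc x1) (invmx g *m z) *m Th by apply: submxMr; exact: hQ.
 have ug := uK Kg; have ez : z = g *m (invmx g *m z) by rewrite mulKVmx.
 rewrite mul_row_block !mulmx0 addr0 add0r mul_vec_lin /= /qr {1 2}ez eE // -trmx_mul.
 congr row_mx; rewrite /TT eE1 // eE0 // !chv_nf mulmxA eY.
 by rewrite -(mulmxA Y) [in LHS]trmx_mul !mulmxA.
have [B1 [Pk [Pr1 [pB1 pPk _ B10 hP]]]] := const_rank (cc x1) pQ.
pose Y2 v := Pk v *m col_mx 1%:M 0 : 'M[k]_(N + N1 * N0, N).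
have I2 x : K x -> d0 x != 0 -> B1 (cc x) != 0 -> forall l, inI H E x l <-> (l <= Y2 (cc x))%MS.
 move=> Kx dx Bx l; have [hk _] := hP _ (rQ x Kx dx) Bx; split=> [hl|/submxP[y ->] h Hh].
  have [m hm] := rel x l Kx dx hl.
  have -> : l = row_mx l (mxvec m) *m col_mx 1%:M 0 by rewrite mul_row_col mulmx1 mulmx0 addr0.
  apply: submxMr; apply/hk; rewrite -[row_mx _ _]trmxK -trmx_mul -[RHS]trmx0; congr (_ ^T).
  apply/row_matrixP => i; rewrite row_mul row0 rowK tr_row_mx mul_row_col -[RHS]trmx0.
  rewrite -(hm (nth x1 zs i)); last by apply: Kzs; exact: nth_In.
  by rewrite linearD /= trmx_mul trmx_mul trmxK.
 rewrite mulmxA -(mulmxA _ (col_mx _ _)) mul_col_mx mul1mx mul0mx.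
 have Kxh : K (x *m h) by exact: sgM cK.1 Kx (HK Hh).
 have : y *m Pk (cc x) *m (Q (cc x))^T = 0 by apply/hk; exact: submxMl.
 have /submxP[c ec] := hQ (cc x) _ Kxh; move/(congr1 (mulmx^~ c^T)); rewrite mul0mx -mulmxA -trmx_mul -ec.
 have -> : qr (cc x) (x *m h) = row_mx (E (x *m h))^T 0; last by rewrite tr_row_mx trmxK trmx0.
 rewrite /qr /TT chv_nf; have -> : (1%:M - nf0 x *m P0) *m E0 (x *m h) = 0.
  by apply/row_matrixP => i; rewrite row_mul row0; apply: (nf_row hn0).
 by rewrite trmx0 mulmx0 linear0.
have pY2 : polmx Y2 by apply: polmxM => //; exact: polmxC.
have [B2 [Pk2 [Pr [pB2 _ pPr B20 hR]]]] := const_rank (cc x1) pY2.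
exists (fun v => B1 v * B2 v), Pr; split=> //; [exact: polM|by rewrite mulf_neq0|].
move=> x Kx dx; rewrite mulf_eq0 negb_or => /andP[b1 b2] l; rewrite (I2 x Kx dx b1); have [|_ -> //] := hR (cc x) _ b2.
have [g Kg [ex _]] := tr x Kx dx; have ug := uK Kg; have [RV _] := fam_unit F ug.
have uR : R g \in unitmx by have [] := mulmx1_unit RV.
rewrite -(mxrankMfree (Y2 (cc x)) (B := R g)) ?row_free_unit //; apply: mxrankS; apply/row_subP => i.
apply/(I2 x1 Kx1 dx1 B10); rewrite row_mul; apply/inI_mul => //.
by rewrite -ex; apply/(I2 x Kx dx b1); exact: row_sub.
Qed.
End Rel.
End Key.

Lemma row_pol_ind (k : fieldType) m (P : ('rV[k]_m -> k) -> Prop) :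
 (forall c, P (fun=> c)) -> (forall j, P (fun v => v 0 j)) ->
 (forall f g, P f -> P g -> P (fun v => f v + g v)) ->
 (forall f g, P f -> P g -> P (fun v => f v * g v)) -> forall f, pol f -> P f.
move=> PC PE PD PM f; elim=> {f} [//|i|i|f g _ Pf Pg|f g _ Pf Pg]; [| |exact: PD|exact: PM].
- have [im|im] := ltnP i #|'I_m|.
  have -> : (fun v : 'rV[k]_m => (enc v)`_i) = (fun v => v 0 (enum_val (Ordinal im))); last exact: PE.
  by apply: funext => v; rewrite -(nth_fenc (fun v j => v 0 j)) enum_valK.
 have -> : (fun v : 'rV[k]_m => (enc v)`_i) = (fun=> 0); last exact: PC.
 by apply: funext => v; rewrite nth_default // size_enc.
- by have -> : (fun v : 'rV[k]_m => nth (fun=> 0) (crdx _) i v) = (fun=> 0); [apply: funext => v; case: i|].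
Qed.

Definition cmap {k : fieldType} {V : Type} m (d : V -> k) (nu : V -> 'rV[k]_m) x : 'rV[k]_m := (d x)^-1 *: nu x.

Lemma clear_den {k : fieldType} {V} {cV : crd k V} m (d : V -> k) (nu : V -> 'rV[k]_m) f : pol d -> polmx nu -> pol f ->
 exists (e : nat) (P : V -> k), pol P /\ forall x, d x != 0 -> f (cmap d nu x) = P x / d x ^+ e.
move=> pd pnu; elim/row_pol_ind => [c|j|{}f g [e1 [P1 [p1 h1]]] [e2 [P2 [p2 h2]]]|{}f g [e1 [P1 [p1 h1]]] [e2 [P2 [p2 h2]]]].
- by exists 0, (fun=> c); split=> [|x _]; [exact: polC|rewrite divr1].
- by exists 1, (fun x => nu x 0 j); split=> // x _; rewrite mxE mulrC expr1.
- exists (e1 + e2), (fun x => P1 x * d x ^+ e2 + P2 x * d x ^+ e1); split.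
  by apply: polD; apply: polM => //; exact: pol_exp.
 by move=> x dx; rewrite h1 // h2 // exprD; field; rewrite !expf_neq0.
- exists (e1 + e2), (fun x => P1 x * P2 x); split; first exact: polM.
 by move=> x dx; rewrite h1 // h2 // exprD; field; rewrite !expf_neq0.
Qed.

(** * Charts of the coset space *)

Section Chart.
Context {k : closedFieldType} {n : nat}.
Local Notation M := 'M[k]_n.
Variables (K H : set M).
Hypotheses (cK : cgrp K) (iK : irr K) (cH : cgrp H) (HK : H `<=` K).
Implicit Types (x y g h : M) (W Y Z : set M).
Let uK x : K x -> x \in unitmx := sg_gl cK.1.
Let uH x : H x -> x \in unitmx := sg_gl cH.1.

Definition cdom (d : M -> k) : set M := [set x | K x /\ d x != 0].

(** [ch_sep] makes the fibres cosets, and [ch_reg] makes invariant regular functions fractions in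
    the coordinates. The second excludes inseparable charts, which can satisfy the first. *)
Record chart m (d : M -> k) (nu : M -> 'rV[k]_m) : Prop := Chart {
 ch_pol : pol d; ch_polmx : polmx nu;
 ch_stab : forall x h, cdom d x -> H h -> cdom d (x *m h);
 ch_sep : forall x y, cdom d x -> cdom d y -> cmap d nu x = cmap d nu y <-> H (invmx x *m y);
 ch_reg : forall W phi x, hinv K H W phi -> lreg K W phi -> cdom d x -> W x ->
  exists A B : 'rV[k]_m -> k, [/\ pol A, pol B, B (cmap d nu x) != 0 & forall y, cdom d y -> B (cmap d nu y) != 0 ->
   W y /\ phi y = A (cmap d nu y) / B (cmap d nu y)] }.

Lemma chart_ex x0 : K x0 -> exists m d nu, @chart m d nu /\ d x0 != 0.
move=> Kx0; have [N0 [E0 [R0 [F0 G0]]]] := genfam_ex H.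
have [a [P0 [d [nf [hn d0]]]]] := nf_ex cK cH F0 Kx0.
have [nu pnu enu] := nf_rat hn.
have eC x : d x != 0 -> cmap d (mxvec \o nu) x = mxvec (nf x) by move=> dx; rewrite enu // linearZ.
exists (N0 * a), d, (mxvec \o nu); split=> //; split.
- exact: nf_pol hn.
- move=> i j; rewrite ord1; case/mxvec_indexP: j => b c.
 by apply: pol_ext (pnu b c) => x; rewrite mxvecE.
- by move=> x h [Kx dx] Hh; split; [exact: sgM cK.1 Kx (HK Hh)|exact: (nf_stab hn)].
- move=> x y [Kx dx] [Ky dy]; rewrite !eC //; split=> [/(can_inj mxvecK) e|Hxy]; last first.
  by rewrite -[y in RHS](mulKVmx (uK Kx)) (nf_H cK cH HK hn).
 apply: contrapT => nH; have [f [pf fH /eqP]] := closed_sep cH.2 nH; apply.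
 case: G0 => m [s [hs gs]]; have [c [_ ->]] := gs _ pf fH; apply: big1 => i _.
 have uV : invmx x \in unitmx by rewrite unitmx_inv uK.
 case: (F0) => _ _ eE0 _; rewrite eE0 // mulmxA.
 have : inI H E0 y (s i *m R0 (invmx x)).
  apply/(nf_ker hn Ky dy); rewrite -e; apply/(nf_ker hn Kx dx); apply/inI_mul => //.
  by rewrite mulVmx ?uK.
 by move=> /(_ _ (sg1 cH.1)); rewrite mulmx1 => ->; rewrite mxE mulr0.
- move=> W phi x hi lr [Kx dx] Wx; have [N [E [R [l [mu [F nm hW hl]]]]]] := lreg_nf cK cH HK hi lr Wx.
 have [B [A [pB pA Bx hBA]]] := nf_key cK HK F0 G0 hn F Kx dx.
 have [j nj] : exists j, (mu *m A (mxvec (nf x))) 0 j != 0.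
  apply: contrapT => nj; apply: nm; apply/(hBA x Kx dx Bx); apply/rowP => j; rewrite [RHS]mxE.
  by apply/eqP/negPn/negP => ne; apply: nj; exists j.
 exists (fun v => (l *m A v) 0 j * B v), (fun v => (mu *m A v) 0 j * B v); split.
 + by apply: polM => //; apply: polmxM => //; exact: polmxC.
 + by apply: polM => //; apply: polmxM => //; exact: polmxC.
 + by rewrite eC // mulf_neq0.
 move=> y [Ky dy]; rewrite eC // mulf_eq0 negb_or => /andP[ny By].
 have Wy : W y.
  apply: hW => // /(hBA y Ky dy By) e; by move: ny; rewrite e mxE eqxx.
 split=> //; have /(hBA y Ky dy By)/eqP := hl y Wy.
 rewrite mulmxBl subr_eq0 -scalemxAl => /eqP ->; rewrite [in RHS]mxE.
 by field; rewrite By.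
Qed.

Section One.
Variables (m : nat) (d : M -> k) (nu : M -> 'rV[k]_m).
Hypotheses (pd : pol d) (pnu : polmx nu).
Local Notation C := (cmap d nu).

Lemma irr_cmap Y x0 : irr Y -> Y x0 -> d x0 != 0 -> irr (C @` [set x | Y x /\ d x != 0]).
move=> iY Y0 d0; split; first by exists (C x0), x0.
move=> f g /(clear_den pd pnu)[e1 [P1 [p1 h1]]] /(clear_den pd pnu)[e2 [P2 [p2 h2]]] z.
have [||x Yx|h|h] := iY.2 (fun x => P1 x * d x) (fun x => P2 x * d x); try exact: polM.
- have [->|dx] := eqVneq (d x) 0; first by rewrite !mulr0.
 have : (C @` [set x | Y x /\ d x != 0]) (C x) by exists x.
 move=> /z/eqP; rewrite h1 // h2 // !mulf_eq0 !invr_eq0 !expf_eq0 (negPf dx) !andbF !orbF.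
 by case/orP=> /eqP ->; rewrite !(mul0r, mulr0).
- left=> _ [x [Yx dx] <-]; have /eqP := h x Yx; rewrite mulf_eq0 (negPf dx) orbF => /eqP e.
 by rewrite h1 // e mul0r.
- right=> _ [x [Yx dx] <-]; have /eqP := h x Yx; rewrite mulf_eq0 (negPf dx) orbF => /eqP e.
 by rewrite h2 // e mul0r.
Qed.

Lemma cst_cmap Y : cst Y -> cst (C @` [set x | Y x /\ d x != 0]).
move=> cY; pose S := [set vx : 'rV[k]_m * M | (Y vx.2 /\ d vx.2 != 0) /\
 forall j, List.In j (enum 'I_m) -> d vx.2 * vx.1 0 j - nu vx.2 0 j = 0].
have cS : cst S.
 apply: cstI; first apply: cstI.
 - by apply: (cst_pre) => //; exact: mor_snd.
 - by apply: (cst_nz); exact: pol_snd.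
 - apply: (@cst_forall _ _ _ _ _ (fun j => [set vx : 'rV[k]_m * M | d vx.2 * vx.1 0 j - nu vx.2 0 j = 0])) => j.
  apply: cst_zero; apply: polB; last exact: (pol_snd (f := fun x => nu x 0 j)).
  by apply: polM; [exact: pol_snd|exact: (pol_fst (pol_row j))].
apply: cst_ext (cst_proj cS) => v; split=> [[x [/= [Yx dx] h]]|[x [Yx dx] <-]].
 exists x => //; apply/rowP => j; rewrite mxE; have := h j; rewrite -mem_In mem_enum => /(_ isT)/eqP.
 by rewrite subr_eq0 => /eqP <-; rewrite mulKf.
by exists x; split=> //= j _; rewrite mxE mulVKf // subrr.
Qed.

End One.

(* Adjoining the inverse of a function makes the image of the chart closed. *)
Lemma closed_chart_ex x0 : K x0 -> exists m d (nu : M -> 'rV[k]_m), [/\ chart d nu, exists2 x, K x & d x != 0 &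
 zclosed (cmap d nu @` cdom d)].
move=> Kx0; have [m [d [nu [cd d0]]]] := chart_ex Kx0.
have [pd pnu] := (ch_pol cd, ch_polmx cd).
have cI : cst (cmap d nu @` cdom d) by apply: cst_cmap (cst_closed cK.2).
have iI : irr (cmap d nu @` cdom d) by exact: irr_cmap Kx0 d0.
have [|h [ph [v0 v0c hv0] hC]] := cst_dense cI (irr_cl iI).
 by move=> v hv; apply: cl_mono hv => w hw; split=> //; exact: sub_cl.
have [e [P [pP hP]]] := clear_den pd pnu ph.
have [x1 [Kx1 d1] hx1] : exists2 x, cdom d x & h (cmap d nu x) != 0.
 apply: contrapT => nx; move/eqP: hv0; apply; apply: v0c => // _ [x dx <-].
 by apply/eqP/negPn/negP => hx; apply: nx; exists x.
pose d' x := d x * P x; pose nu' x : 'rV[k]_(m + 1) := row_mx (P x *: nu x) (d x ^+ e.+1)%:M.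
have hd x : cdom d' x <-> cdom d x /\ h (cmap d nu x) != 0.
 rewrite /cdom /= /d' mulf_eq0 negb_or; split=> [[Kx /andP[dx Px]]|[[Kx dx]]].
  by rewrite hP // mulf_neq0 // invr_eq0 expf_neq0.
 by rewrite hP // mulf_eq0 negb_or dx => /andP[-> _].
have eC x : cdom d' x -> cmap d' nu' x = row_mx (cmap d nu x) (h (cmap d nu x))^-1%:M.
 move=> [Kx]; rewrite /d' mulf_eq0 negb_or => /andP[dx Px].
 rewrite /cmap /d' /nu' scale_row_mx scalerA; congr row_mx; first by congr (_ *: _); field; rewrite dx.
 by rewrite hP // scale_scalar_mx exprS; congr (_ %:M); field; rewrite Px expf_neq0.
have eL x : cdom d' x -> lsubmx (cmap d' nu' x) = cmap d nu x by move=> /eC ->; rewrite row_mxKl.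
have pL : mor setT (fun v : 'rV[k]_(m + 1) => lsubmx v).
 apply: mor_row => j; apply: pon_pol; apply: (pol_ext) => [v|]; [by rewrite mxE|exact: pol_row].
exists (m + 1), d', nu'; split.
- split.
 + exact: polM.
 + move=> i j; rewrite -(splitK j); case: fintype.split => {}j.
   apply: (pol_ext) => [x|]; [by rewrite row_mxEl mxE|exact: polM].
  by apply: (pol_ext (f := fun x => d x ^+ e.+1)) => [x|]; [rewrite row_mxEr !ord1 mxE mulr1n|exact: pol_exp].
 + move=> x a /hd[dx hx] Ha; have dxa := ch_stab cd dx Ha; apply/hd.
  by rewrite -(proj2 (ch_sep cd dx dxa)) // mulKmx // uK; case: dx.
 + move=> x y dx dy; rewrite -(ch_sep cd (proj1 (hd x) dx).1 (proj1 (hd y) dy).1).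
  by split=> [e'|e']; [rewrite -eL // e' eL|rewrite !eC // e'].
 + move=> W phi x hi lr dx Wx; have [A [B [pA pB Bx hAB]]] := ch_reg cd hi lr (proj1 (hd x) dx).1 Wx.
  exists (A \o lsubmx), (B \o lsubmx); split; try exact: pol_comp.
   by rewrite /= eL.
  by move=> y dy /=; rewrite eL //; apply: hAB ((proj1 (hd y) dy).1).
- by exists x1; have /hd[] : cdom d x1 /\ h (cmap d nu x1) != 0 by [].
pose Y : set 'rV[k]_(m + 1) := [set v | cl (cV := row_crd k m) (cmap d nu @` cdom d) (lsubmx v) /\ h (lsubmx v) * v 0 (rshift m 0) - 1 = 0].
suff -> : cmap d' nu' @` cdom d' = Y.
 apply: closedI; first by apply: (closed_preT pL); exact: cl_closed.
 apply: closed_zero; apply: polB; last exact: polC.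
 by apply: polM; [exact: pol_comp|exact: pol_row].
apply/seteqP; split=> [_ [x dx <-]|v [/= cv hv]].
 have [dx0 hx] := proj1 (hd x) dx; split; first by rewrite eL //; apply: sub_cl.
 by rewrite eL // eC // row_mxEr mxE mulfV // subrr.
have hn : h (lsubmx v) != 0.
 by apply/eqP => e0; move/eqP: hv; rewrite e0 mul0r sub0r oppr_eq0 oner_eq0.
have [x dx ex] := hC _ cv hn.
have dx' : cdom d' x by apply/hd; rewrite ex.
exists x => //; rewrite eC // ex -[RHS]hsubmxK; congr row_mx; apply/rowP => j; rewrite !ord1 !mxE mulr1n.
by apply: (mulfI hn); rewrite mulfV //; apply/eqP; rewrite eq_sym -subr_eq0; apply/eqP.
Qed.

Lemma lreg_mul W phi g : K g -> lreg K W phi -> lreg K [set x | K x /\ W (g *m x)] (fun x => phi (g *m x)).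
move=> Kg lr x [Kx Wx]; have [p [q [pp pq q0 h]]] := lr _ Wx.
have mg : mor setT (fun x => g *m x) by apply: mor_mull; exact: morI.
exists (fun x => p (g *m x)), (fun x => q (g *m x)); split; try exact: pol_comp.
 by [].
by move=> y Ky qy; have [Wy ->] := h _ (sgM cK.1 Kg Ky) qy.
Qed.

Lemma hinv_mul W phi g : K g -> hinv K H W phi -> hinv K H [set x | K x /\ W (g *m x)] (fun x => phi (g *m x)).
move=> Kg [WK hi]; split=> [x []//|x h [Kx Wx] Hh]; rewrite mulmxA; have [W' ->] := hi _ _ Wx Hh.
by split=> //; split; [exact: sgM cK.1 Kx (HK Hh)|rewrite mulmxA].
Qed.

(** Homogeneity: translates of one nonempty chart cover the coset space, so properties are checked
    near one point. *)
Lemma chart_mul m d nu g : K g -> @chart m d nu -> chart (fun x => d (g *m x)) (fun x => nu (g *m x)).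
move=> Kg cd; have mg : mor setT (fun x => g *m x) by apply: mor_mull; exact: morI.
have hd x : cdom (fun x => d (g *m x)) x -> cdom d (g *m x) by move=> [Kx dx]; split=> //; exact: sgM cK.1 Kg Kx.
split.
- exact: (pol_comp mg (ch_pol cd)).
- by move=> i j; exact: (pol_comp mg (ch_polmx cd i j)).
- move=> x h dx Hh; have := ch_stab cd (hd _ dx) Hh; case: dx => Kx _ [_].
 by split; [exact: sgM cK.1 Kx (HK Hh)|rewrite mulmxA].
- move=> x y dx dy.
 rewrite (ch_sep cd (hd _ dx) (hd _ dy)) invmxM ?uK //; last by case: dx.
 by rewrite mulmxA -(mulmxA _ (invmx g)) mulVmx ?uK // mulmx1.
- move=> W phi x hi lr dx Wx; have KV := sgV cK.1 Kg.
 have [|A [B [pA pB Bx h]]] := ch_reg cd (hinv_mul KV hi) (lreg_mul KV lr) (hd _ dx).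
  by split; [case: (hd _ dx)|rewrite mulKmx // uK].
 exists A, B; split=> // y dy By; have [[_]] := h _ (hd _ dy) By.
 by rewrite mulKmx // uK.
Qed.

End Chart.

(** * Regular functions on sets of matrices *)

Section Conv.
Context {k : closedFieldType} {a b : nat} {cV : crd k 'M[k]_(a, b)}.
Variable (A : set 'M[k]_(a, b)).
Hypothesis pol_ev : forall p, pol (@mxeval k a b p).
Hypothesis pol_frac : forall f, pol f -> exists p q, forall x, A x -> mxeval q x != 0 /\ f x = mxeval p x / mxeval q x.

(** Admissible functions may involve the inverse determinant; on [A] they are fractions of genuine
    polynomials with nonvanishing denominators, so both kinds have the same zero sets. *)
Lemma matrix_closedP C : matrix_closed A C <-> exists2 D, zclosed D & C = A `&` D.
split=> [[S ->]|[D cD ->]].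
 exists (zero_locus S) => // x hx p Sp; apply: hx => // z; exact.
exists [set p | forall x, A x -> D x -> mxeval p x = 0]; apply/seteqP; split=> x [Ax Dx]; split=> //.
 by move=> p; exact.
apply: contrapT => nD; have [f [pf fD f0]] := closed_sep cD nD; have [p [q h]] := pol_frac pf.
have : mxeval p x = 0.
 by apply: Dx => y Ay /fD; have [q0 ->] := h y Ay; move/eqP; rewrite mulf_eq0 invr_eq0 (negPf q0) orbF => /eqP.
by have [_ e] := h x Ax; move: f0; rewrite e => /[swap] ->; rewrite mul0r eqxx.
Qed.

Lemma matrix_regularP U f : U `<=` A -> @regular k (matrix_space A) U f <-> lreg A U f.
move=> UA; split=> h x Ux.
 have [V [p [q [/matrix_closedP[D cD eD] VU Vx e]]]] := h x Ux.
 have nD : ~ D x by move=> Dx; have [] : (A `\` V) x; [rewrite eD; split; [exact: UA|]|].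
 have [s [ps sD s0]] := closed_sep cD nD; have [q0 _] := e x Vx.
 exists (fun y => mxeval p y * s y), (fun y => mxeval q y * s y); split; try exact: polM.
  by rewrite mulf_neq0.
 move=> y Ay; rewrite mulf_eq0 negb_or => /andP[qy sy].
 have Vy : V y.
  apply: contrapT => nV; have : (A `&` D) y by rewrite -eD.
  by move=> [_ /sD s1]; move: sy; rewrite s1 eqxx.
 by split; [exact: VU|rewrite (e y Vy).2 -mulf_div mulfV // mulr1].
have [p [q [pp pq q0 e]]] := h x Ux.
have [p1 [p2 hp]] := pol_frac pp; have [q1 [q2 hq]] := pol_frac pq.
have em P Q y : mxeval (P * Q) y = mxeval P y * mxeval Q y by exact: mpoly.mevalM.
exists [set y | A y /\ q y != 0], (p1 * q2), (p2 * q1); split.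
- apply/matrix_closedP; exists [set y | q y = 0]; first exact: closed_zero.
 apply/seteqP; split=> y [Ay]; last by move=> q1'; split=> // -[_]; rewrite q1' eqxx.
 by move=> nq; split=> //; apply/eqP/negPn/negP => ne; apply: nq.
- by move=> y [Ay qy]; have [] := e y Ay qy.
- by split=> //; exact: UA.
- move=> y [Ay qy]; have [Uy ->] := e y Ay qy; have [p20 ->] := hp y Ay; have [q20 eq] := hq y Ay.
 move: qy; rewrite eq mulf_eq0 negb_or => /andP[q10 _].
 by rewrite !em mulf_neq0 //; split=> //; field; rewrite p20 q10 q20.
Qed.

End Conv.

Lemma pol_mxeval {k : fieldType} {V} {cV : crd k V} a b (F : V -> 'M[k]_(a, b)) p : polmx F -> pol (fun v => mxeval p (F v)).
move=> pF; have px i : pol (fun v => mxvec (F v) 0 i).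
 by case/mxvec_indexP: i => c d; apply: pol_ext (pF c d) => v; rewrite mxvecE.
rewrite (_ : (fun v => mxeval p (F v)) = fun v => \sum_(m <- mpoly.msupp p)
 mpoly.mcoeff m p * \prod_i mxvec (F v) 0 i ^+ mpoly.fun_of_multinom m i); last first.
 by [].
apply: pol_sum => m; apply: polM; first exact: polC.
by apply: pol_prod => i; exact: pol_exp.
Qed.

Section PolEv.
Context {k : fieldType} {a b : nat}.
Definition evs (f : 'M[k]_(a, b) -> k) := exists p, forall x, f x = mxeval p x.
Lemma evsC c : evs (fun=> c).
by exists (mpoly.mpolyC _ c) => x; rewrite /mxeval mpoly.mevalC. Qed.
Lemma evsX i j : evs (fun x => x i j).
by exists (mpoly.mpolyX _ (mpoly.mnm1 (mxvec_index i j))) => x; rewrite /mxeval mpoly.mevalXU mxvecE. Qed.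
Lemma evsD f g : evs f -> evs g -> evs (fun x => f x + g x).
by move=> [p hp] [q hq]; exists (p + q) => x; rewrite hp hq /mxeval mpoly.mevalD. Qed.
Lemma evsM f g : evs f -> evs g -> evs (fun x => f x * g x).
by move=> [p hp] [q hq]; exists (p * q) => x; rewrite hp hq /mxeval mpoly.mevalM. Qed.
Lemma evs_exp f e : evs f -> evs (fun x => f x ^+ e).
move=> hf; elim: e => [|e IH]; first by have [p hp] := evsC 1; exists p => x.
by have [p hp] := evsM hf IH; exists p => x; rewrite exprS hp.
Qed.
End PolEv.

Lemma evs_det (k : fieldType) n : evs (fun x : 'M[k]_n => \det x).
rewrite /determinant; elim: index_enum => [|s r [p hp]].
 by have [p hp] := @evsC k n n 0; exists p => x; rewrite big_nil -hp.
have [q hq] : evs (fun x : 'M[k]_n => (-1) ^+ perm.odd_perm s * \prod_i x i (perm.fun_of_perm s i)).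
 apply: evsM; first exact: evsC.
 elim: index_enum => [|i r' [q hq]]; first by have [q hq] := @evsC k n n 1; exists q => x; rewrite big_nil -hq.
 by have [q' hq'] := evsM (evsX i (perm.fun_of_perm s i)) (ex_intro _ q hq); exists q' => x; rewrite big_cons hq'.
by have [p' hp'] := evsD (ex_intro _ q hq) (ex_intro _ p hp); exists p' => x; rewrite big_cons hp'.
Qed.

Lemma row_frac (k : fieldType) m (A : set 'rV[k]_m) f : pol f ->
 exists p q, forall x, A x -> mxeval q x != 0 /\ f x = mxeval p x / mxeval q x.
move=> pf; have [p hp] : evs f by elim/row_pol_ind: pf => [c|j|f1 f2|f1 f2]; [exact: evsC|exact: evsX|exact: evsD|exact: evsM].
by have [q hq] := @evsC k 1 m 1; exists p, q => x _; rewrite -hq oner_eq0 divr1.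
Qed.

Lemma mx_frac (k : fieldType) n (A : set 'M[k]_n) f : A `<=` @gl k n -> pol f ->
 exists p q, forall x, A x -> mxeval q x != 0 /\ f x = mxeval p x / mxeval q x.
move=> Agl pf; have dA x : A x -> \det x != 0 by move=> /Agl; rewrite /gl /= unitmxE unitfE.
have [N [p [q [hp hq] e]]] : exists N p q, [/\ evs p, (forall x, q x = \det x ^+ N) & forall x : 'M_n, A x -> f x = p x / q x].
 elim/mxpol_ind: pf => [c|i j||{}f g [N1 [p1 [q1 [h1 k1 e1]]]] [N2 [p2 [q2 [h2 k2 e2]]]]|{}f g [N1 [p1 [q1 [h1 k1 e1]]]] [N2 [p2 [q2 [h2 k2 e2]]]]].
 - by exists 0, (fun=> c), (fun=> 1); split=> [|//|x _]; [exact: evsC|rewrite divr1].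
 - by exists 0, (fun x => x i j), (fun=> 1); split=> [|//|x _]; [exact: evsX|rewrite divr1].
 - by exists 1, (fun=> 1), (fun x => \det x); split=> [|//|x _]; [exact: evsC|rewrite mul1r].
 - exists (N1 + N2), (fun x => p1 x * \det x ^+ N2 + p2 x * \det x ^+ N1), (fun x => \det x ^+ (N1 + N2)); split=> //.
   by apply: evsD; apply: evsM => //; apply: evs_exp; exact: evs_det.
  by move=> x Ax; rewrite e1 // e2 // k1 k2 exprD; field; rewrite !expf_neq0 // dA.
 - exists (N1 + N2), (fun x => p1 x * p2 x), (fun x => \det x ^+ (N1 + N2)); split=> //; first exact: evsM.
  by move=> x Ax; rewrite e1 // e2 // k1 k2 exprD; field; rewrite !expf_neq0 // dA.
case: hp => P hP; have [D hD] := evs_exp N (evs_det k n).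
by exists P, D => x Ax; rewrite -hD expf_neq0 ?dA // e // hP hq.
Qed.

Section Lreg.
Context {k : closedFieldType} {V : Type} {cV : crd k V}.
Implicit Types (K W Z : set V) (f g : V -> k).

Definition zopen K W := W `<=` K /\ forall x, W x -> exists q, [/\ pol q, q x != 0 & forall y, K y -> q y != 0 -> W y].

Lemma zopenP K W : zclosed K -> W `<=` K -> zopen K W <-> zclosed (K `\` W).
move=> cK WK; split=> [[_ h] x cx|cW]; first split.
- by apply: cK; apply: cl_mono cx => y [].
- move=> /h[q [pq /eqP q0 hq]]; apply: q0; apply: cx => // y [Ky nW].
 by apply/eqP/negPn/negP => qy; apply: nW; exact: hq.
split=> // x Wx; have [|q [pq qW q0]] := closed_sep (v := x) cW; first by case.
by exists q; split=> // y Ky qy; apply: contrapT => nW; move: qy; rewrite qW ?eqxx.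
Qed.

Lemma lreg_zopen K W f : W `<=` K -> lreg K W f -> zopen K W.
by move=> WK h; split=> // x /h[p [q [pp pq q0 e]]]; exists q; split=> // y Ky qy; have [] := e y Ky qy. Qed.

Lemma lreg_sub K W W' f g : lreg K W f -> zopen K W' -> W' `<=` W -> (forall x, W' x -> g x = f x) -> lreg K W' g.
move=> h [_ o] s e x W'x; have [p [q [pp pq q0 h']]] := h x (s _ W'x); have [r [pr r0 hr]] := o x W'x.
exists (fun y => p y * r y), (fun y => q y * r y); split; try exact: polM.
 by rewrite mulf_neq0.
move=> y Ky; rewrite mulf_eq0 negb_or => /andP[qy ry]; have W'y := hr y Ky ry.
by split=> //; rewrite e // (h' y Ky qy).2 -mulf_div mulfV // mulr1.
Qed.

Lemma lreg_pol K f : pol f -> lreg K K f.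
by move=> pf x Kx; exists f, (fun=> 1); rewrite oner_eq0; split=> // [|y Ky _]; [exact: polC|rewrite divr1]. Qed.

Lemma lregC K W c : zopen K W -> lreg K W (fun=> c).
by move=> o; apply: (lreg_sub (lreg_pol (polC c)) o); case: o. Qed.

Lemma lregDM K W f g : lreg K W f -> lreg K W g -> lreg K W (fun x => f x + g x) /\ lreg K W (fun x => f x * g x).
move=> hf hg; split=> x Wx; have [p [q [pp pq q0 e]]] := hf x Wx; have [p' [q' [pp' pq' q0' e']]] := hg x Wx.
- exists (fun y => p y * q' y + p' y * q y), (fun y => q y * q' y).
 split; [by apply: polD; exact: polM|exact: polM|by rewrite mulf_neq0|move=> y Ky].
 rewrite mulf_eq0 negb_or => /andP[qy qy']; have [Wy ->] := e y Ky qy; have [_ ->] := e' y Ky qy'.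
 by split=> //; field; rewrite qy'.
- exists (fun y => p y * p' y), (fun y => q y * q' y); split; [exact: polM|exact: polM|by rewrite mulf_neq0|move=> y Ky].
 rewrite mulf_eq0 negb_or => /andP[qy qy']; have [Wy ->] := e y Ky qy; have [_ ->] := e' y Ky qy'.
 by split=> //; field; rewrite qy'.
Qed.

Lemma zopenI K W W' : zopen K W -> zopen K W' -> zopen K (W `&` W').
move=> [WK o] [_ o']; split=> [x [/WK]//|x [/o[q [pq q0 h]] /o'[q' [pq' q0' h']]]].
exists (fun y => q y * q' y); split; [exact: polM|by rewrite mulf_neq0|move=> y Ky].
by rewrite mulf_eq0 negb_or => /andP[/h h1 /h' h2]; split; [exact: h1|exact: h2].
Qed.

Lemma zopenD K Z : zclosed Z -> zopen K (K `\` Z).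
move=> cZ; split=> [x []//|x [Kx nZ]]; have [q [pq qZ q0]] := closed_sep cZ nZ.
by exists q; split=> // y Ky qy; split=> // /qZ e; move: qy; rewrite e eqxx.
Qed.

End Lreg.

(** * The coset space as a space with functions *)

Section QuotSpace.
Context {k : closedFieldType} {n : nat}.
Local Notation M := 'M[k]_n.

Lemma translateM g x (S : set M) : translate g (translate x S) = translate (g *m x) S.
apply/seteqP; split=> [_ [_ [s Ss <-] <-]|_ [s Ss <-]]; first by exists s => //; rewrite mulmxA.
by exists (x *m s); [exists s|rewrite mulmxA].
Qed.

Lemma translate1 (S : set M) : translate 1%:M S = S.
by apply/seteqP; split=> [_ [s Ss <-]|s Ss]; [rewrite mul1mx|exists s => //; rewrite mul1mx]. Qed.

Variables (K H : set M).
Hypotheses (cK : cgrp K) (iK : irr K) (cH : cgrp H) (HK : H `<=` K).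
Local Notation Q := (quotient_space K H).
Local Notation pre := (quotient_preimage K H).
Local Notation img W := [set translate x H | x in W].
Implicit Types (x y g h : M) (W Y Z : set M) (c : set M) (C D U : set (set M)).
Let uK x : K x -> x \in unitmx := sg_gl cK.1.
Let KM x h : K x -> H h -> K (x *m h) := fun Kx Hh => sgM cK.1 Kx (HK Hh).
Let Kgl : K `<=` @gl k n := uK.
Let pev (p : mpoly.mpoly (n * n) k) : pol (mxeval p) := pol_mxeval p (@polmx_id k n).
Let pfr f (pf : @pol k M (mx_crd k n) f) := mx_frac Kgl pf.

Lemma coset_eq x y : x \in unitmx -> translate x H = translate y H <-> H (invmx x *m y).
move=> ux; split=> [e|Hxy].
 have : translate x H y by rewrite e; exists 1%:M; [exact: sg1 cH.1|rewrite mulmx1].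
 by move=> [h Hh <-]; rewrite mulKmx.
rewrite -[y](mulKVmx ux) -translateM; congr translate; apply/seteqP; split=> [z Hz|_ [z Hz <-]].
 by exists (invmx (invmx x *m y) *m z); [exact: (sgM cH.1 (sgV cH.1 Hxy) Hz)|rewrite mulKVmx // (sg_gl cH.1 Hxy)].
exact: sgM cH.1 Hxy Hz.
Qed.

Lemma translateH x h : H h -> translate (x *m h) H = translate x H.
by move=> Hh; rewrite -translateM; have := proj2 (coset_eq h (unitmx1 k n)); rewrite invmx1 mul1mx translate1 => <-. Qed.

(** Invariant functions on [K] become functions of cosets through a representative; [rep_inv] shows
    that its choice does not matter. *)
Definition rep (c : set M) : M := xget 1%:M c.

Lemma repP x : exists2 h, H h & rep (translate x H) = x *m h.
rewrite /rep; case: xgetP => [y -> [h Hh <-]|/(_ (x *m 1%:M)) []]; first by exists h.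
by exists 1%:M => //; exact: sg1 cH.1.
Qed.

Lemma rep_inv W (phi : M -> k) x : hinv K H W phi -> W x -> phi (rep (translate x H)) = phi x.
by move=> [_ hi] Wx; have [h Hh ->] := repP x; have [] := hi x h Wx Hh. Qed.

Lemma mclosedP Z : @kclosed k (matrix_space K) Z <-> Z `<=` K /\ zclosed Z.
have -> : @kclosed k (matrix_space K) Z <-> exists2 D, zclosed D & Z = K `&` D by exact: matrix_closedP.
split=> [[D cD ->]|[ZK cZ]]; first by split=> [x []//|]; apply: closedI => //; exact: cK.2.
by exists Z => //; rewrite setIidr.
Qed.

Lemma mopenP W : @kopen k (matrix_space K) W <-> zopen K W.
split=> [[/= WK /mclosedP[_ cW]]|o]; first by apply/zopenP => //; exact: cK.2.
by split; [case: o|apply/mclosedP; split=> [x []//|]; apply/(zopenP cK.2); case: o].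
Qed.

Lemma mregP W f : W `<=` K -> @regular k (matrix_space K) W f <-> lreg K W f.
exact: matrix_regularP. Qed.

Lemma pre_sub C : pre C `<=` K. by move=> x []. Qed.

Lemma qclosedP C : @kclosed k Q C <-> C `<=` cosets K H /\ zclosed (pre C).
by split=> -[s]; [move=> /mclosedP[]|move=> c; split=> //; apply/mclosedP; split=> //; exact: pre_sub]. Qed.

Lemma qopenP U : @kopen k Q U <-> U `<=` cosets K H /\ zopen K (pre U).
have e : pre (cosets K H `\` U) = K `\` pre U.
 by apply/seteqP; split=> x [Kx]; [move=> [_ nU]; split=> // -[]|move=> nU; split=> //; split=> [|Ux]; [exists x|apply: nU]].
split=> [[UC /qclosedP[_]]|[UC o]]; rewrite ?e; first by split=> //; apply/(zopenP cK.2 (@pre_sub U)).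
by split=> //; apply/qclosedP; split=> [c []//|]; rewrite e; apply/zopenP => //; [exact: cK.2|exact: pre_sub].
Qed.

Lemma pre_img W : W `<=` K -> (forall x h, W x -> H h -> W (x *m h)) -> pre (img W) = W.
move=> WK st; apply/seteqP; split=> x; last by move=> Wx; split; [exact: WK|exists x].
by move=> [Kx [y Wy /coset_eq]] => /(_ (uK (WK _ Wy))) /(st _ _ Wy); rewrite mulKVmx // uK //; exact: WK.
Qed.

Lemma qopen_img W : zopen K W -> (forall x h, W x -> H h -> W (x *m h)) -> @kopen k Q (img W).
move=> o st; apply/qopenP; rewrite pre_img //; last by case: o.
by split=> // _ [x Wx <-]; exists x => //; case: o => + _; apply.
Qed.

Lemma hinv_pre U f : hinv K H (pre U) (fun g => f (translate g H)).
by split=> [|x h [Kx Ux] Hh]; [exact: pre_sub|rewrite translateH //; split=> //; split; [exact: KM|rewrite translateH]]. Qed.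

Lemma qregP U f : @regular k Q U f <-> lreg K (pre U) (fun g => f (translate g H)).
by apply: mregP; exact: pre_sub. Qed.

Lemma qreg_desc W phi : hinv K H W phi -> lreg K W phi -> @regular k Q (img W) (fun c => phi (rep c)).
move=> hi lr; have eW : pre (img W) = W by apply: pre_img => [|x h Wx Hh]; [case: hi|have [] := hi.2 x h Wx Hh].
apply/qregP; rewrite eW => x Wx; have [p [q [pp pq q0 e]]] := lr x Wx.
by exists p, q; split=> // y Ky qy; have [Wy ey] := e y Ky qy; rewrite (rep_inv hi).
Qed.

Lemma quotient_swf : space_with_functions Q.
split; split.
- by move=> C [].
- split; apply/qclosedP; split=> //.
  by rewrite (_ : pre set0 = set0); [exact: closed0|apply/seteqP; split=> x []].
 by rewrite (_ : pre (cosets K H) = K); [exact: cK.2|apply/seteqP; split=> x; [case|split=> //; exists x]].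
- move=> C D /qclosedP[sC cC] /qclosedP[sD cD]; apply/qclosedP; split=> [c [/sC|/sD]//|].
 rewrite (_ : pre (C `|` D) = pre C `|` pre D); first exact: closedU.
 by apply/seteqP; split=> x; [move=> [Kx [?|?]]; [left|right]|move=> [[Kx ?]|[Kx ?]]; split=> //; [left|right]].
- move=> F [C0 FC0] hF; apply/qclosedP; split=> [c hc|]; first by have[+ _] := hF _ FC0; apply; exact: hc.
 rewrite (_ : pre _ = [set x | forall C, (K `&` [set x | F C -> pre C x]) x]).
  apply: closed_cap => C; have [FC|nF] := pselect (F C).
   have /qclosedP[_ cC] := hF _ FC; apply: closedI; first exact: cK.2.
   by move=> x hx _; apply: cC; apply: cl_mono hx => y; exact.
  by apply: closedI; [exact: cK.2|move=> x _].
 apply/seteqP; split=> x; first by move=> [Kx h] C; split=> // FC; split=> //; exact: h.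
 by move=> h; split; [case: (h C0)|move=> C FC; have [_ /(_ FC)[]] := h C].
- by move=> U c /qopenP[_ o]; apply/qregP; exact: lregC.
- by move=> U f g _ /qregP rf /qregP rg; have [rD rM] := lregDM rf rg; split; exact/qregP.
- move=> U V f g _ /qopenP[_ oV] VU /qregP rf e; apply/qregP; apply: (lreg_sub rf oV) => x [Kx Vx].
  by split=> //; exact: VU.
 exact: e.
- move=> U f _ h; apply/qregP => x [Kx Ux]; have [V [_ Vx VU /qregP rV]] := h _ Ux.
 have [p [q [pp pq q0 e]]] := rV x (conj Kx Vx); exists p, q; split=> // y Ky qy.
 by have [[_ /VU Uy] ->] := e y Ky qy.
Qed.

Lemma quotient_irr : irreducible_space Q.
split; first by exists (translate 1%:M H); exists 1%:M => //; exact: sg1 cK.1.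
move=> C D /qclosedP[sC cC] /qclosedP[sD cD] h.
have [|i|i] := irr_sub_closedU iK cC cD.
- by move=> x Kx; have [] := h (translate x H); [exists x|left|right].
- by left=> _ [x Kx <-]; have [] := i x Kx.
- by right=> _ [x Kx <-]; have [] := i x Kx.
Qed.

(** Two nonempty open conditions on [g] hold together in the irreducible [K]. So any two cosets lie
    in one translated chart, which yields separatedness. *)
Lemma common_chart m d nu x y x0 : @chart k n K H m d nu -> K x0 -> d x0 != 0 -> K x -> K y ->
 exists2 g, K g & d (g *m x) != 0 /\ d (g *m y) != 0.
move=> cd K0 d0 Kx Ky; apply: contrapT => ng.
have pm z : pol (fun g => d (g *m z)) by apply: (pol_comp); [exact: mor_mulr (morI _)|exact: ch_pol cd].
have [g Kg|h|h] := iK.2 _ _ (pm x) (pm y).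
- have [->|gx] := eqVneq (d (g *m x)) 0; first by rewrite mul0r.
 by have [->|gy] := eqVneq (d (g *m y)) 0; [rewrite mulr0|case: ng; exists g].
- have := h _ (sgM cK.1 K0 (sgV cK.1 Kx)); rewrite mulmxKV ?uK // => e; by move: d0; rewrite e eqxx.
- have := h _ (sgM cK.1 K0 (sgV cK.1 Ky)); rewrite mulmxKV ?uK // => e; by move: d0; rewrite e eqxx.
Qed.

Section ChartSpace.
Variables (m : nat) (d : M -> k) (nu : M -> 'rV[k]_m) (cd : chart K H d nu).
Local Notation C := (cmap d nu).
Let pd := ch_pol cd.

Lemma cdom_open : zopen K (cdom K d).
by split=> [x []//|x [Kx dx]]; exists d. Qed.

Lemma chart_open : @kopen k Q (img (cdom K d)).
exact: qopen_img cdom_open (ch_stab cd). Qed.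

Lemma cmap_H x h : cdom K d x -> H h -> C (x *m h) = C x.
move=> dx Hh; symmetry; apply/(ch_sep cd dx (ch_stab cd dx Hh)).
by rewrite mulKmx // uK; case: dx.
Qed.

Lemma lreg_cmap (S V : set 'rV[k]_m) f : (forall x, cdom K d x -> S (C x)) -> lreg S V f ->
 lreg K [set x | cdom K d x /\ V (C x)] (fun x => f (C x)).
move=> hS h x [[Kx dx] Vx]; have [p [q [pp pq q0 e]]] := h _ Vx.
have [e1 [P [pP hP]]] := clear_den pd (ch_polmx cd) pp; have [e2 [R [pR hR]]] := clear_den pd (ch_polmx cd) pq.
have R0 y : d y != 0 -> (q (C y) != 0) = (R y != 0).
 by move=> dy; rewrite hR // mulf_eq0 invr_eq0 (negPf (expf_neq0 _ dy)) orbF.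
exists (fun x => P x * d x ^+ e2 * d x), (fun x => R x * d x ^+ e1 * d x); split.
- by apply: polM => //; apply: polM => //; exact: pol_exp.
- by apply: polM => //; apply: polM => //; exact: pol_exp.
- by rewrite !mulf_neq0 ?expf_neq0 // -R0.
move=> y Ky; rewrite !mulf_eq0 !negb_or => /andP[/andP[Ry _] dy].
have [//||Vy ->] := e (C y); [exact: hS|by rewrite R0|].
by split=> //; rewrite hP // hR //; field; rewrite Ry dy !expf_neq0.
Qed.

Lemma hinv_cmap (V : set 'rV[k]_m) f : hinv K H [set x | cdom K d x /\ V (C x)] (fun x => f (C x)).
split=> [x [[]]//|x h [dx Vx] Hh]; rewrite cmap_H //.
by split; [split; [exact: (ch_stab cd dx Hh)|rewrite cmap_H]|].
Qed.

(** The delicate direction is the inverse [psi] of the chart. That it is continuous and pulls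
    regular functions back to fractions are both instances of [ch_reg], continuity through the
    function 0 on an open set. *)
Lemma chart_affine : zclosed (C @` cdom K d) -> affine_space (@subspace k Q (img (cdom K d))).
move=> cI; pose S : set (mpoly.mpoly (1 * m) k) := [set p | forall x, cdom K d x -> mxeval p (C x) = 0].
have Zev (p : mpoly.mpoly (1 * m) k) : pol (mxeval p).
 by apply: pol_mxeval => i j; rewrite ord1; exact: pol_row.
have eS : zero_locus S = C @` cdom K d.
 have [S' e] : matrix_closed setT (C @` cdom K d).
  by apply/(matrix_closedP Zev (row_frac setT)); exists (C @` cdom K d); rewrite ?setTI.
 apply/seteqP; split=> v; last by move=> [x dx <-] p; exact.
 move=> hv; rewrite e; split=> // p S'p; apply: hv => x dx.
 have : (C @` cdom K d) (C x) by [].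
 by rewrite e => -[_]; exact.
exists m, S; rewrite eS; set Z := C @` cdom K d.
have zcP := matrix_closedP Zev (row_frac Z); have zrP := matrix_regularP Zev (row_frac Z).
have zoP V : @kopen k (matrix_space Z) V -> zopen Z V.
 move=> [VZ /zcP[D cD eD]]; split=> // v Vv; have nD : ~ D v.
  by move=> Dv; have [] : (Z `\` V) v; [rewrite eD; split=> //; exact: VZ|].
 have [q [pq qD q0]] := closed_sep cD nD; exists q; split=> // y Zy qy; apply: contrapT => nV.
 by have [_ /qD e] : (Z `&` D) y; [rewrite -eD|move: qy; rewrite e eqxx].
have ZC x : cdom K d x -> Z (C x) by move=> dx; exists x.
pose phi c := C (rep c).
pose psi v := translate (xget 1%:M [set x | cdom K d x /\ C x = v]) H.
have phiE x : cdom K d x -> phi (translate x H) = C x by rewrite /phi; have [h Hh ->] := repP x => dx; exact: cmap_H.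
have psiE x : cdom K d x -> psi (C x) = translate x H.
 move=> dx; rewrite /psi; case: xgetP => [y _ [dy e]|/(_ x) []//].
 by apply/coset_eq; [apply: uK; case: dy|apply/(ch_sep cd)].
have open0 V : zopen Z V -> zopen K [set x | cdom K d x /\ V (C x)].
 by move=> oV; apply: (lreg_zopen) => [x [[]]//|]; exact: (lreg_cmap ZC (lregC 0 oV)).
exists phi, psi; split.
- split=> [_ [x dx <-]|D kD|V f oV rf].
 + by rewrite phiE //; exact: ZC.
 + have : zopen Z (Z `\` D) by have /zcP[D' cD ->] := kD; rewrite setDIr setDv set0U; exact: zopenD.
  move=> /open0 o; exists (cosets K H `\` img [set x | cdom K d x /\ (Z `\` D) (C x)]).
   have [_] : @kopen k Q (img [set x | cdom K d x /\ (Z `\` D) (C x)]); last by [].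
   by apply: qopen_img => // x h [dx Zx] Hh; split; [exact: (ch_stab cd dx Hh)|rewrite cmap_H].
  apply/seteqP; split=> _ [[x dx <-]]; rewrite //= phiE //.
   move=> Dx; split; first by exists x.
   split; first by exists x; case: dx.
   move=> [y [dy [_ nD]] e]; apply: nD.
   by rewrite -phiE // e phiE.
  move=> [_ nI]; split; first by exists x.
  by apply: contrapT => nD; apply: nI; exists x; split=> //; split=> //; exact: ZC.
 + have /(zrP _ _ oV.1) lf := rf; move=> _ [[x dx <-]]; rewrite /= phiE // => Vx.
  exists (img [set x | cdom K d x /\ V (C x)]), (fun c => f (C (rep c))); split=> //.
  * by apply: qopen_img; [exact: open0 (zoP _ oV)|move=> y h [dy Vy] Hh; split; [exact: (ch_stab cd dy Hh)|rewrite cmap_H]].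
  * by exists x.
  * by apply: (qreg_desc (phi := fun x => f (C x))); [exact: hinv_cmap|exact: (lreg_cmap ZC lf)].
- split=> [_ [x dx <-]|_ [D /qclosedP[_ cD] ->]|V f oV rf].
 + by rewrite psiE //; exists x.
 + apply/zcP; exists (cl (C @` [set x | cdom K d x /\ pre D x])); first exact: cl_closed.
  apply/seteqP; split=> _ [[x dx <-]].
   rewrite /= psiE // => -[_ Dx]; split; first exact: ZC.
   by apply: sub_cl; exists x; case: dx.
  move=> hx; split; first exact: ZC.
  rewrite /= psiE //; split; first by exists x.
  apply: contrapT => nD; have hi : hinv K H (K `\` pre D) (fun=> 0).
   split=> [y []//|y h [Ky nDy] Hh]; split=> //; split; first exact: KM.
   by move=> [_]; rewrite translateH // => Dy; apply: nDy.
  have [|A [B [pA pB /eqP B0 hB]]] := ch_reg cd hi (lregC 0 (zopenD _ cD)) dx.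
   by split; [case: dx|case].
  by apply: B0; apply: hx => // _ [y [dy Dy] <-]; apply/eqP/negPn/negP => By; have [[_]] := hB y dy By.
 + move: oV => [VU [D /qclosedP[_ cD] eV]].
  apply/zrP; first by move=> v [].
  move=> _ [[x dx <-]]; rewrite /= psiE // => Vx; have [V0 [g [/qopenP[_ o0] V0x /qregP lg e]]] := rf _ Vx.
  have inV y : cdom K d y -> ~ pre D y -> V (translate y H).
   move=> dy nD; apply: contrapT => nV.
   have [_ Dy] : (img (cdom K d) `&` D) (translate y H) by rewrite -eV; split=> //; exists y.
   by apply: nD; case: dy.
  have nDx : ~ pre D x.
   by move=> [_ Dx]; have [_] : (img (cdom K d) `\` V) (translate x H); [rewrite eV; split=> //; exists x|].
  have Kx : K x by case: dx.
  have lr : lreg K (pre V0 `&` (K `\` pre D)) (fun y => g (translate y H)).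
   by apply: (lreg_sub lg) => //; apply: zopenI => //; exact: zopenD.
  have hi : hinv K H (pre V0 `&` (K `\` pre D)) (fun y => g (translate y H)).
   split=> [y [[]]//|y h [[Ky Vy] [_ nDy]] Hh]; rewrite translateH //; split=> //.
   have Kyh := KM Ky Hh; split; [split=> //; rewrite translateH //|split=> // -[_]; rewrite translateH // => Dy].
   exact: nDy.
  have [|A [B [pA pB B0 hB]]] := ch_reg cd hi lr dx; first by [].
  exists A, B; split=> // _ [y dy <-] By; have [[[_ V0y] [_ nDy]] ey] := hB y dy By.
  rewrite psiE //; split; first by split; [exact: ZC|exact: inV].
  by rewrite e //; exact: inV.
- by move=> _ [x dx <-]; rewrite phiE // psiE.
- by move=> _ [x dx <-]; rewrite psiE // phiE.
Qed.

End ChartSpace.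
End QuotSpace.

(** * The coset space is a variety with algebraic action *)

Section QuotVariety.
Context {k : closedFieldType} {n : nat}.
Local Notation M := 'M[k]_n.
Variables (K H : set M).
Hypotheses (cK : cgrp K) (iK : irr K) (cH : cgrp H) (HK : H `<=` K).
Local Notation Q := (quotient_space K H).
Local Notation pre := (quotient_preimage K H).
Local Notation img W := [set translate x H | x in W].
Implicit Types (x y g h : M).
Let uK x : K x -> x \in unitmx := sg_gl cK.1.

(** Left translates of one closed chart cover; finitely many suffice, by minimality of the common
    zero set of their denominators. *)
Lemma quotient_cover : exists (r : nat) (U : 'I_r -> set (Defs.point Q)),
 (forall i, kopen (U i) /\ affine_space (subspace (U i))) /\ (forall c, carrier Q c -> exists i, U i c).
have K1 := sg1 cK.1; have [m [d [nu [cd [x0 K0 d0] cI]]]] := closed_chart_ex cK iK cH HK K1.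
have pg g : pol (fun x => d (g *m x)).
 by apply: (pol_comp); [exact: mor_mull (morI _)|exact: ch_pol cd].
have [|_ [s [_ ->]]|_ [s [sK ->]] mZ] := closed_min (F := [set Z : set M | exists s : seq M, (forall g, List.In g s -> K g) /\
  Z = K `&` [set x | forall g, List.In g s -> d (g *m x) = 0]]).
- by exists (K `&` [set x | forall g, List.In g [::] -> d (g *m x) = 0]), [::].
- apply: closedI; first exact: cK.2.
 move=> x hx g gs; have := hx (fun x => d (g *m x)) (pg g); apply=> z; exact.
exists (size s), (fun i => img (cdom K (fun x => d (nth 1%:M s i *m x)))); split=> [i|_ [x Kx <-]].
 have Kg : K (nth 1%:M s i) by apply: sK; exact: nth_In.
 have cg := chart_mul cK HK Kg cd; split; first exact: (chart_open cK cH cg).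
 apply: (chart_affine cK cH HK cg); rewrite (_ : _ @` _ = cmap d nu @` cdom K d) //.
 apply/seteqP; split=> [_ [y [Ky dy] <-]|_ [y [Ky dy] <-]].
  by exists (nth 1%:M s i *m y); split=> //; exact: sgM cK.1 Kg Ky.
 exists (invmx (nth 1%:M s i) *m y); last by rewrite /cmap mulKVmx // uK.
 by split; [exact: sgM cK.1 (sgV cK.1 Kg) Ky|rewrite mulKVmx // uK].
have [[g gs dg]|ng] := pselect (exists2 g, List.In g s & d (g *m x) != 0).
 have [i il eg] := In_nth 1%:M gs; exists (Ordinal il); exists x => //.
 by rewrite eg.
have Kg : K (x0 *m invmx x) by exact: sgM cK.1 K0 (sgV cK.1 Kx).
have [|y [Ky hy]||_ /(_ (x0 *m invmx x) (or_introl erefl))] := mZ (K `&` [set y | forall g, List.In g (x0 *m invmx x :: s) -> d (g *m y) = 0]) _ _ x _.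
- by exists (x0 *m invmx x :: s); split=> // g [<-|/sK].
- by split=> // g gs; apply: hy; right.
- by split=> // g gs; apply/eqP/negPn/negP => dg; apply: ng; exists g.
by rewrite mulmxKV ?uK // => e; move: d0; rewrite e eqxx.
Qed.

Lemma quotient_separated : separated Q.
have K1 := sg1 cK.1; have [m [d [nu [cd d1]]]] := chart_ex cK cH HK K1.
split=> [[c c'] /= [hc <-]//|[_ _] /= [[[x Kx <-] [y Ky <-]] ne]].
have [g Kg [dx dy]] := common_chart cK iK cd K1 d1 Kx Ky; have cg := chart_mul cK HK Kg cd.
pose d' x := d (g *m x); pose nu' x := nu (g *m x).
have [j nj] : exists j, cmap d' nu' x 0 j != cmap d' nu' y 0 j.
 apply: contrapT => nj; apply: ne; split; first by exists x.
 apply/(coset_eq cH); first exact: uK.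
 apply/(ch_sep cg) => //; apply/rowP => j; apply/eqP/negPn/negP => e; apply: nj; by exists j.
pose f c := cmap d' nu' (rep c) 0 j.
have hi : hinv K H (cdom K d') (fun x => cmap d' nu' x 0 j).
 by split=> [z []//|z h dz Hh]; rewrite (cmap_H cK cg) //; split=> //; exact: (ch_stab cg).
have o := chart_open cK cH cg.
have rf : @regular k Q (img (cdom K d')) f.
 apply: (qreg_desc cK cH hi) => z [Kz dz]; exists (fun x => nu' x 0 j), d'; split=> //.
 - exact: (ch_polmx cg).
 - exact: (ch_pol cg).
 - by move=> w Kw dw; rewrite mxE mulrC.
have rC c : @regular k Q (img (cdom K d')) (fun=> c).
 by have [_ [h _ _ _]] := quotient_swf H cK; apply: h.
exists (img (cdom K d')), (img (cdom K d')), (fun z => f z.1 - f z.2); split=> //.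
- by split; [exists x|exists y].
- exists 2, (fun i => if i == 0 then f else fun=> -1), (fun i => if i == 0 then fun=> 1 else f).
 split=> [i|i|z]; try by case: ifP.
 by rewrite big_ord_recl big_ord1 mulr1 mulN1r.
- have fE z : cdom K d' z -> f (translate z H) = cmap d' nu' z 0 j by move=> dz; exact: (rep_inv cH hi dz).
 by rewrite !fE // subr_eq0.
- move=> [c c'] [z [Kz _] <-] [w [Kw _] <-] fne; split; first by split; [exists z|exists w].
 by move=> [_ e]; move: fne; rewrite e subrr eqxx.
Qed.

Lemma quotient_variety : variety Q.
by split; [exact: quotient_swf|exact: quotient_cover|exact: quotient_separated]. Qed.

Section Tensor.
Variables (N : nat) (E : M -> 'cV[k]_N) (R : M -> 'M[k]_N) (F : fam E R).
Variables (a : nat) (P0 : 'M[k]_(a, N)) (d : M -> k) (nf : M -> 'M[k]_(N, a)) (hn : isnf K H E P0 d nf).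

Lemma nf_hinv i j : hinv K H (cdom K d) (fun x => nf x i j).
split=> [x []//|x h [Kx dx] Hh]; rewrite (nf_H cK cH HK hn) //; split=> //.
by split; [exact: sgM cK.1 Kx (HK Hh)|exact: (nf_stab hn)].
Qed.

Lemma nf_open : @kopen k Q (img (cdom K d)).
apply: (qopen_img cK cH); last by move=> x h [Kx dx] Hh; split; [exact: sgM cK.1 Kx (HK Hh)|exact: (nf_stab hn)].
by split=> [x []//|x [Kx dx]]; exists d; split=> //; exact: nf_pol hn.
Qed.

(** Separation of variables: testing the equation [l] on the coset of [g *m x] becomes a sum of
    products of functions of [g] and of the coset of [x], as the product variety demands. *)
Lemma nf_tensor (l : 'rV_N) j : @tensor_fun k (matrix_space K) Q K (img (cdom K d))
 (fun z => (l *m R z.1 *m nf (rep z.2)) 0 j).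
exists N, (fun i g => (l *m R g) 0 i), (fun i c => nf (rep c) i j); split=> [i|i|z]; last by rewrite mxE.
 apply/mregP => //; apply: lreg_pol; apply: polmxM; first exact: polmxC.
 by case: F.
apply: (qreg_desc cK cH (phi := fun x => nf x i j)) => [|x [Kx dx]]; first exact: nf_hinv.
have [nu pnu enu] := nf_rat hn; exists (fun x => nu x i j), d; split=> //; first exact: nf_pol hn.
by move=> y Ky dy; rewrite enu // mxE mulrC.
Qed.

Lemma nf_tensorP (l : 'rV_N) g x : K g -> cdom K d x ->
 l *m R g *m nf (rep (translate x H)) = 0 <-> inI H E (g *m x) l.
move=> Kg [Kx dx]; have -> : nf (rep (translate x H)) = nf x.
 by apply/matrixP => i j; apply: (rep_inv cH (W := cdom K d) (phi := fun x => nf x i j)) => //; exact: nf_hinv.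
by rewrite (inI_mul H F x l (uK Kg)) (nf_ker hn).
Qed.

End Tensor.

Lemma row_neq0 (K' : fieldType) m (v : 'rV[K']_m) : v <> 0 -> exists j, v 0 j != 0.
move=> nv; apply: contrapT => nj; apply: nv; apply/rowP => j; rewrite mxE.
by apply/eqP/negPn/negP => e; apply: nj; exists j.
Qed.

(** A closed condition or a regular function at [g *m x] is expressed through a family; [R g] and
    the normal form of the coset of [x] turn it into tensors. *)
Lemma quotient_action : @algebraic_action k n K Q (@translate k n).
have oK : @kopen k (matrix_space K) K.
 by apply/(mopenP cK); split=> // x Kx; exists (fun=> 1); rewrite oner_eq0; split=> //; exact: polC.
split=> [c _|g h c _ _ _|]; [exact: translate1|by rewrite translateM|].
have act g c : K g -> cosets K H c -> cosets K H (translate g c).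
 by move=> Kg [x Kx <-]; exists (g *m x); rewrite ?translateM //; exact: sgM cK.1 Kg Kx.
split=> [[g c] [/= Kg hc]|C /(qclosedP H cK)[_ cC]|V f /(qopenP H cK)[sV oV] /(qregP cK) rf]; first exact: act.
- split=> [[g c] []//|[g _] [[/= Kg [x Kx <-]] nC]].
 have {}nC : ~ pre C (g *m x).
  by move=> [_ Cx]; apply: nC; split=> //; [split=> //; exists x|rewrite translateM].
 have [q [pq qC q0]] := closed_sep cC nC; have [|N [E [R [F hE]]]] := @fam_pols k n [:: q]; first by move=> ? [<-|[]].
 have [l el] := hE q (or_introl erefl); have [a [P0 [d [nf [hn dx]]]]] := nf_ex cK cH F Kx.
 have [|j nj] := @row_neq0 _ _ (l *m R g *m nf (rep (translate x H))).
  move=> /(nf_tensorP F hn l Kg (conj Kx dx)) /(_ _ (sg1 cH.1)); rewrite mulmx1 => e.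
  by move: q0; rewrite el e mxE eqxx.
 exists K, (img (cdom K d)), (fun z => (l *m R z.1 *m nf (rep z.2)) 0 j); split=> //.
 + by split=> //; exact: nf_open hn.
 + by split=> //; exists x.
 + exact: (nf_tensor F hn).
 move=> [g' _] /= Kg' [y [Ky dy] <-] ne; split; first by split=> //; exists y.
 move=> [_]; rewrite translateM => Cy; move: ne.
 have -> : l *m R g' *m nf (rep (translate y H)) = 0; last by rewrite mxE eqxx.
 apply/(nf_tensorP F hn l Kg') => // h Hh; apply/matrixP => i i'; rewrite !ord1 -el [RHS]mxE; apply: qC.
 by split; [exact: sgM cK.1 (sgM cK.1 Kg' Ky) (HK Hh)|rewrite translateH].
- move=> [g _] [[/= Kg [x Kx <-]]]; rewrite translateM => Vx.
 have Kgx := sgM cK.1 Kg Kx.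
 have [N [E [R [l [m [F nm hW hl]]]]]] := lreg_nf cK cH HK (hinv_pre cK cH HK V f) rf (conj Kgx Vx).
 have [a [P0 [d [nf [hn dx]]]]] := nf_ex cK cH F Kx.
 have [|j nj] := @row_neq0 _ _ (m *m R g *m nf (rep (translate x H))); first by move/(nf_tensorP F hn m Kg (conj Kx dx)).
 exists K, (img (cdom K d)), (fun z => (l *m R z.1 *m nf (rep z.2)) 0 j), (fun z => (m *m R z.1 *m nf (rep z.2)) 0 j).
 split=> //.
 + by split=> //; exact: nf_open hn.
 + by split=> //; exists x.
 + by split; exact: (nf_tensor F hn).
 move=> [g' _] /= Kg' [y dy <-] ne.
 have [Kgy Vy] : pre V (g' *m y).
  apply: hW; first by apply: sgM cK.1 Kg' _; case: dy.
  by move/(nf_tensorP F hn m Kg' dy) => e; move: ne; rewrite e mxE eqxx.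
 split; first by split; [split=> //; exists y; case: dy|rewrite translateM].
 rewrite translateM; have /(nf_tensorP F hn _ Kg' dy) := hl _ (conj Kgy Vy).
 rewrite 2!mulmxBl -!scalemxAl => /eqP; rewrite subr_eq0 => /eqP ->.
 by rewrite [X in X / _]mxE mulfK.
Qed.

End QuotVariety.

(** * Purely inseparable descent *)

Section PI.
Context {k : closedFieldType} {V : Type} {cV : crd k V}.

Definition pfm (p : V -> {poly k}) := (forall i, pol (fun v => (p v)`_i)) /\ exists d, forall v, (size (p v) <= d)%N.

Lemma pfmD p q : pfm p -> pfm q -> pfm (fun v => p v + q v).
move=> [cp [d hd]] [cq [e he]]; split=> [i|]; first by apply: pol_ext (polD (cp i) (cq i)) => v; rewrite coefD.
by exists (maxn d e) => v; rewrite (leq_trans (size_polyD _ _)) // geq_max !leq_max hd he orbT.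
Qed.

Lemma pfmM p q : pfm p -> pfm q -> pfm (fun v => p v * q v).
move=> [cp [d hd]] [cq [e he]]; split=> [i|].
 apply: (pol_ext) => [v|]; first by rewrite coefM.
 by apply: pol_sum => j; exact: polM.
exists (d + e) => v; rewrite (leq_trans (size_polyMleq _ _)) // (leq_trans (leq_pred _)) //.
exact: leq_add.
Qed.

Lemma pfmC c : pol c -> pfm (fun v => (c v)%:P).
move=> pc; split=> [[|i]|]; last by exists 1 => v; exact: size_polyC_leq1.
 by apply: pol_ext pc => v; rewrite coefC.
by apply: (pol_ext (f := fun=> 0)) => [v|]; [rewrite coefC|exact: polC].
Qed.

Lemma pfmK (r : {poly k}) : pfm (fun=> r).
by split=> [i|]; [exact: polC|exists (size r)]. Qed.

Variables (U : set (set V)) (uU : ultra U).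

Lemma ae A B : U A -> (forall v, A v -> B v) -> U B. by move=> UA h; exact: ultraS UA. Qed.
Lemma ae2 A B C : U A -> U B -> (forall v, A v -> B v -> C v) -> U C.
by move=> UA UB h; apply: ae (ultraI uU UA UB) _ => v [Av Bv]; exact: h. Qed.
Lemma ae_case (f : V -> k) : U [set v | f v = 0] \/ U [set v | f v != 0].
by have [|h] := ultraC uU [set v | f v = 0]; [left|right; apply: ae h _ => v /eqP]. Qed.
Lemma ae_size p : pfm p -> exists s, U [set v | size (p v) = s].
move=> [_ [d hd]]; have [|s [_ h]] := @ultra_bigU _ U _ (iota 0 d.+1) (fun s => [set v | size (p v) = s]) uU; last by exists s.
by apply: ae (ultraT uU) _ => v _; exists (size (p v)); split=> //; apply/mem_In; rewrite mem_iota /= ltnS.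
Qed.
Lemma ae_prop (P : Prop) : U [set v | P] -> P. by move/ultra_ex => []. Qed.

Lemma pseudo_div (J : set (V -> {poly k})) g s : (forall p, J p -> pfm p) ->
 (forall p q (a b : V -> {poly k}), J p -> J q -> pfm a -> pfm b -> J (fun v => a v * p v + b v * q v)) ->
 J g -> U [set v | size (g v) = s.+1] -> (forall p s', J p -> U [set v | size (p v) = s'.+1] -> (s <= s')%N) ->
 forall p, J p -> exists c h, [/\ pol c, pfm h, U [set v | c v != 0] & U [set v | (c v)%:P * p v = g v * h v]].
move=> Jp Jc Jg sg mg p jp; have [s'] := ae_size (Jp p jp).
elim/ltn_ind: s' p jp => -[_ p jp sp|s' IH p jp sp].
 exists (fun=> 1), (fun=> 0); split; [exact: polC|exact: pfmK| |].
  by apply: ae (ultraT uU) _ => v _; rewrite oner_eq0.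
 by apply: ae sp _ => v /= /eqP; rewrite size_poly_eq0 => /eqP ->; rewrite !mulr0.
have ss := mg _ _ jp sp; have [pg pp] := ((Jp g Jg).1 s, (Jp p jp).1 s').
pose p' v := ((g v)`_s)%:P * p v + (- ((p v)`_s')%:P * 'X^(s' - s)) * g v.
have jp' : J p'.
 apply: Jc => //; first exact: pfmC.
 apply: pfmM; last exact: pfmK.
 by apply: (eq_ind _ pfm (pfmC (polN pp))); apply: funext => v; rewrite polyCN.
have [s''  sp'] := ae_size (Jp p' jp').
have ls : (s'' < s'.+1)%N.
 apply: ae_prop; apply: ae2 sp' (ultraI uU sp sg) _ => v <- [sv gv]; apply/leq_sizeP => i si.
 rewrite /p' coefD coefCM 2!mulNr coefN -mulrA coefCM coefXnM ltnNge (leq_trans (leq_subr _ _) si).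
 move: si; rewrite leq_eqVlt => /orP[/eqP <-|si]; first by rewrite subKn // mulrC subrr.
 have -> : (p v)`_i = 0 by rewrite nth_default ?sv.
 have -> : (g v)`_(i - (s' - s)) = 0 by rewrite nth_default // gv; lia.
 by rewrite !mulr0 subr0.
have [c [h [pc ph cn e]]] := IH _ ls _ jp' sp'.
exists (fun v => c v * (g v)`_s), (fun v => h v + ((c v * (p v)`_s')%:P * 'X^(s' - s))); split.
- exact: polM.
- by apply: pfmD => //; apply: pfmM; [apply: pfmC; exact: polM|exact: pfmK].
- by apply: ae2 cn sg _ => v cv sv; rewrite /= mulf_neq0 //; move: (lead_coef_eq0 (g v)); rewrite lead_coefE sv => ->; rewrite -size_poly_eq0 sv.
- apply: ae e _ => v /= ev; rewrite mulrDr -ev /p' !polyCM; ring.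
Qed.

Variables (F : V -> k) (T : set (V * k)).
Hypotheses (cT : cst T) (hT : U [set v | forall t, T (v, t) <-> t = F v]).

(** If [F v] satisfied no equation, membership of [(v, t)] in a constructible set would be the same
    for [t = F v] and for all but finitely many [t]. The graph contradicts this. *)
Lemma alg_ex : exists p, [/\ pfm p, U [set v | p v != 0] & U [set v | (p v).[F v] = 0]].
apply: contrapT => na.
have gen T' : cst T' -> U [set v | exists2 p : {poly k}, p != 0 & forall t, p.[t] != 0 -> (T' (v, t) <-> T' (v, F v))].
 elim=> [f /pol_last[p [pc pd e]]|S1 S2 _ h1 _ h2|S _ h].
 -
  have [p0|pn] := ultraC uU [set v | p v = 0].
   by apply: ae p0 _ => v pv; exists 1; rewrite ?oner_eq0 // => t _; rewrite /= !e pv !horner0.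
  have [f0|fn] := ae_case (fun v => (p v).[F v]); first by case: na; exists p; split=> //; apply: ae pn _ => v /eqP.
  apply: ae2 pn fn _ => v /eqP pv /= fv; exists (p v) => // t pt; rewrite !e; by split=> e'; [move: pt|move: fv]; rewrite e' eqxx.
 - apply: ae2 h1 h2 _ => v [p1 n1 e1] [p2 n2 e2]; exists (p1 * p2); first by rewrite mulf_neq0.
  by move=> t; rewrite hornerM mulf_eq0 negb_or => /andP[/e1 i1 /e2 i2]; split=> -[a b]; split; tauto.
 - by apply: ae h _ => v [p pn e]; exists p => // t /e /= ->.
apply: (ultra0 uU); apply: ae2 hT (gen T cT) _ => v hv [p pn e].
suff z : p * ('X - (F v)%:P) = 0 by move/eqP: z; rewrite mulf_eq0 (negPf pn) polyXsubC_eq0.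
apply: poly_all0 => t; rewrite hornerM hornerXsubC.
have [->|pt] := eqVneq p.[t] 0; first by rewrite mul0r.
have /hv -> : T (v, t) by apply/e/hv.
by rewrite subrr mulr0.
Qed.

(** For [p] of least degree, a constructible condition holds at any root of [p v] exactly when it
    holds at [F v]: a generator of the ideal of [p] and the equation [r] has degree 0 or the degree
    of [p]. Applied to the graph, every root is [F v]. *)
Lemma single_root : exists p m, [/\ pfm p, U [set v | size (p v) = m.+1], U [set v | (p v).[F v] = 0] &
 U [set v | forall t, root (p v) t -> t = F v]].
have [p0 [pf0 n0 v0]] := alg_ex; have [s0 hs0] := ae_size pf0.
have [|m [[p [pf sp vp]] mm]] := @prop_min (fun s => exists p, [/\ pfm p, U [set v | size (p v) = s.+1] & U [set v | (p v).[F v] = 0]]).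
 exists s0.-1, p0; split=> //; apply: ae2 hs0 n0 _ => v /= <-; rewrite -size_poly_eq0.
 by case: size.
exists p, m; split=> //.
have gen T' : cst T' -> U [set v | forall t, root (p v) t -> (T' (v, t) <-> T' (v, F v))]; last first.
 by apply: ae2 hT (gen T cT) _ => v hv h t /h; rewrite !hv => -[_]; apply.
elim=> [f /pol_last[r [rc rd e]]|S1 S2 _ h1 _ h2|S _ h].
-
 pose J := [set w | exists a b : V -> {poly k}, [/\ pfm a, pfm b & w = fun v => a v * p v + b v * r v]].
 have Jp : J p by exists (fun=> 1), (fun=> 0); split; try exact: pfmK; apply: funext => v; rewrite mul1r mul0r addr0.
 have Jr : J r by exists (fun=> 0), (fun=> 1); split; try exact: pfmK; apply: funext => v; rewrite mul1r mul0r add0r.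
 have Jf w : J w -> pfm w by move=> [a [b [pa pb ->]]]; apply: pfmD; exact: pfmM.
 have Jc w1 w2 a b : J w1 -> J w2 -> pfm a -> pfm b -> J (fun v => a v * w1 v + b v * w2 v).
  move=> [a1 [b1 [pa1 pb1 ->]]] [a2 [b2 [pa2 pb2 ->]]] pa pb.
  exists (fun v => a v * a1 v + b v * a2 v), (fun v => a v * b1 v + b v * b2 v).
  by split; [apply: pfmD; exact: pfmM|apply: pfmD; exact: pfmM|apply: funext => v; ring].
 have [|s [[g [Jg sg]] ms]] := @prop_min (fun s => exists g, J g /\ U [set v | size (g v) = s.+1]); first by exists m, p.
 have pd := pseudo_div Jf Jc Jg sg (fun q s' jq sq => ms s' (ex_intro _ q (conj jq sq))).
 have [c1 [h1 [_ ph1 c1n e1]]] := pd p Jp; have [c2 [h2 [_ _ c2n e2]]] := pd r Jr.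
 have [sh hsh] := ae_size ph1.
 have fac : U [set v | sh = (m - s).+1 /\ (s <= m)%N].
  apply: ae2 (ultraI uU sp sg) (ultraI uU (ultraI uU c1n e1) hsh) _ => v [/= pv gv] [[/= cv ev] <-].
  have := congr1 (size : {poly k} -> nat) ev; rewrite size_Cmul // pv.
  have [h0|hn] := eqVneq (h1 v) 0; first by rewrite h0 mulr0 size_poly0.
  rewrite size_mul //; last by rewrite -size_poly_eq0 gv.
  by rewrite gv; move: hn; rewrite -size_poly_gt0; move: (size (h1 v)) => z zp; lia.
 have [esh sm] := ae_prop fac.
 have [g0|gn] := ae_case (fun v => (g v).[F v]).
  have ms' : (m <= s)%N by apply: mm; exists g; split=> //; exact: Jf.
  apply: ae2 (ultraI uU (ultraI uU c1n e1) hsh) (ultraI uU (ultraI uU c2n e2) g0) _ => v [[/= cv ev] sv] [[/= cv2 ev2] gv] t pt.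
  have /size_poly1P[z zn hz] : size (h1 v) == 1 by rewrite sv esh.
  have gt : (g v).[t] = 0.
   have := congr1 (fun w => w.[t]) ev; rewrite hz !hornerM !hornerC (rootP pt) mulr0 => /esym/eqP.
   by rewrite mulf_eq0 (negPf zn) orbF => /eqP.
  have rz u : (g v).[u] = 0 -> (r v).[u] = 0.
   move=> gu; have := congr1 (fun w => w.[u]) ev2; rewrite !hornerM hornerC gu mul0r => /eqP.
   by rewrite mulf_eq0 (negPf cv2) => /eqP.
  by rewrite !e !rz.
 have h1F : U [set v | (h1 v).[F v] = 0].
  apply: ae2 (ultraI uU e1 vp) gn _ => v [/= ev pv] gv; have := congr1 (fun w => w.[F v]) ev.
  by rewrite !hornerM pv mulr0 => /esym/eqP; rewrite mulf_eq0 (negPf gv) => /eqP.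
 have ms' : (m <= m - s)%N by apply: mm; exists h1; rewrite -esh.
 have s0' : s = 0 by lia.
 have [a [b [_ _ eg]]] := Jg.
 apply: ae2 sg vp _ => v; rewrite s0' => /eqP/size_poly1P[z zn hz] pv t pt.
 have rz u : (p v).[u] = 0 -> (r v).[u] != 0.
  move=> pu; apply/eqP => ru; move: zn; have := congr1 (fun w => w.[u]) hz.
  by rewrite eg hornerD !hornerM pu ru !mulr0 addr0 hornerC => <-; rewrite eqxx.
 by rewrite /= !e; split=> /eqP; rewrite (negPf (rz _ _)) // (rootP pt).
- by apply: ae2 h1 h2 _ => v i1 i2 t pt; split=> -[a b]; split; [apply/(i1 t pt)|apply/(i2 t pt)|apply/i1|apply/i2].
- by apply: ae h _ => v i t /i /= ->.
Qed.

(** Powers of the characteristic exponent, described by additivity so that characteristic 0 is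
    included with [q = 1]. *)
Definition frob (q : nat) := (0 < q)%N /\ forall a b : k, (a + b) ^+ q = a ^+ q + b ^+ q.

(** [p v] is a multiple of [(X - F v) ^ m], and [m = q * m'] with [m'] prime to the characteristic.
    The coefficient of [X ^ (m - q)] is [- m' * F v ^ q] times the leading one, and [m'] is
    invertible in [k]. *)
Lemma pi_ultra : exists q p1 p2, [/\ frob q, pol p1, pol p2, U [set v | p2 v != 0] & U [set v | F v ^+ q * p2 v = p1 v]].
have [p [m [[pc _] sp vp hr]]] := single_root; pose q := (m`_[pchar k])%N; pose m' := (m`_[pchar k]^')%N.
have lin : U [set v | p v = (p v)`_m *: ('X - (F v)%:P) ^+ m].
 apply: ae2 (ultraI uU sp hr) vp _ => v [/= sv rv] _; have [rs e] := closed_field_poly_normal (p v).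
 have el : lead_coef (p v) = (p v)`_m by rewrite lead_coefE sv.
 have ln : (p v)`_m != 0 by rewrite -el lead_coef_eq0 -size_poly_eq0 sv.
 have eF t : t \in rs -> t = F v.
  by move=> ts; apply: rv; rewrite /root e hornerZ horner_prod (big_rem t) //= hornerXsubC subrr mul0r mulr0.
 have ers : rs = nseq (size rs) (F v).
  by elim: rs eF {e} => //= t rs IH h; rewrite (h t) ?mem_head // {1}IH // => u us; apply: h; rewrite inE us orbT.
 have sz : size rs = m.
  by have := congr1 (size : {poly k} -> nat) e; rewrite size_scale ?el // size_prod_XsubC sv => -[].
 by rewrite {1}e el ers sz; congr (_ *: _); elim: (m) => [|j IH]; rewrite ?big_nil ?big_cons // exprS IH.
have m0 : (0 < m)%N.
 apply: ae_prop; apply: ae2 (ultraI uU sp vp) lin _ => v [/= sv v0] _; rewrite lt0n; apply/eqP => m0.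
 move: sv; rewrite m0 => /eqP/size_poly1P[z zn hz]; by move: v0; rewrite hz hornerC => z0; move: zn; rewrite z0 eqxx.
have em : m = (q * m')%N by rewrite /m' partnC.
have qn : [pchar k].-nat q by exact: part_pnat.
have m'n : (m'%:R : k) != 0 by rewrite natf_neq0_pchar; exact: part_pnat.
have q0 : (0 < q)%N by rewrite part_gt0.
have m'0 : (0 < m')%N by rewrite part_gt0.
exists q, (fun v => - (p v)`_(m - q)), (fun v => (p v)`_m * m'%:R); split.
- by split=> // a b; exact: exprDn_pchar.
- exact: polN.
- by apply: polM => //; exact: polC.
- by apply: ae sp _ => v /= sv; rewrite mulf_neq0 //; move: (lead_coef_eq0 (p v)); rewrite lead_coefE sv => ->; rewrite -size_poly_eq0 sv.
apply: ae lin _ => v /= ev; rewrite {2}ev coefZ.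
have -> : ('X - (F v)%:P) ^+ m = ('X - (F v ^+ q)%:P) ^+ m' \Po 'X^q.
 rewrite em exprM rmorphXn /=; congr (_ ^+ _); rewrite comp_polyB comp_polyX comp_polyC.
 rewrite exprDn_pchar; last by rewrite (eq_pnat _ (pchar_poly _)).
 congr (_ + _); rewrite -[RHS]polyCN -[X in X ^+ _]polyCN -polyC_exp; congr (_%:P).
 have := exprDn_pchar (F v) (- F v) qn; rewrite subrr expr0n eqn0Ngt q0 => /esym/eqP.
 by rewrite addrC addr_eq0 => /eqP.
have -> : (m - q)%N = (q * m'.-1)%N by rewrite {1}em -subn1 mulnBr muln1.
rewrite coef_comp_poly_Xn // dvdn_mulr // mulKn //.
have := @coefPn_prod_XsubC k (nseq m' (F v ^+ q)); rewrite size_nseq -lt0n !big_nseq iter_mulr_1 => -> //.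
by rewrite iter_addr_0 -mulr_natr; ring.
Qed.
End PI.

(** The equation of [pi_ultra] holds on a constructible set that is dense in [S], hence on a basic
    open set; the function [h] defining the latter is multiplied into both [p1] and [p2]. *)
Lemma purely_inseparable {k : closedFieldType} {V} {cV : crd k V} (S : set V) (F : V -> k) :
 irr S -> cst [set vt : V * k | S vt.1 /\ vt.2 = F vt.1] ->
 exists q p1 p2, [/\ @frob k q, pol p1, pol p2, exists2 v, S v & p2 v != 0 &
  forall v, S v -> p2 v != 0 -> F v ^+ q = p1 v / p2 v].
move=> iS cT; have [U uU [US Ug]] := ultra_irr iS.
have [|q [p1 [p2 [fq pp1 pp2 n2 e]]]] := pi_ultra uU cT (F := F).
 by apply: ae US _ => // v Sv t; split=> [[]|->].
pose D : set V := [set v | exists t, [set vt : V * k | (S vt.1 /\ vt.2 = F vt.1) /\ vt.2 ^+ q * p2 vt.1 - p1 vt.1 = 0] (v, t)].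
have cD : cst D.
 apply: cst_proj; apply: cstI => //; apply: cst_zero; apply: polB; last exact: pol_fst.
 by apply: polM; [apply: pol_exp (pol_snd pol_id)|exact: pol_fst].
have UD : U D by apply: ae2 US e _ => // v Sv ev; exists (F v); rewrite /= ev subrr.
have [|h [ph [z Sz hz] hD]] := cst_dense cD iS.
 move=> z Sz g pg gD; apply/eqP/negPn/negP => gz; apply: (ultra0 uU).
 apply: ae2 (ultraI uU UD US) (Ug g pg _) _ => //; first by exists z.
 by move=> v [Dv Sv] /=; rewrite gD ?eqxx.
have Up : U [set v | p2 v * h v != 0].
 by apply: ae2 n2 (Ug h ph _) _ => //; [exists z|move=> v /= a b; rewrite mulf_neq0].
have [v [Sv nv]] := ultra_ex uU (ultraI uU US Up).
exists q, (fun v => p1 v * h v), (fun v => p2 v * h v); split; [done|exact: polM|exact: polM|by exists v|].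
move=> u Su; rewrite mulf_eq0 negb_or => /andP[pu hu]; have [t [/= [_ ->] /eqP]] := hD u Su hu.
by rewrite subr_eq0 => /eqP <-; rewrite -mulf_div mulfK // mulfV // mulr1.
Qed.

Section Frob.
Context {k : closedFieldType}.
Variable (q : nat).
Hypothesis (fq : @frob k q).

Lemma frob0 : 0 ^+ q = 0 :> k. by rewrite expr0n eqn0Ngt fq.1. Qed.

Lemma frob_inj (a b : k) : a ^+ q = b ^+ q -> a = b.
move=> e; apply/eqP; rewrite -subr_eq0; have : (a - b) ^+ q = 0; last by move/eqP; rewrite expf_eq0 fq.1.
by have := fq.2 (a - b) b; rewrite subrK e => /eqP; rewrite addrC -subr_eq0 opprD addNKr oppr_eq0 => /eqP.
Qed.

Lemma frob_sum (I : Type) (r : seq I) (F : I -> k) : (\sum_(i <- r) F i) ^+ q = \sum_(i <- r) F i ^+ q.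
by elim: r => [|i r IH]; rewrite ?big_nil ?frob0 // !big_cons fq.2 IH. Qed.

Definition rt (a : k) : k := xget 0 [set b | b ^+ q = a].

Lemma rtK a : rt a ^+ q = a.
rewrite /rt; case: xgetP => [b _ //|/= no].
have [x ex] := GRing.solve_monicpoly q (fun i => if i == 0 then a else 0) fq.1; case: (no x); rewrite ex.
case: (q) fq.1 => // q' _; rewrite big_ord_recl mulr1 big1 ?addr0 // => i _; exact: mul0r.
Qed.

Lemma rt_unique a b : b ^+ q = a -> rt a = b. by move=> e; apply: frob_inj; rewrite rtK. Qed.

Lemma pol_twist m (f : 'rV[k]_m -> k) : pol f -> exists2 f', pol f' & forall v, f v ^+ q = f' (map_mx (fun a => a ^+ q) v).
elim/row_pol_ind=> [c|j|f1 f2 [g1 p1 e1] [g2 p2 e2]|f1 f2 [g1 p1 e1] [g2 p2 e2]].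
- by exists (fun=> c ^+ q) => //; exact: polC.
- by exists (fun v => v 0 j) => [|v]; [exact: pol_row|rewrite mxE].
- by exists (fun v => g1 v + g2 v) => [|v]; [exact: polD|rewrite fq.2 e1 e2].
- by exists (fun v => g1 v * g2 v) => [|v]; [exact: polM|rewrite exprMn e1 e2].
Qed.
End Frob.

Lemma frob_prod (k : closedFieldType) (I : Type) (r : seq I) (F : I -> nat) : (forall i, @frob k (F i)) ->
 @frob k (\prod_(i <- r) F i).
move=> h; elim: r => [|i r [IH1 IH2]]; first by rewrite big_nil.
by rewrite big_cons; split=> [|a b]; [rewrite muln_gt0 (h i).1|rewrite !exprM (h i).2 IH2].
Qed.

Section LregMore.
Context {k : closedFieldType} {V : Type} {cV : crd k V}.
Variables (K W : set V).

Lemma lreg_sum (I : Type) (r : seq I) (F : I -> V -> k) : zopen K W -> (forall i, List.In i r -> lreg K W (F i)) ->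
 lreg K W (fun x => \sum_(i <- r) F i x).
move=> o; elim: r => [|i r IH] h; first by rewrite (_ : (fun => _) = fun=> 0); [exact: lregC|apply: funext => x; rewrite big_nil].
rewrite (_ : (fun => _) = fun x => F i x + \sum_(j <- r) F j x); last by apply: funext => x; rewrite big_cons.
by have [] := lregDM (h i (or_introl erefl)) (IH (fun j jr => h j (or_intror jr))).
Qed.

Lemma lreg_comp m (u : V -> 'rV[k]_m) f : zopen K W -> (forall j, lreg K W (fun v => u v 0 j)) -> pol f -> lreg K W (fun v => f (u v)).
by move=> o hu; elim/row_pol_ind=> [c|j|f1 f2 h1 h2|f1 f2 h1 h2]; [exact: lregC|exact: hu|case: (lregDM h1 h2)|case: (lregDM h1 h2)].
Qed.

Lemma lreg_div f g : W `<=` K -> lreg K W f -> lreg K W g -> lreg K [set v | W v /\ g v != 0] (fun v => f v / g v).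
move=> WK hf hg x [Wx gx]; have [p [r [pp pr r0 e]]] := hf x Wx; have [p' [r' [pp' pr' r0' e']]] := hg x Wx.
exists (fun y => p y * r' y * (r y * r' y)), (fun y => r y * p' y * (r y * r' y)); split; try by repeat apply: polM.
 rewrite !mulf_neq0 //; apply/eqP => p0; move: gx; rewrite (e' x (WK _ Wx) r0').2 p0 mul0r eqxx //.
move=> y Ky; rewrite !mulf_eq0 !negb_or => /andP[/andP[_ p'y] /andP[ry r'y]].
have [Wy ef] := e y Ky ry; have [_ eg] := e' y Ky r'y; split; first by split=> //=; rewrite eg mulf_neq0 ?invr_eq0.
by rewrite ef eg; field; rewrite ry r'y p'y.
Qed.
End LregMore.

(** * Roots of Frobenius powers on the group *)

Section PNormal.
Context {k : closedFieldType} {n : nat}.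
Local Notation M := 'M[k]_n.
Variables (K : set M).
Hypotheses (cK : cgrp K) (iK : irr K).
Let uK x : K x -> x \in unitmx := sg_gl cK.1.

Lemma zopen_meet W W' : zopen K W -> zopen K W' -> W !=set0 -> W' !=set0 -> exists x, W x /\ W' x.
move=> [WK o] [WK' o'] [x Wx] [y Wy]; have [r [pr r0 hr]] := o x Wx; have [r' [pr' r0' hr']] := o' y Wy.
have Ky := WK' _ Wy.
apply: contrapT => no; have [z Kz|h|h] := iK.2 r r' pr pr'.
- have [->|rz] := eqVneq (r z) 0; first by rewrite mul0r.
 by have [->|rz'] := eqVneq (r' z) 0; [rewrite mulr0|case: no; exists z; split; [exact: hr|exact: hr']].
- by move: r0; rewrite h ?eqxx //; exact: WK.
- by move: r0'; rewrite h ?eqxx.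
Qed.

Lemma lreg_eq W W0 f g : W `<=` K -> lreg K W f -> lreg K W g -> zopen K W0 -> W0 !=set0 ->
 (forall x, W x -> W0 x -> f x = g x) -> forall x, W x -> f x = g x.
move=> WK hf hg o0 n0 e x Wx; apply/eqP; rewrite -subr_eq0; apply/negPn/negP => ne.
have h : lreg K W (fun x => f x - g x).
 have [_ hN] := lregDM (lregC (-1) (lreg_zopen WK hg)) hg; have [+ _] := lregDM hf hN.
 by rewrite (_ : (fun x => f x + _) = fun x => f x - g x) //; apply: funext => y; rewrite mulN1r.
have o := lreg_zopen (fun y (Wy : [set y | W y /\ f y - g y != 0] y) => WK _ Wy.1) (lreg_div WK h h).
have [|y [[Wy /eqP fy] W0y]] := zopen_meet o o0 _ n0; first by exists x.
by apply: fy; rewrite e // subrr.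
Qed.

(* If [A] is polynomial, so are finitely many translates spanning all the others,
  and taking [q]-th roots preserves the linear relations between them. *)
Lemma rt_pol q (A f : M -> k) W : @frob k q -> pol A -> zopen K W -> W !=set0 -> lreg K W f ->
 (forall y, W y -> A y = f y ^+ q) -> lreg K K (fun y => rt q (A y)).
move=> fq pA [WK o] [u Wu] lf eA y0 Ky0.
have lr : lreg K W (fun y => rt q (A y)) by apply: (lreg_sub lf) => // y Wy; apply: rt_unique => //; rewrite eA.
have [|N [E [R [F hE]]]] := @fam_pols k n [:: A]; first by move=> ? [<-|[]].
have [l el] := hE A (or_introl erefl); case: (F) => _ _ eE _ _.
have [zs [Kzs hzs]] := fin_span K (fun g => l *m R g); have [r [pr r0 hr]] := o u Wu.
have [||t Kt ht] := @irr_prod_neq0 _ _ _ _ zs (fun z t => r (z *m t *m y0)) K iK.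
- by move=> z; apply: (pol_comp) => //; apply: mor_mulr; exact: mor_mull (morI _).
- move=> z zzs; have Kz := Kzs z zzs; exists (invmx z *m u *m invmx y0).
  by apply: (sgM cK.1) (sgV cK.1 Ky0); apply: (sgM cK.1 (sgV cK.1 Kz)); exact: WK.
 by rewrite !mulmxA mulmxV ?uK // mul1mx mulmxKV // uK.
have [c hc] := hzs _ (sgV cK.1 Kt).
pose D := [set y | K y /\ \prod_(i < size zs) r (nth 1%:M zs i *m t *m y) != 0].
have Kz i : (i < size zs)%N -> K (nth 1%:M zs i *m t) by move=> il; apply: (sgM cK.1) Kt; apply: Kzs; exact: nth_In.
have DW y i : D y -> (i < size zs)%N -> W (nth 1%:M zs i *m t *m y).
 move=> [Ky /prodf_neq0 h] il; apply: hr; first exact: sgM cK.1 (Kz i il) Ky.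
 exact: (h (Ordinal il)).
have pD i : pol (fun y => r (nth 1%:M zs i *m t *m y)).
 by apply: (pol_comp) => //; exact: mor_mull (morI _).
have oD : zopen K D.
 by split=> [y []//|y [Ky ry]]; exists (fun y => \prod_(i < size zs) r (nth 1%:M zs i *m t *m y)); split=> //; apply: pol_prod => i.
have D0 : D y0 by split=> //; apply/prodf_neq0 => i _; apply: ht; exact: nth_In.
have : lreg K D (fun y => rt q (A y)).
 have : lreg K D (fun y => \sum_(i <- enum 'I_(size zs)) rt q (c i) * rt q (A (nth 1%:M zs i *m t *m y))).
  apply: lreg_sum => // i _; have hi : lreg K D (fun y => rt q (A (nth 1%:M zs i *m t *m y))).
   by apply: (lreg_sub (lreg_mul cK (Kz i (ltn_ord i)) lr)) => // y Dy; split; [case: Dy|exact: DW].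
  by have [_ h] := lregDM (lregC (rt q (c i)) oD) hi.
 move/lreg_sub; apply=> // y [Ky _]; apply: rt_unique => //; rewrite frob_sum // big_enum.
 rewrite -{2}[y](mulKmx (uK Kt)) el eE ?unitmx_inv ?uK // mulmxA (hc 1%:M) mulmx_suml summxE.
 apply: eq_bigr => i _; rewrite exprMn !rtK // -scalemxAl mxE el -mulmxA -[in RHS]mulmxA -eE //.
 by apply: uK; apply: Kzs; exact: nth_In.
by move=> /(_ _ D0)[p [s [pp ps s0 h]]]; exists p, s; split=> // y Ky sy; have [_ ->] := h y Ky sy.
Qed.

(** Near [l] write [G = p / r]. Then [A = p * r ^ q.-1] is polynomial and equals [G * r ^ q]; its
    root is regular on all of [K] by [rt_pol], and dividing it by [r] gives the root of [G]. This is
    normality of the group for equations of the form [X ^ q = G]. *)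
Lemma p_normal q W U G f : @frob k q -> W `<=` K -> lreg K W G -> zopen K U -> U !=set0 -> lreg K U f ->
 (forall y, W y -> U y -> G y = f y ^+ q) -> lreg K W (fun y => rt q (G y)).
move=> fq WK lG oU nU lf e l Wl; have [p [r [pp pr r0 h]]] := lG l Wl.
pose A y := p y * r y ^+ q.-1; have pA : pol A by apply: polM => //; exact: pol_exp.
have eA y : K y -> r y != 0 -> A y = G y * r y ^+ q.
 move=> Ky ry; rewrite (h y Ky ry).2 /A; case: (q) fq.1 => // q' _; rewrite exprS mulrA divfK //.
have od : zopen K [set y | K y /\ r y != 0] by split=> [y []//|y [Ky ry]]; exists r.
have oU' := zopenI oU od.
have [|u [Uu du]] := zopen_meet oU od nU; first by exists l; split=> //; exact: WK.
have lA : lreg K K (fun y => rt q (A y)).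
 apply: (rt_pol fq pA oU' (f := fun y => f y * r y)); first by exists u.
  have [_ +] := lregDM (lreg_sub lf oU' (fun y => @proj1 _ _) (fun y _ => erefl)) (lreg_sub (lreg_pol pr) oU' (fun y Uy => oU.1 _ Uy.1) (fun y _ => erefl)).
  by [].
 by move=> y [Uy [Ky ry]]; rewrite eA // e ?exprMn; case: (h y Ky ry).
have [a [b [pa pb b0 hb]]] := lA l (WK _ Wl); exists a, (fun y => b y * r y); split=> //; first exact: polM.
 by rewrite mulf_neq0.
move=> y Ky; rewrite mulf_eq0 negb_or => /andP[bY ry]; have [Wy _] := h y Ky ry; split=> //.
apply: rt_unique => //; rewrite invfM mulrA -(hb y Ky bY).2 exprMn rtK // eA // exprVn mulfK // expf_neq0 //.
Qed.
End PNormal.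

(** * From the normal variety to the coset space *)

Section Descent.
Context {k : closedFieldType} {n : nat}.
Local Notation M := 'M[k]_n.
Variables (G B L H : set M) (ga : M).
Hypotheses (cG : cgrp G) (cB : cgrp B) (BG : B `<=` G) (cL : cgrp L) (iL : irr L) (LG : L `<=` G).
Hypotheses (cH : cgrp H) (HL : H `<=` L) (Gga : G ga) (hH : forall l, L l -> H l <-> B (invmx ga *m l *m ga)).
Local Notation QG := (quotient_space G B).
Local Notation QL := (quotient_space L H).
Local Notation om y := (translate (y *m ga) B).
Implicit Types (x y g l : M).
Let uG x : G x -> x \in unitmx := sg_gl cG.1.
Let uL x (Lx : L x) : x \in unitmx := uG (LG Lx).
Let Gy y : L y -> G (y *m ga) := fun Ly => sgM cG.1 (LG Ly) Gga.

Lemma om_eq x y : L x -> L y -> om x = om y <-> H (invmx x *m y).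
move=> Lx Ly; rewrite (coset_eq cB _ (uG (Gy Lx))) hH; last exact: sgM cL.1 (sgV cL.1 Lx) Ly.
by rewrite (invmxM (uG (LG Lx)) (uG Gga)) !mulmxA.
Qed.

Lemma om_lreg V2 f2 : @regular k QG V2 f2 -> lreg L [set y | L y /\ V2 (om y)] (fun y => f2 (om y)).
move=> /(qregP cG) h y [Ly Vy]; have [p [q [pp pq q0 e]]] := h _ (conj (Gy Ly) Vy).
have mg : mor setT (fun y => y *m ga) by exact: mor_mulr (morI _).
exists (fun y => p (y *m ga)), (fun y => q (y *m ga)); split; try exact: pol_comp.
 by [].
by move=> z Lz qz; have [[_ Vz] ->] := e _ (Gy Lz) qz.
Qed.

(** Points of the orbit correspond to cosets of [H], so each chart coordinate of [L/H] is a function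
    with constructible graph on the image of the orbit in a chart of [G/B]; hence some power of it
    is rational there, and the product of these powers is one [q] for all functions. This works near
    a good point [y1]; translation by [g] carries it to [l]. *)
Lemma frob_descent : exists2 q, @frob k q & forall W phi l, hinv L H W phi -> lreg L W phi -> W l ->
 exists V0 (f0 : set M -> k), [/\ @kopen k QG V0, V0 (om l), @regular k QG V0 f0 &
  forall y, L y -> V0 (om y) -> W y /\ f0 (om y) = phi y ^+ q].
have L1 := sg1 cL.1; have [m [d [nu [cd d1]]]] := chart_ex cL cH HL L1.
have [mG [dG [nuG [cdG dG1]]]] := chart_ex cG cB BG Gga.
have mg : mor setT (fun y => y *m ga) by exact: mor_mulr (morI _).
pose eG y := dG (y *m ga); pose nG y := nuG (y *m ga); pose c2 := cmap eG nG.
have peG : pol eG by exact: (pol_comp mg (ch_pol cdG)).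
have pnG : polmx nG by move=> i j; exact: (pol_comp mg (ch_polmx cdG i j)).
have c2E x y : L x -> L y -> eG x != 0 -> eG y != 0 -> c2 x = c2 y <-> H (invmx x *m y).
 move=> Lx Ly ex ey; rewrite (ch_sep cdG (conj (Gy Lx) ex) (conj (Gy Ly) ey)) -om_eq //.
 by rewrite (coset_eq cB _ (uG (Gy Lx))).
have dH x y : L x -> L y -> d y != 0 -> H (invmx x *m y) -> d x != 0.
 move=> Lx Ly dy Hxy; have [_] := ch_stab cd (conj Ly dy) (sgV cH.1 Hxy).
 have [ux uy] := (uG (LG Lx), uG (LG Ly)).
 by rewrite invmxM ?unitmx_inv // invmxK mulKVmx.
pose S' := c2 @` [set y | L y /\ eG y != 0]; pose S := c2 @` [set y | L y /\ d y * eG y != 0].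
have pd := ch_pol cd; have pde : pol (fun y => d y * eG y) by exact: polM.
have eG1 : eG 1%:M != 0 by rewrite /eG mul1mx.
pose n2 y := d y *: nG y; have pn2 : polmx n2 by exact: polmxZ.
have c2d y : d y * eG y != 0 -> cmap (fun y => d y * eG y) n2 y = c2 y.
 by rewrite mulf_eq0 negb_or => /andP[dy ey]; rewrite /cmap scalerA; congr (_ *: _); field; rewrite ey.
have eS : S = cmap (fun y => d y * eG y) n2 @` [set y | L y /\ d y * eG y != 0].
 by apply/seteqP; split=> _ [y [Ly dy] <-]; exists y => //; rewrite c2d.
have cL' : cst L by exact: cst_closed cL.2.
have cS : cst S by rewrite eS; exact: cst_cmap.
have iS : irr S by rewrite eS; apply: (irr_cmap pde pn2 iL L1); rewrite mulf_neq0.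
have iS' : irr S' by exact: (irr_cmap peG pnG iL L1 eG1).
have dense : S' `<=` cl S.
 move=> _ [x [Lx ex] <-] f pf fS; have [e [P [pP hP]]] := clear_den peG pnG pf.
 have [||y Ly|h|h] := iL.2 (fun y => P y * eG y) d; [exact: polM|done| | |].
 - have [->|dy] := eqVneq (d y) 0; first by rewrite mulr0.
  have [->|ey] := eqVneq (eG y) 0; first by rewrite mulr0 mul0r.
  have /eqP : f (c2 y) = 0 by apply: fS; exists y; split=> //; rewrite mulf_neq0.
  by rewrite hP // mulf_eq0 invr_eq0 (negPf (expf_neq0 _ ey)) orbF => /eqP ->; rewrite !mul0r.
 - have /eqP := h x Lx; rewrite mulf_eq0 (negPf ex) orbF => /eqP P0.
  by rewrite hP // P0 mul0r.
 - by move: d1; rewrite h ?eqxx.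
(* Where [h] is nonzero on the image of the orbit, the chart of [L/H] is defined as well: a
   condition on the side of [G/B] controls the denominator [d]. *)
have [|h [ph [z Sz hz] hS]] := cst_dense cS iS'.
 move=> v S'v; apply: cl_mono (dense _ S'v) => _ [y [Ly dy] <-]; split; last by exists y.
 by exists y; move: dy; rewrite mulf_eq0 negb_or => /andP[].
have {z Sz hz} [z Sz hz] : exists2 z, S z & h z != 0.
 apply: contrapT => no; move/eqP: hz; apply; apply: dense => // v Sv.
 by apply/eqP/negPn/negP => hv; apply: no; exists v.
pose F j v := cmap d nu (xget 1%:M [set y | (L y /\ d y * eG y != 0) /\ c2 y = v]) 0 j.
have FE j y : L y -> d y * eG y != 0 -> F j (c2 y) = cmap d nu y 0 j.
 move=> Ly dy; rewrite /F; case: xgetP => [x _ [[Lx dx] e]|/(_ y) []//].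
 move: dx dy; rewrite !mulf_eq0 !negb_or => /andP[dx ex] /andP[dy ey].
 by have -> : cmap d nu x = cmap d nu y by apply/(ch_sep cd) => //; apply/c2E.
have /choice[Q hQ] j : exists Q : nat * (('rV[k]_mG -> k) * ('rV[k]_mG -> k)), [/\ @frob k Q.1, pol Q.2.1, pol Q.2.2,
  exists2 v, S v & Q.2.2 v != 0 & forall v, S v -> Q.2.2 v != 0 -> F j v ^+ Q.1 = Q.2.1 v / Q.2.2 v].
 have [|q [p1 [p2 h']]] := @purely_inseparable k _ _ S (F j) iS; last by exists (q, (p1, p2)).
 pose n3 y : 'rV[k]_(mG + 1) := row_mx (n2 y) (eG y * nu y 0 j)%:M.
 have pn3 : polmx n3.
  move=> i a; rewrite ord1 -(splitK a); case: fintype.split => {}a.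
   by apply: (pol_ext (f := fun y => n2 y 0 a)) => [y|]; [rewrite row_mxEl|exact: pn2].
  apply: (pol_ext (f := fun y => eG y * nu y 0 j)) => [y|]; first by rewrite row_mxEr !ord1 mxE mulr1n.
  by apply: polM => //; exact: (ch_polmx cd).
 have mr : mor setT (fun vt => row_mx vt.1 (vt.2)%:M : 'rV[k]_(mG + 1)).
  apply: mor_row => a; apply: pon_pol; rewrite -(splitK a); case: fintype.split => {}a.
   by apply: (pol_ext) => [vt|]; [rewrite row_mxEl|exact: (pol_fst (pol_row a))].
  by apply: (pol_ext) => [vt|]; [rewrite row_mxEr !ord1 mxE mulr1n|exact: (pol_snd pol_id)].
 apply: cst_ext (cst_pre mr (cst_cmap pde pn3 cL')) => -[v t] /=.
 have eq y : d y * eG y != 0 -> cmap (fun y => d y * eG y) n3 y = row_mx (c2 y) (cmap d nu y 0 j)%:M.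
  move=> dy; rewrite -(c2d y dy) /cmap scale_row_mx; congr row_mx.
  rewrite scale_scalar_mx mxE; congr (_ %:M); move: dy; rewrite mulf_eq0 negb_or => /andP[dy ey].
  by field; rewrite dy ey.
 split=> [[y [Ly dy]]|[[y [Ly dy] <-] ->]]; last by exists y => //; rewrite eq // FE.
 rewrite eq // => /eq_row_mx[<- /matrixP/(_ 0 0)]; rewrite !mxE !mulr1n => <-.
 by split; [exists y|rewrite FE // mxE].
pose q := (\prod_j (Q j).1); have fq : @frob k q by apply: frob_prod => j; case: (hQ j).
(* Complementary exponents, bringing all coordinates to the common power [q]. *)
pose r j := (\prod_(i | i != j) (Q i).1).
have eqr j : q = ((Q j).1 * r j)%N by rewrite /q (bigD1 j).
exists q => // W phi l hi lr Wl.
have [||v1 [y1 [Ly1 dy1] <-{v1}] hv1] := @irr_prod_neq0 _ _ _ _ (None :: [seq Some j | j <- enum 'I_m])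
 (fun o => if o is Some j then (Q j).2.2 else h) S iS.
- by case=> [j|//]; case: (hQ j).
- by case=> [j _|_]; [case: (hQ j)|exists z].
have hv j : (Q j).2.2 (c2 y1) != 0.
 apply: (hv1 (Some j)); right; apply: List.in_map; apply/mem_In; exact: mem_enum.
have Ll : L l by case: hi => + _; apply.
pose g := l *m invmx y1; have Lg : L g by exact: sgM cL.1 Ll (sgV cL.1 Ly1).
have gy1 : g *m y1 = l by rewrite mulmxKV // uL.
have dy1' : cdom L d y1 by split=> //; move: dy1; rewrite mulf_eq0 negb_or => /andP[].
have [|A0 [B0 [pA0 pB0 B00 hAB]]] := ch_reg cd (hinv_mul cL HL Lg hi) (lreg_mul cL Lg lr) dy1'.
 by split=> //; rewrite gy1.
have [A' pA' eA'] := pol_twist fq pA0; have [B' pB' eB'] := pol_twist fq pB0.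
pose u v : 'rV[k]_m := \row_j ((Q j).2.1 v / (Q j).2.2 v) ^+ r j.
have uE y : L y -> d y * eG y != 0 -> (forall j, (Q j).2.2 (c2 y) != 0) -> u (c2 y) = map_mx (fun a => a ^+ q) (cmap d nu y).
 move=> Ly dy hy; apply/rowP => j; rewrite [LHS]mxE [RHS]mxE; have [_ _ _ _ <-//] := hQ j; last by exists y.
 by rewrite -exprM -eqr FE.
pose D := [set v : 'rV[k]_mG | h v * \prod_j (Q j).2.2 v != 0].
have DE v : D v <-> h v != 0 /\ forall j, (Q j).2.2 v != 0.
 rewrite /D /= mulf_eq0 negb_or; split=> [/andP[-> /prodf_neq0 hj]|[-> hj]]; first by split=> // j; exact: hj.
 by apply/prodf_neq0 => j _.
have oD : zopen setT D.
 split=> // v Dv; exists (fun v => h v * \prod_j (Q j).2.2 v); split=> //; apply: polM => //.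
 by apply: pol_prod => j; case: (hQ j).
have lu j : lreg setT D (fun v => u v 0 j).
 have [_ pQ1 pQ2 _ _] := hQ j.
 apply: (lreg_sub (W := [set v | (Q j).2.2 v ^+ r j != 0]) (f := fun v => (Q j).2.1 v ^+ r j / (Q j).2.2 v ^+ r j)) => //.
 - by move=> v Qv; exists (fun v => (Q j).2.1 v ^+ r j), (fun v => (Q j).2.2 v ^+ r j); split=> //; exact: pol_exp.
 - by move=> v /DE[_ /(_ j) hj]; rewrite /= expf_neq0.
 - by move=> v _; rewrite mxE expr_div_n.
have lP := lreg_div (subsetT D) (lreg_comp oD lu pA') (lreg_comp oD lu pB').
have Gg := LG Lg; have GV := sgV cG.1 Gg; have cg := chart_mul cG BG GV cdG.
pose dg x := dG (invmx g *m x); pose ng x := nuG (invmx g *m x).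
pose W' := [set x | cdom G dg x /\ (D (cmap dg ng x) /\ B' (u (cmap dg ng x)) != 0)].
have lW' := lreg_cmap cg (fun _ _ => I) lP.
have hW' := hinv_cmap cG cg [set v | D v /\ B' (u v) != 0] (fun v => A' (u v) / B' (u v)).
have oW' := lreg_zopen hW'.1 lW'.
have key y : L y -> W' (y *m ga) -> W y /\ A' (u (cmap dg ng (y *m ga))) / B' (u (cmap dg ng (y *m ga))) = phi y ^+ q.
 move=> Ly [[_ dy] [Dy By]]; pose y' := invmx g *m y; have Ly' : L y' by exact: sgM cL.1 (sgV cL.1 Lg) Ly.
 have ey' : eG y' != 0 by rewrite /eG -mulmxA.
 have ec : cmap dg ng (y *m ga) = c2 y' by rewrite /c2 /cmap /eG /nG -mulmxA.
 have [hy' Qy'] := proj1 (DE _) Dy; rewrite ec in hy' Qy' By *.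
 have [|y2 [Ly2 dy2] e2] := hS (c2 y') _ hy'; first by exists y'.
 have {}dy' : d y' != 0.
  move: dy2; rewrite mulf_eq0 negb_or => /andP[dy2 ey2]; apply: (dH y' y2) => //.
  by apply/c2E.
 have dy'' : d y' * eG y' != 0 by rewrite mulf_neq0.
 move: By; rewrite (uE y' Ly' dy'' Qy') -eA' -eB' expf_eq0 fq.1 => By.
 have [[_ +] ee] := hAB y' (conj Ly' dy') By; rewrite -exprVn -exprMn -ee /y' mulKVmx ?uG //.
exists [set translate x B | x in W'], (fun c => A' (u (cmap dg ng (rep c))) / B' (u (cmap dg ng (rep c)))); split.
- by apply: qopen_img => // x b W'x Bb; case: (hW'.2 x b W'x Bb).
- exists (l *m ga) => //; have ly : invmx g *m (l *m ga) = y1 *m ga by rewrite mulmxA -gy1 mulKmx // uG.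
 have ec : cmap dg ng (l *m ga) = c2 y1 by rewrite /cmap /dg /ng ly.
 split; first by split; [exact: Gy|rewrite /dg ly; move: dy1; rewrite mulf_eq0 negb_or => /andP[]].
 rewrite ec; split; first by apply/DE; split=> //; exact: (hv1 None (or_introl erefl)).
 by rewrite uE // -eB' expf_neq0.
- exact: (qreg_desc cG cB hW' lW').
- move=> y Ly [x W'x e]; have Gx : G x by case: W'x => -[].
 have W'y : W' (y *m ga).
  move: e => /(coset_eq cB _ (uG Gx)) Bxy; have [+ _] := hW'.2 x _ W'x Bxy.
  by rewrite mulKVmx // uG.
 by have [Wy <-] := key y Ly W'y; split=> //; exact: (rep_inv cB hW' W'y).
Qed.

Lemma sub_openD (X D : set (set M)) : X `<=` cosets G B -> @kclosed k QG D -> @kopen k (@subspace k QG X) (X `\` D).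
move=> XG cD; split=> [c []//|]; exists D => //; apply/seteqP; split=> c [Xc]; last by move=> Dc; split=> // -[].
by move=> nD; split=> //; apply: contrapT => nDc; apply: nD.
Qed.

(** The [q]-th powers of [f] and of the coefficients [a i] descend to [X], where they satisfy the
    [q]-th power of the integral equation. Normality of [X] extends [f ^ q] over the point, and
    [p_normal] extracts its root on [L], which is invariant under [H]. *)
Lemma quotient_normal (X : set (set M)) : X `<=` cosets G B -> normal_space (@subspace k QG X) ->
 (forall y, L y -> X (om y)) -> @kopen k (@subspace k QG X) [set om y | y in L] -> normal_space QL.
move=> XG nX omX [_ [DO kDO eO]] _ [l Ll <-] U f oU [c0 Uc0] rf V m a oV Vx ra he.
have [q fq desc] := frob_descent; have /(qopenP H cL)[sU zU] := oU; have /(qopenP H cL)[sV zV] := oV.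
have [l1 Ll1 el1] := sU _ Uc0; rewrite -el1 in Uc0; have lf := proj1 (qregP cL _ _) rf.
have [Vf [ff [oVf Vf1 rff hf]]] := desc _ _ l1 (hinv_pre cL cH HL U f) lf (conj Ll1 Uc0).
have [Vc [fc [oVc Vc1 _ hc]]] := desc _ _ l (hinv_pre cL cH HL V (fun=> 0)) (lregC 0 zV) (conj Ll Vx).
have /choice[Va ha] i : exists Va : set (set M) * (set M -> k), [/\ @kopen k QG Va.1, Va.1 (om l), @regular k QG Va.1 Va.2 &
  forall y, L y -> Va.1 (om y) -> quotient_preimage L H V y /\ Va.2 (om y) = a i (translate y H) ^+ q].
 have [V0 [f0 h0]] := desc _ _ l (hinv_pre cL cH HL V (a i)) (proj1 (qregP cL _ _) (ra i)) (conj Ll Vx).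
 by exists (V0, f0).
have [[_ _ cU _] _] := quotient_swf B cG.
(* The complement of a neighbourhood on which all coefficients descend and whose orbit points come
   from [V]. The latter is recorded by descending the function 0, which covers the case [m = 0]. *)
pose D2 := [set c | cosets G B c /\ ((cosets G B `\` Vc) c \/ exists i, (cosets G B `\` (Va i).1) c)].
have cD2 : @kclosed k QG D2.
 apply/(qclosedP B cG); split=> [c []//|].
 pose s := None :: [seq Some i | i <- enum 'I_m]; pose W o := if o is Some i then (Va i).1 else Vc.
 have -> : quotient_preimage G B D2 = [set z | exists o, List.In o s /\ quotient_preimage G B (cosets G B `\` W o) z].
  apply/seteqP; split=> z.
   move=> [Gz [_ [h|[i h]]]]; first by exists None; split=> //; left.
   exists (Some i); split=> //; right; apply: List.in_map; apply/mem_In; exact: mem_enum.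
  by move=> [[i|] [_ [Gz h]]]; split=> //; split; try (by case: h); [right; exists i|left].
 apply: closed_bigU => o; have oo : @kopen k QG (W o) by case: o => [i|//]; case: (ha i).
 by case: oo => _ /qclosedP[].
have UX := sub_openD XG (cU _ _ oVf.2 kDO); set UX' := X `\` _ in UX.
have inUX y : L y -> Vf (om y) -> UX' (om y).
 move=> Ly Vy; split; first exact: omX.
 move=> [[_]//|Dy]; have [_] : (X `\` [set om y | y in L]) (om y) by rewrite [X `\` _]eO; split=> //; exact: omX.
 by apply; exists y.
have [||||c [Xc nD] [_ nD2]|V2 [g2 [oV2 V2l rg2 eg2]]] := nX (om l) (omX _ Ll) UX' ff UX _ _ (X `\` D2) m (fun i => (Va i).2) (sub_openD XG cD2).
- by exists (om l1); exact: inUX.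
- move=> c [Xc nD]; exists Vf, ff; split=> //; apply: contrapT => nV; apply: nD; left; split=> //; exact: XG.
- by split; [exact: omX|move=> [_ [[_ nV]|[i [_ nV]]]]; [exact: nV|case: (ha i)]].
- move=> i; have [oi _ ri _] := ha i; move=> c [Xc nD]; exists (Va i).1, (Va i).2; split=> //; apply: contrapT => nV.
 by apply: nD; have cc := XG _ Xc; split=> //; right; exists i.
- have cc := XG _ Xc; have Vfc : Vf c by apply: contrapT => nV; apply: nD; left.
 have [y Ly ey] : [set om y | y in L] c.
  apply: contrapT => nO; apply: nD; right; have [_ //] : (X `&` DO) c by rewrite -[X `&` DO]eO.
 subst c; have [[_ Uy] ->] := hf y Ly Vfc.
 have [[_ Vy] _] : quotient_preimage L H V y /\ fc (om y) = 0 ^+ q.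
  by apply: hc; apply: contrapT => nV; apply: nD2; split=> //; left.
 have := congr1 (fun z => z ^+ q) (he _ Uy Vy); rewrite frob0 // fq.2 frob_sum // => e0; rewrite -[RHS]e0.
 congr (_ + _); first by rewrite exprAC.
 apply: eq_bigr => i _; have [_ _ _ hi] := ha i; have [|_ ->] := hi y Ly.
  by apply: contrapT => nV; apply: nD2; split=> //; right; exists i.
 by rewrite exprMn exprAC.
pose WG := [set y | L y /\ V2 (om y)]; pose Gf y := g2 (om y).
case: oV2 => sV2 [D3 kD3 eD3].
have lG : lreg L WG Gf.
 move=> y [Ly V2y]; have [V3 [f3 [oV3 V3y rf3 e3]]] := rg2 _ V2y.
 have oD3 : @kopen k QG (cosets G B `\` D3).
  split=> [c []//|]; rewrite (_ : _ `\` _ = D3) //; apply/seteqP; have [[sD _ _ _] _] := quotient_swf B cG.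
  split=> c; last by move=> Dc; split; [exact: sD kD3 _ Dc|move=> []].
  by move=> [cc nc]; apply: contrapT => nDc; apply: nc.
 have r0 : @regular k QG (cosets G B `\` D3) (fun=> 0) by have [_ [+ _ _ _]] := quotient_swf B cG; apply.
 have oD : zopen L [set y | L y /\ (cosets G B `\` D3) (om y)] by apply: lreg_zopen (om_lreg r0) => z [].
 have l3 := om_lreg rf3; have o3 := zopenI (lreg_zopen (fun z (h : [set y | L y /\ V3 (om y)] z) => h.1) l3) oD.
 have [|p [s [pp ps s0 h]]] := lreg_sub l3 o3 (fun z => @proj1 _ _) (fun z _ => erefl) (x := y).
  split=> //; split=> //; split; first exact: XG (omX _ Ly).
  by move=> D3y; have [_] : (X `\` V2) (om y); [rewrite [X `\` _]eD3; split=> //; exact: omX|].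
 exists p, s; split=> // z Lz sz; have [[[_ V3z] [_ [_ nD3]]] ez] := h z Lz sz.
 have V2z : V2 (om z).
  by apply: contrapT => nV; have [_ //] : (X `&` D3) (om z); rewrite -[X `&` _]eD3; split=> //; exact: omX.
 by split=> //; rewrite /Gf e3.
have oU0 : zopen L [set y | L y /\ Vf (om y)] by apply: lreg_zopen (om_lreg rff) => z [].
have nU0 : [set y | L y /\ Vf (om y)] !=set0 by exists l1.
have lf0 : lreg L [set y | L y /\ Vf (om y)] (fun y => f (translate y H)).
 by apply: (lreg_sub lf oU0) => // y [Ly Vy]; case: (hf y Ly Vy).
have Ge y : WG y -> Vf (om y) -> Gf y = f (translate y H) ^+ q.
 by move=> [Ly V2y] Vy; have [_ <-] := hf y Ly Vy; apply: eg2 => //; exact: inUX.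
have lR := p_normal cL iL fq (fun y (h : WG y) => h.1) lG oU0 nU0 lf0 (fun y Wy Uy => Ge y Wy Uy.2).
have hiR : hinv L H WG (fun y => rt q (Gf y)).
 split=> [y []//|y h [Ly Vy] Hh]; have Lyh := sgM cL.1 Ly (HL Hh).
 have e : om (y *m h) = om y by symmetry; apply/om_eq => //; rewrite mulKmx ?uL.
 by rewrite /Gf e; split=> //; split=> //; rewrite e.
have oR := lreg_zopen hiR.1 lR.
exists [set translate y H | y in WG], (fun c => rt q (Gf (rep c))); split.
- by apply: (qopen_img cL cH oR) => y h Wy Hh; case: (hiR.2 y h Wy Hh).
- by exists l.
- exact: (qreg_desc cL cH hiR lR).
- move=> c Uy [y Wy ey]; rewrite -ey in Uy *; rewrite (rep_inv cH hiR Wy).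
 have oI := zopenI oR zU.
 have := lreg_eq iL oI.1 (lreg_sub lR oI (fun z => @proj1 _ _) (fun z _ => erefl)) (lreg_sub lf oI (fun z => @proj2 _ _) (fun z _ => erefl)) oU0 nU0.
 apply=> [z [Wz _] [_ Vz]|]; first by apply: rt_unique => //; rewrite Ge.
 by split=> //; case: Wy.
Qed.

End Descent.

(** * Points in general position *)

Section General.
Context {k : closedFieldType} {n : nat}.
Local Notation M := 'M[k]_n.
Variables (G B : set M).
Hypotheses (cG : cgrp G) (cB : cgrp B) (BG : B `<=` G).
Local Notation QG := (quotient_space G B).
Local Notation pre := (quotient_preimage G B).
Implicit Types (x y g : M) (Z D : set (set M)).

Section InChart.
Variables (m : nat) (d : M -> k) (nu : M -> 'rV[k]_m) (cd : chart G B d nu).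
Local Notation C := (cmap d nu).
Definition shadow Z := C @` [set y | pre Z y /\ d y != 0].

Lemma chart_sep D y : @kclosed k QG D -> G y -> ~ pre D y -> d y != 0 ->
 exists f, [/\ pol f, f (C y) != 0 & forall z, pre D z -> d z != 0 -> f (C z) = 0].
move=> /(qclosedP B cG)[_ cD] Gy nD dy.
have hi : hinv G B (G `\` pre D) (fun=> 0).
 split=> [z []//|z b [Gz nDz] Bb]; split=> //; split; first exact: sgM cG.1 Gz (BG Bb).
 by move=> [_]; rewrite translateH // => Dz; apply: nDz.
have [//|A [f [pA pf f0 hf]]] := ch_reg cd hi (lregC 0 (zopenD G cD)) (conj Gy dy).
by exists f; split=> // z [Gz Dz] dz; apply/eqP/negPn/negP => fz; have [[_ nz] _] := hf z (conj Gz dz) fz; exact: nz.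
Qed.

Lemma shadow_lt Z Z' D y : @kclosed k QG D -> Z `<=` D -> pre Z' y -> ~ pre D y -> d y != 0 -> ~ shadow Z' `<=` cl (shadow Z).
move=> kD ZD [Gy Zy] nD dy sub; have [f [pf /eqP f0 fD]] := chart_sep kD Gy nD dy.
apply: f0; apply: sub => //; first by exists y.
by move=> _ [z [[Gz Zz] dz] <-]; apply: fD => //; split=> //; exact: ZD.
Qed.

Lemma chart_zero f : pol f -> @kclosed k QG [set c | exists2 y, G y /\ (d y = 0 \/ f (C y) = 0) & c = translate y B].
move=> pf; apply/(qclosedP B cG); split=> [_ [y [Gy _] ->]|]; first by exists y.
have [e [P [pP hP]]] := clear_den (ch_pol cd) (ch_polmx cd) pf.
have eP y : (d y = 0 \/ f (C y) = 0) <-> P y * d y = 0.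
 have [d0|dy] := eqVneq (d y) 0; first by rewrite d0 mulr0; split=> //; left.
 rewrite hP //; split=> [[/eqP|/eqP]|/eqP]; rewrite ?(negPf dy) //.
  by rewrite mulf_eq0 invr_eq0 (negPf (expf_neq0 _ dy)) orbF => /eqP ->; rewrite mul0r.
 by rewrite mulf_eq0 (negPf dy) orbF => /eqP ->; right; rewrite mul0r.
rewrite (_ : pre _ = G `&` [set y | P y * d y = 0]).
 by apply: closedI; [exact: cG.2|apply: closed_zero; apply: polM => //; exact: ch_pol cd].
apply/seteqP; split=> y [Gy]; last by move=> /eP h; split=> //; exists y.
move=> [z [Gz hz] /esym /(coset_eq cB _ (sg_gl cG.1 Gz)) Bzy]; split=> //; apply/eP.
have eY : y = z *m (invmx z *m y) by rewrite mulKVmx // (sg_gl cG.1 Gz).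
have [d0|dy] := eqVneq (d y) 0; [by left|right].
have dz : d z != 0.
 have := ch_stab cd (conj Gy dy) (sgV cB.1 Bzy); rewrite invmxM ?unitmx_inv ?(sg_gl cG.1 Gz) ?(sg_gl cG.1 Gy) // invmxK.
 by rewrite mulKVmx ?(sg_gl cG.1 Gy) // => -[].
case: hz => [d0|<-]; first by move: dz; rewrite d0 eqxx.
by rewrite eY (cmap_H cG cd (conj Gz dz) Bzy).
Qed.

Lemma shadow_irr (O Z : set (set M)) y : O `<=` cosets G B -> Z `<=` O -> (forall F F', @kclosed k QG F -> @kclosed k QG F' -> Z `<=` F `|` F' -> Z `<=` F \/ Z `<=` F') ->
 pre Z y -> d y != 0 -> irr (shadow Z).
move=> OG ZO iZ Zy dy; split; first by exists (C y), y.
move=> f g pf pg fg.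
have z F : Z `<=` [set c | exists2 y, G y /\ (d y = 0 \/ F (C y) = 0) & c = translate y B] ->
  forall v, shadow Z v -> F v = 0.
 move=> h _ [x [[Gx Zx] dx] <-]; have [x' [Gx' hx'] e] := h _ Zx.
 have Bx := proj1 (coset_eq cB _ (sg_gl cG.1 Gx)) e; have [_ dx'] := ch_stab cd (conj Gx dx) Bx.
 have := cmap_H cG cd (conj Gx dx) Bx; rewrite mulKVmx ?(sg_gl cG.1 Gx) // in dx' * => <-.
 by case: hx' => // d0; move: dx'; rewrite d0 eqxx.
have [c Zc|h|h] := iZ _ _ (chart_zero pf) (chart_zero pg); [|by left; exact: z|by right; exact: z].
have [x Gx ex] := OG _ (ZO _ Zc); subst c; have [d0|dx] := eqVneq (d x) 0; first by left; exists x; split=> //; left.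
have /eqP : f (C x) * g (C x) = 0 by apply: fg; exists x.
by rewrite mulf_eq0 => /orP[/eqP e|/eqP e]; [left|right]; exists x; split=> //; right.
Qed.

End InChart.

Variables (X O : set (set M)) (DO : set (set M)).
Hypotheses (XG : X `<=` cosets G B) (kX : @kclosed k QG X) (iX : irr (pre X)).
Hypotheses (kDO : @kclosed k QG DO) (OX : O = X `\` DO) (O0 : O !=set0).

Lemma X_irr F F' : @kclosed k QG F -> @kclosed k QG F' -> X `<=` F `|` F' -> X `<=` F \/ X `<=` F'.
move=> /(qclosedP B cG)[_ cF] /(qclosedP B cG)[_ cF'] h.
have [y [Gy Xy]|i|i] := irr_sub_closedU iX cF cF'; first by case: (h _ Xy) => ?; [left|right].
- by left=> c Xc; have [y Gy ey] := XG Xc; subst c; case: (i y).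
- by right=> c Xc; have [y Gy ey] := XG Xc; subst c; case: (i y).
Qed.

Lemma X_point d : pol d -> (exists2 y, pre X y & d y != 0) -> exists y, [/\ pre X y, ~ pre DO y & d y != 0].
move=> pd [y Xy dy]; apply: contrapT => no; have /(qclosedP B cG)[_ cD] := kDO.
have [z Xz|i|i] := irr_sub_closedU iX cD (closed_zero pd).
- have [dz|dz] := eqVneq (d z) 0; first by right.
 by left; apply: contrapT => nz; apply: no; exists z.
- have [c Oc] := O0; move: Oc; rewrite OX => -[Xc nD]; have [x Gx ex] := XG Xc; subst c.
 by apply: nD; case: (i x).
- by move: dy; rewrite (i y Xy : d y = 0) eqxx.
Qed.

(** The chain that [td_ge_chain] gives for the shadow of [O] is pulled back to [G], closed up there,
    and pushed to cosets. Its members meet the shadow of [O] densely, so irreducibility and strict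
    inclusions survive. *)
Lemma open_chain m d (nu : M -> 'rV[k]_m) e : chart G B d nu -> (exists2 y, pre X y & d y != 0) -> td_ge (shadow d nu X) e ->
 dim_ge (@subspace k QG O) e.
move=> cd nX te; have [pd pnu] := (ch_pol cd, ch_polmx cd); pose C := cmap d nu.
have [y0 [Xy0 nDy0 dy0]] := X_point pd nX; have /(qclosedP B cG)[_ cX] := kX; have /(qclosedP B cG)[_ cD] := kDO.
have preO : pre O = pre X `&` [set y | ~ pre DO y].
 by rewrite OX; apply/seteqP; split=> y; [move=> [Gy [Xy nD]]; split=> // -[]|move=> [[Gy Xy] nD]; split=> //; split=> // Dy; exact: nD].
have cO : cst (pre O) by rewrite preO; apply: cstI; [exact: cst_closed|apply: cstC; exact: cst_closed].
have dense y f : pre X y -> pol f -> (forall z, pre O z -> d z != 0 -> f z = 0) -> f y = 0.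
 move=> Xy pf fO; have [s [ps sD s0]] := closed_sep cD nDy0; have [||h|h] := iX.2 f (fun z => s z * d z) pf; first exact: polM.
 - move=> z Xz; have [->|dz] := eqVneq (d z) 0; first by rewrite !mulr0.
  have [Dz|nDz] := pselect (pre DO z); first by rewrite sD // mul0r mulr0.
  by rewrite fO ?mul0r // preO.
 - exact: h.
 - by have /eqP := h y0 Xy0; rewrite mulf_eq0 (negPf s0) (negPf dy0).
have iO : irr (pre O).
 apply: (irr_dense iX) => [y|y Xy f pf fO]; first by rewrite preO => -[].
 by apply: dense => // z Oz _; exact: fO.
have Oy0 : pre O y0 by rewrite preO.
have tO : td_ge (shadow d nu O) e.
 apply: td_ge_cl; apply: td_ge_sub te => _ [y [Xy dy] <-] f pf fO; have [a [P [pP hP]]] := clear_den pd pnu pf.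
 rewrite hP // dense ?mul0r // => z Oz dz; have /eqP : f (C z) = 0 by apply: fO; exists z.
 by rewrite hP // mulf_eq0 invr_eq0 (negPf (expf_neq0 _ dz)) orbF => /eqP.
have [Ch [hC sC]] := td_ge_chain (cst_cmap pd pnu cO) (irr_cmap pd pnu iO Oy0 dy0) tO.
pose Y i := [set y | [/\ pre O y, d y != 0 & Ch i (C y)]].
have YB i y b : B b -> Y i y -> Y i (y *m b).
 move=> Bb [[Gy Oy] dy Cy]; have [Gyb dyb] := ch_stab cd (conj Gy dy) Bb.
 by split=> //; [split=> //; rewrite translateH|rewrite /C (cmap_H cG cd)].
have clB i y b : B b -> cl (Y i) y -> cl (Y i) (y *m b).
 move=> Bb cy f pf fY; apply: (cy (fun y => f (y *m b))) => [|z Yz]; last by apply: fY; exact: YB.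
 by apply: (pol_comp) => //; exact: mor_mulr (morI _).
pose Z i := [set c | O c /\ exists2 y, G y /\ cl (cV := mx_crd k n) (Y i) y & c = translate y B].
have clG i y : cl (Y i) y -> G y by move=> cy; apply: cG.2; apply: cl_mono cy => z [[]].
have ZP i y : G y -> Z i (translate y B) -> cl (Y i) y.
 move=> Gy [_ [z [Gz cz] /esym /(coset_eq cB _ (sg_gl cG.1 Gz)) Bzy]].
 by rewrite -[y](mulKVmx (sg_gl cG.1 Gz)); exact: clB.
have YZ i y : Y i y -> Z i (translate y B) by move=> Yy; case: (Yy) => -[Gy Oy] _ _; split=> //; exists y; split=> //; exact: sub_cl.
exists Z; split=> [i ie|i ie].
 have [_ iC dC _] := hC i ie; split.
  exists [set c | exists2 y, G y /\ cl (Y i) y & c = translate y B]; last by apply/seteqP; split=> c [].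
  apply/(qclosedP B cG); split=> [_ [y [Gy _] ->]|]; first by exists y.
  rewrite (_ : pre _ = cl (Y i)); first exact: cl_closed.
  apply/seteqP; split=> y; last by move=> cy; have Gy := clG _ _ cy; split=> //; exists y.
  move=> [Gy [z [Gz cz] /esym /(coset_eq cB _ (sg_gl cG.1 Gz)) Bzy]].
  by rewrite -[y](mulKVmx (sg_gl cG.1 Gz)); exact: clB.
 split.
  have [v Cv] := iC.1; apply: contrapT => nZ.
  have /eqP : (1 : k) = 0; last by rewrite oner_eq0.
  apply: (dC v Cv (fun=> 1) (polC 1)) => w [Cw [y [Oy dy] ey]]; case: nZ; exists (translate y B); apply: YZ.
  by split=> //; rewrite /C ey.
 move=> _ _ [F /[dup] kF /(qclosedP B cG)[_ cF] ->] [F' /[dup] kF' /(qclosedP B cG)[_ cF'] ->] sub.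
 have fin E : zclosed (pre E) -> Y i `<=` pre E -> Z i `<=` O `&` E.
  move=> cE YE c Zc; have [Oc [y [Gy cy] ey]] := Zc; split=> //; have [_] : pre E y by exact: (cl_sub cE YE).
  by rewrite ey.
 have [[y1 Yy1 nF]|nY] := pselect (exists2 y, Y i y & ~ pre F y); last first.
  by left; apply: fin => // y Yy; apply: contrapT => nF; apply: nY; exists y.
 have [[y2 Yy2 nF']|nY] := pselect (exists2 y, Y i y & ~ pre F' y); last first.
  by right; apply: fin => // y Yy; apply: contrapT => nF'; apply: nY; exists y.
 exfalso; have [[Gy1 _] dy1 Cy1] := Yy1; have [[Gy2 _] dy2 Cy2] := Yy2.
 have [f1 [p1 /eqP n1 z1]] := chart_sep cd kF Gy1 nF dy1; have [f2 [p2 /eqP n2 z2]] := chart_sep cd kF' Gy2 nF' dy2.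
 have [v Cv|h|h] := iC.2 f1 f2 p1 p2; [|exact: n1 (h _ Cy1)|exact: n2 (h _ Cy2)].
 apply: (dC v Cv (fun v => f1 v * f2 v)); first exact: polM.
 move=> w [Cw [y [[Gy Oy] dy] ey]]; have Yy : Y i y by split=> //; rewrite /C ey.
 rewrite -ey; have [] := sub _ (YZ i y Yy) => -[_ Fy]; [rewrite z1|rewrite z2 ?mulr0] => //; by rewrite mul0r.
have [CC nCC] := sC i ie; have [cCi _ _ _] := hC i (ltnW ie); have [_ _ dC _] := hC i.+1 ie.
split.
 move=> c [Oc [y [Gy cy] ey]]; split=> //; exists y => //; split=> //; apply: cl_mono cy => z [Oz dz Cz].
 by split=> //; exact: CC.
move=> sub; apply: nCC => v Cv; apply: contrapT => nCv; have [f [pf fC /eqP f0]] := closed_sep cCi nCv.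
apply: f0; apply: dC => // w [Cw [y [Oy dy] ey]]; rewrite -ey.
have cy : cl (Y i) y by apply: (ZP i y Oy.1); apply: sub; apply: YZ; split=> //; rewrite /C ey.
have [a [P [pP hP]]] := clear_den pd pnu pf; rewrite hP // cy ?mul0r // => z [_ dz Cz].
have /eqP := fC _ Cz; rewrite hP // mulf_eq0 invr_eq0 (negPf (expf_neq0 _ dz)) orbF => /eqP //.
Qed.

(* A chain outside [O] gains one step by adding [X] on top. *)
Lemma small_chain m d0 (nu0 : M -> 'rV[k]_m) (O' : set (set M)) e : chart G B d0 nu0 -> d0 1%:M != 0 ->
 O' `<=` X -> O' `<=` DO -> dim_ge (@subspace k QG O') e -> exists2 g, G g &
 (exists2 y, pre X y & d0 (g *m y) != 0) /\ td_ge (shadow (fun y => d0 (g *m y)) (fun y => nu0 (g *m y)) X) e.+1.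
move=> cd0 d01 OX' OD [Z [hZ sZ]].
have ZO i : (i <= e)%N -> Z i `<=` O' by move=> ie; have [[D _ ->] _] := hZ i ie.
(* The chart is translated to a point of the smallest member of the chain, so that it meets every
   member. *)
have [[c0 Zc0] _] := (hZ 0 (leq0n e)).2; have [y0 Gy0 ey0] := XG (OX' _ (ZO 0 (leq0n e) _ Zc0)).
have GV := sgV cG.1 Gy0; have cd := chart_mul cG BG GV cd0; exists (invmx y0) => //.
set d := (fun y => _) in cd *; set nu := (fun y => _) in cd *.
have dy0 : d y0 != 0 by rewrite /d mulVmx ?(sg_gl cG.1 Gy0).
have pZ0 i : (i <= e)%N -> pre (Z i) y0.
 move=> ie; split=> //; rewrite ey0; elim: i ie => // i IH ie; have [+ _] := sZ i ie; apply; exact: IH (ltnW ie).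
have nX : exists2 y, pre X y & d y != 0 by exists y0 => //; split=> //; rewrite ey0; apply: OX'; exact: (ZO 0).
split=> //; have OG : X `<=` cosets G B by [].
have iZ i : (i <= e)%N -> forall F F', @kclosed k QG F -> @kclosed k QG F' -> Z i `<=` F `|` F' -> Z i `<=` F \/ Z i `<=` F'.
 move=> ie F F' kF kF' sub; have [_ [_ h]] := hZ i ie.
 have [c Zc|i1|i1] := h (O' `&` F) (O' `&` F') (ex_intro2 _ _ F kF erefl) (ex_intro2 _ _ F' kF' erefl).
 - by have Oc := ZO i ie _ Zc; case: (sub _ Zc) => ?; [left|right].
 - by left=> c /i1[].
 - by right=> c /i1[].
have iS i : (i <= e)%N -> irr (shadow d nu (Z i)).
 by move=> ie; apply: (shadow_irr cd OG _ (iZ i ie) (pZ0 i ie) dy0) => c /(ZO i ie) /OX'.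
have te i : (i <= e)%N -> td_ge (shadow d nu (Z i)) i.
 elim: i => [_|i IH ie]; first by apply: td_ge0; have [] := iS 0 (leq0n e).
 have [sub nsub] := sZ i ie; have ie' := ltnW ie; apply: (td_gtP (iS _ ie) _ _ (IH ie')).
  by move=> _ [y [[Gy Zy] dy] <-]; exists y; split=> //; split=> //; exact: sub.
 have [[D kD eD] _] := hZ i ie'.
 have [y [Zy nDy dy]] : exists y, [/\ pre (Z i.+1) y, ~ pre D y & d y != 0].
  apply: contrapT => no; have [c Zc|i1|i1] := iZ _ ie D _ kD (chart_zero cd (polC 1)).
  - have [y Gy ey] := XG (OX' _ (ZO _ ie _ Zc)); subst c; have [dz|dy] := eqVneq (d y) 0; first by right; exists y; split=> //; left.
   by left; apply: contrapT => nD; apply: no; exists y; split=> // -[].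
  - by apply: nsub => c Zc; rewrite eD; split; [exact: ZO ie _ Zc|exact: i1].
  - have [_ Zy] := pZ0 _ ie; have [y [Gy hy] ey] := i1 _ Zy.
   case: hy => [dz|/eqP]; last by rewrite oner_eq0.
   by have [_] := ch_stab cd (conj Gy0 dy0) (proj1 (coset_eq cB _ (sg_gl cG.1 Gy0)) ey); rewrite mulKVmx ?(sg_gl cG.1 Gy0) // dz eqxx.
 by apply: (shadow_lt cd kD _ Zy nDy dy); rewrite eD => [].
have [y [Xy nDy dy]] := X_point (ch_pol cd) nX; have OXe : Z e `<=` X by move=> c /(ZO e (leqnn e)) /OX'.
apply: (td_gtP _ _ _ (te e (leqnn e))).
- exact: (shadow_irr cd OG (fun c Xc => Xc) X_irr Xy dy).
- by move=> _ [z [[Gz Zz] dz] <-]; exists z; split=> //; split=> //; exact: OXe.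
- by apply: (shadow_lt cd kDO _ Xy nDy dy) => c /(ZO e (leqnn e)) /OD.
Qed.

End General.

(** * The notions of the statement in terms of closed matrix groups *)

Section Bridge.
Context {k : closedFieldType} {n : nat}.
Local Notation M := 'M[k]_n.
Implicit Types (G K H B T : set M).

Lemma closed_subgroupE K H : cgrp K -> closed_subgroup K H <-> cgrp H /\ H `<=` K.
move=> cK; split=> [[sH HK /(mclosedP cK)[_ cH]]|[[sH cH] HK]]; first by [].
by split=> //; apply/mclosedP.
Qed.

(** The complement of the identity component is a finite union of its other cosets, hence closed, so
    connectedness leaves only the component. *)
Lemma connectedE H : cgrp H -> connected_space (matrix_space H) <-> irr H.
move=> cH; split=> [[_ h]|iH]; last first.
 split=> [|C D /(mclosedP cH)[_ cC] /(mclosedP cH)[_ cD] e d]; first exact: iH.1.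
 have [x Hx|i|i] := irr_sub_closedU iH cC cD; first by rewrite e.
  right; apply/seteqP; split=> x // Dx; rewrite -d; split=> //; apply: i; rewrite -[H]e; by right.
 left; apply/seteqP; split=> x // Cx; rewrite -d; split=> //; apply: i; rewrite -[H]e; by left.
have [cg ig _] := gcompP cH; have [s [us hs]] := gcomp_fin cH.
have cD : zclosed (H `\` gcomp H).
 have -> : H `\` gcomp H = [set x | exists g, List.In g s /\
   [set x | (forall y, gcomp H (invmx g *m y) -> ~ gcomp H y) /\ (H `&` [set x | gcomp H (invmx g *m x)]) x] x].
  apply/seteqP; split=> x [].
   move=> Hx ng; have [g [gs hg]] := hs x Hx; exists g; split=> //; split=> // y hy gy; apply: ng.
   have hgV := proj1 (sg_mulr (invmx g) cg.1 gy) hy; exact: proj1 (sg_mull x cg.1 hgV) hg.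
  by move=> g [_ [hg [Hx gx]]]; split=> //; exact: hg.
 apply: closed_bigU => g; apply: closed_cond; apply: closedI; [exact: cH.2|exact: closed_coset cg.2].
have [||||e|e] := h (gcomp H) (H `\` gcomp H).
- by apply/(mclosedP cH); split; [exact: gcomp_sub|exact: cg.2].
- by apply/mclosedP.
- apply/seteqP; split=> x; first by case=> [/gcomp_sub|[]].
 by move=> Hx; have [gx|ng] := pselect (gcomp H x); [left|right].
- by apply/seteqP; split=> x // [gx []].
- by have := sg1 cg.1; rewrite e.
rewrite (_ : H = gcomp H) //; apply/seteqP; split=> x; last exact: gcomp_sub.
by move=> Hx; apply: contrapT => ng; have : (H `\` gcomp H) x by []; rewrite e.
Qed.

Lemma connected_subgroupE K H : cgrp K -> connected_subgroup K H <-> [/\ cgrp H, irr H & H `<=` K].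
move=> cK; split=> [[/(closed_subgroupE _ cK)[cH HK] /(connectedE cH) iH]|[cH iH HK]]; first by [].
by split; [apply/closed_subgroupE|apply/connectedE].
Qed.

Lemma borelE K B : cgrp K -> borel_subgroup K B <-> borel K B.
move=> cK; split=> [[/(connected_subgroupE _ cK)[cB iB BK] sB mB]|[cB iB BK sB mB]].
 split=> // B' cB' iB' B'K sB' BB'; have -> // := mB B' _ sB' BB'; exact/connected_subgroupE.
split=> //; first exact/connected_subgroupE.
by move=> B' /(connected_subgroupE _ cK)[cB' iB' B'K] sB' BB'; apply/seteqP; split=> //; exact: mB.
Qed.

Lemma maxtorE K T : cgrp K -> maximal_torus K T -> maxtor K T.
move=> cK [[/(connected_subgroupE _ cK)[cT iT TK] dT] mT]; split=> // S [cS iS dS] SK TS.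
have -> // := mT S _ TS; by split=> //; apply/connected_subgroupE.
Qed.

Lemma weyl_rep G T w wd : cgrp G -> weyl_group G T w -> w wd -> G wd /\ cj wd T = T.
move=> cG [g [Gg eg] <-] [z [Gz hz] <-]; split; first exact: sgM cG.1 Gg Gz.
rewrite -{2}eg; apply/seteqP; have ug := sg_gl cG.1 Gg; have uz := sg_gl cG.1 Gz.
by split=> _ [t Tt <-]; exists t => //; rewrite mxconjMl // hz.
Qed.

Lemma parabolic_group G B T J : cgrp G -> borel G B -> let P := standard_parabolic G B T J in
 [/\ cgrp P, irr P, B `<=` P & P `<=` G].
move=> cG [cB iB BG _ _] P; pose R a := root_subgroup G T (opp_char a).
(* [root_subgroup] is a chosen set with the empty set as default, so each generator is either empty
   or a closed irreducible group; only the nonempty ones enter [F]. *)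
have hR a : R a = set0 \/ [/\ cgrp (R a), irr (R a) & R a `<=` G].
 by rewrite /R /root_subgroup; case: xgetP => [U _ [/(connected_subgroupE _ cG) hU _ _]|_]; [right|left].
pose F := [set A | A = B \/ exists2 a, J a & A = R a /\ R a !=set0].
have eP : P = generated (\bigcup_(A in F) A).
 congr generated; apply/seteqP; split=> x.
  by move=> [Bx|[a Ja Rx]]; [exists B => //; left|exists (R a) => //; right; exists a => //; split=> //; exists x].
 by move=> [A [->|[a Ja [-> _]]] Ax]; [left|right; exists a].
have [||cP iP] := @generated_irr_closed k n F; last rewrite -eP in cP iP.
- by move=> A [->//|[a _ [-> [x Rx]]]]; case: (hR a) => [e|[]//]; move: Rx; rewrite e.
- by exists B; left.
split=> //; first by move=> b Bb H sH sub; apply: sub; left.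
apply: gen_least; first exact: cG.1.
by move=> x [/BG//|[a _ Rx]]; case: (hR a) => [e|[_ _]]; [move: Rx; rewrite -/(R a) e|apply].
Qed.

Lemma dim_ge_sub (S : kspace k) (X O : set (Defs.point S)) e : O `<=` X ->
 dim_ge (@subspace k (@subspace k S X) O) e <-> dim_ge (@subspace k S O) e.
move=> OX; suff h : @kclosed k (@subspace k (@subspace k S X) O) = @kclosed k (@subspace k S O).
 by rewrite /dim_ge /irreducible_set h.
apply/seteqP; split=> C.
 move=> [_ [D kD ->] ->]; exists D => //; apply/seteqP; split=> c [Oc]; first by case.
 by move=> Dc; split=> //; split=> //; exact: OX.
move=> [D kD ->]; exists (X `&` D); first by exists D.
by apply/seteqP; split=> c [Oc]; [move=> Dc; split=> //; split=> //; exact: OX|case].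
Qed.

(** The preimage of the Schubert variety in [G] is the closure of the double coset of [wd], which is
    a product of irreducible sets. *)
Lemma schubert_pre G B wd : cgrp G -> borel G B -> G wd ->
 let X := @kclosure k (quotient_space G B) [set translate (b *m wd) B | b in B] in
 [/\ X `<=` cosets G B, @kclosed k (quotient_space G B) X, irr (quotient_preimage G B X),
   forall b, B b -> X (translate (b *m wd) B) &
   forall D, @kclosed k (quotient_space G B) D -> (forall b, B b -> D (translate (b *m wd) B)) -> X `<=` D].
move=> cG [cB iB BG _ _] Gw X; have [[_ [_ kc] _ kI] _] := quotient_swf B cG.
have kX : @kclosed k (quotient_space G B) X.
 have := kI [set C | @kclosed k (quotient_space G B) C /\ [set translate (b *m wd) B | b in B] `<=` C].
 have sc : [set translate (b *m wd) B | b in B] `<=` cosets G B by move=> _ [b Bb <-]; exists (b *m wd) => //; exact: sgM cG.1 (BG _ Bb) Gw.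
 case=> [|C []//|]; first by exists (cosets G B).
 rewrite (_ : [set x | _] = X) //; apply/seteqP; split=> c h; last by move=> C [kC sC]; apply: h.2.
 by split=> [|C kC sC]; apply: h.
have XG : X `<=` cosets G B by move=> c [].
have bX b : B b -> X (translate (b *m wd) B).
 by move=> Bb; split=> [|C kC sC]; [exists (b *m wd) => //; exact: sgM cG.1 (BG _ Bb) Gw|apply: sC; exists b].
split=> //; last by move=> D kD hD c [_ h]; apply: h => // _ [b Bb <-]; exact: hD.
pose Y := [set x | exists y z, [/\ [set b *m wd | b in B] y, B z & x = y *m z]].
have iY : irr Y by apply: irr_mul => //; apply: (irr_image iB); exact: mor_mulr (morI _).
have YG : cl Y `<=` G.
 apply: cl_sub; [exact: cG.2|move=> _ [_ [z [[b Bb <-] Bz ->]]]].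
 by apply: sgM cG.1 _ (BG _ Bz); exact: sgM cG.1 (BG _ Bb) Gw.
have clB y b : B b -> cl Y y -> cl Y (y *m b).
 move=> Bb cy f pf fY; apply: (cy (fun y => f (y *m b))) => [|_ [u [z [Bu Bz ->]]]].
  by apply: (pol_comp) => //; exact: mor_mulr (morI _).
 by apply: fY; exists u, (z *m b); split=> //; [exact: sgM cB.1 Bz Bb|rewrite mulmxA].
suff -> : quotient_preimage G B X = cl (cV := mx_crd k n) Y by exact: irr_cl.
have /(qclosedP B cG)[_ cX] := kX; apply/seteqP; split=> y.
 move=> [Gy [_ h]]; have [|_ [b Bb <-]|z cz e] := h [set translate z B | z in cl Y].
 - apply/(qclosedP B cG); rewrite (pre_img cG cB YG); last by move=> z b cz Bb; exact: clB.
  by split; [move=> _ [z /YG Gz <-]; exists z|exact: cl_closed].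
 - by exists (b *m wd) => //; apply: sub_cl; exists (b *m wd), 1%:M; split; [exists b|exact: sg1 cB.1|rewrite mulmx1].
 - have Gz := YG _ cz; have /(clB z _) := proj1 (coset_eq cB _ (sg_gl cG.1 Gz)) e.
  by rewrite mulKVmx ?(sg_gl cG.1 Gz); exact.
apply: cl_sub => // _ [_ [z [[b Bb <-] Bz ->]]]; split; last by rewrite translateH //; exact: bX.
by apply: sgM cG.1 _ (BG _ Bz); exact: sgM cG.1 (BG _ Bb) Gw.
Qed.

Section Orbits.
Variables (G B L : set M) (X : set (set M)).
Hypotheses (cG : cgrp G) (cB : cgrp B) (BG : B `<=` G) (cL : cgrp L) (LG : L `<=` G) (XG : X `<=` cosets G B).
Hypothesis (aX : forall l c, L l -> X c -> X (translate l c)).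
Local Notation QG := (quotient_space G B).
Local Notation orb' K x := (act_orbit K (@translate k n) x).

Lemma translateK l (c : set M) : L l -> translate (invmx l) (translate l c) = c.
by move=> Ll; rewrite translateM mulVmx ?translate1 // (sg_gl cL.1 Ll). Qed.

(** Openness passes from the orbit of [N] to that of [L]: in [X] the complement of the latter
    consists of the points all of whose [L]-translates lie in [D0], an intersection of closed
    sets. *)
Lemma orbit_open (N : set M) x0 D0 : N `<=` L -> N 1%:M -> X x0 -> @kclosed k QG D0 -> X `\` orb' N x0 = X `&` D0 ->
 exists2 DO, @kclosed k QG DO & orb' L x0 = X `\` DO.
move=> NL N1 X0 /(qclosedP B cG)[_ cD] e; exists [set c | cosets G B c /\ forall l, L l -> D0 (translate l c)].
 apply/(qclosedP B cG); split=> [c []//|].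
 rewrite (_ : _ _ = [set y | forall l, (G `&` [set y | L l -> quotient_preimage G B D0 (l *m y)]) y]).
  apply: closed_cap => l; apply: closedI; first exact: cG.2.
  have [Ll|nL] := pselect (L l); last by [].
  by move=> y hy _; have := closed_coset cD; apply; apply: cl_mono hy => z; exact.
 apply/seteqP; split=> y.
  by move=> [Gy [_ h]] l; split=> // Ll; split; [exact: sgM cG.1 (LG Ll) Gy|rewrite -translateM; exact: h].
 move=> h; have Gy : G y by case: (h 1%:M).
 by split=> //; split=> [|l Ll]; [exists y|rewrite translateM; have [_ /(_ Ll)[]] := h l].
apply/seteqP; split=> c.
 move=> [l Ll <-]; split; first exact: aX.
 move=> [_ /(_ _ (sgV cL.1 Ll))]; rewrite translateK // => Dx.
 by have [_] : (X `\` orb' N x0) x0; [rewrite e|apply; exists 1%:M => //; rewrite translate1].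
move=> [Xc nD]; apply: contrapT => nO; apply: nD; split=> [|l Ll]; first exact: XG.
suff [_ //] : (X `&` D0) (translate l c).
rewrite -e; split; first exact: aX.
move=> [b Nb eb]; apply: nO; exists (invmx l *m b); first exact: sgM cL.1 (sgV cL.1 Ll) (NL _ Nb).
by rewrite -translateM eb translateK.
Qed.

(** Outside the open orbit, the orbit of [x] would lie in the boundary yet have chains as long as
    those of the open orbit. Then [open_chain], the hypothesis on dimensions and [small_chain]
    together raise [td_ge] by one, again and again, against [td_bound]. *)
Lemma general_orbit x x0 DO : @kclosed k QG X -> irr (quotient_preimage G B X) -> @kclosed k QG DO -> orb' L x0 = X `\` DO ->
 X x0 -> X x -> dim_le (@subspace k (@subspace k QG X) (orb' L x0)) (@subspace k (@subspace k QG X) (orb' L x)) -> orb' L x0 x.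
move=> kX iX kD eO X0 Xx dl; apply: contrapT => nO.
have sO y : X y -> orb' L y `<=` X by move=> Xy _ [l Ll <-]; exact: aX.
have OD : orb' L x `<=` DO.
 move=> _ [l Ll <-]; apply: contrapT => nD; apply: nO.
 have [l' Ll' e] : orb' L x0 (translate l x) by rewrite eO; split=> //; exact: aX.
 exists (invmx l *m l'); first exact: sgM cL.1 (sgV cL.1 Ll) Ll'.
 by rewrite -translateM e translateK.
have O0 : orb' L x0 !=set0 by exists x0, 1%:M; [exact: sg1 cL.1|exact: translate1].
have [m [d [nu [cd d1]]]] := chart_ex cG cB BG (sg1 cG.1).
have all_td e : exists2 g, G g & (exists2 y, quotient_preimage G B X y & d (g *m y) != 0) /\
  td_ge (shadow G B (fun y => d (g *m y)) (fun y => nu (g *m y)) X) e.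
 elim: e => [|e [g Gg [ny te]]]; last first.
  apply: (small_chain cG cB BG XG iX kD eO O0 cd d1 (sO _ Xx) OD).
  apply: (proj1 (@dim_ge_sub QG _ _ _ (sO _ Xx))); apply: dl; apply: (proj2 (@dim_ge_sub QG _ _ _ (sO _ X0))).
  exact: (open_chain cG cB BG XG kX iX kD eO O0 (chart_mul cG BG Gg cd) ny te).
 have [y Gy ey] := XG X0; have dy : d (invmx y *m y) != 0 by rewrite mulVmx // (sg_gl cG.1 Gy).
 have Xy : quotient_preimage G B X y by split=> //; rewrite ey.
 exists (invmx y); first exact: sgV cG.1 Gy.
 by split; [exists y|apply: td_ge0; exists (cmap (fun z => d (invmx y *m z)) (fun z => nu (invmx y *m z)) y), y].
have [g _ [_ /td_bound]] := all_td (edim 'rV[k]_m + size (crdx 'rV[k]_m)).+1.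
by rewrite ltnn.
Qed.

End Orbits.
End Bridge.

Theorem proposition5p3 (k : closedFieldType) (n : nat)
    (G B T : set 'M[k]_n)
    (G_semisimple : connected_semisimple G)
    (B_borel : borel_subgroup G B)
    (T_torus : maximal_torus G T)
    (T_sub_B : T `<=` B)
    (w : set 'M[k]_n) (w_in_W : weyl_group G T w)
    (wd : 'M[k]_n) (wd_repr : w wd)
    (J : set ('M[k]_n -> k)) (J_sub : J `<=` left_descents B T wd)
    (L : set 'M[k]_n)
    (L_levi : levi_subgroup (standard_parabolic G B T J) L)
    (T_sub_L : T `<=` L)
    (X_spherical :
       @spherical_variety k n L (schubert_variety G B wd) (@translate k n))
    (x : set 'M[k]_n)
    (x_general :
       @general_position k n L (schubert_variety G B wd) (@translate k n) x) :
  strongly_solvable L (stabilizer L (@translate k n) x) /\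
  spherical_subgroup L (stabilizer L (@translate k n) x).
Proof.
have [aG /connectedE iG _] := G_semisimple.
have [cG _] := proj1 (closed_subgroupE _ (conj (@sg_GL k n) (@closed_gl k n))) aG; move: (iG cG) => {}iG.
have bB := proj1 (borelE _ cG) B_borel; have [cB iB BG _ _] := bB.
have [Gw wT] := weyl_rep cG w_in_W wd_repr; have mT := maxtorE cG T_torus.
have [] := parabolic_group T J cG bB; move: L_levi; set P := standard_parabolic _ _ _ _.
move=> [LP0 [U [[U0 nU _ _] LU PLU]]] cP iP BP PG; have [cL LP] := proj1 (closed_subgroupE _ cP) LP0.
have [cU iU UP] := proj1 (connected_subgroupE _ cP) U0; have LU1 : L `&` U `<=` [set 1%:M] by rewrite LU.
have LG : L `<=` G by move=> l /LP/PG.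
have iL : irr L by have := irr_levi cP iP cL cU UP nU LU1 PLU; rewrite setIidr.
have [] := schubert_pre cG bB Gw; move: X_spherical x_general; rewrite /schubert_variety; set X := kclosure _.
move=> [_ [_ _ [actX _ _]] _ nX [N /(borelE _ cL) bN [x0 X0 [_ [D0 kD0 eD0]]]]] [Xx gx] XG kX iX bX Xmin.
have [cN _ NL _ _] := bN.
have aX l c : L l -> X c -> X (translate l c) by move=> Ll Xc; exact: (actX (l, c) (conj Ll Xc)).
have [DO kDO eO] := orbit_open cG cL LG XG aX NL (sg1 cN.1) X0 kD0 eD0.
have [l0 Ll0 ex0] := general_orbit cG cB BG cL XG aX kX iX kDO eO X0 Xx (gx x0 X0).
(* Otherwise the closed set [DO] would contain the whole Schubert cell, hence [X], and in particular
   [x0]. *)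
have [b Bb [l' Ll' el]] : exists2 b, B b & act_orbit L (@translate k n) x0 (translate (b *m wd) B).
 apply: contrapT => nb; have /(_ _ X0) : X `<=` DO.
  by apply: Xmin => // b Bb; apply: contrapT => nD; apply: nb; exists b => //; rewrite eO; split=> //; exact: bX.
 suff [] : (X `\` DO) x0 by [].
 by rewrite -eO; exists 1%:M; [exact: sg1 cL.1|exact: translate1].
(* As [x = l0 x0], [l' x0 = b wd B] and [b = l u], the point [x] is the coset of
   [ga = l0 l'^-1 l u wd]. *)
have [l [u [Ll Uu eb]]] := PLU _ (BP _ Bb); set l1 := l0 *m invmx l' *m l; set ga := l1 *m u *m wd.
have Ll1 : L l1 by apply: sgM cL.1 _ Ll; exact: sgM cL.1 Ll0 (sgV cL.1 Ll').
have Gga : G ga by apply: sgM cG.1 _ Gw; exact: sgM cG.1 (LG _ Ll1) (PG _ (UP _ Uu)).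
have ex : translate ga B = x.
 by rewrite -ex0 -(translateK cL x0 Ll') el !translateM eb /ga /l1 !mulmxA.
have uga := sg_gl cG.1 Gga; set H := stabilizer L (@translate k n) x.
have hH y : L y -> H y <-> B (invmx ga *m y *m ga).
 move=> Ly; rewrite -mulmxA -(coset_eq cB _ uga) -(translateM y ga) ex.
 by split=> [[_ ->]|e]; last split.
have cH : cgrp H.
 suff -> : H = L `&` cj ga B by apply: cgrpI => //; exact: cj_cgrp.
 by apply/seteqP; split=> y; [case=> Ly e|case=> Ly]; first split=> //; rewrite ?cjP // /mxconj invmxK -?hH.
have HL : H `<=` L by move=> y [].
split.
 split; first exact: cH.1.
 have [K bK hK] := stab_in_borel cG iG bB mT T_sub_B Gw wT cP iP BP PG cL LP cU iU UP nU LU1 PLU Ll1 Uu.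
 exists K; first exact/borelE.
 move=> y Hy; have Ly := HL _ Hy; apply: hK => //; exists (invmx ga *m y *m ga); first exact/hH.
 by rewrite -/ga -(mulmxA (invmx ga)) mulKVmx.
split; first exact/closed_subgroupE.
have omX y : L y -> X (translate (y *m ga) B) by move=> Ly; rewrite -(translateM y ga) ex; exact: aX.
have oN z : translate (z *m invmx l0 *m ga) B = translate z x0.
 by rewrite -(translateM _ ga) ex -ex0 -(translateM z) (translateK cL).
split; [exact: quotient_variety|exact: quotient_action|exact: quotient_irr| |].
 apply: (quotient_normal cG cB BG cL iL LG cH HL Gga hH XG nX omX).
 rewrite (_ : [set _ | _ in _] = X `\` DO); first exact: sub_openD.
 rewrite -eO; apply/seteqP; split=> _ [y Ly <-].
  by exists (y *m l0); [exact: sgM cL.1 Ly Ll0|rewrite -(translateM y ga) ex -ex0 translateM].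
 by exists (y *m invmx l0); [exact: sgM cL.1 Ly (sgV cL.1 Ll0)|exact: oN].
exists N; first exact/borelE.
(* The open orbit of [N] on [X] passes through [x0 = l0^-1 x], so its counterpart in [L/H] passes
   through the coset of [l0^-1]. *)
have LV := sgV cL.1 Ll0; exists (translate (invmx l0) H); first by exists (invmx l0).
have oH y z : L y -> L z -> translate (y *m ga) B = translate (z *m ga) B <-> translate y H = translate z H.
 by move=> Ly Lz; rewrite (om_eq cG cB cL LG Gga hH Ly Lz) (coset_eq cH _ (sg_gl cL.1 Ly)).
have NV z : N z -> L (z *m invmx l0) by move=> Nz; exact: sgM cL.1 (NL _ Nz) LV.
apply/(qopenP H cL); split=> [_ [z Nz <-]|].
 by exists (z *m invmx l0); [exact: NV|rewrite translateM].
rewrite (_ : quotient_preimage _ _ _ = L `\` [set y | quotient_preimage G B D0 (y *m ga)]).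
 by apply: zopenD; apply: closed_preT; [exact: mor_mulr (morI _)|case/(qclosedP B cG): kD0].
apply/seteqP; split=> y [Ly h]; split=> //.
 move=> [_ Dy]; have [z Nz /esym ez] := h; rewrite translateM in ez.
 have : (X `\` act_orbit N (@translate k n) x0) (translate (y *m ga) B) by rewrite eD0; split=> //; exact: omX.
 case=> _; apply; exists z => //.
 by rewrite -oN; apply/oH => //; exact: NV.
have [z Nz ez] : act_orbit N (@translate k n) x0 (translate (y *m ga) B).
 apply: contrapT => nO; have [_ Dy] : (X `&` D0) (translate (y *m ga) B) by rewrite -eD0; split=> //; exact: omX.
 by apply: h; split=> //; exact: sgM cG.1 (LG _ Ly) Gga.
exists z => //; rewrite translateM; apply/oH => //; [exact: NV|by rewrite oN].
Qed.
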